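(* Let $p>0$, $\omega:=p+1-\lceil p\rceil$, and let $(X^{(n)}_i)_{i\in T_n}$ be a sequence of mean-zero random fields as in the context, with $\alpha$-mixing coefficients $(\alpha_{\ell,n})_{\ell\ge1}$ (of order $\lceil p\rceil+1$). Suppose that for some $r\in(p+2,\infty]$ $$\liminf_{n\to\infty}\frac{\sigma_n^2}{|T_n|}>0,\qquad \sup_{n,\,i\in T_n}\|X^{(n)}_i\|_r<\infty,\qquad \sup_n\sum_{\ell=1}^{\lfloor |T_n|^{1/d}\rfloor}\ell^{d-1}\alpha_{\ell,n}^{(r-p-2)/r}<\infty,$$ and put $M_n:=|T_n|^{-p/2}\sum_{\ell=1}^{\lfloor |T_n|^{1/d}\rfloor}\ell^{d(p+1)-\omega}\alpha_{\ell,n}^{(r-p-2)/r}$. Suppose moreover that there are constants $C>0$ and $$v>\frac{(d(p+2)+2(1-\omega))\,r}{2(r-p-2)},$$ independent of $n$, such that $\alpha_{\ell,n}\le C\ell^{-v}$ whenever $1\le\ell\le\lfloor|T_n|^{1/d}\rfloor$. Let $u:=(r-p-2)v/r-1+\omega$. Then $$M_n=\begin{cases}\mathcal O(|T_n|^{-p/2})&\text{if }u>d(p+1),\\ \mathcal O(|T_n|^{-p/2}\log|T_n|)&\text{if }u=d(p+1),\\ \mathcal O(|T_n|^{-p/2+p+1-u/d})&\text{if }\tfrac{d(p+2)}2<u<d(p+1).\end{cases}$$ In particular, if $p\ge1$, then $$\mathcal W_p(\mathcal L(W_n),N(0,1))=\begin{cases}\mathcal O(|T_n|^{-1/2})&\text{if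 }u>d(p+1),\\ \mathcal O\bigl(|T_n|^{-1/2}(\log|T_n|)^{1/p}\bigr)&\text{if }u=d(p+1),\\ \mathcal O(|T_n|^{-1/2+(p+1)/p-u/(dp)})&\text{if }\tfrac{d(p+2)}2<u<d(p+1).\end{cases}$$ At the critical value $u=d(p+1)$, one has, uniformly over $h\in\Lambda_p$, $$\mathbb E[h(W_n)]-\mathcal N h=\sum_{(a,s_{1:a})\in\Gamma(\lceil p\rceil-1)}(-1)^a\prod_{j=1}^a\frac{\kappa_{s_j+2}(W_n)}{(s_j+1)!}\;\mathcal N\Bigl[(\partial^{s_1+1}\Theta)\circ\cdots\circ(\partial^{s_a+1}\Theta)\,h\Bigr]+\mathcal O(|T_n|^{-p/2}\log|T_n|).$$
   Context: Setting. Fix $d\in\mathbb N_+$. $T_1\subseteq T_2\subseteq\cdots$ are finite nonempty subsets of $\mathbb Z^d$ with $|T_n|\to\infty$. For each $n$, $(X^{(n)}_i)_{i\in T_n}$ is a family of real random variables with mean zero and finite second moments (no stationarity is assumed). Put $\sigma_n^2:=\operatorname{Var}(\sum_{i\in T_n}X^{(n)}_i)$ and $W_n:=\sigma_n^{-1}\sum_{i\in T_n}X^{(n)}_i$ (defined when $\sigma_n>0$). $\|X\|_r:=(\mathbb E|X|^r)^{1/r}$ for $r<\infty$, and $\|X\|_\infty$ is the essential supremum norm. When $r=\infty$, ratios $(r-a)/r$ and $r/(r-a)$ with finite $a$ are read as $1$. $\kappa_j(W_n)$ is the $j$-th cumulant of $W_n$. Mixing coefficients. For sub-$\sigma$-algebras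 $\mathcal A,\mathcal B$, $\alpha(\mathcal A,\mathcal B):=\sup_{A\in\mathcal A,B\in\mathcal B}|\mathbb P(A\cap B)-\mathbb P(A)\mathbb P(B)|$. For positive integers $\ell,q$, $\alpha^{[q]}_{\ell,n}:=0\vee\sup\{\alpha(\sigma(X^{(n)}_i:i\in U_1),\sigma(X^{(n)}_i:i\in U_2)):U_1,U_2\subseteq T_n,\ |U_1|\le q,\ d(U_1,U_2)\ge\ell\}$, where $d(U_1,U_2)=\min\{\|i_1-i_2\|:i_1\in U_1,i_2\in U_2\}$ and $\|\cdot\|$ is the maximum norm. Throughout, $\alpha_{\ell,n}:=\alpha_{\ell,n}^{[\lceil p\rceil+1]}$. Function class. For $k\in\mathbb N$ and $\omega\in(0,1]$, $f\in\mathcal C^{k,\omega}(\mathbb R)$ means $f\in\mathcal C^k(\mathbb R)$ and $|f|_{k,\omega}:=\sup_{x\ne y}|f^{(k)}(x)-f^{(k)}(y)|/|x-y|^\omega<\infty$. For $p>0$, with $\omega=p+1-\lceil p\rceil$, $\Lambda_p:=\{f\in\mathcal C^{\lceil p\rceil-1,\omega}(\mathbb R):|f|_{\lceil p\rceil-1,\omega}\le1\}$. Operators. $\mathcal N h:=\mathbb E[h(Z)]$ with $Z\sim N(0,1)$. $\partial$ is differentiation. $\Theta h$ is the standard solution $f$ of Stein's equation $xf(x)-f'(x)=\mathcal N h-h(x)$, i.e. $\Theta h(x)=e^{x^2/2}\int_{-\infty}^x(h(w)-\mathcal N h)e^{-w^2/2}\,dw$. For an integer $q\ge0$, $\Gamma(q):=\{(a,s_1,\dots,s_a):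 a,s_1,\dots,s_a\in\mathbb N_+,\ \sum_{j=1}^a s_j\le q\}$, so $\Gamma(0)=\varnothing$; $s_{1:a}$ abbreviates $s_1,\dots,s_a$. Wasserstein distance. $\mathcal W_p(\nu,\mu):=\inf_\gamma(\mathbb E_{(X,Y)\sim\gamma}|X-Y|^p)^{1/p}$, the infimum being over all couplings $\gamma$ of $\nu$ and $\mu$. $\mathcal L(W)$ is the law of $W$. $\mathcal O$-notation is as $n\to\infty$: implied constants do not depend on $n$ (nor on $h\in\Lambda_p$ in the expansion). *)

(* Defs.v *)
From HB Require Import structures.
From mathcomp Require Import all_boot all_order all_algebra finmap.
From mathcomp Require Import all_classical all_reals all_analysis.
From mathcomp Require Import measurable_realfun.

Set Implicit Arguments.
Unset Strict Implicit.
Unset Printing Implicit Defensive.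

Import Order.TTheory GRing.Theory Num.Theory.
Import numFieldNormedType.Exports.

Local Open Scope classical_set_scope.
Local Open Scope ring_scope.

Definition ceiln (R : realType) (p : R) : nat := `|Num.ceil p|%N.

Definition hoelder_exp (R : realType) (p : R) : R := p + 1 - (ceiln p)%:R.

(* (r - a) / r, read as 1 when r = +oo; r / (r - a) is written as its inverse.
   The value at -oo is irrelevant. *)
Definition moment_ratio (R : realType) (r : \bar R) (a : R) : R :=
  if r is s%:E then (s - a) / s else 1.

(* floor (|T|^(1/d)) *)
Definition range_radius (R : realType) (d : nat) (T : {fset 'rV[int]_d}) : nat :=
  Num.truncn ((#|` T|)%:R `^ (d%:R)^-1 : R).

Definition field_sum d (T : {fset 'rV[int]_d}) (R : realType)
    (disp : measure_display) (Omega : measurableType disp)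
    (P : probability Omega R) (X : T -> {RV P >-> R}) : {RV P >-> R} :=
  \sum_(i : T) (X i : {mfun Omega >-> R}).

Definition sum_sd d (T : {fset 'rV[int]_d}) (R : realType)
    (disp : measure_display) (Omega : measurableType disp)
    (P : probability Omega R) (X : T -> {RV P >-> R}) : R :=
  Num.sqrt (fine ('V_P[field_sum X])%E).

(* This is 0 when the variance vanishes, by the convention 0^-1 = 0. *)
Definition normed_sum d (T : {fset 'rV[int]_d}) (R : realType)
    (disp : measure_display) (Omega : measurableType disp)
    (P : probability Omega R) (X : T -> {RV P >-> R}) : {RV P >-> R} :=
  (sum_sd X)^-1 *: (field_sum X : {mfun Omega >-> R}).

(* `|i1 - i2| is the maximum norm on matrices. The distance is +oo if one of the
   sets is empty. *)
Definition set_dist (R : realType) d (T : {fset 'rV[int]_d})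
    (U1 U2 : {set T}) : \bar R :=
  ereal_inf [set ((`|val i1 - val i2| : int)%:~R)%:E |
              i1 in [set` U1] & i2 in [set` U2]].

Definition sigma_of d (T : {fset 'rV[int]_d}) (R : realType)
    (disp : measure_display) (Omega : measurableType disp)
    (P : probability Omega R) (X : T -> {RV P >-> R}) (U : {set T}) :
    set (set Omega) :=
  <<s \bigcup_(i in [set` U]) preimage_set_system setT (X i) measurable >>.

Definition alpha_coef (R : realType) (disp : measure_display)
    (Omega : measurableType disp) (P : probability Omega R)
    (F G : set (set Omega)) : R :=
  sup [set `|fine (P (A `&` B)) - fine (P A) * fine (P B)| | A in F & B in G].

Definition alpha_mixing d (T : {fset 'rV[int]_d}) (R : realType)
    (disp : measure_display) (Omega : measurableType disp)
    (P : probability Omega R) (X : T -> {RV P >-> R}) (q l : nat) : R :=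
  Num.max 0 (sup [set alpha_coef P (sigma_of X U.1) (sigma_of X U.2) |
    U in [set U : {set T} * {set T} |
           (#|U.1| <= q)%N /\ (l%:R%:E <= set_dist R U.1 U.2)%E]]).

Definition mixing_M d (T : {fset 'rV[int]_d}) (R : realType)
    (disp : measure_display) (Omega : measurableType disp)
    (P : probability Omega R) (X : T -> {RV P >-> R}) (p : R) (r : \bar R) : R :=
  (#|` T|)%:R `^ (- p / 2) *
  \sum_(1 <= l < (range_radius R T).+1)
    l%:R `^ (d%:R * (p + 1) - hoelder_exp p) *
    alpha_mixing X (ceiln p).+1 l `^ moment_ratio r (p + 2).

Definition Ck (R : realType) (k : nat) (f : R -> R) : Prop :=
  (forall j x, (j < k)%N -> derivable (derive1n j f) x 1) /\
  continuous (derive1n k f).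

Definition hoelder_seminorm (R : realType) (k : nat) (w : R) (f : R -> R) :
    \bar R :=
  ereal_sup [set (`|derive1n k f z.1 - derive1n k f z.2| / `|z.1 - z.2| `^ w)%:E |
              z in [set z : R * R | z.1 != z.2]].

Definition Ckw (R : realType) (k : nat) (w : R) : set (R -> R) :=
  [set f | Ck k f /\ (hoelder_seminorm k w f < +oo)%E].

Definition Lambda (R : realType) (p : R) : set (R -> R) :=
  [set f | Ckw (ceiln p).-1 (hoelder_exp p) f /\
           (hoelder_seminorm (ceiln p).-1 (hoelder_exp p) f <= 1)%E].

Definition gaussE (R : realType) (h : R -> R) : R :=
  Rintegral (normal_prob (0 : R) 1) setT h.

Definition Theta (R : realType) (h : R -> R) (x : R) : R :=
  expR (x ^+ 2 / 2) *
  Rintegral (@lebesgue_measure R) `]-oo, x]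
    (fun w => (h w - gaussE h) * expR (- w ^+ 2 / 2)).

(* The tuple (a, s_1, ..., s_a) is the sequence [:: s_1; ...; s_a] of size a. *)
Definition Gamma (q : nat) : set (seq nat) :=
  [set s | [/\ (0 < size s)%N, all (fun j => 0 < j)%N s & (sumn s <= q)%N]].

(* (d^(s_1 + 1) Theta) o ... o (d^(s_a + 1) Theta) applied to h *)
Definition Stein_iter (R : realType) (s : seq nat) (h : R -> R) : R -> R :=
  foldr (fun j g => derive1n j.+1 (Theta g)) h s.

Definition moment (R : realType) (disp : measure_display)
    (Omega : measurableType disp) (P : probability Omega R)
    (W : {RV P >-> R}) (k : nat) : R :=
  fine 'E_P[fun w => (W w ^+ k)%R]%E.

(* j! times the coefficient of t^j in the formal cumulant generating series
   log (sum_k E[W^k] t^k / k!) = sum_(i >= 1) (-1)^(i-1) / i *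
   (sum_(k >= 1) E[W^k] t^k / k!)^i. Truncating both sums at j does not change
   this coefficient, which only involves the moments of order at most j. *)
Definition cumulant (R : realType) (disp : measure_display)
    (Omega : measurableType disp) (P : probability Omega R)
    (W : {RV P >-> R}) (j : nat) : R :=
  j`!%:R *
  (\sum_(1 <= i < j.+1) ((-1) ^+ i.-1 / i%:R) *:
     (\sum_(1 <= k < j.+1) (moment W k / k`!%:R) *: 'X^k) ^+ i : {poly R})`_j.

Definition expansion (R : realType) (disp : measure_display)
    (Omega : measurableType disp) (P : probability Omega R)
    (W : {RV P >-> R}) (p : R) (h : R -> R) : R :=
  \sum_(s \in Gamma (ceiln p).-1)
    (-1) ^+ size s *
    (\prod_(j <- s) (cumulant W j.+2 / (j.+1)`!%:R)) *
    gaussE (Stein_iter s h).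

(* Laws are passed as set functions because distribution and normal_prob are
   measures on two differently displayed copies of the Borel sigma-algebra. *)
Definition coupling (R : realType) (nu mu : set R -> \bar R) :
    set (probability (R * R)%type R) :=
  [set g | forall A : set R, measurable A ->
             pushforward g fst A = nu A /\ pushforward g snd A = mu A].

Definition Wasserstein (R : realType) (p : R) (nu mu : set R -> \bar R) :
    \bar R :=
  ereal_inf [set ((\int[g]_z (`|z.1 - z.2| `^ p)%:E) `^ p^-1)%E |
              g in coupling nu mu].

(* Main.v *)
Require Import Defs.
From HB Require Import structures.
From mathcomp Require Import all_boot all_order all_algebra finmap.
From mathcomp Require Import all_classical all_reals all_analysis.
From mathcomp Require Import measurable_realfun.
From mathcomp Require Import zify ring lra.

Set Implicit Arguments.
Unset Strict Implicit.
Unset Printing Implicit Defensive.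

Import Order.TTheory GRing.Theory Num.Theory.
Import numFieldNormedType.Exports.

Local Open Scope classical_set_scope.
Local Open Scope ring_scope.

(** The normalized sum is split dyadically according to the distance from a
    site. Repeatedly removing the sites near those already chosen, Taylor
    expanding, and bounding each covariance between separated groups by
    Davydov's inequality approximates [E[W g(W)]] by
    [sum_j kappa_(j+1)(W) / j! E[g^(j)(W)]] up to the power [eps^p] of one
    rate, [eps^p = N^(-p/2) sum_l 2^(l (d (p+1) - u))]; applied to monomials the
    same approximation bounds the cumulants by powers of [eps]. Stein's
    equation, with sharp Hoelder regularity for [Theta], turns this into the
    expansion of [E[h(W)]].

    For the transport distance let [X] be the quantile coupling [z |-> X z] of
    [L(W)] with [N(0,1)]. A test function in the Hoelder class of order [p],
    adapted to [tau z = z - X z], satisfies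
    [h z - h (X z) >= c |tau z|^p - C eps^(p-1) |tau z|] while
    [|h'| <= C (|tau| + eps)^(p-1)]. Gaussian integration by parts rewrites
    every term of the expansion as [E[q(Z) h'(Z)]] with a polynomial [q]; so the
    expansion for this [h] bounds [E|tau|^p] by [eps^p] through Young's
    inequality. *)

(** * Norm bounds and Young's inequality *)

(** Three obstacles shape the proof. Errors arise at several orders [q], each as
    [N^(-q/2) sum_l 2^(l (d (q+1) - u))], but must all be powers of one quantity: since [u > d]
    these sums interpolate, the one of order [q] being at most a constant times the power [q/p] of
    the one of order [p]. The coefficients of the approximation are never computed: its error
    carries the Hölder seminorm as a factor, monomials of low degree have seminorm zero, so the
    approximation is exact on them, and exactness there forces the recursion between moments and
    cumulants. In the transport bound the correction terms are only of size [eps], while the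
    seminorm of the test function is of order one; the missing powers must come from the smallness
    of [h'] where the displacement is small, so the corrections are moved onto [h'] and the test
    function is built at a scale that follows the displacement. All constants are fixed before the
    field is given, so uniformity in [n] and [h] lies in the order of the quantifiers. *)

Section young.
Context {R : realType}.
Implicit Types x y s t : R.

Lemma young2 x y s t : 0 <= x -> 0 <= y -> 0 <= s -> 0 <= t -> s + t = 1 ->
  x `^ s * y `^ t <= s * x + t * y.
Proof.
move=> x0 y0; rewrite le_eqVlt => /predU1P[<-|s0].
  by move=> _; rewrite add0r => ->; rewrite powRr0 powRr1// mul0r !mul1r add0r.
rewrite le_eqVlt => /predU1P[<-|t0].
  by rewrite addr0 => ->; rewrite powRr0 powRr1// mul0r mul1r mulr1 addr0.
move=> st; have s1 : 0 < s^-1 by rewrite invr_gt0.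
have t1 : 0 < t^-1 by rewrite invr_gt0.
have := @conjugate_powR R (x `^ s) (y `^ t) s^-1 t^-1 (powR_ge0 _ _) (powR_ge0 _ _) s1 t1.
rewrite !invrK -!powRrM !divff ?gt_eqF// !powRr1// => /(_ st).
by rewrite (mulrC x) (mulrC y).
Qed.

Lemma young1 x s : 0 <= x -> 0 <= s <= 1 -> x `^ s <= s * x + (1 - s).
Proof.
move=> x0 /andP[s0 s1]; have := @young2 x 1 s (1 - s) x0 ler01 s0.
by rewrite powR1 !mulr1; apply; rewrite ?subr_ge0//; ring.
Qed.

Lemma powR_convex x y a b q : 1 <= q -> 0 <= x -> 0 <= y -> 0 <= a -> 0 <= b -> a + b = 1 ->
  (a * x + b * y) `^ q <= a * x `^ q + b * y `^ q.
Proof.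
move=> q1 x0 y0 a0 b0 ab.
have b1 : b <= 1 by lra.
have hx : (x : R^o) \in (`[0, +oo[%classic : set R) by rewrite inE/= in_itv/= andbT.
have hy : (y : R^o) \in (`[0, +oo[%classic : set R) by rewrite inE/= in_itv/= andbT.
have h := convex_powR q1 (Itv01 b0 b1) hy hx.
rewrite convRE [X in X `^ _ <= _]convRE /= in h; move: h.
have -> : unstable.onem b = a by (rewrite /unstable.onem -ab; exact: addrK).
by rewrite (addrC (b * y)) (addrC (b * _)).
Qed.

Lemma ndiv_ge0 x c : 0 < c -> 0 <= `|x| / c.
Proof. by move=> c0; rewrite divr_ge0// ltW. Qed.

Lemma powR_div x c w : 0 <= x -> 0 < c -> (x / c) `^ w = x `^ w / c `^ w.
Proof.
move=> x0 c0; rewrite powRM// ?invr_ge0 ?(ltW c0)//; congr (_ * _).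
by rewrite -(powR_inv1 (ltW c0)) -powRrM mulN1r powRN.
Qed.

End young.

Section moment_bound.
Context {R : realType} {d} {Om : measurableType d} (P : probability Om R).
Implicit Types (A B : Om -> R) (th c : R).

Definition Ex A : R := \int[P]_x A x.
Definition itg A : Prop := P.-integrable setT (EFin \o A).

(* The scale-invariant form of [‖A‖_(1/th) <= c]. *)
Definition mb th c A : Prop :=
  [/\ measurable_fun setT A, 0 < c &
      (\int[P]_x ((`|A x| / c) `^ th^-1)%:E <= 1)%E].

Lemma measurable_mbfun th c A : measurable_fun setT A ->
  measurable_fun setT (fun x => ((`|A x| / c) `^ th^-1)%:E).
Proof.
move=> mA; apply/measurable_EFinP.
apply: (measurableT_comp (measurable_powR _)).
apply: measurable_funM => //.
exact: measurableT_comp.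
Qed.

Lemma itg_mbfun th c A : mb th c A -> itg (fun x => (`|A x| / c) `^ th^-1).
Proof.
move=> [mA c0 h]; apply/integrableP; split; first exact: measurable_mbfun.
rewrite (eq_integral (fun x => ((`|A x| / c) `^ th^-1)%:E)); last first.
  by move=> x _ /=; rewrite ger0_norm ?powR_ge0.
exact: le_lt_trans h (ltry _).
Qed.

Lemma itg_cst (k : R) : itg (fun=> k).
Proof. exact: finite_measure_integrable_cst. Qed.

Lemma itgD A B : itg A -> itg B -> itg (fun x => A x + B x).
Proof. by move=> iA iB; have := integrableD measurableT iA iB. Qed.

Lemma itgB A B : itg A -> itg B -> itg (fun x => A x - B x).
Proof. by move=> iA iB; have := integrableB measurableT iA iB. Qed.

Lemma itgZ k A : itg A -> itg (fun x => k * A x).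
Proof. by move=> iA; have := integrableZl measurableT k iA. Qed.

Lemma itg_norm A : itg A -> itg (fun x => `|A x|).
Proof. by move=> iA; have := integrable_norm iA. Qed.

Lemma itg_le A B : measurable_fun setT A -> (forall x, `|A x| <= `|B x|) -> itg B -> itg A.
Proof.
move=> mA AB iB; apply: (le_integrable _ _ _ iB) => //.
- exact/measurable_EFinP.
- by move=> x _; rewrite lee_fin.
Qed.

Lemma itg_le0 A B : measurable_fun setT A -> (forall x, `|A x| <= B x) -> itg B -> itg A.
Proof.
by move=> mA AB; apply: itg_le => // x; apply: le_trans (AB x) (ler_norm _).
Qed.

Lemma itg_sum I (s : seq I) (F : I -> Om -> R) : (forall i, itg (F i)) ->
  itg (fun x => \sum_(i <- s) F i x).
Proof.
move=> h; elim: s => [|i s IH].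
  rewrite (_ : (fun x => _) = fun=> 0); first exact: itg_cst.
  by apply/funext => x; rewrite big_nil.
rewrite (_ : (fun x => _) = fun x => F i x + \sum_(j <- s) F j x); first exact: itgD.
by apply/funext => x; rewrite big_cons.
Qed.

Lemma ExD A B : itg A -> itg B -> Ex (fun x => A x + B x) = Ex A + Ex B.
Proof. by move=> iA iB; rewrite /Ex RintegralD. Qed.

Lemma ExB A B : itg A -> itg B -> Ex (fun x => A x - B x) = Ex A - Ex B.
Proof. by move=> iA iB; rewrite /Ex RintegralB. Qed.

Lemma ExZ k A : itg A -> Ex (fun x => k * A x) = k * Ex A.
Proof. by move=> iA; rewrite /Ex RintegralZl. Qed.

Lemma Ex_cst k : Ex (fun=> k) = k.
Proof.
by rewrite /Ex Rintegral_cst// [X in fine X]probability_setT /= mulr1.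
Qed.

Lemma Ex_le A B : itg A -> itg B -> (forall x, A x <= B x) -> Ex A <= Ex B.
Proof. by move=> iA iB AB; apply: le_Rintegral. Qed.

Lemma Ex_norm A : itg A -> `|Ex A| <= Ex (fun x => `|A x|).
Proof. by move=> iA; apply: le_normr_Rintegral. Qed.

Lemma Ex_ge0 A : (forall x, 0 <= A x) -> 0 <= Ex A.
Proof. by move=> h; apply: Rintegral_ge0. Qed.

Lemma Ex_normle A B : itg A -> itg B -> (forall x, `|A x| <= B x) -> `|Ex A| <= Ex B.
Proof.
by move=> iA iB AB; apply: (le_trans (Ex_norm iA)); apply: Ex_le => //; exact: itg_norm.
Qed.

Lemma Ex_sum I (s : seq I) (F : I -> Om -> R) : (forall i, itg (F i)) ->
  Ex (fun x => \sum_(i <- s) F i x) = \sum_(i <- s) Ex (F i).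
Proof.
move=> h; elim: s => [|i s IH].
  rewrite (_ : (fun x => _) = fun=> 0) ?Ex_cst ?big_nil//.
  by apply/funext => x; rewrite big_nil.
rewrite (_ : (fun x => _) = fun x => F i x + \sum_(j <- s) F j x).
  by rewrite ExD// ?IH ?big_cons//; exact: itg_sum.
by apply/funext => x; rewrite big_cons.
Qed.

Lemma mb_Ex th c A : mb th c A -> Ex (fun x => (`|A x| / c) `^ th^-1) <= 1.
Proof.
move=> h; have iA := itg_mbfun h; have [mA c0 hA] := h.
rewrite /Ex /Rintegral -lee_fin fineK//.
exact: (integrable_fin_num measurableT iA).
Qed.

Lemma mb_intro th c A B : measurable_fun setT A -> 0 < c -> itg B ->
  (forall x, (`|A x| / c) `^ th^-1 <= B x) -> Ex B <= 1 -> mb th c A.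
Proof.
move=> mA c0 iB AB EB; split => //.
have iA : itg (fun x => (`|A x| / c) `^ th^-1).
  apply: itg_le0 iB; first by apply/measurable_EFinP; exact: measurable_mbfun.
  by move=> x; rewrite ger0_norm ?powR_ge0.
rewrite -(@fineK _ (\int[P]_x _)%E); last exact: (integrable_fin_num measurableT iA).
rewrite lee_fin; apply: le_trans EB.
exact: Ex_le iA iB AB.
Qed.

(** Hölder's inequality. Orders are reciprocals of exponents, so they add; as both factors are
    normalised, the weighted Young inequality with weights [th / (th + th')] and [th' / (th + th')]
    is applied pointwise and then integrated. *)
Lemma mb_mul th th' c c' A B : 0 < th -> 0 < th' -> mb th c A -> mb th' c' B ->
  mb (th + th') (c * c') (fun x => A x * B x).
Proof.
move=> t0 t0' hA hB; have [mA c0 _] := hA; have [mB c0' _] := hB.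
have tt0 : 0 < th + th' by rewrite addr_gt0.
pose s := th / (th + th'); pose t := th' / (th + th').
have s0 : 0 < s by rewrite divr_gt0.
have t00 : 0 < t by rewrite divr_gt0.
have st : s + t = 1 by rewrite -mulrDl divff ?gt_eqF.
apply: (@mb_intro _ _ _ (fun x => s * (`|A x| / c) `^ th^-1 + t * (`|B x| / c') `^ th'^-1)).
- exact: measurable_funM.
- exact: mulr_gt0.
- by apply: itgD; apply: itgZ; exact: itg_mbfun.
- move=> x; rewrite normrM invfM mulrACA powRM; last 2 first.
    exact: ndiv_ge0.
    exact: ndiv_ge0.
  have -> : (`|A x| / c) `^ (th + th')^-1 = ((`|A x| / c) `^ th^-1) `^ s.
    by rewrite -powRrM; congr (_ `^ _); rewrite /s; field; rewrite !gt_eqF.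
  have -> : (`|B x| / c') `^ (th + th')^-1 = ((`|B x| / c') `^ th'^-1) `^ t.
    by rewrite -powRrM; congr (_ `^ _); rewrite /t; field; rewrite !gt_eqF.
  by apply: young2 => //; rewrite ?powR_ge0// ltW.
- rewrite ExD; [|by apply: itgZ; exact: itg_mbfun..].
  rewrite !ExZ; [|exact: itg_mbfun..].
  rewrite -st lerD//.
    by apply: ler_piMr; [exact: ltW|exact: mb_Ex].
  by apply: ler_piMr; [exact: ltW|exact: mb_Ex].
Qed.

(** Norms grow with the exponent because [P] has mass one: the constant [1 - s] in [young1]
    integrates to itself. *)
Lemma mb_mono th th' c A : 0 < th <= th' -> mb th c A -> mb th' c A.
Proof.
move=> /andP[t0 tt] hA; have [mA c0 _] := hA.
have t0' : 0 < th' by apply: lt_le_trans tt.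
pose s := th / th'.
have s01 : 0 <= s <= 1 by rewrite divr_ge0 ?(ltW t0) ?(ltW t0')//= ler_pdivrMr// mul1r.
apply: (@mb_intro _ _ _ (fun x => s * (`|A x| / c) `^ th^-1 + (1 - s))) => //.
- by apply: itgD (itg_cst _); apply: itgZ; exact: itg_mbfun.
- move=> x; have -> : (`|A x| / c) `^ th'^-1 = ((`|A x| / c) `^ th^-1) `^ s.
    by rewrite -powRrM; congr (_ `^ _); rewrite /s; field; rewrite !gt_eqF.
  by apply: young1; rewrite ?powR_ge0.
- rewrite ExD ?ExZ ?Ex_cst; [|exact: itg_mbfun|by apply: itgZ; exact: itg_mbfun|exact: itg_cst].
  have := ler_wpM2l (proj1 (andP s01)) (mb_Ex hA); lra.
Qed.

Lemma mb_dom th c A B : 0 <= th -> measurable_fun setT A -> (forall x, `|A x| <= `|B x|) ->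
  mb th c B -> mb th c A.
Proof.
move=> t0 mA AB hB; have [mB c0 _] := hB.
apply: (@mb_intro _ _ _ _ mA c0 (itg_mbfun hB) _ (mb_Ex hB)) => x.
apply: ge0_ler_powR; rewrite ?invr_ge0 ?nnegrE ?ndiv_ge0//.
by rewrite ler_wpM2r// invr_ge0 ltW.
Qed.

Lemma mb_const th c k : 0 <= th -> 0 < c -> `|k| <= c -> mb th c (fun=> k).
Proof.
move=> t0 c0 kc; apply: (@mb_intro _ _ _ (fun=> 1)) => //.
- exact: itg_cst.
- move=> _; rewrite [leRHS](_ : 1 = 1 `^ th^-1); last by rewrite powR1.
  apply: ge0_ler_powR; rewrite ?invr_ge0 ?nnegrE ?ndiv_ge0//.
  by rewrite ler_pdivrMr// mul1r.
- by rewrite Ex_cst.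
Qed.

Lemma mb_lec th c c' A : 0 <= th -> c <= c' -> mb th c A -> mb th c' A.
Proof.
move=> t0 cc hA; have [mA c0 _] := hA; have c0' : 0 < c' by apply: lt_le_trans cc.
apply: (@mb_intro _ _ _ _ mA c0' (itg_mbfun hA) _ (mb_Ex hA)) => x.
apply: ge0_ler_powR; rewrite ?invr_ge0 ?nnegrE ?ndiv_ge0//.
by rewrite ler_wpM2l// lef_pV2.
Qed.

Lemma mb_scale th c k A : 0 <= th -> 0 < k -> mb th c A -> mb th (k * c) (fun x => k * A x).
Proof.
move=> t0 k0 hA; have [mA c0 _] := hA.
apply: (@mb_intro _ _ _ _ _ _ (itg_mbfun hA) _ (mb_Ex hA)) => [||x].
- exact: measurable_funM.
- exact: mulr_gt0.
by rewrite normrM gtr0_norm// invfM mulrACA divff ?gt_eqF// mul1r.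
Qed.

(** Minkowski's inequality: the sum divided by [c + c'] is dominated by a convex combination, with
    weights proportional to [c] and [c'], of the normalised summands, and the power [th^-1] is
    convex as [th <= 1]. *)
Lemma mb_add th c c' A B : 0 < th <= 1 -> mb th c A -> mb th c' B ->
  mb th (c + c') (fun x => A x + B x).
Proof.
move=> /andP[t0 t1] hA hB; have [mA c0 _] := hA; have [mB c0' _] := hB.
have cc : 0 < c + c' by rewrite addr_gt0.
pose s := c / (c + c'); pose t := c' / (c + c').
have s0 : 0 < s by rewrite divr_gt0.
have t00 : 0 < t by rewrite divr_gt0.
have st : s + t = 1 by rewrite -mulrDl divff ?gt_eqF.
apply: (@mb_intro _ _ _ (fun x => s * (`|A x| / c) `^ th^-1 + t * (`|B x| / c') `^ th^-1)) => //.
- exact: measurable_funD.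
- by apply: itgD; apply: itgZ; exact: itg_mbfun.
- move=> x; apply: (@le_trans _ _ ((s * (`|A x| / c) + t * (`|B x| / c')) `^ th^-1)).
    apply: ge0_ler_powR; rewrite ?nnegrE.
    - by rewrite invr_ge0 ltW.
    - exact: ndiv_ge0.
    - by rewrite addr_ge0// mulr_ge0 ?ndiv_ge0 ?(ltW s0) ?(ltW t00).
    have -> : s * (`|A x| / c) + t * (`|B x| / c') = (`|A x| + `|B x|) / (c + c').
      by rewrite /s /t; field; rewrite !gt_eqF.
    by apply: ler_wpM2r; [rewrite invr_ge0 ltW|exact: ler_normD].
  apply: powR_convex => //; rewrite ?ndiv_ge0 ?(ltW s0) ?(ltW t00)//.
  by rewrite invf_ge1.
- rewrite ExD; [|by apply: itgZ; exact: itg_mbfun..].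
  rewrite !ExZ; [|exact: itg_mbfun..].
  rewrite -st lerD//.
    by apply: ler_piMr; [exact: ltW|exact: mb_Ex].
  by apply: ler_piMr; [exact: ltW|exact: mb_Ex].
Qed.

Lemma mb_powR th c w A : 0 < w -> 0 <= th -> mb th c A -> mb (th * w) (c `^ w) (fun x => `|A x| `^ w).
Proof.
move=> w0 t0 hA; have [mA c0 _] := hA.
apply: (@mb_intro _ _ _ _ _ _ (itg_mbfun hA) _ (mb_Ex hA)) => [||x].
- apply: (measurableT_comp (measurable_powR _)); exact: measurableT_comp.
- exact: powR_gt0.
- have -> : `|(`|A x| `^ w)| / c `^ w = (`|A x| / c) `^ w.
    by rewrite ger0_norm ?powR_ge0// powR_div.
  by rewrite -powRrM invfM mulrCA divff ?gt_eqF// mulr1.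
Qed.

Lemma mb_expr th c n A : 0 < th -> mb th c A -> mb (th * n.+1%:R) (c ^+ n.+1) (fun x => A x ^+ n.+1).
Proof.
move=> t0 hA; elim: n => [|n IH]; first by rewrite mulr1 expr1.
rewrite -addn1 natrD mulrDr mulr1 addn1 [c ^+ _]exprSr.
rewrite (_ : (fun x => A x ^+ n.+2) = fun x => A x ^+ n.+1 * A x); last first.
  by apply/funext => x; rewrite exprSr.
by apply: mb_mul => //; rewrite mulr_gt0.
Qed.

Lemma mb_itg th c A : 0 < th <= 1 -> mb th c A -> itg A.
Proof.
move=> /andP[t0 t1] hA; have [mA c0 _] := hA.
apply: (@itg_le0 _ (fun x => c * (th * (`|A x| / c) `^ th^-1 + (1 - th)))) => //.
  move=> x; rewrite -ler_pdivrMl// mulrC.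
  have := @young1 R ((`|A x| / c) `^ th^-1) th (powR_ge0 _ _).
  rewrite -powRrM mulVf ?gt_eqF// powRr1 ?ndiv_ge0//; apply.
  by rewrite ltW.
by apply: itgZ; apply: itgD (itg_cst _); apply: itgZ; exact: itg_mbfun.
Qed.

Lemma mb_Ele th c A : 0 < th <= 1 -> mb th c A -> Ex (fun x => `|A x|) <= c.
Proof.
move=> /andP[t0 t1] hA; have [mA c0 _] := hA.
have iA : itg A by apply: mb_itg hA; rewrite t0.
have iB := itg_mbfun hA.
apply: (@le_trans _ _ (Ex (fun x => c * (th * (`|A x| / c) `^ th^-1 + (1 - th))))).
  apply: Ex_le; first exact: itg_norm.
    by apply: itgZ; apply: itgD (itg_cst _); apply: itgZ.
  move=> x; rewrite -ler_pdivrMl// mulrC.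
  have := @young1 R ((`|A x| / c) `^ th^-1) th (powR_ge0 _ _).
  rewrite -powRrM mulVf ?gt_eqF// powRr1 ?ndiv_ge0//; apply.
  by rewrite ltW.
rewrite ExZ; last by apply: itgD (itg_cst _); apply: itgZ.
rewrite ExD ?Ex_cst; [|exact: itgZ|exact: itg_cst].
rewrite ExZ//; apply: ler_piMr; first exact: ltW.
have := ler_wpM2l (ltW t0) (mb_Ex hA); lra.
Qed.

Lemma mb_absEle th c A : 0 < th <= 1 -> mb th c A -> `|Ex A| <= c.
Proof.
move=> t hA; apply: le_trans (mb_Ele t hA); apply: Ex_norm; exact: mb_itg hA.
Qed.

Lemma mb_sum th c I (s : seq I) (F : I -> Om -> R) (n : R) : 0 < th <= 1 -> 0 < c -> 0 < n ->
  (size s)%:R <= n -> (forall i, mb th c (F i)) ->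
  mb th (n * c) (fun x => \sum_(i <- s) F i x).
Proof.
move=> t c0 n0 sn hF; have t0 : 0 <= th by case/andP: t => /ltW.
case: s sn => [|i s] sn.
  rewrite (_ : (fun x => _) = fun=> 0); last by apply/funext => x; rewrite big_nil.
  by apply: mb_const; rewrite ?mulr_gt0// normr0 mulr_ge0// ltW.
apply: (@mb_lec _ ((size (i :: s))%:R * c)) => //; first by rewrite ler_pM2r.
elim: s i {sn} => [|j s IH] i.
  rewrite mul1r (_ : (fun x => _) = F i)//.
  by apply/funext => x; rewrite big_seq1.
rewrite (_ : (fun x => _) = fun x => F i x + \sum_(k <- j :: s) F k x); last first.
  by apply/funext => x; rewrite big_cons.
rewrite -[size (i :: j :: s)]/(size (j :: s)).+1 -addn1 natrD mulrDl mul1r addrC.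
by apply: mb_add.
Qed.

End moment_bound.

(** * Strong mixing and Davydov's covariance inequality *)

Section sub_sigma.
Context {R : realType} {d} {Om : measurableType d}.
Implicit Types (G H : set (set Om)) (A B : Om -> R).

Definition smeas G A := measurable_fun setT (A : g_sigma_algebraType G -> R).

Lemma smeas_pre G A C : smeas G A -> measurable C -> <<s G>> (A @^-1` C).
Proof. by move=> /(_ measurableT C); rewrite setTI. Qed.

Lemma smeas_sub G H A : G `<=` <<s H>> -> smeas G A -> smeas H A.
Proof.
move=> GH hA _ C mC; rewrite setTI.
have := smeas_pre hA mC.
exact: (smallest_sub (smallest_sigma_algebra setT H) GH).
Qed.

Lemma smeas_comp G A (phi : R -> R) : measurable_fun setT phi -> smeas G A ->
  smeas G (fun x => phi (A x)).
Proof. by move=> mphi mA; apply: measurableT_comp. Qed.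

Lemma smeas_cst G k : smeas G (fun=> k).
Proof. exact: measurable_cst. Qed.

Lemma smeasD G A B : smeas G A -> smeas G B -> smeas G (fun x => A x + B x).
Proof. by move=> mA mB; apply: measurable_funD. Qed.

Lemma smeasM G A B : smeas G A -> smeas G B -> smeas G (fun x => A x * B x).
Proof. by move=> mA mB; apply: measurable_funM. Qed.

Lemma smeasB G A B : smeas G A -> smeas G B -> smeas G (fun x => A x - B x).
Proof. by move=> mA mB; apply: measurable_funB. Qed.

Lemma smeasX G A n : smeas G A -> smeas G (fun x => A x ^+ n).
Proof. by move=> mA; apply: measurable_funX. Qed.

Lemma smeas_sum G I (s : seq I) (F : I -> Om -> R) : (forall i, smeas G (F i)) ->
  smeas G (fun x => \sum_(i <- s) F i x).
Proof. by move=> h; apply: measurable_sum. Qed.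

End sub_sigma.

Section covariance_inequality.
Context {R : realType} {d} {Om : measurableType d} (P : probability Om R).
Implicit Types (A B : Om -> R) (G : set (set Om)).

Local Notation Ex := (Ex P).
Local Notation itg := (itg P).
Local Notation mb := (mb P).

Definition cov A B := Ex (fun x => A x * B x) - Ex A * Ex B.

Definition mixing (a : R) G1 G2 := forall E F, <<s G1>> E -> <<s G2>> F ->
  `|fine (P (E `&` F)) - fine (P E) * fine (P F)| <= a.

Lemma itg_bounded A k : measurable_fun setT A -> (forall x, `|A x| <= k) -> itg A.
Proof. by move=> mA Ak; apply: (@itg_le0 _ _ _ _ _ (fun=> k)) => //; exact: itg_cst. Qed.

Lemma covDl A A' B : itg A -> itg A' -> itg (fun x => A x * B x) -> itg (fun x => A' x * B x) ->
  cov (fun x => A x + A' x) B = cov A B + cov A' B.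
Proof.
move=> iA iA' iAB iAB'; rewrite /cov ExD//.
rewrite (_ : (fun x => (A x + A' x) * B x) = fun x => A x * B x + A' x * B x).
  by rewrite ExD//; ring.
by apply/funext => x; rewrite mulrDl.
Qed.

Lemma covC A B : cov A B = cov B A.
Proof.
rewrite /cov mulrC; congr (_ - _); congr Ex.
by apply/funext => x; rewrite mulrC.
Qed.

Lemma covDr A B B' : itg B -> itg B' -> itg (fun x => A x * B x) -> itg (fun x => A x * B' x) ->
  cov A (fun x => B x + B' x) = cov A B + cov A B'.
Proof.
move=> iB iB' iAB iAB'; rewrite covC covDl//; first by rewrite !(covC A).
  by move: iAB; congr itg; apply/funext => x; rewrite mulrC.
by move: iAB'; congr itg; apply/funext => x; rewrite mulrC.
Qed.

Lemma Ex_indic (E : set Om) : measurable E -> Ex \1_E = fine (P E).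
Proof. by move=> mE; rewrite /Ex /Rintegral integral_indic// setIT. Qed.

Lemma itg_indic (E : set Om) : measurable E -> itg \1_E.
Proof. by move=> mE; apply: integrable_indic. Qed.

(** The sum is the integer part of [y]; written with indicators it turns a function into its
    superlevel sets. *)
Lemma count_floor (y : R) n : 0 <= y <= n%:R ->
  y - 1 <= \sum_(i < n) ((i.+1%:R <= y)%R : nat)%:R <= y.
Proof.
elim: n => [|n IH] /andP[y0 yn].
  by rewrite big_ord0; apply/andP; split; lra.
rewrite big_ord_recr/=; have [yn'|yn'] := lerP y n%:R.
  have -> : (n.+1%:R <= y) = false.
    by apply/negbTE; rewrite -ltNge (le_lt_trans yn')// ltr_nat.
  by rewrite addr0; apply: IH; rewrite y0.
have -> : \sum_(i < n) (((i.+1%:R <= y)%R : nat)%:R : R) = n%:R.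
  rewrite (eq_bigr (fun=> 1)) ?sumr_const ?card_ord// => i _.
  by rewrite (le_trans _ (ltW yn')) ?ler_nat.
by move: yn; rewrite -natr1; case: (lerP (n%:R + 1) y) => /= h1 h2; apply/andP; split; lra.
Qed.

Section unit_interval.
Variables (G1 G2 : set (set Om)) (a : R).
Hypotheses (a0 : 0 <= a) (mix : mixing a G1 G2).

Let lev A n (i : nat) : set Om := [set x | i.+1%:R <= n%:R * A x].

(** The staircase [floor (n A) / n] of a function with values in [[0, 1]], as an average of
    indicators of superlevel sets. *)
Let stp A n x : R := n%:R^-1 * \sum_(i < n) \1_(lev A n i) x.

Let lev_pre A n i : lev A n i = A @^-1` [set y | i.+1%:R <= n%:R * y].
Proof. by []. Qed.

Let mlev A n i : measurable_fun setT A -> measurable (lev A n i).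
Proof.
move=> mA; rewrite lev_pre -[X in measurable X]setTI; apply: mA => //.
rewrite -[X in measurable X]setTI.
apply: (@measurable_fun_le _ _ _ setT (fun=> i.+1%:R) (fun y : R => n%:R * y)) => //.
exact: measurable_funM.
Qed.

Let stp_close A n x : (0 < n)%N -> 0 <= A x <= 1 -> `|A x - stp A n x| <= n%:R^-1.
Proof.
move=> n0 /andP[A0 A1]; have n0' : 0 < n%:R :> R by rewrite ltr0n.
have := @count_floor (n%:R * A x) n.
rewrite mulr_ge0 ?ler0n//= ler_piMr ?ler0n// => /(_ isT).
rewrite (eq_bigr (fun i : 'I_n => \1_(lev A n i) x)); last first.
  by move=> i _; rewrite indicE; congr (_%:R); apply: congr1; apply/idP/idP; rewrite inE.
rewrite /stp; set S := \sum_(i < n) _ => /andP[h1 h2].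
have -> : A x - n%:R^-1 * S = n%:R^-1 * (n%:R * A x - S).
  by field; rewrite gt_eqF.
rewrite normrM ger0_norm ?invr_ge0 ?ler0n// ler_piMr ?invr_ge0 ?ler0n//.
by rewrite ler_norml; apply/andP; split; lra.
Qed.

Let stp01 A n x : (0 < n)%N -> 0 <= stp A n x <= 1.
Proof.
move=> n0; rewrite /stp mulr_ge0 ?invr_ge0 ?ler0n//=; last by apply: sumr_ge0.
rewrite ler_pdivrMl ?ltr0n// mulr1.
rewrite [leRHS](_ : _ = \sum_(i < n) (1 : R)); last by rewrite sumr_const card_ord.
by rewrite ler_sum.
Qed.

Let mstp A n : measurable_fun setT A -> measurable_fun setT (stp A n).
Proof.
move=> mA; apply: measurable_funM => //; apply: measurable_sum => i.
exact/measurable_indic/mlev.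
Qed.

Lemma cov_sum A B n m (F : 'I_n -> set Om) (H : 'I_m -> set Om) :
  (forall i, measurable (F i)) -> (forall j, measurable (H j)) ->
  (forall i, <<s G1>> (F i)) -> (forall j, <<s G2>> (H j)) ->
  A = (fun x => \sum_(i < n) \1_(F i) x) -> B = (fun x => \sum_(i < m) \1_(H i) x) ->
  `|cov A B| <= n%:R * m%:R * a.
Proof.
move=> mF mH sF sH -> ->; rewrite /cov.
rewrite (_ : (fun x => _ * _) = fun x => \sum_(i < n) \sum_(j < m) \1_(F i `&` H j) x); last first.
  apply/funext => x; rewrite mulr_suml; apply: eq_bigr => i _.
  by rewrite mulr_sumr; apply: eq_bigr => j _; rewrite indicI.
rewrite !Ex_sum; [|by move=> i; exact: itg_indic|by move=> i; exact: itg_indic|]; last first.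
  by move=> i; apply: itg_sum => j; apply: itg_indic; exact: measurableI.
rewrite mulr_suml -sumrB (le_trans (ler_norm_sum _ _ _))//.
rewrite [leRHS](_ : _ = \sum_(i < n) (m%:R * a)); last first.
  by rewrite sumr_const card_ord -[RHS]mulr_natl mulrA.
rewrite ler_sum// => i _.
rewrite Ex_sum; last by move=> j; apply: itg_indic; exact: measurableI.
rewrite mulr_sumr -sumrB (le_trans (ler_norm_sum _ _ _))//.
rewrite [leRHS](_ : _ = \sum_(j < m) a); last by rewrite sumr_const card_ord -[RHS]mulr_natl.
rewrite ler_sum// => j _.
by rewrite !Ex_indic//; [exact: mix|exact: measurableI].
Qed.

(** The staircases of [A] and [B] are averages of [n] indicators of events of the two
    sigma-algebras, so their covariance is an average of [n^2] quantities bounded by [a]. Passing to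
    the staircases costs [4 / n], and [n] is arbitrary. *)
Lemma cov_unit A B : measurable_fun setT A -> measurable_fun setT B ->
  smeas G1 A -> smeas G2 B -> (forall x, 0 <= A x <= 1) -> (forall x, 0 <= B x <= 1) ->
  `|cov A B| <= a.
Proof.
move=> mA mB sA sB A01 B01.
have bd (C : Om -> R) : (forall x, 0 <= C x <= 1) -> forall x, `|C x| <= 1.
  by move=> C01 x; have /andP[? ?] := C01 x; rewrite ger0_norm.
have step n : (0 < n)%N -> `|cov A B| <= a + 4 / n%:R.
  move=> n0; have n0' : 0 < n%:R :> R by rewrite ltr0n.
  have An01 x := @stp01 A n x n0; have Bn01 x := @stp01 B n x n0.
  have iA : itg A by apply: (@itg_bounded _ 1) => //; exact: bd.
  have iB : itg B by apply: (@itg_bounded _ 1) => //; exact: bd.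
  have iAn : itg (stp A n) by apply: (@itg_bounded _ 1); [exact: mstp|exact: bd].
  have iBn : itg (stp B n) by apply: (@itg_bounded _ 1); [exact: mstp|exact: bd].
  have mul1 (x y : R) : `|x| <= 1 -> `|y| <= 1 -> `|x * y| <= 1.
    by move=> x1 y1; rewrite normrM mulr_ile1.
  have iAB : itg (fun x => A x * B x).
    by apply: (@itg_bounded _ 1); [exact: measurable_funM|move=> x; apply: mul1; exact: bd].
  have iABn : itg (fun x => stp A n x * stp B n x).
    apply: (@itg_bounded _ 1); last by move=> x; apply: mul1; exact: bd.
    by apply: measurable_funM; exact: mstp.
  have c1 : `|cov (stp A n) (stp B n)| <= a.
    have h := @cov_sum _ _ n n (fun i => lev A n i) (fun i => lev B n i) _ _ _ _ erefl erefl.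
    have {h} := h (fun i => @mlev _ _ _ mA) (fun i => @mlev _ _ _ mB) _ _.
    set SA := fun x => _; set SB := fun x => _ => h.
    have -> : cov (stp A n) (stp B n) = n%:R^-1 * n%:R^-1 * cov SA SB.
      have iS C : measurable_fun setT C -> itg (fun x => \sum_(i < n) \1_(lev C n i) x).
        by move=> mC; apply: itg_sum => i; exact/itg_indic/mlev.
      rewrite /cov (_ : (fun x => _ * _) = fun x => n%:R^-1 * n%:R^-1 * (SA x * SB x)).
        rewrite ExZ; first by rewrite /stp !ExZ; [ring|exact: iS..].
        have := itgZ (n%:R * n%:R) iABn; congr itg; apply/funext => x.
        by rewrite /stp -/(SA x) -/(SB x); field; rewrite gt_eqF.
      by apply/funext => x; rewrite /stp -/(SA x) -/(SB x); ring.
    rewrite normrM ger0_norm ?mulr_ge0 ?invr_ge0 ?ler0n//.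
    rewrite -invfM ler_pdivrMl ?mulr_gt0//; apply: h.
      move=> i; rewrite lev_pre; apply: smeas_pre => //.
      rewrite -[X in measurable X]setTI.
      apply: (@measurable_fun_le _ _ _ setT (fun=> i.+1%:R) (fun y : R => n%:R * y)) => //.
      exact: measurable_funM.
    move=> i; rewrite lev_pre; apply: smeas_pre => //.
    rewrite -[X in measurable X]setTI.
    apply: (@measurable_fun_le _ _ _ setT (fun=> i.+1%:R) (fun y : R => n%:R * y)) => //.
    exact: measurable_funM.
  have c2 : `|Ex (fun x => A x * B x) - Ex (fun x => stp A n x * stp B n x)| <= 2 / n%:R.
    rewrite -ExB// -[leRHS](Ex_cst P); apply: Ex_normle; [exact: itgB|exact: itg_cst|] => x.
    have -> : A x * B x - stp A n x * stp B n x =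
       (A x - stp A n x) * B x + stp A n x * (B x - stp B n x) by ring.
    rewrite (le_trans (ler_normD _ _))// (normrM (A x - _)) (normrM (stp A n x)).
    have h1 := stp_close n0 (A01 x); have h2 := stp_close n0 (B01 x).
    have h3 := bd _ B01 x; have h4 := bd _ An01 x.
    rewrite (_ : 2 / n%:R = n%:R^-1 + n%:R^-1); last by ring.
    apply: lerD; first by rewrite -[leRHS]mulr1; apply: ler_pM.
    by rewrite -[leRHS]mul1r; apply: ler_pM.
  have EC (C : Om -> R) : itg C -> (forall x, 0 <= C x <= 1) -> `|Ex C| <= 1.
    by move=> iC C01; rewrite -[leRHS](Ex_cst P); apply: Ex_normle; [|exact: itg_cst|exact: bd].
  have Eclose (C : Om -> R) : itg C -> itg (stp C n) -> (forall x, 0 <= C x <= 1) ->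
      `|Ex C - Ex (stp C n)| <= n%:R^-1.
    move=> iC iCn C01; rewrite -ExB// -[leRHS](Ex_cst P).
    by apply: Ex_normle; [exact: itgB|exact: itg_cst|] => x; exact: stp_close.
  have c3 : `|Ex A * Ex B - Ex (stp A n) * Ex (stp B n)| <= 2 / n%:R.
    have -> : Ex A * Ex B - Ex (stp A n) * Ex (stp B n) =
       (Ex A - Ex (stp A n)) * Ex B + Ex (stp A n) * (Ex B - Ex (stp B n)) by ring.
    rewrite (le_trans (ler_normD _ _))// !normrM.
    have h1 := Eclose _ iA iAn A01; have h2 := Eclose _ iB iBn B01.
    have h3 := EC _ iB B01; have h4 := EC _ iAn An01.
    rewrite (_ : 2 / n%:R = n%:R^-1 + n%:R^-1); last by ring.
    apply: lerD; first by rewrite -[leRHS]mulr1; apply: ler_pM.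
    by rewrite -[leRHS]mul1r; apply: ler_pM.
  have -> : cov A B = cov (stp A n) (stp B n)
      + (Ex (fun x => A x * B x) - Ex (fun x => stp A n x * stp B n x))
      - (Ex A * Ex B - Ex (stp A n) * Ex (stp B n)) by rewrite /cov; ring.
  rewrite (le_trans (ler_normB _ _))// (le_trans (lerD (ler_normD _ _) (lexx _)))//.
  have -> : a + 4 / n%:R = a + 2 / n%:R + 2 / n%:R by ring.
  exact: lerD (lerD c1 c2) c3.
rewrite leNgt; apply/negP => h.
pose e := `|cov A B| - a; have e0 : 0 < e by rewrite subr_gt0.
have [n _ /=] := near_infty_natSinv_lt (PosNum (divr_gt0 e0 (ltr0n R 4))).
move=> /(_ n (leqnn n)) /= hn.
have := step n.+1 isT; apply/negP; rewrite -ltNge -ltrBrDl -/e.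
by move: hn; rewrite ltr_pdivlMr// mulrC.
Qed.

(** Affine maps onto [[0, 1]] divide the variables by [2 x] and [2 y], whence the factor 4. *)
Lemma cov_bounded A B x y : measurable_fun setT A -> measurable_fun setT B ->
  smeas G1 A -> smeas G2 B -> 0 < x -> 0 < y ->
  (forall t, `|A t| <= x) -> (forall t, `|B t| <= y) ->
  `|cov A B| <= 4 * (x * y) * a.
Proof.
move=> mA mB sA sB x0 y0 Ax By.
pose A' t := (2 * x)^-1 * A t + 2^-1; pose B' t := (2 * y)^-1 * B t + 2^-1.
have x20 : 2 * x != 0 by rewrite mulf_neq0// gt_eqF.
have y20 : 2 * y != 0 by rewrite mulf_neq0// gt_eqF.
have iA : itg A by exact: (itg_bounded mA Ax).
have iB : itg B by exact: (itg_bounded mB By).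
have iAB : itg (fun t => A t * B t).
  apply: (@itg_bounded _ (x * y)); first exact: measurable_funM.
  by move=> t; rewrite normrM ler_pM.
have b01 (k z : R) : 0 < k -> `|z| <= k -> 0 <= (2 * k)^-1 * z + 2^-1 <= 1.
  move=> k0; rewrite ler_norml => /andP[z1 z2]; rewrite invfM.
  have -> : 2^-1 * k^-1 * z + 2^-1 = (z + k) / (2 * k) by field; rewrite gt_eqF.
  rewrite divr_ge0 ?mulr_ge0 ?(ltW k0)//=; last by lra.
  rewrite ler_pdivrMr ?mulr_gt0//; lra.
have -> : cov A B = 4 * (x * y) * cov A' B'.
  have ic k : itg (fun=> k) by exact: itg_cst.
  rewrite /cov /A' /B' !ExD ?ExZ ?Ex_cst//; [|exact: itgZ..].
  rewrite (_ : (fun t => (_ + _) * (_ + _)) = fun t => (2 * x)^-1 * (2 * y)^-1 * (A t * B t) +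
     ((2 * x)^-1 / 2 * A t + ((2 * y)^-1 / 2 * B t + 4^-1))); last first.
    by apply/funext => t; field; rewrite !gt_eqF.
  rewrite !ExD ?ExZ ?Ex_cst//; try by repeat first [apply: itgD|apply: itgZ|apply: itg_cst].
  by field; rewrite !gt_eqF.
rewrite normrM ger0_norm; last by rewrite mulr_ge0// mulr_ge0// ltW.
apply: ler_wpM2l; first by rewrite mulr_ge0// mulr_ge0// ltW.
apply: cov_unit.
- by apply: measurable_funD => //; exact: measurable_funM.
- by apply: measurable_funD => //; exact: measurable_funM.
- by apply: smeasD; [apply: smeasM => //|]; exact: smeas_cst.
- by apply: smeasD; [apply: smeasM => //|]; exact: smeas_cst.
- by move=> t; exact: b01.
- by move=> t; exact: b01.
Qed.

End unit_interval.
End covariance_inequality.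

Section davydov.
Context {R : realType} {d} {Om : measurableType d} (P : probability Om R).
Implicit Types (A B : Om -> R) (G : set (set Om)).

(** Above the truncation height one has [a z^(1/th) >= 1]; the power [e] of this inequality buys the
    factor [a^e] at the price of a higher power of [z]. *)
Let davydov_tail (a th e z : R) : 0 < a -> 0 < th -> 0 <= e -> a `^ (- th) < z ->
  z <= a `^ e * (z `^ th^-1) `^ (th + e).
Proof.
move=> a0 th0 e0 az.
have z0 : 0 < z by apply: le_lt_trans az; exact: powR_ge0.
have -> : (z `^ th^-1) `^ (th + e) = z * (z `^ th^-1) `^ e.
  rewrite powRD; last by apply/implyP => _; rewrite gt_eqF// powR_gt0.
  by rewrite -[in X in X * _]powRrM mulVf ?gt_eqF// powRr1 ?ltW.
rewrite mulrCA ler_peMr ?(ltW z0)//.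
rewrite -powRM ?(ltW a0) ?powR_ge0//.
rewrite -[leLHS](_ : 1 `^ e = 1); last by rewrite powR1.
apply: ge0_ler_powR => //; rewrite ?nnegrE ?mulr_ge0 ?(ltW a0) ?powR_ge0//.
have -> : a = (a `^ th) `^ th^-1 by rewrite -powRrM mulfV ?gt_eqF// powRr1// ltW.
rewrite -powRM ?powR_ge0 ?(ltW z0)//.
rewrite -[leLHS](_ : 1 `^ th^-1 = 1); last by rewrite powR1.
apply: ge0_ler_powR; rewrite ?nnegrE ?invr_ge0 ?mulr_ge0 ?powR_ge0 ?(ltW z0) ?(ltW th0)//.
by move: az; rewrite powRN -[X in X < z -> _]mulr1 ltr_pdivrMl ?powR_gt0// => /ltW.
Qed.

(** Each variable is cut at the height [c a^(-th)], which by Markov's inequality is exceeded with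
    probability at most [a]. The truncated parts obey the bound for bounded variables; every product
    containing a tail is small by Young's inequality, the tail supplying the power of [a]. *)
Lemma davydov (a th th' c c' : R) G1 G2 A B : 0 < a <= 1 -> mixing P a G1 G2 ->
  0 < th -> 0 < th' -> th + th' < 1 ->
  mb P th c A -> mb P th' c' B -> smeas G1 A -> smeas G2 B ->
  `|cov P A B| <= 8 * a `^ (1 - th - th') * (c * c').
Proof.
move=> /andP[a0 a1] mix t0 t0' tt hA hB sA sB.
have [mA c0 _] := hA; have [mB c0' _] := hB.
pose k := 1 - th - th'; have k0 : 0 < k by rewrite /k; lra.
pose x := a `^ (- th); pose y := a `^ (- th').
have x0 : 0 < x by exact: powR_gt0.
have y0 : 0 < y by exact: powR_gt0.
pose f (c z w : R) := if `|w| <= c * z then w else 0.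
have mf u z : measurable_fun setT (f u z).
  apply: measurable_fun_ifT => //.
  by apply: measurable_fun_ler => //; exact: measurableT_comp.
pose A1 t := f c x (A t); pose B1 t := f c' y (B t).
pose A2 t := A t - A1 t; pose B2 t := B t - B1 t.
have mA1 : measurable_fun setT A1 by apply: measurableT_comp.
have mB1 : measurable_fun setT B1 by apply: measurableT_comp.
have mA2 : measurable_fun setT A2 by apply: measurable_funB.
have mB2 : measurable_fun setT B2 by apply: measurable_funB.
have fle u z w : `|f u z w| <= `|w| by rewrite /f; case: ifP => // _; rewrite normr0.
have f2le u z w : `|w - f u z w| <= `|w| by rewrite /f; case: ifP => // _; rewrite ?subrr ?normr0// subr0.
have th1 : 0 < th <= 1 by rewrite t0/=; lra.
have th1' : 0 < th' <= 1 by rewrite t0'/=; lra.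
have tt1 : 0 < th + th' <= 1 by rewrite addr_gt0//= ltW.
have hA1 : mb P th c A1 by apply: mb_dom (ltW t0) mA1 _ hA => t; exact: fle.
have hB1 : mb P th' c' B1 by apply: mb_dom (ltW t0') mB1 _ hB => t; exact: fle.
have hA2 : mb P th c A2 by apply: mb_dom (ltW t0) mA2 _ hA => t; exact: f2le.
have hB2 : mb P th' c' B2 by apply: mb_dom (ltW t0') mB2 _ hB => t; exact: f2le.
have iM U V : mb P th c U -> mb P th' c' V -> itg P (fun t => U t * V t).
  by move=> hU hV; apply: mb_itg (mb_mul _ _ hU hV).
(* Stated for any two orders with the same sum, so that it serves for the tail of either variable,
   against the other one, its truncation, or the constant 1. *)
have tail1 (s s' u u' : R) (U V : Om -> R) (s0 : 0 < s) (s0' : 0 < s') : s + s' = th + th' -> 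
    mb P s u U -> mb P s' u' V ->
    `|Ex P (fun t => (U t - f u (a `^ (- s)) (U t)) * V t)| <= a `^ k * (u * u').
  move=> ss hU hV; have [mU u0 _] := hU; have [mV u0' _] := hV.
  have iU := itg_mbfun hU; have iV := itg_mbfun hV.
  have sk1 : s + k + s' = 1.
    by rewrite /k (addrC s) -addrA ss; ring.
  pose W t := a `^ k * (u * u') * ((s + k) * (`|U t| / u) `^ s^-1 + s' * (`|V t| / u') `^ s'^-1).
  have iW : itg P W by apply: itgZ; apply: itgD; exact: itgZ.
  apply: (@le_trans _ _ (Ex P W)); last first.
    rewrite /W ExZ ?ExD ?ExZ//; [|exact: itgZ|exact: itgZ|by apply: itgD; exact: itgZ].
    apply: ler_piMr; first by rewrite mulr_ge0 ?powR_ge0 ?mulr_ge0// ltW.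
    have h1 := mb_Ex hU; have h2 := mb_Ex hV.
    have sk : 0 <= s + k by rewrite addr_ge0// ltW.
    by rewrite -[leRHS]sk1; apply: lerD; [exact: (ler_piMr sk h1)|exact: (ler_piMr (ltW s0') h2)].
  have UVW t : `|(U t - f u (a `^ (- s)) (U t)) * V t| <= W t.
    have z0 : 0 <= (`|U t| / u) `^ s^-1 by exact: powR_ge0.
    have z0' : 0 <= (`|V t| / u') `^ s'^-1 by exact: powR_ge0.
    rewrite /f; case: ifPn => [_|].
      rewrite subrr mul0r normr0 /W mulr_ge0 ?mulr_ge0 ?powR_ge0 ?(ltW u0) ?(ltW u0')//.
      apply: addr_ge0; apply: mulr_ge0 => //; last exact: ltW.
      by rewrite addr_ge0 ?(ltW s0) ?(ltW k0).
    rewrite -ltNge mulrC -ltr_pdivlMr// => h; rewrite subr0 normrM.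
    have h1 := davydov_tail a0 s0 (ltW k0) h.
    have h2 : (((`|U t| / u) `^ s^-1) `^ (s + k)) * (((`|V t| / u') `^ s'^-1) `^ s') <=
        (s + k) * (`|U t| / u) `^ s^-1 + s' * (`|V t| / u') `^ s'^-1.
      apply: young2 => //; last exact: ltW.
      by rewrite addr_ge0 ?(ltW s0) ?(ltW k0).
    rewrite -[in X in _ * X](powRrM (`|V t| / u')) mulVf ?gt_eqF// powRr1 ?ndiv_ge0// in h2.
    have -> : `|U t| * `|V t| = (u * u') * ((`|U t| / u) * (`|V t| / u')).
      by field; rewrite !gt_eqF.
    rewrite (_ : W t = u * u' * (a `^ k * ((s + k) * (`|U t| / u) `^ s^-1 +
      s' * (`|V t| / u') `^ s'^-1))); last by rewrite /W; ring.
    apply: ler_wpM2l; first by rewrite mulr_ge0// ltW.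
    apply: le_trans (ler_wpM2r (ndiv_ge0 (V t) u0') h1) _.
    by rewrite -mulrA; apply: ler_wpM2l => //; exact: powR_ge0.
  apply: Ex_normle => //; apply: itg_le0 iW => //.
  by apply: measurable_funM => //; apply: measurable_funB => //; exact: measurableT_comp.
have cst1 (s : R) : 0 <= s -> mb P s 1 (fun=> 1) by move=> s0; apply: mb_const; rewrite ?normr1.
have EA2 : `|Ex P A2| <= a `^ k * c.
  have := tail1 _ _ _ _ _ _ t0 t0' erefl hA (cst1 _ (ltW t0')).
  by rewrite mulr1; under [X in Ex P X]eq_fun do rewrite mulr1.
have EB2 : `|Ex P B2| <= a `^ k * c'.
  have := tail1 _ _ _ _ _ _ t0' t0 (addrC _ _) hB (cst1 _ (ltW t0)).
  by rewrite mulr1; under [X in Ex P X]eq_fun do rewrite mulr1.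
have EA2B : `|Ex P (fun t => A2 t * B t)| <= a `^ k * (c * c').
  exact: (tail1 _ _ _ _ _ _ t0 t0' erefl hA hB).
have EA1B2 : `|Ex P (fun t => A1 t * B2 t)| <= a `^ k * (c * c').
  have := tail1 _ _ _ _ _ _ t0' t0 (addrC _ _) hB hA1.
  by rewrite (mulrC c'); under [X in Ex P X]eq_fun do rewrite mulrC.
have EB := mb_absEle th1' hB.
have EA1 := mb_absEle th1 hA1.
have c1 : `|cov P A1 B1| <= 4 * ((c * x) * (c' * y)) * a.
  apply: (@cov_bounded _ _ _ _ G1 G2) => //; rewrite ?(ltW a0) ?mulr_gt0//.
  - exact: smeas_comp.
  - exact: smeas_comp.
  - by move=> t; rewrite /A1 /f; case: ifP => // _; rewrite normr0 mulr_ge0// ltW.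
  - by move=> t; rewrite /B1 /f; case: ifP => // _; rewrite normr0 mulr_ge0// ltW.
(* The heights are chosen so that the bound for the truncated parts carries exactly the power of [a]
   found in the tails. *)
have xya : x * y * a = a `^ k.
  rewrite /x /y -powRD; last by apply/implyP => _; rewrite gt_eqF.
  rewrite -[in X in _ * X](powRr1 (ltW a0)) -powRD; last by apply/implyP => _; rewrite gt_eqF.
  by congr (_ `^ _); rewrite /k; ring.
have iA := mb_itg th1 hA; have iB := mb_itg th1' hB.
have iA1 := mb_itg th1 hA1; have iB1 := mb_itg th1' hB1.
have iA2 := mb_itg th1 hA2; have iB2 := mb_itg th1' hB2.
have -> : cov P A B = cov P A1 B1 + cov P A1 B2 + cov P A2 B.
  rewrite -covDr//; [|exact: iM|exact: iM].
  have -> : (fun t => B1 t + B2 t) = B by apply/funext => t; rewrite /B2; ring.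
  rewrite -covDl//; [|exact: iM|exact: iM].
  by congr cov; apply/funext => t; rewrite /A2; ring.
have c2 : `|cov P A1 B2| <= 2 * (a `^ k * (c * c')).
  rewrite /cov (le_trans (ler_normB _ _))// normrM (_ : 2 * _ = a `^ k * (c * c') + c * (a `^ k * c')); last by ring.
  by apply: lerD => //; apply: ler_pM.
have c3 : `|cov P A2 B| <= 2 * (a `^ k * (c * c')).
  rewrite /cov (le_trans (ler_normB _ _))// normrM (_ : 2 * _ = a `^ k * (c * c') + (a `^ k * c) * c'); last by ring.
  by apply: lerD => //; apply: ler_pM.
rewrite (le_trans (ler_normD _ _))// (le_trans (lerD (ler_normD _ _) (lexx _)))//.
have -> : 8 * a `^ (1 - th - th') * (c * c') = 4 * ((c * x) * (c' * y)) * a +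
    2 * (a `^ k * (c * c')) + 2 * (a `^ k * (c * c')).
  rewrite -/k (_ : 4 * ((c * x) * (c' * y)) * a = 4 * (c * c') * (x * y * a)); last by ring.
  by rewrite xya; ring.
by rewrite !lerD.
Qed.

End davydov.

(** * Derivatives on the line and Taylor's formula with Hölder remainder *)

Section calculus.
Context {R : realType}.
Implicit Types (f g : R -> R) (x y a b : R).

Definition isd f x l := is_derive x (1 : R) f l.

Lemma isd_eq f x a b : isd f x a -> a = b -> isd f x b.
Proof. by move=> h <-. Qed.

Lemma isd_cst k x : isd (fun=> k) x 0.
Proof. exact: is_derive_cst. Qed.

Lemma isd_id x : isd (fun y => y) x 1.
Proof. exact: is_derive_id. Qed.

Lemma isdD f g x a b : isd f x a -> isd g x b -> isd (fun y => f y + g y) x (a + b).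
Proof. by move=> hf hg; exact: is_deriveD. Qed.

Lemma isdB f g x a b : isd f x a -> isd g x b -> isd (fun y => f y - g y) x (a - b).
Proof. by move=> hf hg; exact: is_deriveB. Qed.

Lemma isdN f x a : isd f x a -> isd (fun y => - f y) x (- a).
Proof. by move=> hf; exact: is_deriveN. Qed.

Lemma isdM f g x a b : isd f x a -> isd g x b ->
  isd (fun y => f y * g y) x (a * g x + f x * b).
Proof.
move=> hf hg; have h := is_deriveM hf hg.
by apply: isd_eq h _; rewrite /GRing.scale/= addrC (mulrC (g x)).
Qed.

Lemma isdZ k f x a : isd f x a -> isd (fun y => k * f y) x (k * a).
Proof. by move=> hf; apply: isd_eq (isdM (isd_cst k x) hf) _; rewrite mul0r add0r. Qed.

Lemma isd_comp f g x a b : isd f (g x) a -> isd g x b -> isd (fun y => f (g y)) x (a * b).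
Proof.
move=> hf hg; by have h := is_derive1_comp hf hg; apply: isd_eq h _; rewrite // mulrC.
Qed.

Lemma isd_sum n (F : nat -> R -> R) (D : nat -> R) x : (forall i, (i < n)%N -> isd (F i) x (D i)) ->
  isd (fun y => \sum_(i < n) F i y) x (\sum_(i < n) D i).
Proof.
elim: n => [|n IH] h.
  rewrite big_ord0 (_ : (fun y => _) = fun=> 0); first exact: isd_cst.
  by apply/funext => y; rewrite big_ord0.
rewrite big_ord_recr/= (_ : (fun y => _) = fun y => \sum_(i < n) F i y + F n y).
  by apply: isdD; [apply: IH => i ni; apply: h; rewrite ltnS ltnW|exact: h].
by apply/funext => y; rewrite big_ord_recr.
Qed.

Lemma isdX n x : isd (fun y => y ^+ n) x (n%:R * x ^+ n.-1).
Proof.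
elim: n => [|n IH]; first by rewrite mul0r; exact: isd_cst.
rewrite (_ : (fun y => _) = fun y => y * y ^+ n); last by apply/funext => y; rewrite exprS.
apply: isd_eq (isdM (isd_id x) IH) _ => /=.
case: n {IH} => [|n]; first by ring.
by rewrite mulrCA -exprS -mulrDl nat1r.
Qed.

Lemma isd_exp x : isd expR x (expR x).
Proof. exact: is_derive_expR. Qed.

Lemma isd_continuous f x a : isd f x a -> {for x, continuous f}.
Proof. by case=> h _; apply/differentiable_continuous/derivable1_diffP. Qed.

Lemma isd_within f (df : R -> R) a b : (forall x, isd f x (df x)) ->
  {within `[a, b], continuous f}.
Proof.
move=> h; apply: continuous_subspaceT => x; exact: isd_continuous (h x).
Qed.

Lemma mvt f (df : R -> R) a b : a <= b -> (forall x, isd f x (df x)) ->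
  exists2 c, a <= c <= b & f b - f a = df c * (b - a).
Proof.
move=> ab h; have [c cab e] := MVT_segment ab (fun x _ => h x) (isd_within (a := a) (b := b) h).
by exists c => //; rewrite in_itv in cab.
Qed.

Lemma mvt_abs f (df : R -> R) y : (forall x, isd f x (df x)) ->
  exists2 c, `|c| <= `|y| & f y - f 0 = df c * y.
Proof.
move=> h; have [y0|y0] := leP 0 y.
  have [c /andP[c1 c2] e] := mvt y0 h; rewrite subr0 in e.
  by exists c => //; rewrite !ger0_norm.
have [c /andP[c1 c2] e] := mvt (ltW y0) h; rewrite sub0r in e.
exists c; first by rewrite !ler0_norm ?lerN2 ?(ltW y0).
by rewrite -opprB e mulrN opprK.
Qed.

End calculus.

Section smooth.
Context {R : realType}.

(** The derivatives travel as a sequence: [g j] is the [j]-th derivative for [j <= m], entries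
    beyond [m] are free, and passing to a derivative is a shift of the sequence. *)
Definition smooth (m : nat) (w H : R) (g : nat -> R -> R) :=
  (forall j x, (j < m)%N -> isd (g j) x (g j.+1 x)) /\ (forall x y, `|g m x - g m y| <= H * `|x - y| `^ w).

Definition shiftn (q : nat) (g : nat -> R -> R) : nat -> R -> R := fun j => g (q + j)%N.

Lemma smooth_shift m w H g q : (q <= m)%N -> smooth m w H g -> smooth (m - q) w H (shiftn q g).
Proof.
move=> qm [h1 h2]; split; last by move=> x y; rewrite /shiftn subnKC.
by move=> j x jm; rewrite /shiftn addnS; apply: h1; lia.
Qed.

Lemma smooth_leH m w H H' g : H <= H' -> smooth m w H g -> smooth m w H' g.
Proof.
move=> HH [h1 h2]; split => // x y; apply: le_trans (h2 x y) _.
by rewrite ler_wpM2r// powR_ge0.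
Qed.

Lemma hoelder_continuous (w H : R) (f : R -> R) : 0 < w ->
  (forall x y, `|f x - f y| <= H * `|x - y| `^ w) -> continuous f.
Proof.
move=> w0 h x; have H0 : 0 <= H by have := h 1 0; rewrite subr0 normr1 powR1 mulr1; apply: le_trans.
have H1 : 0 < H + 1 by rewrite ltr_wpDl.
apply/cvgrPdist_lt => e e0.
have e1 : 0 < (H + 1)^-1 * e by rewrite mulr_gt0// invr_gt0.
near=> y.
apply: le_lt_trans (h x y) _.
apply: (@le_lt_trans _ _ ((H + 1) * `|x - y| `^ w)); first by rewrite ler_wpM2r ?powR_ge0// lerDl.
rewrite -ltr_pdivlMl//.
have -> : (H + 1)^-1 * e = (((H + 1)^-1 * e) `^ w^-1) `^ w.
  by rewrite -powRrM mulVf ?gt_eqF// powRr1// ltW.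
apply: gt0_ltr_powR; rewrite ?nnegrE ?powR_ge0//.
near: y; apply/nbhs_ballP; exists (((H + 1)^-1 * e) `^ w^-1) => //=.
exact: powR_gt0.
Unshelve. all: by end_near. Qed.

Lemma smooth_continuous m w H g j : 0 < w -> smooth m w H g -> (j <= m)%N -> continuous (g j).
Proof.
move=> w0 [h1 h2]; rewrite leq_eqVlt => /predU1P[->|jm]; first exact: hoelder_continuous h2.
by move=> x; apply: isd_continuous (h1 j x jm).
Qed.

Lemma smooth_measurable m w H g j : 0 < w -> smooth m w H g -> (j <= m)%N ->
  measurable_fun setT (g j).
Proof. by move=> w0 hg jm; apply: continuous_measurable_fun; exact: smooth_continuous hg jm. Qed.

Definition taylor (m : nat) (g : nat -> R -> R) x y := \sum_(q < m.+1) g q x * y ^+ q / q`!%:R.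

(** The derivative in [y] of the remainder is the remainder of the derivative, one order lower;
    induction with the mean value theorem therefore keeps the constant [H]. *)
Lemma taylor_bound m w H g : 0 < w -> smooth m w H g ->
  forall x y, `|g 0 (x + y) - taylor m g x y| <= H * `|y| `^ (m%:R + w).
Proof.
move=> w0; elim: m g => [|m IH] g hg x y.
  rewrite /taylor big_ord1/= expr0 fact0 mulr1 divr1 add0r.
  by apply: le_trans (proj2 hg _ _) _; rewrite addrAC subrr add0r.
have hg1 : smooth m w H (shiftn 1 g) by have := smooth_shift (ltn0Sn m) hg; rewrite subSS subn0.
pose phi z := g 0 (x + z) - taylor m.+1 g x z.
pose dphi z := shiftn 1 g 0 (x + z) - taylor m (shiftn 1 g) x z.
have dp z : isd phi z (dphi z).
  apply: isdB.
    have h : isd (fun t => x + t) z (0 + 1) by apply: isdD; [exact: isd_cst|exact: isd_id].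
    have := isd_comp (g := fun t => x + t) (proj1 hg 0%N (x + z) (ltn0Sn m)) h.
    by rewrite add0r mulr1.
  pose F q t := g q x * t ^+ q / q`!%:R.
  pose D q := if q is q'.+1 then g q x * z ^+ q' / q'`!%:R else 0.
  have : isd (fun t => \sum_(q < m.+2) F q t) z (\sum_(q < m.+2) D q).
    apply: isd_sum => -[|q] _ /=.
      rewrite /F (_ : (fun t => _) = fun=> g 0 x * 1 / 1); first exact: isd_cst.
      by apply/funext => t; rewrite expr0 fact0.
    rewrite /F (_ : (fun t => _) = fun t => (g q.+1 x / q.+1`!%:R) * t ^+ q.+1); last first.
      by apply/funext => t; rewrite mulrAC.
    apply: isd_eq (isdZ _ (isdX q.+1 z)) _ => /=.
    have q0 : q`!%:R != 0 :> R by rewrite pnatr_eq0 -lt0n fact_gt0.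
    have q1 : q.+1%:R != 0 :> R by rewrite pnatr_eq0.
    by rewrite factS natrM; field; rewrite q0 nat1r q1.
  rewrite big_ord_recl/= add0r /taylor; congr isd; apply: eq_bigr => q _.
have phi0 : phi 0 = 0.
  rewrite /phi /taylor big_ord_recl/= big1; last first.
    by move=> i _; rewrite /bump/= add1n expr0n/= mulr0 mul0r.
  by rewrite expr0 fact0 mulr1 divr1 !addr0 subrr.
have [c cy e] := mvt_abs y dp; rewrite phi0 subr0 in e.
rewrite -/(phi y) e normrM -natr1 addrAC powRD; last first.
  apply/implyP => /eqP h; exfalso.
  have : 0 < m%:R + w + 1 by rewrite ltr_wpDl// addr_ge0// ltW.
  by rewrite h ltxx.
rewrite powRr1// mulrA ler_wpM2r//; apply: le_trans (IH _ hg1 x c) _.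
have H0 : 0 <= H by have := proj2 hg 1 0; rewrite subr0 normr1 powR1 mulr1; apply: le_trans.
rewrite ler_wpM2l//; apply: ge0_ler_powR => //; by rewrite addr_ge0// ltW.
Qed.

End smooth.

(** * Sums over dyadic levels *)

Section level_sums.
Context {R : realType}.
Implicit Types (c e u w D : R) (F : nat -> R).

Definition E2 (x : R) : R := 2 `^ x.

Lemma E2_gt0 x : 0 < E2 x.
Proof. exact: powR_gt0. Qed.

Lemma E2_ge0 x : 0 <= E2 x.
Proof. exact: powR_ge0. Qed.

Lemma E2D x y : E2 (x + y) = E2 x * E2 y.
Proof. by rewrite /E2 powRD//; apply/implyP => _; rewrite pnatr_eq0. Qed.

Lemma E20 : E2 0 = 1.
Proof. exact: powRr0. Qed.

Lemma le_E2 x y : x <= y -> E2 x <= E2 y.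
Proof. by move=> xy; apply: ler_powR => //; rewrite ler1n. Qed.

Definition geo c : R := (1 - E2 (- c))^-1.

Lemma E2N_lt1 c : 0 < c -> E2 (- c) < 1.
Proof.
move=> c0; rewrite /E2 powRN invf_lt1 ?powR_gt0//.
rewrite -[ltLHS](@powRr0 _ 2) ltNge; apply/negP => h.
have : 2 `^ 0 <= 2 `^ c :> R by apply: ler_powR; rewrite ?ler1n ?ltW.
move=> h'; have e : 2 `^ c = 2 `^ 0 :> R by apply/eqP; rewrite eq_le h.
have := congr1 (@ln R) e; rewrite !ln_powR mul0r => /eqP.
by rewrite mulf_eq0 (gt_eqF c0)/= gt_eqF// ln_gt0// ltr1n.
Qed.

Lemma geo_gt0 c : 0 < c -> 0 < geo c.
Proof. by move=> c0; rewrite invr_gt0 subr_gt0 E2N_lt1. Qed.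

Lemma E2Nn c n : E2 (- (c * n%:R)) = E2 (- c) ^+ n.
Proof. by rewrite -mulNr /E2 powRrM powR_mulrn// powR_ge0. Qed.

Lemma sum_geo_le c n : 0 < c -> \sum_(s < n) E2 (- (c * s%:R)) <= geo c.
Proof.
move=> c0; set x := E2 (- c); have x1 : x < 1 by exact: E2N_lt1.
have x0 : 0 <= x by exact: E2_ge0.
rewrite (eq_bigr (fun s : 'I_n => x ^+ s)); last by move=> s _; rewrite E2Nn.
have h : (1 - x) * \sum_(s < n) x ^+ s = 1 - x ^+ n.
  by rewrite -[in RHS](expr1n _ n) subrXX; congr (_ * _); apply: eq_bigr => i _; rewrite expr1n mul1r.
rewrite /geo -/x -[leRHS]mulr1 ler_pdivlMl ?subr_gt0// h.
by rewrite lerBlDr lerDl exprn_ge0.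
Qed.

(** Pairs are split by which index is larger. The larger one carries [F], the smaller one is summed
    out at cost [g], once for each ordering; hence the factor 2. *)
Lemma double_level_sum (phi : nat -> nat -> R) g F n : 0 <= g ->
  (forall t s, 0 <= phi t s) -> (forall t, 0 <= F t) ->
  (forall t, \sum_(s < t.+1) phi t s <= g) ->
  \sum_(l < n) \sum_(m < n) phi (maxn l m) (minn l m) * F (maxn l m) <= 2 * g * \sum_(t < n) F t.
Proof.
move=> g0 phi0 F0 hg.
have half : \sum_(l < n) \sum_(m < n) ((m <= l)%N : nat)%:R * (phi l m * F l) <= g * \sum_(t < n) F t.
  rewrite mulr_sumr ler_sum// => l _.
  rewrite -(big_mkord xpredT (fun m => ((m <= l)%N : nat)%:R * (phi l m * F l))).
  rewrite (big_cat_nat (n := l.+1))//= [X in _ + X]big_nat_cond [X in _ + X]big1 ?addr0; last first.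
    by move=> m /andP[/andP[h _] _]; rewrite leqNgt h/= mul0r.
  rewrite big_mkord (eq_bigr (fun m : 'I_l.+1 => phi l m * F l)); last first.
    by move=> m _; rewrite -ltnS ltn_ord mul1r.
  rewrite -mulr_suml; apply: ler_wpM2r; [exact: F0|exact: hg].
have -> : 2 * g * \sum_(t < n) F t = g * \sum_(t < n) F t + g * \sum_(t < n) F t by ring.
apply: le_trans (lerD half half); rewrite [X in _ <= _ + X]exchange_big/= -big_split/=.
rewrite ler_sum// => l _; rewrite -big_split/= ler_sum// => m _.
have pos x y : 0 <= phi x y * F x by rewrite mulr_ge0.
case: (leqP l m) => lm.
  by rewrite mul1r lerDr mulr_ge0.
by rewrite (ltnW lm) mul1r lerDl mulr_ge0.
Qed.

Lemma double_level_sum_gap c F n : 0 < c -> (forall t, 0 <= F t) ->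
  \sum_(l < n) \sum_(m < n) E2 (- (c * (maxn l m - minn l m)%:R)) * F (maxn l m)
    <= 2 * geo c * \sum_(t < n) F t.
Proof.
move=> c0 F0; apply: (@double_level_sum (fun t s => E2 (- (c * (t - s)%:R)))) => //.
- by rewrite ltW// geo_gt0.
- by move=> *; exact: E2_ge0.
- move=> t; apply: le_trans (sum_geo_le t.+1 c0).
  rewrite (reindex_inj rev_ord_inj)/= ler_sum// => s _.
  by rewrite subSS subKn// -ltnS.
Qed.

Lemma double_level_sum_min c F n : 0 < c -> (forall t, 0 <= F t) ->
  \sum_(l < n) \sum_(m < n) E2 (- (c * (minn l m)%:R)) * F (maxn l m)
    <= 2 * geo c * \sum_(t < n) F t.
Proof.
move=> c0 F0; apply: (@double_level_sum (fun t s => E2 (- (c * s%:R)))) => //.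
- by rewrite ltW// geo_gt0.
- by move=> *; exact: E2_ge0.
- by move=> t; exact: sum_geo_le.
Qed.

End level_sums.

Section error_sums.
Context {R : realType}.
Variables (J dm : nat) (w u : R).
Hypotheses (w01 : 0 < w <= 1) (u0 : 0 < u) (dm0 : (0 < dm)%N).
Implicit Types (e : R) (i j l q : nat).

(** These quantities are chosen to be stable under the removal of sites. [Lv j] is the covariance
    decay at level [j]; [Hs e i] is the error for a partial sum that misses as many sites as a ball
    of level [i]; [As e j i] is the error for a factor decorrelated to level [j]. Removing the sites
    up to level [l] turns [j] and [i] into maxima with [l], which explains [maxn]. *)
Definition Lv j : R := E2 (- (u * j%:R)).
Definition Hs e i : R := \sum_(q < J.+1) E2 (e * (maxn i q)%:R - u * q%:R).
Definition As e j i : R :=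
  \sum_(l < J.+1) E2 (dm%:R * w * l%:R) * Lv (maxn j l) * Hs (e - dm%:R * w) (maxn i l).

Let d0 : 0 < dm%:R :> R. Proof. by rewrite ltr0n. Qed.
Let dw0 : 0 < dm%:R * w. Proof. by case/andP: w01 => ? _; rewrite mulr_gt0. Qed.
Let dwd : dm%:R * w <= dm%:R. Proof. by case/andP: w01 => _ ?; rewrite ler_piMr. Qed.

Lemma Lv_ge0 j : 0 <= Lv j. Proof. exact: E2_ge0. Qed.

Lemma Lv0 : Lv 0 = 1. Proof. by rewrite /Lv mulr0 oppr0 E20. Qed.
Lemma Hs_ge0 e i : 0 <= Hs e i. Proof. by apply: sumr_ge0 => q _; exact: E2_ge0. Qed.
Lemma As_ge0 e j i : 0 <= As e j i.
Proof. by apply: sumr_ge0 => l _; rewrite !mulr_ge0 ?E2_ge0 ?Hs_ge0. Qed.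

Lemma Hs_ge e i : E2 (e * i%:R) <= Hs e i.
Proof.
rewrite /Hs big_ord_recl/= maxn0 mulr0 subr0 lerDl.
by apply: sumr_ge0 => q _; exact: E2_ge0.
Qed.

Lemma Hs_ge1 e i : 0 <= e -> 1 <= Hs e i.
Proof.
move=> e0; apply: le_trans (Hs_ge e i); rewrite -[leLHS]E20; apply: le_E2.
by apply: mulr_ge0 => //; exact: ler0n.
Qed.

Lemma le_Hs e e' i : e <= e' -> Hs e i <= Hs e' i.
Proof. by move=> ee; apply: ler_sum => q _; apply: le_E2; rewrite lerD2r ler_wpM2r. Qed.

Lemma le_As e e' j i : e <= e' -> As e j i <= As e' j i.
Proof.
move=> ee; apply: ler_sum => l _; rewrite ler_wpM2l ?mulr_ge0 ?E2_ge0//.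
by apply: le_Hs; rewrite lerD2r.
Qed.

(** Every exponent contains [maxn i q >= t], so lowering the growth rate by [c] pays for the factor
    [2^(c t)]. *)
Lemma Hs_shift c e t i : 0 <= c -> (t <= i)%N -> E2 (c * t%:R) * Hs (e - c) i <= Hs e i.
Proof.
move=> c0 ti; rewrite mulr_sumr ler_sum// => q _; rewrite -E2D; apply: le_E2.
rewrite addrA lerD2r mulrBl addrCA gerDl subr_le0 ler_wpM2l// ler_nat.
exact: leq_trans ti (leq_maxl _ _).
Qed.

Lemma sum_AsHs e j i : \sum_(l < J.+1) E2 (dm%:R * l%:R) * (Lv (maxn j l) * Hs (e - dm%:R) (maxn i l)) <= As e j i.
Proof.
apply: ler_sum => l _; rewrite mulrCA.
rewrite [leRHS](_ : _ = Lv (maxn j l) * (E2 (dm%:R * w * l%:R) * Hs (e - dm%:R * w) (maxn i l))).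
  apply: ler_wpM2l; first exact: Lv_ge0.
  have -> : dm%:R * l%:R = dm%:R * w * l%:R + (dm%:R - dm%:R * w) * l%:R by ring.
  rewrite E2D -(mulrA (E2 _)); apply: ler_wpM2l; first exact: E2_ge0.
  have -> : e - dm%:R = e - dm%:R * w - (dm%:R - dm%:R * w) by ring.
  by apply: Hs_shift; [rewrite subr_ge0|exact: leq_maxr].
by ring.
Qed.

Lemma sum_AsL e j i : dm%:R <= e -> \sum_(l < J.+1) E2 (dm%:R * l%:R) * Lv (maxn j l) <= As e j i.
Proof.
move=> de; apply: le_trans (sum_AsHs e j i); apply: ler_sum => l _.
rewrite ler_wpM2l ?E2_ge0// ler_peMr ?Lv_ge0// Hs_ge1// subr_ge0.
exact: de.
Qed.

Lemma sum_AsLw j i : \sum_(l < J.+1) E2 (dm%:R * w * l%:R) * Lv (maxn j l) <= As (dm%:R * w) j i.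
Proof.
apply: ler_sum => l _; rewrite ler_peMr ?mulr_ge0 ?E2_ge0//.
by rewrite subrr Hs_ge1.
Qed.

(** One more removal step does not enlarge the order of the error. Once [2^(dm t)] is absorbed at
    the larger level [t], what remains decays in the gap between the two levels at rate [dm w]; this
    uses [0 < w <= 1]. *)
Lemma sum_AsAs e j i :
  \sum_(l < J.+1) E2 (dm%:R * l%:R) * As (e - dm%:R) (maxn j l) (maxn i l)
    <= 2 * geo (dm%:R * w) * As e j i.
Proof.
pose F t := E2 (dm%:R * w * t%:R) * Lv (maxn j t) * Hs (e - dm%:R * w) (maxn i t).
have F0 t : 0 <= F t by rewrite /F !mulr_ge0 ?E2_ge0 ?Hs_ge0.
apply: le_trans (double_level_sum_gap J.+1 dw0 F0).
apply: ler_sum => l _; rewrite mulr_sumr; apply: ler_sum => m _.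
rewrite -!maxnA; set t := maxn l m; rewrite /F.
set H1 := Hs (e - dm%:R - _) _; set H2 := Hs _ (maxn i t); set Lt := Lv _.
have h : E2 (dm%:R * t%:R) * H1 <= H2.
  rewrite /H1 (_ : e - dm%:R - dm%:R * w = e - dm%:R * w - dm%:R); last by ring.
  by apply: Hs_shift => //; exact: leq_maxr.
pose a : R := E2 (dm%:R * l%:R + dm%:R * w * m%:R - dm%:R * t%:R).
have ea : E2 (dm%:R * l%:R) * E2 (dm%:R * w * m%:R) = a * E2 (dm%:R * t%:R).
  by rewrite -!E2D; congr E2; ring.
rewrite [leLHS](_ : _ = a * Lt * (E2 (dm%:R * t%:R) * H1)); last first.
  by rewrite !mulrA ea; ring.
apply: (@le_trans _ _ (a * Lt * H2)).
  by rewrite ler_wpM2l// mulr_ge0 ?E2_ge0.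
rewrite !mulrA -E2D; apply: ler_wpM2r; first exact: Hs_ge0.
apply: ler_wpM2r; first exact: Lv_ge0.
apply: le_E2; rewrite /t; move: (dwd).
case: (leqP l m) => lm; rewrite natrB ?(ltnW lm)//.
  have : 0 <= m%:R - l%:R :> R by rewrite subr_ge0 ler_nat.
  nra.
lra.
Qed.

(** The larger of [l] and [q] plays the part of the index in [Hs]; the smaller one is left with a
    summable weight of rate [u]. *)
Lemma Hs_minmax e i : \sum_(l < J.+1) \sum_(q < J.+1) 
    E2 (e * (maxn i (maxn l q))%:R - u * l%:R - u * q%:R) <= 2 * geo u * Hs e i.
Proof.
pose F t := E2 (e * (maxn i t)%:R - u * t%:R).
apply: le_trans (double_level_sum_min J.+1 u0 (fun t => E2_ge0 _ : 0 <= F t)).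
apply: ler_sum => l _; apply: ler_sum => q _; rewrite /F -E2D; apply: le_E2.
case: (leqP l q) => lq; lra.
Qed.

(** The factor [2^(dm i)] stands for the number of sites put back into a hole of level [i]. *)
Lemma sum_HsAs e i : E2 (dm%:R * i%:R) * As (e - dm%:R) 0 i <= 2 * geo u * Hs e i.
Proof.
apply: le_trans (Hs_minmax e i); rewrite mulr_sumr ler_sum// => l _.
rewrite max0n /Lv mulrA -!E2D mulr_sumr ler_sum// => q _; rewrite -E2D; apply: le_E2.
rewrite maxnA; set t := maxn (maxn i l) q.
have h1 : 0 <= t%:R - i%:R :> R by rewrite subr_ge0 ler_nat /t; lia.
have h2 : 0 <= t%:R - l%:R :> R by rewrite subr_ge0 ler_nat /t; lia.
have hd := d0; have hdw := dw0; nra.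
Qed.

Lemma sum_HsHs e i : E2 (dm%:R * i%:R) * Hs (e - dm%:R) i <= Hs e i.
Proof. exact: Hs_shift. Qed.

Lemma As00 e : dm%:R * w <= e -> As e 0 0 <= 2 * geo u * Hs e 0.
Proof.
move=> dwe; apply: le_trans (Hs_minmax e 0); apply: ler_sum => l _.
rewrite !max0n /Lv -!E2D mulr_sumr ler_sum// => q _; rewrite -E2D; apply: le_E2.
rewrite max0n; have h2 : 0 <= (maxn l q)%:R - l%:R :> R by rewrite subr_ge0 ler_nat; lia.
have hdw := dw0; nra.
Qed.

End error_sums.

(** * Removing sites from a mixing field *)

Section core.
Context {R : realType} {d} {Om : measurableType d} (P : probability Om R) (T : finType).
Variables (Y : T -> Om -> R) (G : {set T} -> set (set Om)) (lv : T -> T -> nat) (al : nat -> R).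
Variables (J dm Q : nat) (rho b w u D Cl : R).

Local Notation Ex := (Ex P).
Local Notation itg := (itg P).
Local Notation mb := (mb P).
Local Notation Lv := (Lv u).
Local Notation Hs := (Hs J u).
Local Notation As := (As J dm w u).

(** All that is used of the lattice: levels [lv] capped at [J], at most [D 2^(dm l)] sites within
    level [l] of a site, and a mixing coefficient for each positive level. [Q] bounds the number of
    sites entering a product. The strict inequality [mf_rhoQ] leaves a positive power of the
    coefficient in Davydov's inequality, and [mf_decay] says that this power decays like
    [2^(-u l)]. *)
Record mixing_field : Prop := MixingField {
  mf_rho : 0 < rho;
  mf_b : 0 < b;
  mf_w : 0 < w <= 1;
  mf_u : 0 < u;
  mf_dm : (0 < dm)%N;
  mf_D : 1 <= D;
  mf_Cl : 1 <= Cl;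
  mf_rhoQ : (Q%:R + w) * rho < 1;
  mf_lvJ : forall i s, (lv i s <= J)%N;
  mf_count : forall i l, (l <= J)%N -> #|[set s | (lv i s <= l)%N]%SET|%:R <= D * E2 (dm%:R * l%:R);
  mf_Gmono : forall U V : {set T}, U \subset V -> G U `<=` <<s G V>>;
  mf_GY : forall i, smeas (G [set i]%SET) (Y i);
  mf_Y : forall i, mb rho b (Y i);
  mf_al : forall l, 0 < al l <= 1;
  mf_mix : forall (U1 U2 : {set T}) l, (#|U1| <= Q)%N -> (0 < l <= J)%N ->
    (forall i s, i \in U1 -> s \in U2 -> (l <= lv i s)%N) -> mixing P (al l) (G U1) (G U2);
  mf_decay : forall l, (0 < l <= J)%N -> al l `^ (1 - (Q%:R + w) * rho) <= Cl * Lv l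
}.

Hypothesis MF : mixing_field.

Let rho0 := mf_rho MF.
Let b0 := mf_b MF.
Let w0 : 0 < w. Proof. by case/andP: (mf_w MF). Qed.
Let w1 : w <= 1. Proof. by case/andP: (mf_w MF). Qed.
Let Cl0 : 0 < Cl. Proof. by apply: lt_le_trans (mf_Cl MF). Qed.
Let D0 : 0 < D. Proof. by apply: lt_le_trans (mf_D MF). Qed.
Let mY i : measurable_fun setT (Y i). Proof. by case: (mf_Y MF i). Qed.

Definition psum (S : {set T}) (x : Om) : R := \sum_(i in S) Y i x.

Lemma psum_add s (S : {set T}) x : s \notin S -> psum (s |: S) x = Y s x + psum S x.
Proof. by move=> sS; rewrite /psum big_setU1. Qed.

Lemma psum0 x : psum finset.set0 x = 0.
Proof. by rewrite /psum big_set0. Qed.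

Lemma smeas_Y (S : {set T}) i : i \in S -> smeas (G S) (Y i).
Proof.
by move=> iS; apply: (smeas_sub _ (@mf_GY MF i)); apply: (mf_Gmono MF); rewrite finset.sub1set.
Qed.

Lemma smeas_mono (U V : {set T}) (A : Om -> R) : U \subset V -> smeas (G U) A -> smeas (G V) A.
Proof. by move=> UV; apply: smeas_sub; exact: (mf_Gmono MF UV). Qed.

Lemma smeas_psum S : smeas (G S) (psum S).
Proof.
rewrite /psum (_ : (fun x => _) = fun x => \sum_(i <- enum S) if i \in S then Y i x else 0).
  apply: smeas_sum => i; case: (boolP (i \in S)) => iS; [exact: smeas_Y|exact: smeas_cst].
apply/funext => x; rewrite [RHS]big_enum/= big_mkcond/= [RHS]big_mkcond/=.
by apply: eq_bigr => i _; case: ifP.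
Qed.

Lemma measurable_psum S : measurable_fun setT (psum S).
Proof.
rewrite /psum; under eq_fun do rewrite big_mkcond/=.
apply: measurable_sum => i; case: (i \in S) => //; exact: measurable_cst.
Qed.

Lemma mb_psum (S : {set T}) n : (1 <= Q)%N -> 0 < n -> #|S|%:R <= n -> mb rho (n * b) (psum S).
Proof.
move=> Q1 n0 Sn.
rewrite (_ : psum S = fun x => \sum_(i <- enum S) Y i x); last first.
  by apply/funext => x; rewrite /psum big_enum.
have r1 : 0 < rho <= 1.
  have h1 : 1 <= Q%:R :> R by rewrite ler1n.
  have h2 := mf_rhoQ MF; have h3 := rho0; have h4 := w0.
  by rewrite rho0/=; nra.
have sz : (size (enum S))%:R <= n by rewrite -cardE.
exact: mb_sum r1 b0 n0 sz (fun i => @mf_Y MF i).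
Qed.

Lemma smooth_growth m H g : 0 <= H -> smooth m w H g ->
  exists2 C0 : R, 0 < C0 & forall x, `|g 0 x| <= C0 * (1 + `|x| `^ (m%:R + w)).
Proof.
move=> H0 hg; pose C0 := \sum_(q < m.+1) `|g q 0| + H + 1.
have S0 : 0 <= \sum_(q < m.+1) `|g q 0| by apply: sumr_ge0.
have mw0 : 0 < m%:R + w by rewrite ltr_wpDl.
exists C0; first by rewrite /C0 ltr_wpDl// addr_ge0.
move=> x; have := taylor_bound w0 hg 0 x; rewrite add0r => h.
have {h} : `|g 0 x| <= `|taylor m g 0 x| + H * `|x| `^ (m%:R + w).
  rewrite -lerBlDl; apply: le_trans h; exact: lerB_dist.
move/le_trans; apply.
have y0 : 0 <= `|x| `^ (m%:R + w) by exact: powR_ge0.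
have h1 : `|taylor m g 0 x| <= (\sum_(q < m.+1) `|g q 0|) * (1 + `|x| `^ (m%:R + w)).
  rewrite /taylor mulr_suml; apply: le_trans (ler_norm_sum _ _ _) _; apply: ler_sum => q _.
  rewrite !normrM -mulrA ler_wpM2l// normrX.
  have xq : `|x| ^+ q <= 1 + `|x| `^ (m%:R + w).
    have [x1|x1] := leP `|x| 1.
      by apply: (@le_trans _ _ 1); [exact: exprn_ile1|rewrite lerDl].
    apply: (@le_trans _ _ (`|x| `^ (m%:R + w))); last by rewrite lerDr.
    rewrite -powR_mulrn//; apply: ler_powR; first exact: ltW.
    by apply: (@le_trans _ _ m%:R); [rewrite ler_nat -ltnS|rewrite lerDl ltW].
  rewrite normfV normr_nat; apply: le_trans xq.
  rewrite ler_piMr ?exprn_ge0// invf_le1 ?ltr0n ?fact_gt0//.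
  by rewrite ler1n fact_gt0.
rewrite /C0; nra.
Qed.

Definition fin (th : R) (A : Om -> R) := exists c, mb th c A.

Lemma fin_itg th A : 0 < th <= 1 -> fin th A -> itg A.
Proof. by move=> h [c hA]; apply: mb_itg hA. Qed.

Lemma fin_mul th th' A B : 0 < th -> 0 < th' -> fin th A -> fin th' B -> fin (th + th') (fun x => A x * B x).
Proof. by move=> t t' [c hA] [c' hB]; exists (c * c'); apply: mb_mul. Qed.

Lemma fin_psum S : (1 <= Q)%N -> fin rho (psum S).
Proof.
move=> Q1; exists ((#|S|%:R + 1) * b).
have n0 : 0 < #|S|%:R + 1 :> R by rewrite ltr_wpDl.
by apply: mb_psum => //; rewrite lerDl.
Qed.

Lemma fin_smooth m H g S j : (1 <= Q)%N -> (m <= Q)%N -> 0 <= H -> smooth m w H g -> (j <= m)%N ->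
  fin ((m%:R + w) * rho) (fun x => g j (psum S x)).
Proof.
move=> Q1 mQ H0 hg jm; have mg := smooth_measurable w0 hg jm.
have hg' := smooth_shift jm hg.
have [C0 C00 hC] := smooth_growth H0 hg'.
have [c hc] := fin_psum S Q1.
have t0 : 0 < (m - j)%:R + w by rewrite ltr_wpDl.
have tle : (m - j)%:R + w <= m%:R + w by rewrite lerD2r ler_nat leq_subr.
have t1 : (m%:R + w) * rho <= 1.
  apply/ltW; apply: le_lt_trans (mf_rhoQ MF).
  by rewrite ler_wpM2r ?(ltW rho0)// lerD2r ler_nat.
have t1' : ((m - j)%:R + w) * rho <= (m%:R + w) * rho by rewrite ler_wpM2r ?(ltW rho0).
have tr0 : 0 < ((m - j)%:R + w) * rho by exact: mulr_gt0.
have h1 := mb_powR t0 (ltW rho0) hc.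
have h2 : mb (rho * ((m - j)%:R + w)) 1 (fun=> 1).
  by apply: mb_const; rewrite ?normr1// mulr_ge0 ?ltW.
have h3 : mb (rho * ((m - j)%:R + w)) (1 + c `^ ((m - j)%:R + w)) (fun x => 1 + `|psum S x| `^ ((m - j)%:R + w)).
  by apply: mb_add => //; rewrite mulrC tr0 (le_trans t1').
have h4 := mb_scale (ltW (mulr_gt0 rho0 t0)) C00 h3.
exists (C0 * (1 + c `^ ((m - j)%:R + w))).
apply: (@mb_mono _ _ _ _ (((m - j)%:R + w) * rho)); first by rewrite tr0.
rewrite mulrC; apply: mb_dom h4; first by rewrite mulr_ge0 ?ltW.
  exact: measurableT_comp mg (measurable_psum S).
move=> x; have := hC (psum S x); rewrite /shiftn addn0 => /le_trans; apply.
exact: ler_norm.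
Qed.

Lemma itg_smooth m H g S j : (1 <= Q)%N -> (m <= Q)%N -> 0 <= H -> smooth m w H g -> (j <= m)%N ->
  itg (fun x => g j (psum S x)).
Proof.
move=> Q1 mQ H0 hg jm; apply: fin_itg (fin_smooth S Q1 mQ H0 hg jm).
rewrite mulr_gt0//= ?ltr_wpDl//; apply/ltW; apply: le_lt_trans (mf_rhoQ MF).
by rewrite ler_wpM2r ?(ltW rho0)// lerD2r ler_nat.
Qed.

(* [Phi] is, up to [e] times the Hölder seminorm, a fixed linear combination of
   the expectations of the derivatives at the full sum. *)
Definition approx (m : nat) (e : R) (Phi : (nat -> R -> R) -> R) :=
  exists c : nat -> R, forall H g, 0 < H -> smooth m w H g ->
    `|Phi g - \sum_(j < m.+1) c j * Ex (fun x => g j (psum [set: T]%SET x))| <= H * e.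

Lemma approx_ext m e Phi Psi : (forall H g, 0 < H -> smooth m w H g -> Phi g = Psi g) ->
  approx m e Phi -> approx m e Psi.
Proof. by move=> h [c hc]; exists c => H g H0 hg; rewrite -(h H)//; apply: hc. Qed.

Lemma approx_le m e e' Phi : e <= e' -> approx m e Phi -> approx m e' Phi.
Proof.
move=> ee [c hc]; exists c => H g H0 hg; apply: le_trans (hc H g H0 hg) _.
by rewrite ler_wpM2l// ltW.
Qed.

Lemma approx_rem m e Phi : (forall H g, 0 < H -> smooth m w H g -> `|Phi g| <= H * e) ->
  approx m e Phi.
Proof.
move=> h; exists (fun=> 0) => H g H0 hg.
by rewrite big1 ?subr0 => [|i _]; [exact: h|rewrite mul0r].
Qed.

Lemma approx_add m e e' Phi Psi : approx m e Phi -> approx m e' Psi ->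
  approx m (e + e') (fun g => Phi g + Psi g).
Proof.
move=> [c hc] [c' hc']; exists (fun j => c j + c' j) => H g H0 hg.
under eq_bigr do rewrite mulrDl.
rewrite big_split/= opprD addrACA mulrDr (le_trans (ler_normD _ _))// lerD//.
  exact: hc.
exact: hc'.
Qed.

Lemma approx_scale m e k Phi : approx m e Phi -> approx m (`|k| * e) (fun g => k * Phi g).
Proof.
move=> [c hc]; exists (fun j => k * c j) => H g H0 hg.
under eq_bigr do rewrite -mulrA.
rewrite -mulr_sumr -mulrBr normrM mulrCA ler_wpM2l//.
exact: hc.
Qed.

Lemma approx_sum m n (e : nat -> R) (Phi : nat -> (nat -> R -> R) -> R) :
  (forall k, (k < n)%N -> approx m (e k) (Phi k)) ->
  approx m (\sum_(k < n) e k) (fun g => \sum_(k < n) Phi k g).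
Proof.
elim: n => [|n IH] h.
  by apply: approx_rem => H g _ _; rewrite !big_ord0 normr0 mulr0.
rewrite big_ord_recr/=; apply: (@approx_ext _ _ (fun g => \sum_(k < n) Phi k g + Phi n g)).
  by move=> H g _ _; rewrite big_ord_recr.
by apply: approx_add; [apply: IH => k kn; apply: h; exact: ltnW|exact: h].
Qed.

Lemma approx_shift m q e Phi : (q <= m)%N -> approx (m - q) e Phi ->
  approx m e (fun g => Phi (shiftn q g)).
Proof.
move=> qm [c hc]; exists (fun j => if (q <= j)%N then c (j - q)%N else 0) => H g H0 hg.
have := hc H _ H0 (smooth_shift qm hg).
congr (`|_ - _| <= _).
rewrite -(big_mkord xpredT (fun j => (if (q <= j)%N then c (j - q)%N else 0) * Ex (fun x => g j (psum [set: T]%SET x)))).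
rewrite (big_cat_nat (n := q))//=; last by rewrite ltnW.
rewrite [X in _ = X + _]big_nat_cond [X in _ = X + _]big1 ?add0r; last first.
  by move=> j /andP[/andP[_ jq] _]; rewrite leqNgt jq/= mul0r.
rewrite -[X in index_iota X _](add0n q) big_addn subSn// big_mkord.
by apply: eq_bigr => i _; rewrite leq_addl addnK /shiftn addnC.
Qed.

Definition centre (A : Om -> R) (x : Om) : R := A x - Ex A.

(** Invariant of the removal process. [A] is a product of order [a] on the sites [I]; [S] holds the
    sites still in play, and its complement, the hole, is no larger than a ball of level [i]. [A] is
    orthogonal, up to the decay of level [j], to every variable of order [m + w] that depends on
    [S]; [m] counts the derivatives left. The budget [a + m <= Q] keeps all products within the
    available moments and mixing order. *)
Definition state (a m : nat) (K : R) (A : Om -> R) (I S : {set T}) (j i : nat) : Prop :=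
  [/\ (0 < a)%N /\ (a + m <= Q)%N,
      (0 < #|I| <= a)%N /\ smeas (G I) A,
      mb (a%:R * rho) (K * b ^+ a) A,
      forall Z g, smeas (G S) Z -> mb ((m%:R + w) * rho) g Z ->
        `|Ex (fun x => A x * Z x)| <= K * b ^+ a * Lv j * g &
      [/\ (j <= J)%N, (i <= J)%N & #|~: S|%:R <= K * E2 (dm%:R * i%:R)]].

Section with_state.
Variables (a m : nat) (K : R) (A : Om -> R) (I S : {set T}) (j i : nat).
Hypotheses (K1 : 1 <= K) (st : state a m K A I S j i).

Let a0 : (0 < a)%N. Proof. by case: st => -[]. Qed.
Let amQ : (a + m <= Q)%N. Proof. by case: st => -[]. Qed.
Let Q1 : (1 <= Q)%N. Proof. by apply: leq_trans amQ; rewrite addn_gt0 a0. Qed.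
Let mQ : (m <= Q)%N. Proof. by apply: leq_trans amQ; rewrite leq_addl. Qed.
Let K0 : 0 < K. Proof. by apply: lt_le_trans K1. Qed.
Let ba0 : 0 < b ^+ a. Proof. exact: exprn_gt0. Qed.
Let stA : mb (a%:R * rho) (K * b ^+ a) A. Proof. by case: st. Qed.
Let mA : measurable_fun setT A. Proof. by case: stA. Qed.
Let sA : smeas (G I) A. Proof. by case: st => _ []. Qed.
Let ar0 : 0 < a%:R * rho. Proof. by rewrite mulr_gt0// ltr0n. Qed.
Let mr0 : 0 < (m%:R + w) * rho. Proof. by rewrite mulr_gt0// ltr_wpDl. Qed.
Let amr : a%:R * rho + (m%:R + w) * rho < 1.
Proof.
apply: le_lt_trans (mf_rhoQ MF); rewrite -mulrDl ler_wpM2r ?(ltW rho0)//.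
by rewrite addrA -natrD lerD2r ler_nat.
Qed.
Let ar1 : 0 < a%:R * rho <= 1. Proof. by rewrite ar0/=; move: amr mr0; lra. Qed.
Let mr1 : 0 < (m%:R + w) * rho <= 1. Proof. by rewrite mr0/=; move: amr ar0; lra. Qed.
Let iA : itg A. Proof. exact: mb_itg ar1 stA. Qed.

Lemma state_Ex : `|Ex A| <= K * b ^+ a * Lv j.
Proof.
have [_ _ _ h _] := st.
have := h (fun=> 1) 1 (@smeas_cst _ _ _ _ _) (mb_const _ (ltW mr0) ltr01 _).
by rewrite normr1 mulr1 => /(_ (lexx _)); under eq_fun do rewrite mulr1.
Qed.

(** If [l <= j], the inherited bound serves for [E[A Z]] and for [E[A]] separately; otherwise
    Davydov's inequality at level [l] gives the decay. Either way the larger level wins. *)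
Lemma state_cov (S' : {set T}) l (Z : Om -> R) g : S' \subset S -> (l <= J)%N ->
  (forall k s, k \in I -> s \in S' -> (l <= lv k s)%N) ->
  smeas (G S') Z -> mb ((m%:R + w) * rho) g Z ->
  `|Ex (fun x => centre A x * Z x)| <= 8 * K * Cl * b ^+ a * Lv (maxn j l) * g.
Proof.
move=> SS lJ far sZ hZ; have [mZ g0 _] := hZ.
have iZ := mb_itg mr1 hZ.
have iAZ : itg (fun x => A x * Z x).
  by apply: mb_itg (mb_mul ar0 mr0 stA hZ); rewrite addr_gt0//= ltW.
have -> : Ex (fun x => centre A x * Z x) = cov P A Z.
  rewrite /cov /centre (_ : (fun x => _ * _) = fun x => A x * Z x - Ex A * Z x).
    by rewrite ExB ?ExZ//; exact: itgZ.
  by apply/funext => x; rewrite mulrBl.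
have pos : 0 <= K * b ^+ a * g by rewrite !mulr_ge0// ltW.
case: (leqP l j) => [lj|jl].
  have [_ _ _ h _] := st.
  have h1 := h Z g (smeas_mono SS sZ) hZ.
  have h2 : `|Ex A * Ex Z| <= K * b ^+ a * Lv j * g.
    by rewrite normrM; apply: ler_pM => //; [exact: state_Ex|exact: mb_absEle mr1 hZ].
  rewrite /cov (le_trans (ler_normB _ _))// (le_trans (lerD h1 h2))//.
  have := mf_Cl MF; have := Lv_ge0 u j.
  have : 0 <= K * b ^+ a * Lv j * g by rewrite !mulr_ge0 ?Lv_ge0// ltW.
  rewrite (_ : 8 * K * Cl * b ^+ a * Lv j * g = 8 * Cl * (K * b ^+ a * Lv j * g)); last by ring.
  set X := K * _ * _ * _ => X0 _ Cl1; nra.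
have l0 : (0 < l <= J)%N by rewrite lJ andbT; exact: leq_ltn_trans jl.
have Ia : (#|I| <= Q)%N.
  by case: st => _ [/andP[_ Ia] _] _ _ _; apply: leq_trans Ia (leq_trans (leq_addr _ _) amQ).
have hm := mf_mix MF Ia l0 far.
have := davydov (mf_al MF l) hm ar0 mr0 amr stA hZ sA sZ.
move/le_trans; apply.
have /andP[al0 al1] := mf_al MF l.
have h3 : al l `^ (1 - a%:R * rho - (m%:R + w) * rho) <= Cl * Lv l.
  apply: le_trans (mf_decay MF l0); apply: ger_powR; first by rewrite al0.
  rewrite -addrA -opprD lerD2l lerN2 -mulrDl ler_wpM2r ?(ltW rho0)//.
  by rewrite addrA -natrD lerD2r ler_nat.
rewrite (_ : 8 * K * Cl * b ^+ a * Lv l * g = 8 * (Cl * Lv l) * (K * b ^+ a * g)); last by ring.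
by rewrite ler_wpM2r// ler_wpM2l.
Qed.

Lemma mb_centre : mb (a%:R * rho) (2 * K * b ^+ a) (centre A).
Proof.
rewrite (_ : 2 * K * b ^+ a = K * b ^+ a + K * b ^+ a); last by ring.
have hc : mb (a%:R * rho) (K * b ^+ a) (fun=> - Ex A).
  apply: mb_const; [exact: ltW|exact: mulr_gt0|rewrite normrN].
  exact: mb_absEle ar1 stA.
exact: (mb_add ar1 stA hc).
Qed.

(** Growth of the constant in one step: [8 K Cl] comes from the covariance bound, [Q D] from the
    sites added to the hole. *)
Definition stepK (K : R) : R := 8 * K * Cl + Q%:R * D.

(** The power [Y s ^+ q] is counted as part of the test variable, so the orthogonality of the new
    product is the covariance bound of [A] against a variable on [s |: S']. *)
Lemma next_state s (S' : {set T}) l q : S' \subset S -> s \in S -> s \notin S' -> (l <= J)%N ->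
  (forall k t, k \in I -> t \in s |: S' -> (l <= lv k t)%N) -> (0 < q <= m)%N ->
  #|~: S'|%:R <= stepK K * E2 (dm%:R * (maxn i l)%:R) ->
  state (a + q) (m - q) (stepK K) (fun x => centre A x * Y s x ^+ q) (s |: I) S' (maxn j l) (maxn i l).
Proof.
move=> SS sS sS' lJ far /andP[q0 qm] hole.
have [_ [/andP[I0 Ia] _] _ _ [jJ iJ _]] := st.
have KK : 8 * K * Cl <= stepK K by rewrite lerDl mulr_ge0// ltW.
have K2 : 2 * K <= stepK K.
  by apply: le_trans KK; have := mf_Cl MF; move: (K0); nra.
have mbYq : mb (q%:R * rho) (b ^+ q) (fun x => Y s x ^+ q).
  rewrite -(prednK q0) mulrC; exact: (mb_expr q.-1 rho0 (@mf_Y MF s)).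
have q0r : 0 < q%:R * rho by rewrite mulr_gt0// ltr0n.
have sC : smeas (G (s |: I)) (centre A).
  have h1 : smeas (G (s |: I)) A by apply: smeas_mono sA; exact: finset.subsetUr.
  exact: (smeasB h1 (@smeas_cst _ _ _ (G (s |: I)) (Ex A))).
split.
- by split; [rewrite addn_gt0 a0|rewrite -addnA subnKC].
- split; last first.
    apply: smeasM.
      exact: sC.
    by apply: smeasX; apply: smeas_Y; rewrite finset.setU11.
  rewrite (leq_trans I0 (subset_leq_card (finset.subsetUr _ _)))/=.
  by rewrite (leq_trans (leq_card_setU _ _))// cards1 addnC leq_add.
- rewrite natrD mulrDl exprD mulrA.
  have h := mb_mul ar0 q0r mb_centre mbYq.
  apply: mb_lec h; first by rewrite ltW// addr_gt0.
  rewrite ler_pM2r ?exprn_gt0// ler_pM2r//.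
- move=> Z g sZ hZ; have [_ g0 _] := hZ.
  have mqr0 : 0 < ((m - q)%:R + w) * rho by rewrite mulr_gt0// ltr_wpDl.
  have h := mb_mul q0r mqr0 mbYq hZ.
  have eth : q%:R * rho + ((m - q)%:R + w) * rho = (m%:R + w) * rho.
    by rewrite -mulrDl addrA -natrD subnKC.
  rewrite eth in h.
  have sub : s |: S' \subset S by rewrite finset.subUset finset.sub1set sS.
  have smZ : smeas (G (s |: S')) (fun x => Y s x ^+ q * Z x).
    apply: smeasM; last by apply: smeas_mono sZ; exact: finset.subsetUr.
    by apply: smeasX; apply: smeas_Y; rewrite finset.setU11.
  have := state_cov sub lJ far smZ h.
  under eq_fun do rewrite mulrA.
  move/le_trans; apply.
  rewrite exprD (_ : 8 * K * Cl * b ^+ a * Lv (maxn j l) * (b ^+ q * g) =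
     8 * K * Cl * (b ^+ a * b ^+ q * Lv (maxn j l) * g)); last by ring.
  rewrite -!(mulrA (stepK K)); apply: ler_wpM2r => //.
  by rewrite !mulr_ge0 ?Lv_ge0 ?exprn_ge0// ltW.
- by split; rewrite ?geq_max ?jJ ?iJ.
Qed.

End with_state.

(** [J] is the neutral value of the minimum because levels are capped there. *)
Definition lvI (I : {set T}) (s : T) : nat := \big[minn/J]_(i <- enum I) lv i s.

Lemma lvI_le (I : {set T}) i s : i \in I -> (lvI I s <= lv i s)%N.
Proof.
rewrite -mem_enum /lvI; elim: (enum I) => // k l IH.
rewrite in_cons big_cons geq_min => /predU1P[->|/IH ->]; first by rewrite leqnn.
by rewrite orbT.
Qed.

Lemma lvI_J (I : {set T}) s : (lvI I s <= J)%N.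
Proof.
rewrite /lvI; elim/big_rec: _ => // i x _ xJ.
by rewrite geq_min xJ orbT.
Qed.

Lemma lvI_ex (I : {set T}) s : (0 < #|I|)%N -> exists2 i, i \in I & (lv i s <= lvI I s)%N.
Proof.
move=> /card_gt0P[i0 i0I].
have [->|//] : lvI I s = J \/ exists2 i, i \in I & (lv i s <= lvI I s)%N.
  rewrite /lvI.
  have : {subset enum I <= I} by move=> x; rewrite mem_enum.
  elim: (enum I) => [|k l IH] sub; first by rewrite big_nil; left.
  have kI : k \in I by apply: sub; rewrite mem_head.
  rewrite big_cons; have [kx|xk] := leqP (lv k s) (\big[minn/J]_(i <- l) lv i s).
    by right; exists k.
  have [|->|[i iI hi]] := IH; first by move=> x xl; apply: sub; rewrite in_cons xl orbT.
    by left.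
  by right; exists i.
by exists i0 => //; exact: mf_lvJ MF _ _.
Qed.

Lemma card_bigcup_le (I : {set T}) (F : T -> {set T}) :
  (#|(\bigcup_(i in I) F i)%SET| <= \sum_(i in I) #|F i|)%N.
Proof.
elim/big_rec2: _ => [|i x S _ IH]; first by rewrite cards0.
by apply: leq_trans (leq_card_setU _ _) _; rewrite leq_add2l.
Qed.

Lemma lvI_count (I : {set T}) l : (0 < #|I|)%N -> (l <= J)%N ->
  #|[set s | (lvI I s <= l)%N]%SET|%:R <= #|I|%:R * D * E2 (dm%:R * l%:R).
Proof.
move=> I0 lJ.
have sub : [set s | (lvI I s <= l)%N]%SET \subset (\bigcup_(i in I) [set s | (lv i s <= l)%N])%SET.
  apply/fintype.subsetP => s; rewrite inE => h.
  have [i iI hi] := lvI_ex s I0.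
  by apply/finset.bigcupP; exists i => //; rewrite inE (leq_trans hi).
have h := leq_trans (subset_leq_card sub) (card_bigcup_le _ _).
have := h; rewrite -(ler_nat R) => /le_trans; apply.
rewrite natr_sum -mulrA mulr_natl -sumr_const ler_sum// => i _.
exact: mf_count MF _ _ lJ.
Qed.

(** Sites are grouped by level, and the sites at level [l] are counted by the whole ball up to
    [l]. *)
Lemma sum_levels (I S : {set T}) (F : nat -> R) : (0 < #|I|)%N -> (forall l, 0 <= F l) ->
  \sum_(s in S) F (lvI I s) <= #|I|%:R * D * \sum_(l < J.+1) E2 (dm%:R * l%:R) * F l.
Proof.
move=> I0 F0; apply: (@le_trans _ _ (\sum_s F (lvI I s))).
  by rewrite [leRHS](bigID (mem S))/= lerDl sumr_ge0.
have e s : F (lvI I s) = \sum_(l < J.+1) (if lvI I s == l then F l else 0).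
  have lt : (lvI I s < J.+1)%N by rewrite ltnS lvI_J.
  rewrite (bigD1 (Ordinal lt))//= eqxx big1 ?addr0// => l ll.
  by case: eqP => // el; case/eqP: ll; apply: val_inj; rewrite /= el.
rewrite (eq_bigr _ (fun s _ => e s)) exchange_big/= mulr_sumr ler_sum// => l _.
rewrite mulrA -big_mkcond/= sumr_const -[leLHS]mulr_natl ler_wpM2r//.
apply: (@le_trans _ _ #|[set s | (lvI I s <= l)%N]%SET|%:R).
  rewrite ler_nat; apply: subset_leq_card; apply/fintype.subsetP => s.
  by rewrite !inE => /eqP ->.
by apply: lvI_count => //; rewrite -ltnS.
Qed.

Lemma b_split q m : (q <= m)%N -> b ^+ q * b `^ ((m - q)%:R + w) = b `^ (m%:R + w).
Proof.
move=> qm; rewrite -powR_mulrn ?(ltW b0)// -powRD; last by apply/implyP => _; rewrite gt_eqF.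
by rewrite addrA -natrD subnKC.
Qed.

Definition taylor_rem m (g : nat -> R -> R) x y :=
  g 0%N (x + y) - g 0%N x - \sum_(q < m) (q.+1`!%:R)^-1 * (g q.+1 x * y ^+ q.+1).

Lemma taylor_rem_bound m H g x y : smooth m w H g ->
  `|taylor_rem m g x y| <= H * `|y| `^ (m%:R + w).
Proof.
move=> hg; have := taylor_bound w0 hg x y; rewrite /taylor big_ord_recl/= expr0 fact0 mulr1 divr1.
rewrite /taylor_rem opprD addrA; congr (`|_ - _| <= _); apply: eq_bigr => q _.
by rewrite mulrC.
Qed.

Section peel_one.
Variables (a m : nat) (c : R) (A : Om -> R) (s : T) (S' : {set T}).
Hypotheses (amQ : (a + m <= Q)%N) (Q1 : (1 <= Q)%N) (sS' : s \notin S').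
Hypothesis hA : a = 0%N /\ A = (fun=> 1) \/ (0 < a)%N /\ mb (a%:R * rho) c A.

Let peel_mb th Z : 0 < th -> fin th Z -> (a%:R * rho + th < 1) -> itg (fun x => A x * Z x).
Proof.
move=> th0 fZ h; case: hA => [[_ ->]|[a0 hA']].
  under eq_fun do rewrite mul1r.
  by apply: fin_itg fZ; rewrite th0/= ltW//; apply: le_lt_trans h; rewrite lerDr mulr_ge0// ltW.
have ar0 : 0 < a%:R * rho by rewrite mulr_gt0// ltr0n.
apply: (@fin_itg (a%:R * rho + th)); first by rewrite addr_gt0//= ltW.
exact: (fin_mul ar0 th0 (ex_intro _ c hA') fZ).
Qed.

Let mrQ : a%:R * rho + (m%:R + w) * rho < 1.
Proof.
apply: le_lt_trans (mf_rhoQ MF); rewrite -mulrDl ler_wpM2r ?(ltW rho0)//.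
by rewrite addrA -natrD lerD2r ler_nat.
Qed.

Let mQ : (m <= Q)%N. Proof. by apply: leq_trans amQ; rewrite leq_addl. Qed.
Let mr0 : 0 < (m%:R + w) * rho. Proof. by rewrite mulr_gt0// ltr_wpDl. Qed.

Lemma fin_term H g q : 0 < H -> smooth m w H g -> (q < m)%N ->
  fin ((m%:R + w) * rho) (fun x => g q.+1 (psum S' x) * Y s x ^+ q.+1).
Proof.
move=> H0 hg qm.
have h1 : fin (((m - q.+1)%:R + w) * rho) (fun x => g q.+1 (psum S' x)).
  have := fin_smooth S' Q1 (leq_trans (leq_subr q.+1 _) mQ) (ltW H0) (smooth_shift qm hg) (leq0n _).
  by rewrite /shiftn addn0.
have h2 : fin (q.+1%:R * rho) (fun x => Y s x ^+ q.+1).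
  by exists (b ^+ q.+1); rewrite mulrC; exact: (mb_expr q rho0 (@mf_Y MF s)).
have t1 : 0 < ((m - q.+1)%:R + w) * rho by rewrite mulr_gt0// ltr_wpDl.
have t2 : 0 < q.+1%:R * rho by rewrite mulr_gt0.
have e : (m%:R + w) * rho = ((m - q.+1)%:R + w) * rho + q.+1%:R * rho.
  by rewrite -mulrDl addrAC -natrD subnK.
rewrite e; exact: (fin_mul t1 t2 h1 h2).
Qed.

Lemma fin_rem H g : 0 < H -> smooth m w H g ->
  mb ((m%:R + w) * rho) (H * b `^ (m%:R + w)) (fun x => taylor_rem m g (psum S' x) (Y s x)).
Proof.
move=> H0 hg; have mw0 : 0 < m%:R + w by rewrite ltr_wpDl.
have h := mb_scale (ltW (mulr_gt0 rho0 mw0)) H0 (mb_powR mw0 (ltW rho0) (@mf_Y MF s)).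
rewrite (mulrC (_ + w)); apply: mb_dom h; first by rewrite mulr_ge0 ?ltW.
  have mW := measurable_psum S'.
  apply: measurable_funB; first apply: measurable_funB.
  - apply: measurableT_comp; first exact: smooth_measurable w0 hg (leq0n _).
    by apply: measurable_funD => //; exact: mY.
  - by apply: measurableT_comp => //; exact: smooth_measurable w0 hg (leq0n _).
  apply: measurable_sum => q; apply: measurable_funM => //; apply: measurable_funM.
    by apply: measurableT_comp => //; apply: smooth_measurable w0 hg _; rewrite ltn_ord.
  by apply: measurable_funX; exact: mY.
move=> x; apply: le_trans (taylor_rem_bound _ _ hg) _.
exact: ler_norm.
Qed.

(** Taylor expansion at the sum without [s]. The factor [A = 1], of order 0, is a case of its own
    because products of norms are formed for positive orders; it is the one used when a hole is
    refilled. *)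
Lemma peel_expand H g : 0 < H -> smooth m w H g ->
  Ex (fun x => A x * (g 0%N (psum (s |: S') x) - g 0%N (psum S' x))) =
  \sum_(q < m) (q.+1`!%:R)^-1 * Ex (fun x => A x * Y s x ^+ q.+1 * g q.+1 (psum S' x)) +
  Ex (fun x => A x * taylor_rem m g (psum S' x) (Y s x)).
Proof.
move=> H0 hg.
have it (q : 'I_m) : itg (fun x => (q.+1`!%:R)^-1 * (A x * (g q.+1 (psum S' x) * Y s x ^+ q.+1))).
  by apply: itgZ; apply: peel_mb mr0 (fin_term H0 hg (ltn_ord q)) mrQ.
have ir : itg (fun x => A x * taylor_rem m g (psum S' x) (Y s x)).
  by apply: peel_mb mr0 _ mrQ; eexists; exact: fin_rem H0 hg.
rewrite (_ : (fun x => A x * (_ - _)) = fun x =>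
   \sum_(q < m) (q.+1`!%:R)^-1 * (A x * (g q.+1 (psum S' x) * Y s x ^+ q.+1)) +
   A x * taylor_rem m g (psum S' x) (Y s x)); last first.
  apply/funext => x; rewrite psum_add// /taylor_rem.
  under eq_bigr do rewrite mulrCA.
  rewrite -mulr_sumr -mulrDr; congr (_ * _).
  by rewrite (addrC (Y s x)); ring.
rewrite ExD//; last by apply: itg_sum.
rewrite Ex_sum//; congr (_ + _); apply: eq_bigr => q _.
rewrite ExZ; last by apply: peel_mb mr0 (fin_term H0 hg (ltn_ord q)) mrQ.
by congr (_ * Ex _); apply/funext => x; ring.
Qed.

End peel_one.

End core.

Section steps.
Context {R : realType} {d} {Om : measurableType d} (P : probability Om R) (T : finType).
Variables (Y : T -> Om -> R) (G : {set T} -> set (set Om)) (lv : T -> T -> nat) (al : nat -> R).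
Variables (J dm Q : nat) (rho b w u D Cl : R).

Local Notation Ex := (Ex P).
Local Notation itg := (itg P).
Local Notation mb := (mb P).
Local Notation Lv := (Lv u).
Local Notation Hs := (Hs J u).
Local Notation As := (As J dm w u).
Local Notation psum := (psum Y).
Local Notation approx := (approx P Y w).
Local Notation state := (state P G J dm Q rho b w u).
Local Notation centre := (centre P).
Local Notation stepK := (stepK Q D Cl).
Local Notation lvI := (lvI lv J).

(** The two claims are proved together by induction on [m]. In [claimA] the sum over [S] is emptied
    and the centred factor kills the constant that is left; in [claimB] the sum over [S] is
    completed to the full sum. A Taylor term of order [q] contains the [q]-th derivative of [g] and
    refers to the claims at [m - q]. *)
Definition claimA (K C : R) m := forall a A I S j i, state a m K A I S j i ->
  approx m (C * (b ^+ a * b `^ (m%:R + w)) * As (dm%:R * (m%:R + w)) j i)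
    (fun g => Ex (fun x => centre A x * g 0%N (psum S x))).

Definition claimB (K C : R) m := forall S i, (i <= J)%N -> #|~: S|%:R <= K * E2 (dm%:R * i%:R) ->
  approx m (C * b `^ (m%:R + w) * Hs (dm%:R * (m%:R + w)) i)
    (fun g => Ex (fun x => g 0%N (psum S x))).

Hypothesis MF : mixing_field P Y G lv al J dm Q rho b w u D Cl.

Let rho0 := mf_rho MF.
Let b0 := mf_b MF.
Let w0 : 0 < w. Proof. by case/andP: (mf_w MF). Qed.
Let w1 : w <= 1. Proof. by case/andP: (mf_w MF). Qed.
Let u0 := mf_u MF.
Let dm0 := mf_dm MF.
Let Cl0 : 0 < Cl. Proof. by apply: lt_le_trans (mf_Cl MF). Qed.
Let D0 : 0 < D. Proof. by apply: lt_le_trans (mf_D MF). Qed.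
Let bp0 k : 0 < b `^ k. Proof. exact: powR_gt0. Qed.

Lemma claimA_le K C C' m : C <= C' -> claimA K C m -> claimA K C' m.
Proof.
move=> CC h a A I S j i st; apply: approx_le (h _ _ _ _ _ _ st).
by rewrite ler_wpM2r ?As_ge0// ler_wpM2r// mulr_ge0 ?exprn_ge0 ?ltW.
Qed.

Lemma claimB_le K C C' m : C <= C' -> claimB K C m -> claimB K C' m.
Proof.
move=> CC h S i iJ hS; apply: approx_le (h _ _ iJ hS).
by rewrite ler_wpM2r ?Hs_ge0// ler_wpM2r// ltW.
Qed.

Lemma stepK_ge K : 1 <= K -> 1 <= stepK K.
Proof.
move=> K1; have := mf_Cl MF => Cl1.
have : 0 <= Q%:R * D by rewrite mulr_ge0// ltW.
rewrite /stepK; nra.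
Qed.

Section stepA.
Variables (K C : R) (a m : nat) (A : Om -> R) (I S : {set T}) (j i : nat).
Hypotheses (K1 : 1 <= K) (C0 : 0 <= C) (st : state a m K A I S j i).
Hypothesis IHA : forall m', (m' < m)%N -> claimA (stepK K) C m'.
Hypothesis IHB : forall m', (m' < m)%N -> claimB (stepK K) C m'.

Let K' := stepK K.
Let K'1 : 1 <= K'. Proof. exact: stepK_ge. Qed.
Let K'0 : 0 < K'. Proof. exact: lt_le_trans K'1. Qed.
Let bb := b ^+ a * b `^ (m%:R + w).
Let bb0 : 0 < bb. Proof. by rewrite mulr_gt0// exprn_gt0. Qed.
Let a0 : (0 < a)%N. Proof. by case: st => -[]. Qed.
Let amQ : (a + m <= Q)%N. Proof. by case: st => -[]. Qed.
Let Q1 : (1 <= Q)%N. Proof. by apply: leq_trans amQ; rewrite addn_gt0 a0. Qed.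
Let I0 : (0 < #|I|)%N. Proof. by case: st => _ [/andP[]]. Qed.
Let IQ : (#|I| <= Q)%N.
Proof. by case: st => _ [/andP[_ h] _] _ _ _; apply: leq_trans h (leq_trans (leq_addr _ _) amQ). Qed.
Let jJ : (j <= J)%N. Proof. by case: st => _ _ _ _ []. Qed.
Let iJ : (i <= J)%N. Proof. by case: st => _ _ _ _ []. Qed.
Let e1 : R := dm%:R * (m%:R - 1 + w).

Definition peel_err l : R :=
  bb * (m%:R * C * (As e1 (maxn j l) (maxn i l) + K' * (Lv (maxn j l) * Hs e1 (maxn i l)))
        + K' * Lv (maxn j l)).

(** For [A' = centre A * Y s ^+ q.+1], the expectation of [A'] times a derivative of [g] splits into
    a centred part, governed by [claimA], and a product of expectations, where [claimB] treats the
    second factor and the first has the decay [Lv]. The Taylor remainder depends on [s |: S'] only,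
    so the covariance bound is enough for it. *)
Lemma peelA s (S' : {set T}) l : S' \subset S -> s \in S -> s \notin S' -> (l <= J)%N ->
  (forall k t, k \in I -> t \in s |: S' -> (l <= lv k t)%N) ->
  #|~: S'|%:R <= K' * E2 (dm%:R * (maxn i l)%:R) ->
  approx m (peel_err l)
    (fun g => Ex (fun x => centre A x * (g 0%N (psum (s |: S') x) - g 0%N (psum S' x)))).
Proof.
move=> SS sS sS' lJ far hole.
have mbc := mb_centre MF K1 st.
have jlJ : (maxn j l <= J)%N by rewrite geq_max jJ lJ.
have ilJ : (maxn i l <= J)%N by rewrite geq_max iJ lJ.
pose Xi q g := (q.+1`!%:R)^-1 * Ex (fun x => centre A x * Y s x ^+ q.+1 * g q.+1 (psum S' x)).
pose Rm g := Ex (fun x => centre A x * taylor_rem m g (psum S' x) (Y s x)).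
pose er := bb * (C * (As e1 (maxn j l) (maxn i l) + K' * (Lv (maxn j l) * Hs e1 (maxn i l)))).
apply: (@approx_ext _ _ _ _ _ _ _ _ _ (fun g => \sum_(q < m) Xi q g + Rm g)).
  move=> H g H0 hg; symmetry.
  exact: (peel_expand MF (c := 2 * K * b ^+ a) amQ Q1 sS' (or_intror (conj a0 mbc)) H0 hg).
have -> : peel_err l = \sum_(q < m) er + bb * (K' * Lv (maxn j l)).
  by rewrite sumr_const card_ord /peel_err /er -[X in _ = X + _]mulr_natl; ring.
apply: approx_add; last first.
  apply: approx_rem => H g H0 hg.
  have hr := fin_rem MF s S' H0 hg.
  have sub : s |: S' \subset S by rewrite finset.subUset finset.sub1set sS.
  have sr : smeas (G (s |: S')) (fun x => taylor_rem m g (psum S' x) (Y s x)).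
    have sP : smeas (G S') (psum S') by exact: (smeas_psum MF).
    have sW' : smeas (G (s |: S')) (psum S').
      by apply: (smeas_mono MF _ sP); exact: finset.subsetUr.
    have sY : smeas (G (s |: S')) (Y s) by apply: (smeas_Y MF); exact: finset.setU11.
    have mg k : (k <= m)%N -> measurable_fun setT (g k) by move=> km; exact: smooth_measurable w0 hg km.
    rewrite /taylor_rem; apply: smeasB; first apply: smeasB.
    - by apply: smeas_comp (smeasD sW' sY); exact: mg.
    - by apply: smeas_comp sW'; exact: mg.
    apply: smeas_sum => q; apply: smeasM; first exact: smeas_cst.
    apply: smeasM; last exact: smeasX.
    by apply: smeas_comp sW'; apply: mg; exact: ltn_ord.
  have := state_cov MF K1 st sub lJ far sr hr; move/le_trans; apply.
  rewrite (_ : _ * _ * (H * _) = 8 * K * Cl * (H * (bb * Lv (maxn j l)))); last by rewrite /bb; ring.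
  rewrite (_ : H * (bb * (K' * _)) = K' * (H * (bb * Lv (maxn j l)))); last by ring.
  apply: ler_wpM2r; first by rewrite mulr_ge0 ?(ltW H0)// mulr_ge0 ?(ltW bb0) ?Lv_ge0.
  by rewrite /K' /stepK lerDl mulr_ge0// ltW.
apply: (approx_sum (e := fun=> er) (Phi := Xi)) => q qm.
have q0m : (0 < q.+1 <= m)%N by [].
have st' := next_state MF K1 st SS sS sS' lJ far q0m hole.
pose A' x := centre A x * Y s x ^+ q.+1.
have K'1' : 1 <= stepK K by [].
have EA' := state_Ex MF st'.
have m'm : (m - q.+1 < m)%N by rewrite ltn_subrL (leq_trans _ qm).
have hA := IHA m'm st'.
have hB := IHB m'm ilJ hole.
(* The centred part and the product of expectations, both at the shifted order; the shift back to
   [g] follows. *)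
have h1 := approx_add hA (approx_scale (Ex A') hB).
have h2 := approx_shift qm h1.
have h3 := approx_scale (q.+1`!%:R)^-1 h2.
apply: (approx_le _ (approx_ext _ h3)).
  have f1 : `|(q.+1`!%:R)^-1| <= 1 :> R.
    by rewrite ger0_norm ?invr_ge0// invf_le1 ?ltr0n ?fact_gt0// ler1n fact_gt0.
  have ee : dm%:R * ((m - q.+1)%:R + w) <= e1.
    rewrite /e1 ler_wpM2l// lerD2r natrB// lerD2l lerN2 ler1n//.
  have bbE : b ^+ (a + q.+1) * b `^ ((m - q.+1)%:R + w) = bb.
    by rewrite exprD -mulrA (b_split MF).
  rewrite bbE; apply: (@le_trans _ _ (1 * er)); last by rewrite mul1r.
  apply: ler_pM => //.
    apply: addr_ge0; first by rewrite mulr_ge0 ?As_ge0// mulr_ge0// ltW.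
    by rewrite mulr_ge0// mulr_ge0 ?Hs_ge0// mulr_ge0// ltW.
  rewrite (_ : er = C * bb * As e1 (maxn j l) (maxn i l) +
      bb * (C * (K' * (Lv (maxn j l) * Hs e1 (maxn i l))))); last by rewrite /er; ring.
  apply: lerD.
    apply: ler_wpM2l; [by rewrite mulr_ge0// ltW|exact: le_As].
  apply: (@le_trans _ _ ((K' * b ^+ (a + q.+1) * Lv (maxn j l)) *
     (C * b `^ ((m - q.+1)%:R + w) * Hs e1 (maxn i l)))).
    apply: ler_pM => //; first by rewrite mulr_ge0 ?Hs_ge0// mulr_ge0// ltW.
    by rewrite ler_wpM2l ?mulr_ge0 ?(ltW (bp0 _))//; exact: le_Hs.
  by rewrite -bbE le_eqVlt; apply/orP; left; apply/eqP; ring.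
move=> H g H0 hg; congr (_ * _); rewrite /shiftn addn0.
have mQ : (m <= Q)%N by apply: leq_trans amQ; rewrite leq_addl.
have hgs := smooth_shift qm hg.
have fg : fin P (((m - q.+1)%:R + w) * rho) (fun x => g q.+1 (psum S' x)).
  have := fin_smooth MF S' Q1 (leq_trans (leq_subr q.+1 _) mQ) (ltW H0) hgs (leq0n _).
  by rewrite /shiftn addn0.
have t1 : 0 < ((m - q.+1)%:R + w) * rho by rewrite mulr_gt0// ltr_wpDl.
have t2 : 0 < (a + q.+1)%:R * rho by rewrite mulr_gt0// ltr0n addnS.
have tt : (a + q.+1)%:R * rho + ((m - q.+1)%:R + w) * rho < 1.
  apply: le_lt_trans (mf_rhoQ MF); rewrite -mulrDl ler_wpM2r ?(ltW rho0)//.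
  by rewrite addrA -natrD lerD2r ler_nat -addnA subnKC.
have iAg : itg (fun x => A' x * g q.+1 (psum S' x)).
  have [_ _ hA' _ _] := st'.
  have hA'' : fin P ((a + q.+1)%:R * rho) A' by exists (stepK K * b ^+ (a + q.+1)).
  have hF := fin_mul t2 t1 hA'' fg.
  by apply: fin_itg hF; rewrite addr_gt0//= ltW.
have ig : itg (fun x => g q.+1 (psum S' x)).
  by apply: fin_itg fg; rewrite t1/=; move: tt t2; lra.
rewrite [X in X + _ = _](_ : _ = Ex (fun x => A' x * g q.+1 (psum S' x) - Ex A' * g q.+1 (psum S' x))).
  by rewrite ExB ?ExZ//; [rewrite subrK|exact: itgZ].
by congr Ex; apply/funext => x; rewrite /centre mulrBl.
Qed.

Let Fpos l : 0 <= peel_err l.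
Proof.
rewrite /peel_err; apply: mulr_ge0; first exact: ltW.
apply: addr_ge0; last by rewrite mulr_ge0 ?Lv_ge0// ltW.
apply: mulr_ge0; first by rewrite mulr_ge0.
by rewrite addr_ge0 ?As_ge0// mulr_ge0 ?(ltW K'0)// mulr_ge0 ?Lv_ge0 ?Hs_ge0.
Qed.

Lemma sum_peel_err : (0 < m)%N ->
  \sum_(s in S) peel_err (lvI I s) <=
  Q%:R * D * (Q%:R * C * (2 * geo (dm%:R * w) + stepK K) + stepK K) * bb * As (dm%:R * (m%:R + w)) j i.
Proof.
move=> m0; apply: le_trans (sum_levels MF S I0 Fpos) _.
set e := dm%:R * (m%:R + w).
have ee : e1 = e - dm%:R by rewrite /e1 /e; ring.
have sA := sum_AsAs J u (mf_w MF) dm0 e j i.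
have sH := sum_AsHs J dm u (mf_w MF) e j i.
have de : dm%:R <= e.
  by rewrite /e ler_peMr// ler_wpDr ?(ltW w0)// ler1n.
have sL := sum_AsL J u (mf_w MF) j i de.
have As0 := As_ge0 J dm w u e j i.
have -> : \sum_(l < J.+1) E2 (dm%:R * l%:R) * peel_err l =
  bb * (m%:R * C * ((\sum_(l < J.+1) E2 (dm%:R * l%:R) * As (e - dm%:R) (maxn j l) (maxn i l)) +
    K' * (\sum_(l < J.+1) E2 (dm%:R * l%:R) * (Lv (maxn j l) * Hs (e - dm%:R) (maxn i l)))) +
    K' * (\sum_(l < J.+1) E2 (dm%:R * l%:R) * Lv (maxn j l))).
  rewrite [K' * (\sum_(_ < _) _ * (_ * _))]mulr_sumr -big_split/= mulr_sumr [K' * _]mulr_sumr -big_split/= mulr_sumr.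
  by apply: eq_bigr => l _; rewrite /peel_err ee; ring.
set x := \sum_(l < _) _ in sA *; set y := \sum_(l < _) _ in sH *; set z := \sum_(l < _) _ in sL *.
have g0 : 0 < geo (dm%:R * w) by apply: geo_gt0; rewrite mulr_gt0// ltr0n.
have mQ : m%:R <= Q%:R :> R by rewrite ler_nat (leq_trans _ amQ)// leq_addl.
have h1 : x + K' * y <= (2 * geo (dm%:R * w) + K') * As e j i.
  by rewrite [leRHS]mulrDl; exact: (lerD sA (ler_wpM2l (ltW K'0) sH)).
have h2 : m%:R * C * (x + K' * y) <= Q%:R * C * ((2 * geo (dm%:R * w) + K') * As e j i).
  apply: (@le_trans _ _ (m%:R * C * ((2 * geo (dm%:R * w) + K') * As e j i))).
    by rewrite ler_wpM2l// mulr_ge0.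
  rewrite ler_wpM2r//; last by rewrite ler_wpM2r.
  by rewrite mulr_ge0// addr_ge0 ?mulr_ge0// ltW.
have h3 : K' * z <= K' * As e j i by rewrite ler_wpM2l// ltW.
rewrite [leRHS](_ : _ = Q%:R * D * (bb * (Q%:R * C * ((2 * geo (dm%:R * w) + K') * As e j i) + K' * As e j i))); last first.
  by rewrite /K'; ring.
apply: ler_pM.
- by rewrite mulr_ge0// ltW.
- apply: mulr_ge0; first exact: ltW.
  have x0 : 0 <= x by apply: sumr_ge0 => l _; rewrite mulr_ge0 ?E2_ge0 ?As_ge0.
  have y0 : 0 <= y by apply: sumr_ge0 => l _; rewrite !mulr_ge0 ?E2_ge0 ?Lv_ge0 ?Hs_ge0.
  have z0 : 0 <= z by apply: sumr_ge0 => l _; rewrite !mulr_ge0 ?E2_ge0 ?Lv_ge0.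
  apply: addr_ge0; last exact: (mulr_ge0 (ltW K'0) z0).
  apply: mulr_ge0; first by rewrite mulr_ge0.
  exact: (addr_ge0 x0 (mulr_ge0 (ltW K'0) y0)).
- by rewrite ler_wpM2r ?(ltW D0)// ler_nat.
- by rewrite ler_wpM2l ?(ltW bb0)// lerD.
Qed.

(** Sites leave in increasing order of their level from [I]. When [s] leaves, all sites still
    present, [s] included, are at least as far away, so the covariance bound at the level of [s]
    applies; and the hole has gained only sites no farther than [s], whose number is controlled by
    the same level. *)
Lemma stepA : (0 < m)%N ->
  approx m (Q%:R * D * (Q%:R * C * (2 * geo (dm%:R * w) + stepK K) + stepK K) * bb * As (dm%:R * (m%:R + w)) j i)
    (fun g => Ex (fun x => centre A x * g 0%N (psum S x))).
Proof.
move=> m0; apply: approx_le (sum_peel_err m0) _.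
have [x0 _] := card_gt0P I0.
pose ss := sort (relpre (lvI I) leq) (enum S).
have uss : uniq ss by rewrite sort_uniq enum_uniq.
have mss s : (s \in ss) = (s \in S) by rewrite mem_sort mem_enum.
have sss : sorted (relpre (lvI I) leq) ss by apply: sort_sorted => x y; exact: leq_total.
pose N := size ss.
pose Sn n : {set T} := [set x in drop n ss]%SET.
pose Phi n g := Ex (fun x => centre A x * (g 0%N (psum (Sn n) x) - g 0%N (psum (Sn n.+1) x))).
have -> : \sum_(s in S) peel_err (lvI I s) = \sum_(n < N) peel_err (lvI I (nth x0 ss n)).
  rewrite -(big_mkord xpredT (fun n => peel_err (lvI I (nth x0 ss n)))) -(big_nth x0 xpredT (fun s => peel_err (lvI I s))).
  have pm : perm_eq ss (enum S) by rewrite /ss perm_sort.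
  by rewrite (perm_big _ pm) big_enum.
have S0 : Sn 0%N = S by apply/setP => x; rewrite inE drop0 mss.
have SN : Sn N = finset.set0 by apply/setP => x; rewrite !inE drop_size.
have mbc := mb_centre MF K1 st.
have mQ : (m <= Q)%N by apply: leq_trans amQ; rewrite leq_addl.
have t1 : 0 < (m%:R + w) * rho by rewrite mulr_gt0// ltr_wpDl.
have t2 : 0 < a%:R * rho by rewrite mulr_gt0// ltr0n.
have tt : a%:R * rho + (m%:R + w) * rho < 1.
  apply: le_lt_trans (mf_rhoQ MF); rewrite -mulrDl ler_wpM2r ?(ltW rho0)//.
  by rewrite addrA -natrD lerD2r ler_nat.
apply: (@approx_ext _ _ _ _ _ _ _ _ _ (fun g => \sum_(n < N) Phi n g)).
  move=> H g H0 hg.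
  have itn n : itg (fun x => centre A x * g 0%N (psum (Sn n) x)).
    have fg := fin_smooth MF (Sn n) Q1 mQ (ltW H0) hg (leq0n _).
    have fA : fin P (a%:R * rho) (centre A) by exists (2 * K * b ^+ a).
    have hF := fin_mul t2 t1 fA fg.
    by apply: fin_itg hF; rewrite addr_gt0//= ltW.
  pose V n := Ex (fun x => centre A x * g 0%N (psum (Sn n) x)).
  rewrite (eq_bigr (fun n : 'I_N => V n - V n.+1)); last first.
    move=> n _; rewrite /Phi /V -ExB//; congr Ex; apply/funext => x; ring.
  rewrite -(big_mkord xpredT (fun n => V n - V n.+1)).
  rewrite (eq_bigr (fun n => - (V n.+1 - V n))); last by move=> n _; rewrite opprB.
  rewrite sumrN telescope_sumr// opprB /V S0 SN.
  (* The end of the telescope has an empty sum: the constant [g 0%N 0] times the mean of a centred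
     variable. *)
  rewrite [X in _ - X = _](_ : _ = 0) ?subr0//.
  rewrite (_ : (fun x => _) = fun x => g 0%N 0 * centre A x); last first.
    by apply/funext => x; rewrite psum0 mulrC.
  have ar1 : 0 < a%:R * rho <= 1 by rewrite t2/=; move: tt t1; lra.
  have iA : itg A by have [_ _ h _ _] := st; exact: mb_itg ar1 h.
  rewrite ExZ; last by apply: itgB => //; exact: itg_cst.
  by rewrite /centre ExB ?Ex_cst ?subrr ?mulr0//; exact: itg_cst.
apply: (approx_sum (e := fun n => peel_err (lvI I (nth x0 ss n))) (Phi := Phi)) => n nN.
set s := nth x0 ss n.
have dn : drop n ss = s :: drop n.+1 ss by rewrite -drop_nth.
have SnE : Sn n = s |: Sn n.+1 by apply/setP => x; rewrite !inE dn in_cons.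
have sS : s \in S by rewrite -mss mem_nth.
have ud : uniq (drop n ss) by exact: drop_uniq.
have sSn : s \notin Sn n.+1 by rewrite inE; move: ud; rewrite dn => /andP[].
have lJ : (lvI I s <= J)%N by exact: lvI_J.
have SS : Sn n.+1 \subset S.
  by apply/fintype.subsetP => x; rewrite inE => /mem_drop; rewrite mss.
have mono p q : (p <= q)%N -> (q < N)%N -> (lvI I (nth x0 ss p) <= lvI I (nth x0 ss q))%N.
  move=> pq qN; have h := sorted_leq_nth _ _ x0 sss.
  apply: h => //; [by move=> y x z; exact: leq_trans|by move=> x /=|exact: leq_ltn_trans pq qN].
rewrite /Phi SnE; apply: (peelA SS sS sSn lJ).
  move=> k t kI; rewrite -SnE inE => td.
  have [p pN e] : exists2 p, (p < size (drop n ss))%N & nth x0 (drop n ss) p = t.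
    by exists (index t (drop n ss)); rewrite ?index_mem// nth_index.
  rewrite nth_drop in e; rewrite size_drop in pN.
  apply: (leq_trans _ (lvI_le lv J t kI)); rewrite -e; apply: mono; first exact: leq_addr.
  by rewrite -ltn_subRL.
have [_ _ _ _ [_ _ hole]] := st.
(* A missing site lies in the old hole or left no later than [s], hence is no farther than [s]. *)
have sub : ~: Sn n.+1 \subset (~: S) :|: [set x | (lvI I x <= lvI I s)%N]%SET.
  apply/fintype.subsetP => x; rewrite !inE => xd.
  case: (boolP (x \in S)) => //= xS.
  have xt : x \in take n.+1 ss.
    by move: xS; rewrite -mss -{1}(cat_take_drop n.+1 ss) mem_cat (negbTE xd) orbF.
  have h1 : (index x (take n.+1 ss) < size (take n.+1 ss))%N by rewrite index_mem.
  rewrite -(nth_index x0 xt) nth_take; last by rewrite (leq_trans h1)// size_take_min geq_minl.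
  apply: mono => //; rewrite -ltnS (leq_trans h1)// size_take_min geq_minl//.
apply: (@le_trans _ _ (#|~: S|%:R + #|[set x | (lvI I x <= lvI I s)%N]%SET|%:R)).
  rewrite -natrD ler_nat; apply: leq_trans (subset_leq_card sub) _; exact: leq_card_setU.
apply: (@le_trans _ _ (K * E2 (dm%:R * (maxn i (lvI I s))%:R) + Q%:R * D * E2 (dm%:R * (maxn i (lvI I s))%:R))).
  have K0 : 0 <= K by apply: le_trans K1.
  apply: lerD.
    apply: le_trans hole _; rewrite ler_wpM2l//; apply: le_E2.
    by rewrite ler_wpM2l// ler_nat leq_maxl.
  apply: le_trans (lvI_count MF I0 lJ) _; apply: ler_pM; rewrite ?mulr_ge0 ?(ltW D0) ?E2_ge0//.
    by rewrite ler_wpM2r ?(ltW D0)// ler_nat.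
  by apply: le_E2; rewrite ler_wpM2l// ler_nat leq_maxr.
rewrite -mulrDl ler_wpM2r ?E2_ge0// /K' /stepK lerD2r.
have h8 (x y : R) : 1 <= x -> 1 <= y -> x <= 8 * x * y by move=> *; nra.
exact: (h8 _ _ K1 (mf_Cl MF)).
Qed.

End stepA.
End steps.

Section base_and_back.
Context {R : realType} {d} {Om : measurableType d} (P : probability Om R) (T : finType).
Variables (Y : T -> Om -> R) (G : {set T} -> set (set Om)) (lv : T -> T -> nat) (al : nat -> R).
Variables (J dm Q : nat) (rho b w u D Cl : R).

Local Notation Ex := (Ex P).
Local Notation itg := (itg P).
Local Notation mb := (mb P).
Local Notation Lv := (Lv u).
Local Notation Hs := (Hs J u).
Local Notation As := (As J dm w u).
Local Notation psum := (psum Y).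
Local Notation approx := (approx P Y w).
Local Notation state := (state P G J dm Q rho b w u).
Local Notation centre := (centre P).
Local Notation stepK := (stepK Q D Cl).
Local Notation lvI := (lvI lv J).

Local Notation claimA := (claimA P Y G J dm Q rho b w u).
Local Notation claimB := (claimB P Y J dm b w u).

Hypothesis MF : mixing_field P Y G lv al J dm Q rho b w u D Cl.

Let rho0 := mf_rho MF.
Let b0 := mf_b MF.
Let w0 : 0 < w. Proof. by case/andP: (mf_w MF). Qed.
Let w1 : w <= 1. Proof. by case/andP: (mf_w MF). Qed.
Let u0 := mf_u MF.
Let dm0 := mf_dm MF.
Let Cl0 : 0 < Cl. Proof. by apply: lt_le_trans (mf_Cl MF). Qed.
Let D0 : 0 < D. Proof. by apply: lt_le_trans (mf_D MF). Qed.
Let bp0 k : 0 < b `^ k. Proof. exact: powR_gt0. Qed.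

Let rho0' := ltW rho0.
Let b0' := ltW b0.

Lemma count_ge1 : 1 <= Q%:R * D -> forall l, 0 <= l ->
  (Q%:R * D * E2 (dm%:R * l) * b) `^ w <= Q%:R * D * (E2 (dm%:R * w * l) * b `^ w).
Proof.
move=> QD l l0; have QD0 : 0 <= Q%:R * D by apply: le_trans QD.
rewrite powRM; [|by rewrite mulr_ge0 ?E2_ge0|exact: b0'].
rewrite powRM ?E2_ge0// -mulrA.
have -> : E2 (dm%:R * l) `^ w = E2 (dm%:R * w * l).
  by rewrite /E2 -powRrM; congr (_ `^ _); ring.
apply: ler_wpM2r; first by rewrite mulr_ge0 ?E2_ge0 ?powR_ge0.
exact: ler1_powR.
Qed.

Lemma diff_psum (S1 S2 : {set T}) x : S2 \subset S1 -> psum S1 x - psum S2 x = psum (S1 :\: S2) x.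
Proof.
move=> sub; rewrite /psum (big_setID S2)/= (finset.setIidPr sub).
by rewrite addrAC subrr add0r.
Qed.

Lemma mb_hoelder_diff H g (S1 S2 : {set T}) n : (1 <= Q)%N -> S2 \subset S1 -> 0 < H ->
  smooth 0 w H g -> 0 < n -> #|S1 :\: S2|%:R <= n ->
  mb (w * rho) (H * (n * b) `^ w) (fun x => g 0%N (psum S1 x) - g 0%N (psum S2 x)).
Proof.
move=> Q1 sub H0 hg n0 card.
have h := mb_scale (ltW (mulr_gt0 rho0 w0)) H0 (mb_powR w0 rho0' (mb_psum MF Q1 n0 card)).
have mg := smooth_measurable w0 hg (leqnn 0).
rewrite (mulrC w); apply: mb_dom h; first by rewrite mulr_ge0// ltW.
  by apply: measurable_funB; apply: measurableT_comp => //; exact: (measurable_psum MF).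
move=> x; rewrite [leRHS]ger0_norm; last by rewrite mulr_ge0 ?powR_ge0// ltW.
by rewrite -(diff_psum _ sub); exact: (proj2 hg).
Qed.

(** Without derivatives, removing sites singly would cost [2^(dm l)] at level [l]. A whole level is
    removed at once, so that the Hölder bound is applied to the sum over the level and costs
    [(2^(dm l) b)^w] up to a constant; this is the origin of the weight [2^(dm w l)] in [As]. *)
Lemma claimA0 K : 1 <= K -> claimA K (8 * K * Cl * (Q%:R * D)) 0.
Proof.
move=> K1 a A I S j i st.
have a0 : (0 < a)%N by case: st => -[].
have aQ : (a <= Q)%N by case: st => -[_]; rewrite addn0.
have Q1 : (1 <= Q)%N by apply: leq_trans aQ.
have I0 : (0 < #|I|)%N by case: st => _ [/andP[]].
have IQ : (#|I| <= Q)%N by case: st => _ [/andP[_ h] _] _ _ _; apply: leq_trans h aQ.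
have QD1 : 1 <= Q%:R * D.
  rewrite -[leLHS]mulr1; apply: ler_pM => //; last exact: mf_D MF.
  by rewrite ler1n.
have QD0 : 0 < Q%:R * D by apply: lt_le_trans QD1.
have K0 : 0 < K by apply: lt_le_trans K1.
rewrite add0r.
pose Sl l : {set T} := [set s in S | (l <= lvI I s)%N]%SET.
pose Phi l (g : nat -> R -> R) :=
  Ex (fun x => centre A x * (g 0%N (psum (Sl l) x) - g 0%N (psum (Sl l.+1) x))).
pose er l := 8 * K * Cl * (Q%:R * D) * (b ^+ a * b `^ w) * (E2 (dm%:R * w * l%:R) * Lv (maxn j l)).
have S0 : Sl 0%N = S by apply/setP => x; rewrite inE andbT.
have SJ : Sl J.+1 = finset.set0.
  apply/setP => x; have h : (lvI I x <= J)%N by exact: lvI_J.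
  by rewrite !inE ltnNge h andbF.
have Ssub l : Sl l.+1 \subset Sl l.
  by apply/fintype.subsetP => x; rewrite !inE => /andP[-> h]; exact: ltnW.
have mbc := mb_centre MF K1 st.
have t1 : 0 < w * rho by rewrite mulr_gt0.
have t2 : 0 < a%:R * rho by rewrite mulr_gt0// ltr0n.
have tt : a%:R * rho + w * rho < 1.
  by apply: le_lt_trans (mf_rhoQ MF); rewrite -mulrDl ler_wpM2r// lerD2r ler_nat.
apply: (@approx_le _ _ _ _ _ _ _ _ (\sum_(l < J.+1) er l)).
  rewrite -mulr_sumr; apply: ler_wpM2l; last exact: (sum_AsLw J dm w u j i).
  by rewrite !mulr_ge0 ?exprn_ge0 ?powR_ge0 ?(ltW K0) ?(ltW Cl0) ?(ltW QD0) ?(ltW D0).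
apply: (@approx_ext _ _ _ _ _ _ _ _ _ (fun g => \sum_(l < J.+1) Phi l g)).
  move=> H g H0 hg.
  have itn l : itg (fun x => centre A x * g 0%N (psum (Sl l) x)).
    have fg := fin_smooth MF (Sl l) Q1 (leq0n _) (ltW H0) hg (leqnn 0).
    have fA : fin P (a%:R * rho) (centre A) by exists (2 * K * b ^+ a).
    rewrite add0r in fg; have hF := fin_mul t2 t1 fA fg.
    by apply: fin_itg hF; rewrite addr_gt0//= ltW.
  pose V l := Ex (fun x => centre A x * g 0%N (psum (Sl l) x)).
  rewrite (eq_bigr (fun l : 'I_J.+1 => V l - V l.+1)); last first.
    move=> l _; rewrite /Phi /V -ExB//; congr Ex; apply/funext => x; ring.
  rewrite -(big_mkord xpredT (fun l => V l - V l.+1)).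
  rewrite (eq_bigr (fun l => - (V l.+1 - V l))); last by move=> l _; rewrite opprB.
  rewrite sumrN telescope_sumr// opprB /V S0 SJ.
  rewrite [X in _ - X = _](_ : _ = 0) ?subr0//.
  rewrite (_ : (fun x => _) = fun x => g 0%N 0 * centre A x); last first.
    by apply/funext => x; rewrite psum0 mulrC.
  have ar1 : 0 < a%:R * rho <= 1 by rewrite t2/=; move: tt t1; lra.
  have iA : itg A by have [_ _ h _ _] := st; exact: mb_itg ar1 h.
  rewrite ExZ; last by apply: itgB => //; exact: itg_cst.
  by rewrite /centre ExB ?Ex_cst ?subrr ?mulr0//; exact: itg_cst.
apply: (approx_sum (e := er) (Phi := Phi)) => l lJ.
rewrite ltnS in lJ; apply: approx_rem => H g H0 hg.
have n0 : 0 < Q%:R * D * E2 (dm%:R * l%:R) :> R by rewrite mulr_gt0 ?E2_gt0.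
have card : #|Sl l :\: Sl l.+1|%:R <= Q%:R * D * E2 (dm%:R * l%:R).
  apply: (@le_trans _ _ #|[set s | (lvI I s <= l)%N]%SET|%:R).
    rewrite ler_nat; apply: subset_leq_card; apply/fintype.subsetP => x; rewrite !inE.
    by case/andP => h /andP[xS _]; move: h; rewrite xS/= -leqNgt.
  apply: le_trans (lvI_count MF I0 lJ) _.
  by rewrite ler_wpM2r ?E2_ge0// ler_wpM2r ?(ltW D0)// ler_nat.
have hZ := mb_hoelder_diff Q1 (Ssub l) H0 hg n0 card.
rewrite -[X in X * rho]add0r in hZ.
have mg := smooth_measurable w0 hg (leqnn 0).
have sZ : smeas (G (Sl l)) (fun x => g 0%N (psum (Sl l) x) - g 0%N (psum (Sl l.+1) x)).
  have sP k : smeas (G (Sl k)) (psum (Sl k)) by exact: (smeas_psum MF).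
  have sP' : smeas (G (Sl l)) (psum (Sl l.+1)) by apply: (smeas_mono MF _ (sP l.+1)); exact: Ssub.
  by apply: smeasB; [exact: (smeas_comp mg (sP l))|exact: (smeas_comp mg sP')].
have SlS : Sl l \subset S by apply/fintype.subsetP => x; rewrite inE => /andP[].
have far k s : k \in I -> s \in Sl l -> (l <= lv k s)%N.
  move=> kI; rewrite inE => /andP[_ h].
  by apply: leq_trans h _; exact: (lvI_le lv J s kI).
have := state_cov MF K1 st SlS lJ far sZ hZ; move/le_trans; apply.
have hc := count_ge1 QD1 (ler0n R l).
rewrite (_ : H * er l = 8 * K * Cl * b ^+ a * Lv (maxn j l) *
  (H * (Q%:R * D * (E2 (dm%:R * w * l%:R) * b `^ w)))); last by rewrite /er; ring.
apply: ler_wpM2l.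
  by rewrite mulr_ge0 ?Lv_ge0// mulr_ge0 ?exprn_ge0// mulr_ge0 ?(ltW Cl0)// mulr_ge0// ltW.
by apply: ler_wpM2l; [exact: ltW|exact: hc].
Qed.

Lemma approx_full m : approx m 0 (fun g => Ex (fun x => g 0%N (psum [set: T]%SET x))).
Proof.
exists (fun j => if j == 0%N then 1 else 0) => H g H0 hg.
rewrite big_ord_recl/= mul1r big1 ?addr0 ?subrr ?normr0 ?mulr0// => j _.
by rewrite mul0r.
Qed.

Lemma claimB0 K : (1 <= Q)%N -> 1 <= K -> claimB K K 0.
Proof.
move=> Q1 K1 S i iJ hole; rewrite add0r.
have K0 : 0 < K by apply: lt_le_trans K1.
have wr1 : 0 < w * rho <= 1.
  rewrite mulr_gt0//= ltW//; apply: le_lt_trans (mf_rhoQ MF).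
  by rewrite ler_wpM2r// lerDr.
pose Psi (g : nat -> R -> R) :=
  - Ex (fun x => g 0%N (psum [set: T]%SET x) - g 0%N (psum S x)).
have hr : approx 0 (K * b `^ w * Hs (dm%:R * w) i) Psi.
  apply: approx_rem => H g H0 hg; rewrite /Psi normrN.
  have n0 : 0 < K * E2 (dm%:R * i%:R) by rewrite mulr_gt0 ?E2_gt0.
  have card : #|[set: T]%SET :\: S|%:R <= K * E2 (dm%:R * i%:R) by rewrite finset.setTD.
  have hZ := mb_hoelder_diff Q1 (finset.subsetT S) H0 hg n0 card.
  apply: le_trans (mb_absEle wr1 hZ) _; apply: ler_wpM2l; first exact: ltW.
  rewrite powRM; [|by rewrite mulr_ge0 ?E2_ge0 ?(ltW K0)|exact: b0'].
  rewrite powRM ?E2_ge0 ?(ltW K0)//.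
  have -> : E2 (dm%:R * i%:R) `^ w = E2 (dm%:R * w * i%:R).
    by rewrite /E2 -powRrM; congr (_ `^ _); ring.
  rewrite mulrAC; apply: ler_pM; rewrite ?mulr_ge0 ?powR_ge0 ?E2_ge0//.
    by apply: ler_wpM2r; [exact: powR_ge0|exact: ler1_powR].
  exact: Hs_ge.
apply: (approx_le _ (approx_ext _ (approx_add (approx_full 0) hr))); first by rewrite add0r.
move=> H g H0 hg; rewrite /Psi.
have ig U : itg (fun x => g 0%N (psum U x)).
  by have := itg_smooth MF U Q1 (leq0n _) (ltW H0) hg (leqnn 0).
by rewrite ExB//; ring.
Qed.

(** A single power starts the process at level 0, where [Lv 0 = 1] and the orthogonality bound is
    only Hölder's inequality. *)
Lemma state_power z (S : {set T}) K i m q : (m <= Q)%N -> (q < m)%N -> 1 <= K -> (i <= J)%N ->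
  #|~: S|%:R <= K * E2 (dm%:R * i%:R) ->
  state q.+1 (m - q.+1) K (fun x => Y z x ^+ q.+1) [set z]%SET S 0%N i.
Proof.
move=> mQ qm K1 iJ hole; have K0 : 0 < K by apply: lt_le_trans K1.
have hY : mb (q.+1%:R * rho) (b ^+ q.+1) (fun x => Y z x ^+ q.+1).
  by rewrite mulrC; exact: (mb_expr q rho0 (@mf_Y _ _ _ _ _ _ _ _ _ _ _ _ _ _ _ _ _ _ MF z)).
have q0 : 0 < q.+1%:R * rho by rewrite mulr_gt0.
split.
- by rewrite subnKC.
- split; first by rewrite cards1.
  by apply: smeasX; apply: (smeas_Y MF); rewrite inE.
- apply: mb_lec hY; first exact: ltW.
  by rewrite ler_peMl// exprn_ge0.
- move=> Z g sZ hZ; have [_ g0 _] := hZ.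
  have t0 : 0 < ((m - q.+1)%:R + w) * rho by rewrite mulr_gt0// ltr_wpDl.
  have hh := mb_mul q0 t0 hY hZ.
  have t1 : 0 < q.+1%:R * rho + ((m - q.+1)%:R + w) * rho <= 1.
    rewrite addr_gt0//= ltW//; apply: le_lt_trans (mf_rhoQ MF).
    by rewrite -mulrDl ler_wpM2r// addrA -natrD subnKC// lerD2r ler_nat.
  apply: le_trans (mb_absEle t1 hh) _; rewrite Lv0 mulr1 -mulrA ler_peMl//.
  by rewrite mulr_ge0 ?exprn_ge0// ltW.
- by [].
Qed.

(** The hole is refilled one site at a time. No distance between these sites and the rest is known,
    so every Taylor term starts again from level 0. There are at most [K 2^(dm i)] sites, and
    [sum_HsAs] shows that the total is still of the order of [Hs]. *)
Lemma stepB m K C : 1 <= K -> 0 <= C -> (0 < m <= Q)%N ->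
  (forall m', (m' < m)%N -> claimA K C m') -> (forall m', (m' < m)%N -> claimB K C m') ->
  claimB K (K * (Q%:R * C * (2 * geo u + 1) + 1)) m.
Proof.
move=> K1 C0 /andP[m0 mQ] IHA IHB S i iJ hole.
have K0 : 0 < K by apply: lt_le_trans K1.
have Q1 : (1 <= Q)%N by apply: leq_trans mQ.
pose zs := enum (~: S); pose N := size zs.
set bb := b `^ (m%:R + w); set e := dm%:R * (m%:R + w).
pose e1 := e - dm%:R.
have bb0 : 0 <= bb by exact: powR_ge0.
pose Sn n : {set T} := S :|: [set x in take n zs]%SET.
have S0 : Sn 0%N = S by apply/setP => x; rewrite !inE take0 orbF.
have SN : Sn N = [set: T]%SET.
  by apply/setP => x; rewrite !inE take_size mem_enum inE orbN.
have uz : uniq zs by exact: enum_uniq.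
pose Phi n (g : nat -> R -> R) :=
  Ex (fun x => 1 * (g 0%N (psum (Sn n.+1) x) - g 0%N (psum (Sn n) x))).
pose er := bb * (m%:R * (C * (As e1 0 i + Hs e1 i)) + 1).
have hPhi n : (n < N)%N -> approx m er (Phi n).
  move=> nN.
  have [z0 _] : exists z : T, z \in ~: S.
    by apply/card_gt0P; rewrite cardE; exact: leq_ltn_trans nN.
  pose z := nth z0 zs n.
  have zz : z \in zs by exact: mem_nth.
  have SnE : Sn n.+1 = z |: Sn n.
    apply/setP => x; rewrite !inE (take_nth z0 nN) mem_rcons in_cons -/z.
    by rewrite orbCA.
  have zSn : z \notin Sn n.
    rewrite !inE negb_or; apply/andP; split; first by move: zz; rewrite mem_enum inE.
    by rewrite in_take// index_uniq// ltnn.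
  have holen : #|~: Sn n|%:R <= K * E2 (dm%:R * i%:R).
    apply: le_trans hole; rewrite ler_nat; apply: subset_leq_card.
    by rewrite finset.setCS finset.subsetUl.
  pose Xi q (g : nat -> R -> R) := (q.+1`!%:R)^-1 * Ex (fun x => 1 * Y z x ^+ q.+1 * g q.+1 (psum (Sn n) x)).
  pose Rm g := Ex (fun x => 1 * taylor_rem m g (psum (Sn n) x) (Y z x)).
  pose er1 := bb * (C * (As e1 0 i + Hs e1 i)).
  apply: (@approx_ext _ _ _ _ _ _ _ _ _ (fun g => \sum_(q < m) Xi q g + Rm g)).
    move=> H g H0 hg; symmetry; rewrite /Phi SnE.
    exact: (peel_expand MF (a := 0) (c := 1) mQ Q1 zSn (or_introl (conj erefl erefl)) H0 hg).
  have -> : er = \sum_(q < m) er1 + bb.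
    by rewrite sumr_const card_ord /er /er1 -[X in _ = X + _]mulr_natl; ring.
  have mr : 0 < (m%:R + w) * rho <= 1.
    rewrite mulr_gt0//= ?ltr_wpDl//; apply/ltW; apply: le_lt_trans (mf_rhoQ MF).
    by rewrite ler_wpM2r// lerD2r ler_nat.
  apply: approx_add; last first.
    apply: approx_rem => H g H0 hg.
    have hr := fin_rem MF z (Sn n) H0 hg.
    rewrite /Rm; under eq_fun do rewrite mul1r.
    exact: mb_absEle mr hr.
  apply: (approx_sum (e := fun=> er1) (Phi := Xi)) => q qm.
  have st := state_power z mQ qm K1 iJ holen.
  have m'm : (m - q.+1 < m)%N by rewrite ltn_subrL m0.
  have hA := IHA _ m'm _ _ _ _ _ _ st.
  have hB := IHB _ m'm _ _ iJ holen.
  pose Yq x := Y z x ^+ q.+1.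
  have hY : mb (q.+1%:R * rho) (b ^+ q.+1) Yq.
    by rewrite mulrC; exact: (mb_expr q rho0 (@mf_Y _ _ _ _ _ _ _ _ _ _ _ _ _ _ _ _ _ _ MF z)).
  have t2 : 0 < q.+1%:R * rho by rewrite mulr_gt0.
  have t1 : 0 < ((m - q.+1)%:R + w) * rho by rewrite mulr_gt0// ltr_wpDl.
  have tt : q.+1%:R * rho + ((m - q.+1)%:R + w) * rho < 1.
    apply: le_lt_trans (mf_rhoQ MF); rewrite -mulrDl ler_wpM2r//.
    by rewrite addrA -natrD subnKC// lerD2r ler_nat.
  have EY : `|Ex Yq| <= b ^+ q.+1.
    by apply: mb_absEle hY; rewrite t2/=; move: tt t1; lra.
  have h1 := approx_add hA (approx_scale (Ex Yq) hB).
  have h2 := approx_shift qm h1.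
  have h3 := approx_scale (q.+1`!%:R)^-1 h2.
  apply: (approx_le _ (approx_ext _ h3)).
    have f1 : `|(q.+1`!%:R)^-1| <= 1 :> R.
      by rewrite ger0_norm ?invr_ge0// invf_le1 ?ltr0n ?fact_gt0// ler1n fact_gt0.
    have ee : dm%:R * ((m - q.+1)%:R + w) <= e1.
      rewrite (_ : e1 = dm%:R * (m%:R - 1 + w)); last by rewrite /e1 /e; ring.
      by rewrite ler_wpM2l// lerD2r natrB// lerD2l lerN2 ler1n.
    have bbE : b ^+ q.+1 * b `^ ((m - q.+1)%:R + w) = bb by rewrite (b_split MF).
    rewrite bbE; apply: (@le_trans _ _ (1 * er1)); last by rewrite mul1r.
    apply: ler_pM => //.
      apply: addr_ge0; first by rewrite mulr_ge0 ?As_ge0// mulr_ge0.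
      by rewrite mulr_ge0// mulr_ge0 ?Hs_ge0// mulr_ge0// powR_ge0.
    rewrite (_ : er1 = C * bb * As e1 0 i + bb * (C * Hs e1 i)); last by rewrite /er1; ring.
    apply: lerD; first by apply: ler_wpM2l; [rewrite mulr_ge0|exact: le_As].
    apply: (@le_trans _ _ (b ^+ q.+1 * (C * b `^ ((m - q.+1)%:R + w) * Hs e1 i))).
      apply: ler_pM => //; first by rewrite mulr_ge0 ?Hs_ge0// mulr_ge0// powR_ge0.
      by rewrite ler_wpM2l ?mulr_ge0 ?powR_ge0//; exact: le_Hs.
    by rewrite -bbE le_eqVlt; apply/orP; left; apply/eqP; ring.
  move=> H g H0 hg; congr (_ * _); rewrite /shiftn addn0.
  have hgs := smooth_shift qm hg.
  have fg : fin P (((m - q.+1)%:R + w) * rho) (fun x => g q.+1 (psum (Sn n) x)).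
    have := fin_smooth MF (Sn n) Q1 (leq_trans (leq_subr q.+1 _) mQ) (ltW H0) hgs (leq0n _).
    by rewrite /shiftn addn0.
  have iAg : itg (fun x => Yq x * g q.+1 (psum (Sn n) x)).
    have fY : fin P (q.+1%:R * rho) Yq by exists (b ^+ q.+1).
    have hF := fin_mul t2 t1 fY fg.
    by apply: fin_itg hF; rewrite addr_gt0//= ltW.
  have ig : itg (fun x => g q.+1 (psum (Sn n) x)).
    by apply: fin_itg fg; rewrite t1/=; move: tt t2; lra.
  rewrite [X in X + _ = _](_ : _ = Ex (fun x => Yq x * g q.+1 (psum (Sn n) x) - Ex Yq * g q.+1 (psum (Sn n) x))).
    rewrite ExB ?ExZ//; last exact: itgZ.
    by rewrite subrK; congr Ex; apply/funext => x; rewrite mul1r.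
  by congr Ex; apply/funext => x; rewrite /centre mulrBl.
have h := approx_add (approx_full m) (approx_scale (-1) (approx_sum (e := fun=> er) (Phi := Phi) hPhi)).
apply: (approx_le _ (approx_ext _ h)); last first.
  move=> H g H0 hg.
  have ig U : itg (fun x => g 0%N (psum U x)) by have := itg_smooth MF U Q1 mQ (ltW H0) hg (leq0n _).
  pose V n := Ex (fun x => g 0%N (psum (Sn n) x)).
  rewrite (eq_bigr (fun n : 'I_N => V n.+1 - V n)); last first.
    by move=> n _; rewrite /Phi /V -ExB//; congr Ex; apply/funext => x; rewrite mul1r.
  rewrite -(big_mkord xpredT (fun n => V n.+1 - V n)) telescope_sumr// /V S0 SN.
  by rewrite mulN1r opprB addrC subrK.
rewrite add0r normrN1 mul1r [\sum_(_ < _) _](_ : _ = N%:R * er); last first.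
  by rewrite sumr_const card_ord -[LHS]mulr_natl.
have NK : N%:R <= K * E2 (dm%:R * i%:R) by rewrite /N -cardE.
have er0 : 0 <= er.
  rewrite mulr_ge0// addr_ge0// mulr_ge0// mulr_ge0// addr_ge0 ?As_ge0 ?Hs_ge0//.
apply: le_trans (ler_wpM2r er0 NK) _.
have hA : E2 (dm%:R * i%:R) * As (e - dm%:R) 0 i <= 2 * geo u * Hs e i.
  by apply: sum_HsAs; [exact: (mf_w MF)|exact: (mf_u MF)|exact: dm0].
have hH : E2 (dm%:R * i%:R) * Hs (e - dm%:R) i <= Hs e i by exact: sum_HsHs.
have de : dm%:R <= e by rewrite /e ler_peMr// ler_wpDr ?(ltW w0)// ler1n.
have h1 : E2 (dm%:R * i%:R) <= Hs e i.
  by apply: le_trans (Hs_ge J u e i); apply: le_E2; rewrite ler_wpM2r.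
have mQ' : m%:R <= Q%:R :> R by rewrite ler_nat.
have Hs0 := Hs_ge0 J u e i.
set X := E2 (dm%:R * i%:R) * _ in hA; set Z := E2 (dm%:R * i%:R) * _ in hH.
have X0 : 0 <= X by rewrite mulr_ge0 ?E2_ge0 ?As_ge0.
have Z0 : 0 <= Z by rewrite mulr_ge0 ?E2_ge0 ?Hs_ge0.
rewrite (_ : K * E2 (dm%:R * i%:R) * er = K * (bb * (m%:R * (C * (X + Z)) + E2 (dm%:R * i%:R)))); last first.
  by rewrite /er /X /Z; ring.
rewrite (_ : _ * _ * Hs e i = K * (bb * (Q%:R * (C * ((2 * geo u + 1) * Hs e i)) + Hs e i))); last by ring.
apply: ler_wpM2l; first exact: ltW.
apply: ler_wpM2l => //; apply: lerD => //.
apply: ler_pM => //; first by rewrite mulr_ge0// addr_ge0.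
apply: ler_wpM2l => //.
by rewrite [leRHS]mulrDl mul1r; exact: lerD hA hH.
Qed.

End base_and_back.

(** * Moments and formal cumulants *)

Section cumulant_recursion.
Context {R : realType}.
Implicit Types (mu : nat -> R).

(** The constant term is left out, so that the [i]-th power starts in degree [i]. *)
Definition mgf mu n : {poly R} := \sum_(1 <= k < n.+1) (mu k / k`!%:R) *: 'X^k.

Definition cgf mu n : {poly R} := \sum_(1 <= i < n.+1) ((-1) ^+ i.-1 / i%:R) *: mgf mu n ^+ i.

Definition cum mu j : R := j`!%:R * (cgf mu j)`_j.

Lemma coef_mgf mu n t : (mgf mu n)`_t = if (0 < t <= n)%N then mu t / t`!%:R else 0.
Proof.
rewrite /mgf coef_sum (eq_bigr (fun k => if t == k then mu t / t`!%:R else 0)); last first.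
  by move=> k _; rewrite coefZ coefXn; case: eqP => [->|_]; rewrite ?mulr1 ?mulr0.
case: (boolP (0 < t <= n)%N) => h.
  rewrite (bigD1_seq t) ?iota_uniq ?mem_index_iota ?ltnS//= eqxx big1 ?addr0// => k kt.
  by rewrite eq_sym (negbTE kt).
rewrite big_seq big1// => k; rewrite mem_index_iota ltnS => hk.
by case: eqP => // tk; rewrite tk hk in h.
Qed.

Lemma coef_mgf_exp_lt mu n i t : (t < i)%N -> (mgf mu n ^+ i)`_t = 0.
Proof.
elim: i t => // i IH t; rewrite ltnS => ti.
rewrite exprS coefM big1// => -[[|s] hs] _ /=.
  by rewrite coef_mgf mul0r.
rewrite IH ?mulr0//; move: hs; rewrite ltnS => hs.
by apply: leq_trans ti; rewrite subnS prednK ?subn_gt0// leq_subr.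
Qed.

Lemma coef_mgf_exp_trunc mu n n' i t : (t <= n)%N -> (t <= n')%N ->
  (mgf mu n ^+ i)`_t = (mgf mu n' ^+ i)`_t.
Proof.
elim: i t => // i IH t tn tn'; rewrite !exprS !coefM; apply: eq_bigr => -[s hs] _ /=.
rewrite ltnS in hs; rewrite !coef_mgf (leq_trans hs tn) (leq_trans hs tn'); congr (_ * _).
by apply: IH; apply: leq_trans (leq_subr _ _) _.
Qed.

Lemma coef_cgf mu n t : (t <= n)%N -> t`!%:R * (cgf mu n)`_t = cum mu t.
Proof.
move=> tn; rewrite /cum; congr (_ * _); rewrite /cgf !coef_sum (big_cat_nat (n := t.+1))//=.
rewrite [X in _ + X]big_nat_cond [X in _ + X]big1 ?addr0; last first.
  by move=> i /andP[/andP[ti _] _]; rewrite coefZ coef_mgf_exp_lt// mulr0.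
by apply: eq_bigr => i _; rewrite !coefZ (coef_mgf_exp_trunc _ i tn (leqnn t)).
Qed.

(** Differentiating the truncated logarithm yields a finite geometric series in [- mgf]; its defect
    [(- mgf) ^+ n] has no coefficient below degree [n]. *)
Lemma deriv_cgf mu n : (cgf mu n)^`() * (1 + mgf mu n) = (mgf mu n)^`() * (1 - (- mgf mu n) ^+ n).
Proof.
set M := mgf mu n.
have -> : (cgf mu n)^`() = M^`() * \sum_(i < n) (- M) ^+ i.
  rewrite /cgf -/M raddf_sum/= big_add1 big_mkord mulr_sumr; apply: eq_bigr => i _.
  rewrite derivZ deriv_exp/= -[X in _ *: X](scaler_nat i.+1 (M^`() * M ^+ i)) scalerA divfK ?pnatr_eq0// scalerAr.
  by congr (_ * _); rewrite [RHS]exprNn -mul_polyC polyC_exp polyCN.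
rewrite -mulrA; congr (_ * _); rewrite mulrC -(expr1n _ n) subrXX opprK expr1n.
by congr (_ * _); apply: eq_bigr => i _; rewrite expr1n mul1r.
Qed.

(** Coefficient [j] of [deriv_cgf] at truncation order [j.+1], where the defect is not yet
    visible. *)
Lemma cum_rec mu j : mu 0%N = 1 ->
  mu j.+1 = \sum_(q < j.+1) 'C(j, q)%:R * cum mu q.+1 * mu (j - q)%N.
Proof.
move=> mu0; have h := congr1 (fun p : {poly R} => p`_j) (deriv_cgf mu j.+1).
have f0 t : t`!%:R != 0 :> R by rewrite pnatr_eq0 -lt0n fact_gt0.
have rhs : ((mgf mu j.+1)^`() * (1 - (- mgf mu j.+1) ^+ j.+1))`_j = mu j.+1 / j`!%:R.
  rewrite mulrBr mulr1 coefB [X in _ - X](_ : _ = 0) ?subr0; last first.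
    have cN t : (t < j.+1)%N -> ((- mgf mu j.+1) ^+ j.+1)`_t = 0.
      move=> tj; rewrite exprNn -signr_odd.
      by case: (odd _); rewrite ?expr1 ?mulN1r ?expr0 ?mul1r ?coefN coef_mgf_exp_lt ?oppr0.
    rewrite coefM big1// => -[s hs] _ /=; rewrite cN ?mulr0// ltnS.
    exact: leq_subr.
  rewrite coef_deriv coef_mgf/= leqnn factS natrM -mulr_natr.
  by field; rewrite f0 nat1r pnatr_eq0.
rewrite {}rhs coefM in h.
apply: (mulIf (invr_neq0 (f0 j))); rewrite -h mulr_suml; apply: eq_bigr => -[q hq] _ /=.
rewrite ltnS in hq; rewrite coef_deriv -(@coef_cgf mu j.+1) ?ltnS//.
have -> : (1 + mgf mu j.+1)`_(j - q) = mu (j - q)%N / (j - q)`!%:R.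
  rewrite coefD coef1 coef_mgf; case: (posnP (j - q)%N) => [->|jq].
    by rewrite mu0 addr0 fact0 divr1.
  by rewrite add0r/= (leq_trans (leq_subr _ _)).
have -> : 'C(j, q)%:R = j`!%:R / (q`!%:R * (j - q)`!%:R) :> R.
  by apply: (mulIf (mulf_neq0 (f0 q) (f0 (j - q)%N))); rewrite divfK ?mulf_neq0// -!natrM bin_fact.
rewrite factS natrM -mulr_natr; field.
by rewrite !f0.
Qed.

(** Exactness on the monomials of degree at most [k] is a triangular system for [c] with diagonal
    entries [j!]; by [cum_rec] the cumulants divided by factorials solve it. *)
Lemma cum_unique mu (c : nat -> R) k : mu 0%N = 1 ->
  (forall j, (j <= k)%N -> mu j.+1 = \sum_(q < j.+1) c q * (j ^_ q)%:R * mu (j - q)%N) ->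
  forall j, (j <= k)%N -> c j = cum mu j.+1 / j`!%:R.
Proof.
move=> mu0 hc; elim/ltn_ind => j IH jk.
have f0 t : t`!%:R != 0 :> R by rewrite pnatr_eq0 -lt0n fact_gt0.
have := hc j jk; rewrite cum_rec// !big_ord_recr/= subnn mu0 !mulr1 ffactnn binn mul1r.
rewrite (eq_bigr (fun q : 'I_j => c q * (j ^_ q)%:R * mu (j - q)%N)); last first.
  move=> -[q qj] _ /=; rewrite IH ?(leq_trans (ltnW qj))// -bin_ffact natrM.
  by field; rewrite f0.
by move=> /addrI ->; rewrite mulfK.
Qed.

End cumulant_recursion.

(** * The cumulant approximation with uniform constants *)

Section core_result.
Context {R : realType}.

Lemma approx_big {d} {Om : measurableType d} (P : probability Om R) (T : finType)
  (Y : T -> Om -> R) w m I (s : seq I) (e : I -> R) (Phi : I -> (nat -> R -> R) -> R) :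
  (forall i, approx P Y w m (e i) (Phi i)) ->
  approx P Y w m (\sum_(i <- s) e i) (fun g => \sum_(i <- s) Phi i g).
Proof.
move=> h; elim: s => [|i s IH].
  by apply: approx_rem => H g _ _; rewrite !big_nil normr0 mulr0.
rewrite big_cons; apply: (approx_ext _ (approx_add (h i) IH)).
by move=> H g _ _; rewrite big_cons.
Qed.

(** The constant is chosen before the probability space, the field and the number of levels; this
    order gives the uniformity in the end. The induction quantifies over all [K] because removing
    sites replaces [K] by [stepK]. *)
Lemma claims_exist (dm Q : nat) (w u D Cl : R) : (1 <= Q)%N -> 0 <= D -> 1 <= Cl -> 0 < u ->
  forall m K, 1 <= K -> exists2 C, 0 <= C &
  forall d (Om : measurableType d) (P : probability Om R) (T : finType)
    (Y : T -> Om -> R) (G : {set T} -> set (set Om)) (lv : T -> T -> nat) (al : nat -> R)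
    (J : nat) (rho b : R), mixing_field P Y G lv al J dm Q rho b w u D Cl ->
  forall m', (m' <= m)%N -> (m' <= Q)%N ->
    claimA P Y G J dm Q rho b w u K C m' /\ claimB P Y J dm b w u K C m'.
Proof.
move=> Q1 D0 Cl1 u0; have gu := geo_gt0 u0; elim=> [|m IH] K K1.
  have K0 : 0 <= K by apply: le_trans K1.
  have Cl0 : 0 <= Cl by apply: le_trans Cl1.
  exists (8 * K * Cl * (Q%:R * D) + K).
    by rewrite addr_ge0// !mulr_ge0.
  move=> d Om P T Y G lv al J rho b MF m'; rewrite leqn0 => /eqP -> _; split.
    by apply: (claimA_le MF) (claimA0 MF K1); rewrite lerDl.
  by apply: (claimB_le MF) (claimB0 MF Q1 K1); rewrite lerDr !mulr_ge0.
have K0 : 0 <= K by apply: le_trans K1.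
have Cl0 : 0 <= Cl by apply: le_trans Cl1.
have K'1 : 1 <= stepK Q D Cl K.
  have : 0 <= Q%:R * D by rewrite mulr_ge0.
  rewrite /stepK; nra.
have K'0 : 0 <= stepK Q D Cl K by apply: le_trans K'1.
have [C1 C10 h1] := IH K K1.
have [C2 C20 h2] := IH _ K'1.
(* Positivity of [w], hence of [geo (dm%:R * w)], is known only once a field is given; the maximum
   with 0 provides a nonnegative constant beforehand and changes nothing afterwards. *)
pose g2 := Num.max 0 (geo (dm%:R * w)).
have g20 : 0 <= g2 by rewrite /g2 le_max lexx.
pose CA := Q%:R * D * (Q%:R * C2 * (2 * g2 + stepK Q D Cl K) + stepK Q D Cl K).
pose CB := K * (Q%:R * C1 * (2 * geo u + 1) + 1).
have CA0 : 0 <= CA by rewrite mulr_ge0 ?mulr_ge0// addr_ge0// !mulr_ge0// addr_ge0// mulr_ge0.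
have CB0 : 0 <= CB.
  by rewrite mulr_ge0// addr_ge0// !mulr_ge0// addr_ge0// mulr_ge0// ltW.
exists (C1 + CA + CB); first by rewrite !addr_ge0.
move=> d Om P T Y G lv al J rho b MF m' m'm m'Q.
move: m'm; rewrite leq_eqVlt => /predU1P[m'E|m'm]; last first.
  have [hA hB] := h1 _ _ _ _ _ _ _ _ _ _ _ MF m' m'm m'Q; split.
    by apply: (claimA_le MF) hA; rewrite -addrA lerDl addr_ge0.
  by apply: (claimB_le MF) hB; rewrite -addrA lerDl addr_ge0.
have below q : (q < m')%N -> (q <= m)%N /\ (q <= Q)%N.
  by move=> qm'; split; [rewrite -ltnS -m'E|apply: leq_trans (ltnW qm') m'Q].
have gE : geo (dm%:R * w) = g2.
  rewrite /g2 max_r// ltW// geo_gt0// mulr_gt0 ?ltr0n ?(mf_dm MF)//.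
  by case/andP: (mf_w MF).
split.
  apply: (@claimA_le _ _ _ _ _ _ _ _ _ _ _ _ _ _ _ _ _ _ MF _ CA).
    by rewrite addrAC lerDr addr_ge0.
  move=> a A I S j i st; rewrite /CA -gE.
  have m'0 : (0 < m')%N by rewrite m'E.
  rewrite -[_ * (b ^+ a * _)]mulrA.
  have := stepA MF K1 C20 st _ _ m'0; rewrite -!mulrA; apply.
    by move=> q /below[qm qQ]; have [] := h2 _ _ _ _ _ _ _ _ _ _ _ MF q qm qQ.
  by move=> q /below[qm qQ]; have [] := h2 _ _ _ _ _ _ _ _ _ _ _ MF q qm qQ.
apply: (@claimB_le _ _ _ _ _ _ _ _ _ _ _ _ _ _ _ _ _ _ MF _ CB); first by rewrite lerDr addr_ge0.
apply: (stepB MF K1 C10); first by rewrite m'Q m'E.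
  by move=> q /below[qm qQ]; have [] := h1 _ _ _ _ _ _ _ _ _ _ _ MF q qm qQ.
by move=> q /below[qm qQ]; have [] := h1 _ _ _ _ _ _ _ _ _ _ _ MF q qm qQ.
Qed.

(** [E[W g(W)]] is the sum over the sites of [E[Y i g(W)]]. Each [Y i] is centred and starts with an
    empty hole, so [claimA] applies with [a = 1] and both levels 0, at the same cost for all
    sites. *)
Lemma core_approx (dm k : nat) (w u D Cl : R) : 0 <= D -> 1 <= Cl -> 0 < u -> exists2 C, 0 <= C &
  forall d (Om : measurableType d) (P : probability Om R) (T : finType)
    (Y : T -> Om -> R) (G : {set T} -> set (set Om)) (lv : T -> T -> nat) (al : nat -> R)
    (J : nat) (rho b : R), mixing_field P Y G lv al J dm k.+1 rho b w u D Cl ->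
  (forall i, Ex P (Y i) = 0) ->
  approx P Y w k (C * (#|T|%:R * b `^ (k.+1%:R + w) * Hs J u (dm%:R * (k%:R + w)) 0))
    (fun g => Ex P (fun x => psum Y [set: T]%SET x * g 0%N (psum Y [set: T]%SET x))).
Proof.
move=> D0 Cl1 u0; have Q1 : (1 <= k.+1)%N by [].
have [C C0 hC] := claims_exist dm w Q1 D0 Cl1 u0 k (lexx 1).
have gu := geo_gt0 u0.
exists (C * (2 * geo u)); first by rewrite mulr_ge0// mulr_ge0// ltW.
move=> d Om P T Y G lv al J rho b MF EY.
have [hA _] := hC _ _ _ _ _ _ _ _ _ _ _ MF k (leqnn k) (leqnSn k).
have /andP[w0 w1] := mf_w MF.
have b0 := mf_b MF.
pose e := C * (b ^+ 1 * b `^ (k%:R + w)) * As J dm w u (dm%:R * (k%:R + w)) 0 0.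
have hi i : approx P Y w k e (fun g => Ex P (fun x => Y i x * g 0%N (psum Y [set: T]%SET x))).
  have h0 : #|~: [set: T]%SET|%:R <= 1 * E2 (dm%:R * 0%:R) :> R.
    by rewrite finset.setCT cards0 mul1r mulr0 E20.
  have st := state_power MF i (leqnn k.+1) (ltn0Sn k) (lexx 1) (leq0n J) h0.
  rewrite subSS subn0 in st.
  apply: (approx_ext _ (hA _ _ _ _ _ _ st)) => H g _ _.
  have E0 : Ex P (fun y => Y i y ^+ 1) = 0.
    by rewrite -(EY i); congr Ex; apply/funext => y; rewrite expr1.
  by congr Ex; apply/funext => x; rewrite /centre E0 subr0 expr1.
have h := approx_big (enum T) hi.
apply: (approx_le _ (approx_ext _ h)); last first.
  move=> H g H0 hg; rewrite -Ex_sum; last first.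
    move=> i; have hg' := fin_smooth MF [set: T]%SET Q1 (leqnSn k) (ltW H0) hg (leq0n k).
    have t1 : 0 < (k%:R + w) * rho by rewrite mulr_gt0 ?(mf_rho MF)// ltr_wpDl.
    have fY : fin P rho (Y i) by exists b; exact: (mf_Y MF).
    have hF := fin_mul (mf_rho MF) t1 fY hg'.
    apply: fin_itg hF; rewrite addr_gt0 ?(mf_rho MF)//=.
    rewrite -[X in X + _]mul1r -mulrDl addrA nat1r.
    exact: ltW (mf_rhoQ MF).
  congr Ex; apply/funext => x; rewrite -mulr_suml; congr (_ * _).
  by rewrite /psum big_enum/=; apply: eq_bigl => i; rewrite !inE.
rewrite big_enum/= sumr_const -[leLHS]mulr_natl /e.
have bE : b ^+ 1 * b `^ (k%:R + w) = b `^ (k.+1%:R + w).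
  by have := b_split MF (ltn0Sn k : (1 <= k.+1)%N); rewrite subSS subn0.
rewrite bE; have dw : dm%:R * w <= dm%:R * (k%:R + w) by rewrite ler_wpM2l// lerDr.
have hAs := As00 J (mf_w MF) u0 (mf_dm MF) dw.
rewrite (_ : #|T|%:R * _ = C * (#|T|%:R * b `^ (k.+1%:R + w)) * As J dm w u (dm%:R * (k%:R + w)) 0 0); last by ring.
rewrite (_ : _ * (2 * geo u) * _ = C * (#|T|%:R * b `^ (k.+1%:R + w)) * (2 * geo u * Hs J u (dm%:R * (k%:R + w)) 0)); last by ring.
by apply: ler_wpM2l hAs; rewrite mulr_ge0// mulr_ge0// powR_ge0.
Qed.

End core_result.

Section core_cumulant.
Context {R : realType}.

(** The [q]-th derivative of [x^j]. *)
Definition pwr (j q : nat) (x : R) : R := (j ^_ q)%:R * x ^+ (j - q).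

Lemma isd_pwr j q x : isd (pwr j q) x (pwr j q.+1 x).
Proof.
have h := isdZ (j ^_ q)%:R (isdX (j - q) x).
apply: (isd_eq h); rewrite /pwr.
case: (leqP j q) => jq.
  by rewrite (eqP (jq : (j - q == 0)%N)) mul0r mulr0 ffact_small ?ltnS// mul0r.
by rewrite ffactnSr natrM -mulrA subnS.
Qed.

(** The [k]-th derivative is constant, so every positive [H] is allowed. *)
Lemma smooth_pwr j k w H : 0 < H -> (j <= k)%N -> smooth k w H (pwr j).
Proof.
move=> H0 jk; split => [q x _|x y]; first exact: isd_pwr.
rewrite /pwr (eqP (jk : (j - k == 0)%N)) !expr0 subrr normr0.
by rewrite mulr_ge0 ?powR_ge0// ltW.
Qed.

Lemma smooth_pwr1 k : smooth k 1 (k.+1)`!%:R (pwr k.+1).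
Proof.
split => [q x _|x y]; first exact: isd_pwr.
rewrite /pwr subSnn !expr1 powRr1// -mulrBr normrM.
by rewrite [leLHS](_ : _ = k.+1`!%:R * `|x - y|)// ger0_norm// -ffactnn ffactnSr subSnn muln1.
Qed.

Context {d} {Om : measurableType d} (P : probability Om R) (T : finType) (Y : T -> Om -> R).

Definition smom (j : nat) : R := Ex P (fun x => psum Y [set: T]%SET x ^+ j).

Lemma smom0 : smom 0 = 1.
Proof. by rewrite /smom -[RHS](Ex_cst P 1); congr Ex; apply/funext => x; rewrite expr0. Qed.

Context {G : {set T} -> set (set Om)} {lv : T -> T -> nat} {al : nat -> R}
  {J dm Q : nat} {rho b w u D Cl : R}.
Hypothesis MF : mixing_field P Y G lv al J dm Q rho b w u D Cl.

Lemma itg_smom j : (j <= Q)%N -> itg P (fun x => psum Y [set: T]%SET x ^+ j).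
Proof.
move=> jQ; have r0 := mf_rho MF; have w0 : 0 < w by case/andP: (mf_w MF).
case: j jQ => [_|j jQ]; first by rewrite (_ : (fun x => _) = cst 1); [exact: itg_cst|apply/funext => x; rewrite expr0].
have [c hc] := fin_psum MF [set: T]%SET (leq_ltn_trans (leq0n j) jQ).
apply: mb_itg (mb_expr j r0 hc).
rewrite mulr_gt0//= mulrC; apply: le_trans (ltW (mf_rhoQ MF)).
rewrite ler_wpM2r ?(ltW r0)//; apply: ler_wpDr; first exact: ltW.
by rewrite ler_nat.
Qed.

Lemma Ex_pwr j q : (j <= Q)%N ->
  Ex P (fun x => pwr j q (psum Y [set: T]%SET x)) = (j ^_ q)%:R * smom (j - q)%N.
Proof.
by move=> jQ; rewrite /pwr ExZ//; apply: itg_smom; exact: leq_trans (leq_subr _ _) jQ.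
Qed.

Lemma Ex_mulW j : Ex P (fun x => psum Y [set: T]%SET x * pwr j 0 (psum Y [set: T]%SET x)) = smom j.+1.
Proof. by congr Ex; apply/funext => x; rewrite /pwr ffactn0 mul1r subn0 exprS. Qed.

Lemma sum_pwr_ffact (c : nat -> R) j k : (j <= k)%N -> (j <= Q)%N ->
  \sum_(q < k.+1) c q * Ex P (fun x => pwr j q (psum Y [set: T]%SET x)) =
  \sum_(q < j.+1) c q * (j ^_ q)%:R * smom (j - q)%N.
Proof.
move=> jk jQ; rewrite -(big_mkord xpredT (fun q => c q * Ex P (fun x => pwr j q (psum Y [set: T]%SET x)))).
rewrite (big_cat_nat (n := j.+1))//= [X in _ + X]big_nat_cond [X in _ + X]big1 ?addr0; last first.
  move=> q /andP[/andP[jq _] _]; rewrite Ex_pwr// ffact_small// mul0r mulr0.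
  by [].
by rewrite big_mkord; apply: eq_bigr => q _; rewrite Ex_pwr// mulrA.
Qed.

End core_cumulant.

Lemma le_eps_eq0 {R : realType} (x e : R) : (forall H, 0 < H -> `|x| <= H * e) -> x = 0.
Proof.
move=> h; apply/eqP; rewrite -normr_le0; apply/ler_addgt0Pr => s s0; rewrite add0r.
have e1 : 0 < `|e| + 1 by rewrite ltr_wpDl.
apply: le_trans (h (s / (`|e| + 1)) _) _; first by rewrite divr_gt0.
rewrite mulrAC ler_pdivrMr// ler_pM2l//; apply: le_trans (ler_norm e) _.
by rewrite lerDl.
Qed.

Section core_bounds.
Context {R : realType}.

Definition rate (u : R) (J dm : nat) (e : R) : R := Hs J u (dm%:R * e) 0.

(** On monomials of degree at most [k] the bound holds for all [H > 0], hence with error zero, and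
    these identities determine the unknown coefficients. *)
Lemma core_cumulant (dm k : nat) (w u D Cl : R) : 0 <= D -> 1 <= Cl -> 0 < u -> exists2 C, 0 <= C &
  forall d (Om : measurableType d) (P : probability Om R) (T : finType)
    (Y : T -> Om -> R) (G : {set T} -> set (set Om)) (lv : T -> T -> nat) (al : nat -> R)
    (J : nat) (rho b : R), mixing_field P Y G lv al J dm k.+1 rho b w u D Cl ->
  (forall i, Ex P (Y i) = 0) -> forall H g, 0 < H -> smooth k w H g ->
  `|Ex P (fun x => psum Y [set: T]%SET x * g 0%N (psum Y [set: T]%SET x)) -
    \sum_(j < k.+1) cum (smom P Y) j.+1 / j`!%:R * Ex P (fun x => g j (psum Y [set: T]%SET x))|
  <= H * (C * (#|T|%:R * b `^ (k.+1%:R + w) * rate u J dm (k%:R + w))).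
Proof.
move=> D0 Cl1 u0; have [C C0 hC] := core_approx dm k w D0 Cl1 u0; exists C => //.
move=> d Om P T Y G lv al J rho b MF EY H g H0 hg.
have [c hc] := hC _ _ _ _ _ _ _ _ _ _ _ MF EY.
have cE : forall j, (j <= k)%N -> c j = cum (smom P Y) j.+1 / j`!%:R.
  apply: cum_unique; first exact: smom0.
  move=> j jk; apply/eqP; rewrite -subr_eq0; apply/eqP.
  apply: le_eps_eq0 => H' H'0; have := hc _ _ H'0 (smooth_pwr w H'0 jk).
  by rewrite (sum_pwr_ffact MF)// ?(leq_trans jk)// Ex_mulW; apply.
have := hc _ _ H0 hg; congr (`|_ - _| <= _).
by apply: eq_bigr => -[j jk] _ /=; rewrite cE.
Qed.

(** The test function [x^(s+1)] is one degree too high for exactness. The approximation stops just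
    before the term of the moment recursion that contains cumulant [s + 2], so its error is that
    cumulant. *)
Lemma cum_bound (dm s : nat) (u D Cl : R) : 0 <= D -> 1 <= Cl -> 0 < u -> exists2 C, 0 <= C &
  forall d (Om : measurableType d) (P : probability Om R) (T : finType)
    (Y : T -> Om -> R) (G : {set T} -> set (set Om)) (lv : T -> T -> nat) (al : nat -> R)
    (J : nat) (rho b : R), mixing_field P Y G lv al J dm s.+1 rho b 1 u D Cl ->
  (forall i, Ex P (Y i) = 0) ->
  `|cum (smom P Y) s.+2| <= C * (#|T|%:R * b `^ s.+2%:R * rate u J dm s.+1%:R).
Proof.
move=> D0 Cl1 u0; have [C C0 hC] := core_cumulant dm s 1 D0 Cl1 u0.
exists ((s.+1)`!%:R * C); first by rewrite mulr_ge0.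
move=> d Om P T Y G lv al J rho b MF EY.
have f0 : 0 < s.+1`!%:R :> R by rewrite ltr0n fact_gt0.
have := hC _ _ _ _ _ _ _ _ _ _ _ MF EY _ _ f0 (smooth_pwr1 s).
rewrite Ex_mulW cum_rec ?smom0// big_ord_recr/= subnn smom0 mulr1 binn mul1r.
rewrite [X in _ - X](eq_bigr (fun q : 'I_s.+1 => 'C(s.+1, q)%:R * cum (smom P Y) q.+1 * smom P Y (s.+1 - q)%N)); last first.
  move=> -[q qs] _ /=; rewrite (Ex_pwr MF)// -bin_ffact natrM.
  by field; rewrite pnatr_eq0 -lt0n fact_gt0.
rewrite addrAC subrr add0r !natr1 mulrA.
by [].
Qed.

End core_bounds.

(** * Rates as sums over levels *)

Section rates.
Context {R : realType}.
Implicit Types (u p a c : R) (J dm : nat).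

Lemma E2M c n : E2 (c * n%:R) = E2 c ^+ n :> R.
Proof. by rewrite /E2 powRrM powR_mulrn// powR_ge0. Qed.

Lemma E2n n : E2 n%:R = (2 ^ n)%:R :> R.
Proof. by rewrite -[n%:R]mul1r E2M /E2 powRr1// natrX. Qed.

Lemma powR_E2 (x y : R) : E2 x `^ y = E2 (x * y).
Proof. by rewrite /E2 powRrM. Qed.

Lemma rateE u J dm (p : R) :
  rate u J dm (p + 1) = \sum_(l < J.+1) E2 ((dm%:R * (p + 1) - u) * l%:R).
Proof. by rewrite /rate /Hs; apply: eq_bigr => l _; rewrite max0n mulrBl. Qed.

Lemma rate_gt0 u J dm (e : R) : 0 < rate u J dm e.
Proof.
rewrite /rate /Hs big_ord_recl/=; apply: ltr_wpDr; last exact: E2_gt0.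
by apply: sumr_ge0 => i _; exact: E2_ge0.
Qed.

Lemma sum_E2_le c n : 0 < c -> \sum_(l < n.+1) E2 (c * l%:R) <= geo c * E2 (c * n%:R).
Proof.
move=> c0; rewrite (reindex_inj rev_ord_inj)/=.
rewrite (eq_bigr (fun l : 'I_n.+1 => E2 (c * n%:R) * E2 (- (c * l%:R)))); last first.
  move=> [l ln] _ /=; rewrite -E2D; congr E2.
  by rewrite subSS natrB -1?ltnS// mulrBr.
by rewrite -mulr_sumr mulrC ler_wpM2r ?E2_ge0// sum_geo_le.
Qed.

Definition Ep u J dm p (N : R) : R := N `^ (- p / 2) * rate u J dm (p + 1).

Lemma Ep_gt0 u J dm p N : 0 < N -> 0 < Ep u J dm p N.
Proof. by move=> N0; rewrite mulr_gt0 ?powR_gt0 ?rate_gt0. Qed.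

(** At a level [l <= J], [2^(dm l) <= N] turns [N^(-p/2)] into at most [2^(-dm p l / 2)] and leaves
    the exponent [dm (p + 2) / 2 - u]; the lower threshold for [u] makes it negative. *)
Lemma Ep_bounded u J dm p N : (0 < dm)%N -> dm%:R * (p + 2) / 2 < u -> 0 < p -> 0 < N ->
  E2 (dm%:R * J%:R) <= N -> Ep u J dm p N <= geo (u - dm%:R * (p + 2) / 2).
Proof.
move=> d0 hu p0 N0 hN; set c := u - _; have c0 : 0 < c by rewrite subr_gt0.
have d0' : 0 < dm%:R :> R by rewrite ltr0n.
rewrite /Ep rateE.
have h : \sum_(l < J.+1) E2 ((dm%:R * (p + 1) - u) * l%:R) <= N `^ (p / 2) * \sum_(l < J.+1) E2 (- (c * l%:R)).
  rewrite mulr_sumr; apply: ler_sum => -[l lJ] _ /=; rewrite ltnS in lJ.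
  rewrite (_ : (_ - u) * l%:R = dm%:R * l%:R * (p / 2) + - (c * l%:R)); last by rewrite /c; field.
  rewrite E2D ler_wpM2r ?E2_ge0// -powR_E2 ge0_ler_powR ?nnegrE ?E2_ge0 ?(ltW N0)//.
    by rewrite divr_ge0// ltW.
  apply: le_trans hN; apply: le_E2; rewrite ler_wpM2l// ?(ltW d0')//.
  by rewrite ler_nat.
apply: le_trans (ler_wpM2l (powR_ge0 _ _) h) _.
rewrite mulrA -powRD ?(gt_eqF N0) ?implybT// mulNr addNr powRr0 mul1r.
exact: sum_geo_le.
Qed.

(** Interpolation between orders. Apart from the weights [2^(-(u - dm) l)], summable since [dm < u],
    the terms of order [a] are those of order [p] raised to [a / p]. Division by the total makes the
    weighted sum of [y] equal to 1, and then [y^(a/p) <= 1 + y] does the work of Jensen's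
    inequality. *)
Lemma Ep_power u J dm p a N : (0 < dm)%N -> dm%:R < u -> 0 < p -> 0 < N -> 0 <= a <= p ->
  Ep u J dm a N <= (geo (u - dm%:R) + 1) * Ep u J dm p N `^ (a / p).
Proof.
move=> d0 hu p0 N0 /andP[a0 ap]; set E := Ep u J dm p N.
have E0 : 0 < E by exact: Ep_gt0.
have c0 : 0 < u - dm%:R by rewrite subr_gt0.
have ap1 : a / p <= 1 by rewrite ler_pdivrMr// mul1r.
have ap0 : 0 <= a / p by rewrite divr_ge0// ltW.
pose y (l : nat) := E2 (dm%:R * p * l%:R) * N `^ (- p / 2) / E.
have y0 (l : nat) : 0 <= y l by exact: (divr_ge0 (mulr_ge0 (E2_ge0 _) (powR_ge0 _ _)) (ltW E0)).
have ya (l : nat) : y l `^ (a / p) <= 1 + y l.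
  have [h|h] := leP (y l) 1.
    apply: (@le_trans _ _ 1); last by rewrite lerDl.
    have o : 1 `^ (a / p) = 1 :> R by rewrite powR1.
    by rewrite -[leRHS]o ge0_ler_powR ?nnegrE.
  apply: (@le_trans _ _ (y l)); last by rewrite lerDr.
  by rewrite -[leRHS]powRr1// ler_powR// ltW.
have e1 (l : nat) : N `^ (- a / 2) * E2 ((dm%:R * (a + 1) - u) * l%:R) =
    E2 (- ((u - dm%:R) * l%:R)) * (y l `^ (a / p) * E `^ (a / p)).
  rewrite -powRM ?(ltW E0)// divfK ?gt_eqF// powRM ?powR_ge0 ?E2_ge0// powR_E2 -powRrM.
  rewrite (_ : - p / 2 * (a / p) = - a / 2); last by field; rewrite gt_eqF.
  rewrite mulrCA mulrA -E2D mulrC; congr (E2 _ * _).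
  by field; rewrite gt_eqF.
have s1 : \sum_(l < J.+1) E2 (- ((u - dm%:R) * l%:R)) * y l = 1.
  transitivity (N `^ (- p / 2) * (\sum_(l < J.+1) E2 ((dm%:R * (p + 1) - u) * l%:R)) / E); last first.
    by rewrite -rateE divff// gt_eqF.
  rewrite mulr_sumr mulr_suml; apply: eq_bigr => l _.
  rewrite /y !mulrA; congr (_ / _); rewrite -E2D mulrC; congr (_ * E2 _); ring.
rewrite {1}/Ep rateE mulr_sumr (eq_bigr _ (fun (l : 'I_J.+1) _ => e1 l)).
under eq_bigr do rewrite mulrA.
rewrite -mulr_suml ler_wpM2r ?powR_ge0//.
apply: le_trans (_ : \sum_(l < J.+1) (E2 (- ((u - dm%:R) * l%:R)) + E2 (- ((u - dm%:R) * l%:R)) * y l) <= _).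
  apply: ler_sum => l _; rewrite [leRHS](_ : _ = E2 (- ((u - dm%:R) * l%:R)) * (1 + y l)); last by ring.
  by rewrite ler_wpM2l ?E2_ge0.
by rewrite big_split/= s1 lerD2r sum_geo_le.
Qed.

Lemma Ep_super u J dm p N : 0 < N -> dm%:R * (p + 1) < u ->
  Ep u J dm p N <= geo (u - dm%:R * (p + 1)) * N `^ (- p / 2).
Proof.
move=> N0 hu; rewrite /Ep rateE mulrC ler_wpM2r ?powR_ge0//.
under eq_bigr do rewrite -opprB mulNr.
by apply: sum_geo_le; rewrite subr_gt0.
Qed.

Lemma level_log J (N : R) : 2 <= N -> E2 J%:R <= N -> J.+1%:R <= 2 / ln 2 * ln N.
Proof.
move=> N2 hJ; have l2 : 0 < ln (2 : R) by rewrite ln_gt0// ltr1n.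
have N0 : 0 < N by apply: lt_le_trans N2.
have h1 : J%:R * ln 2 <= ln N :> R by rewrite -ln_powR ler_ln ?posrE ?powR_gt0.
have h2 : ln 2 <= ln N :> R by rewrite ler_ln ?posrE.
rewrite mulrAC ler_pdivlMr// -natr1 mulrDl mul1r (_ : 2 * ln N = ln N + ln N); last by ring.
exact: lerD.
Qed.

(** At the critical exponent all levels contribute equally, and the logarithm is their number. *)
Lemma Ep_crit u J dm p N : 2 <= N -> E2 J%:R <= N -> u = dm%:R * (p + 1) ->
  Ep u J dm p N <= 2 / ln 2 * (N `^ (- p / 2) * ln N).
Proof.
move=> N2 hJ hu; rewrite /Ep rateE hu subrr.
under eq_bigr do rewrite mul0r E20.
rewrite sumr_const card_ord [leRHS]mulrCA; apply: ler_wpM2l; first exact: powR_ge0.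
exact: level_log.
Qed.

(** The series grows geometrically, so the last level dominates, and there [2^(dm J) <= N]. *)
Lemma Ep_sub u J dm p N : (0 < dm)%N -> 0 < N -> E2 (dm%:R * J%:R) <= N -> u < dm%:R * (p + 1) ->
  Ep u J dm p N <= geo (dm%:R * (p + 1) - u) * N `^ (- p / 2 + p + 1 - u / dm%:R).
Proof.
move=> d0 N0 hN hu; have c0 : 0 < dm%:R * (p + 1) - u by rewrite subr_gt0.
have d0' : 0 < dm%:R :> R by rewrite ltr0n.
rewrite /Ep rateE; apply: le_trans (ler_wpM2l (powR_ge0 _ _) (sum_E2_le _ c0)) _.
rewrite mulrCA ler_wpM2l ?(ltW (geo_gt0 c0))//.
rewrite (_ : _ + p + 1 - _ = - p / 2 + (dm%:R * (p + 1) - u) / dm%:R); last by field; rewrite gt_eqF.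
rewrite powRD ?(gt_eqF N0) ?implybT// ler_wpM2l ?powR_ge0//.
rewrite (_ : _ * J%:R = dm%:R * J%:R * ((dm%:R * (p + 1) - u) / dm%:R)); last by field; rewrite gt_eqF.
by rewrite -powR_E2 ge0_ler_powR ?nnegrE ?E2_ge0// ?divr_ge0// ltW.
Qed.

(** On the block from [2^j] to [2^(j+1)] the power changes by at most the factor [2^|c - 1|],
    whatever the sign of [c - 1], and the block has [2^j] terms. *)
Lemma dyadic_sum_powR c J : \sum_(1 <= l < 2 ^ J.+1) l%:R `^ (c - 1) <=
  E2 `|c - 1| * \sum_(j < J.+1) E2 (c * j%:R).
Proof.
elim: J => [|J IH].
  rewrite expn1 big_nat1 powR1 big_ord1 mulr0 E20 mulr1 -[leLHS]E20.
  exact: le_E2.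
have p2 : (0 < 2 ^ J.+1)%N by rewrite expn_gt0.
rewrite (big_cat_nat (n := 2 ^ J.+1))//=; last by rewrite leq_exp2l.
rewrite [X in _ * X]big_ord_recr/= mulrDr; apply: lerD => //.
apply: (@le_trans _ _ (\sum_(2 ^ J.+1 <= l < 2 ^ J.+2) E2 `|c - 1| * E2 (J.+1%:R * (c - 1)))).
  apply: ler_sum_nat => l /andP[l1 l2].
  have l0 : (0 : R) < l%:R by rewrite ltr0n (leq_trans p2).
  have E0 := @E2_gt0 R J.+1%:R.
  rewrite -[X in X `^ _](@divfK _ (E2 J.+1%:R)) ?(gt_eqF E0)// powRM ?divr_ge0 ?(ltW E0) ?(ltW l0)//.
  rewrite powR_E2 ler_wpM2r ?E2_ge0//.
  have r1 : 1 <= l%:R / E2 J.+1%:R :> R by rewrite ler_pdivlMr// mul1r E2n ler_nat.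
  apply: (@le_trans _ _ ((l%:R / E2 J.+1%:R) `^ `|c - 1|)); first by rewrite ler_powR// ler_norm.
  have r2 : l%:R / E2 J.+1%:R <= 2 :> R.
    rewrite ler_pdivrMr// E2n -natrM ler_nat -expnS.
    exact: ltnW.
  have r0 := le_trans ler01 r1.
  exact: (ge0_ler_powR (normr_ge0 _) r0 (ler0n _ 2) r2).
rewrite sumr_const_nat expnS mul2n -addnn addnK -[leLHS]mulr_natl mulrCA ler_wpM2l ?E2_ge0//.
rewrite -E2n -E2D (_ : J.+1%:R + _ = c * J.+1%:R); last by ring.
exact: lexx.
Qed.

End rates.

(** * Dyadic distances on the lattice; the field as an instance *)

Section lattice_levels.
Context {d : nat} {T : {fset 'rV[int]_d}}.

Definition zdist (i s : T) : nat := absz `|val i - val s|.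

Lemma ltz_coord (x y : int) (m : nat) : (`|x - y| < m%:Z)%R -> (absz (x - y + m%:Z)%R < m.*2.+1)%N.
Proof. by lia. Qed.

Lemma coord_inj (x y z : int) (m : nat) : (`|x - z| < m%:Z)%R -> (`|y - z| < m%:Z)%R ->
  absz (x - z + m%:Z) = absz (y - z + m%:Z) -> x = y.
Proof. by lia. Qed.

Lemma coord_lt (i s : T) (m : nat) j : (zdist i s < m)%N ->
  (`|(val s) ord0 j - (val i) ord0 j| < m%:Z)%R.
Proof.
move=> h; have h1 : `|val i - val s| < m%:Z.
  by move: h; rewrite /zdist; have := normr_ge0 (val i - val s); lia.
apply: le_lt_trans h1; rewrite distrC.
rewrite [leRHS](_ : _ = mx_norm (val i - val s))// mx_normrE; apply/bigmax_geP; right => /=; exists (ord0, j) => //=.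
by rewrite !mxE.
Qed.

(** Coordinates relative to the centre, shifted by [m] to become nonnegative, embed the ball into
    the functions from ['I_d] to ['I_(m.*2.+1)]. *)
Lemma count_ball (i : T) (m : nat) : (#|[set s | (zdist i s < m)%N]%SET| <= m.*2.+1 ^ d)%N.
Proof.
pose f (s : T) : {ffun 'I_d -> 'I_(m.*2.+1)} :=
  [ffun j => inord (absz ((val s) ord0 j - (val i) ord0 j + m%:Z))].
rewrite -[X in (_ <= _ ^ X)%N](card_ord d) -[X in (_ <= X ^ _)%N](card_ord m.*2.+1) -card_ffun.
apply: (leq_card_in f) => s t; rewrite !inE => hs ht /ffunP fst.
apply/val_inj/matrixP => a j; rewrite (ord1 a).
have hs' := coord_lt j hs; have ht' := coord_lt j ht.
have /(congr1 val) := fst j; rewrite !ffunE /= !inordK ?ltz_coord//.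
exact: coord_inj hs' ht'.
Qed.

Definition levels (R : realType) : nat := trunc_log 2 (range_radius R T).
(** Distances 0 and 1 both have level 0, since [trunc_log] is 0 at 0; level 0 therefore expresses no
    separation, and mixing is asked for at positive levels. *)
Definition lvl (R : realType) (i s : T) : nat := minn (levels R) (trunc_log 2 (zdist i s)).

Context {R : realType}.
Hypothesis d_gt0 : (0 < d)%N.
Hypothesis T0 : T != fset0.
Local Notation J := (levels R).
Local Notation N := ((#|` T|)%:R : R).

Lemma N_ge1 : 1 <= N.
Proof. by rewrite ler1n cardfs_gt0. Qed.

Lemma range_radius_gt0 : (0 < range_radius R T)%N.
Proof.
rewrite /range_radius truncn_gt0 -[leLHS](powRr0 N).
by rewrite ler_powR ?N_ge1// invr_ge0.
Qed.

Let dR : 0 < d%:R :> R. Proof. by rewrite ltr0n. Qed.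

Lemma levels_radius : (2 ^ J <= range_radius R T)%N.
Proof. by apply: trunc_logP => //; exact: range_radius_gt0. Qed.

Lemma radius_levels : (range_radius R T < 2 ^ J.+1)%N.
Proof. exact: trunc_log_ltn. Qed.

Lemma levels_le : E2 (d%:R * J%:R) <= N.
Proof.
have N0 : 0 < N by apply: lt_le_trans N_ge1.
rewrite mulrC -powR_E2 E2n.
have h : (2 ^ J)%:R <= N `^ d%:R^-1.
  apply: le_trans (_ : (range_radius R T)%:R <= _); first by rewrite ler_nat levels_radius.
  by have /andP[] := truncn_itv (powR_ge0 N d%:R^-1).
have e : (N `^ d%:R^-1) `^ d%:R = N by rewrite -powRrM mulVf ?gt_eqF// powRr1// ltW.
rewrite -[leRHS]e.
exact: (ge0_ler_powR (ltW dR) (ler0n _ _) (powR_ge0 _ _) h).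
Qed.

Lemma E2_levels_le : E2 J%:R <= N.
Proof.
apply: le_trans levels_le; apply: le_E2.
by rewrite -[leLHS]mul1r ler_wpM2r// ler1n.
Qed.

Lemma card_le_levels : N <= E2 (d%:R * J.+1%:R).
Proof.
have N0 : 0 < N by apply: lt_le_trans N_ge1.
rewrite mulrC -powR_E2 E2n.
have h : N `^ d%:R^-1 <= (2 ^ J.+1)%:R.
  have /andP[_ /ltW h] := truncn_itv (powR_ge0 N d%:R^-1).
  by apply: le_trans h _; rewrite ler_nat radius_levels.
have e : (N `^ d%:R^-1) `^ d%:R = N by rewrite -powRrM mulVf ?gt_eqF// powRr1// ltW.
rewrite -[leLHS]e.
exact: (ge0_ler_powR (ltW dR) (powR_ge0 _ _) (ler0n _ _) h).
Qed.

Lemma count_lvl (i : T) l : (l <= J)%N ->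
  #|[set s | (lvl R i s <= l)%N]%SET|%:R <= E2 (3 * d%:R) * E2 (d%:R * l%:R) :> R.
Proof.
(* Level [J] reaches all of [T] because of the cap, and the count is then the volume bound
   [N <= 2^(d (J + 1))]. Below it the distance is less than [2^(l+1)], and
   [2 * 2^(l+1) + 1 <= 2^(l+3)] explains the constant [2^(3 d)]. *)
move=> lJ; rewrite -E2D; have [lJ'|lJ'] := ltnP l J; last first.
  have -> : l = J by apply/eqP; rewrite eqn_leq lJ.
  apply: (@le_trans _ _ N).
    by rewrite ler_nat; apply: leq_trans (max_card _) _; rewrite cardfE.
  apply: le_trans card_le_levels _; apply: le_E2.
  rewrite -natr1 mulrDr mulr1 addrC lerD2r ler_peMl// ?(ltW dR)//.
  by rewrite ler1n.
apply: (@le_trans _ _ ((2 ^ l.+1).*2.+1 ^ d)%:R).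
  rewrite ler_nat; apply: leq_trans (count_ball i (2 ^ l.+1)); apply: subset_leq_card.
  apply/fintype.subsetP => s; rewrite !inE /lvl geq_min leqNgt lJ'/= => h.
  by apply: leq_trans (@trunc_log_ltn 2 (zdist i s) isT) _; rewrite leq_exp2l.
rewrite natrX (_ : 3 * d%:R + _ = (l.+3)%:R * d%:R); last first.
  by rewrite -[l.+3]addn3 natrD; ring.
rewrite E2M; apply: lerXn2r; rewrite ?nnegrE ?E2_ge0// E2n ler_nat.
by rewrite !expnS; have := expn_gt0 2 l; lia.
Qed.

Lemma lvl_dist (U1 U2 : {set T}) l : (0 < l <= J)%N ->
  (forall i s, i \in U1 -> s \in U2 -> (l <= lvl R i s)%N) ->
  ((2 ^ l)%:R%:E <= set_dist R U1 U2)%E.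
Proof.
move=> /andP[l0 lJ] h; apply: le_ereal_inf_tmp => _ [i iU [s sU <-]].
rewrite lee_fin; have := h i s iU sU; rewrite /lvl leq_min lJ/= => hl.
have z0 : (0 < zdist i s)%N.
  by case: (zdist i s) hl => //; rewrite trunc_log0 leqNgt l0.
have h2 : (2 ^ l <= zdist i s)%N.
  by apply: leq_trans (@trunc_logP 2 _ isT z0); rewrite leq_exp2l.
apply: (@le_trans _ _ (zdist i s)%:R); first by rewrite ler_nat.
by rewrite /zdist natr_absz ger0_norm// normr_ge0.
Qed.

End lattice_levels.

Section field_instance.
Context {R : realType} {d : nat} {T : {fset 'rV[int]_d}} {disp : measure_display}
  {Om : measurableType disp} (P : probability Om R) (X : T -> {RV P >-> R}).

Definition nfield (i : T) (x : Om) : R := (sum_sd X)^-1 * X i x.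

Lemma mfun_sumE (I : Type) (s : seq I) (F : I -> {RV P >-> R}) x :
  ((\sum_(i <- s) (F i : {mfun Om >-> R})) : {mfun Om >-> R}) x = \sum_(i <- s) F i x.
Proof. by elim: s => [|i s IH]; rewrite ?big_nil ?big_cons//= -IH. Qed.

Lemma normed_sumE x : normed_sum X x = psum nfield [set: T]%SET x.
Proof.
rewrite /psum /nfield -mulr_sumr; congr (_ * _).
transitivity (\sum_(i <- index_enum T) X i x); first exact: mfun_sumE.
by apply: eq_bigl => i; rewrite inE.
Qed.

Lemma sigma_of_id (U : {set T}) : <<s sigma_of X U >> = sigma_of X U.
Proof. by apply: sigma_algebra_id; exact: smallest_sigma_algebra. Qed.

Lemma sigma_of_measurable (U : {set T}) E : sigma_of X U E -> measurable E.
Proof.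
apply: smallest_sub; first exact: sigma_algebra_measurable.
move=> _ [i _ [C mC <-]]; exact: measurable_funPT.
Qed.

Lemma sigma_of_mono (U V : {set T}) : U \subset V -> sigma_of X U `<=` sigma_of X V.
Proof.
move=> UV; apply: smallest_sub; first exact: smallest_sigma_algebra.
move=> A [i iU hA]; apply: sub_sigma_algebra; exists i => //.
exact: (fintype.subsetP UV).
Qed.

Lemma smeas_nfield i : smeas (sigma_of X [set i]%SET) (nfield i).
Proof.
have h : smeas (sigma_of X [set i]%SET) (X i).
  move=> _ C mC; apply: sub_sigma_algebra; apply: sub_sigma_algebra.
  by exists i; [rewrite /= inE|exists C].
exact: (smeas_comp (measurable_funM (measurable_cst _) (@measurable_id _ _ _)) h).
Qed.

Lemma prob_diff_le1 (x y z : R) : 0 <= x <= 1 -> 0 <= y <= 1 -> 0 <= z <= 1 -> `|x - y * z| <= 1.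
Proof.
move=> /andP[x0 x1] /andP[y0 y1] /andP[z0 z1]; rewrite ler_norml.
have h : y * z <= 1 by rewrite mulr_ile1.
have h' : 0 <= y * z by rewrite mulr_ge0.
by rewrite lerBrDr lerBlDr; lra.
Qed.

Lemma prob_itv01 (E : set Om) : measurable E -> 0 <= fine (P E) <= 1.
Proof.
move=> mE; rewrite fine_ge0//= -lee_fin fineK ?fin_num_measure//.
exact: probability_le1.
Qed.

Lemma alpha_coef_ub (F G : set (set Om)) : F `<=` measurable -> G `<=` measurable ->
  ubound [set `|fine (P (A `&` B)) - fine (P A) * fine (P B)| | A in F & B in G] 1.
Proof.
move=> mF mG _ [A FA [B GB <-]]; have mA := mF _ FA; have mB := mG _ GB.
by apply: prob_diff_le1; apply: prob_itv01 => //; exact: measurableI.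
Qed.

Lemma alpha_coef_ge (F G : set (set Om)) A B : F `<=` measurable -> G `<=` measurable ->
  F A -> G B -> `|fine (P (A `&` B)) - fine (P A) * fine (P B)| <= alpha_coef P F G.
Proof.
move=> mF mG FA GB; apply: ub_le_sup; first by exists 1; exact: alpha_coef_ub.
by exists A => //; exists B.
Qed.

Lemma sup_le1 (A : set R) : ubound A 1 -> sup A <= 1.
Proof.
move=> h; have [->|/set0P ne] := eqVneq A set0; first by rewrite sup0.
exact: ge_sup.
Qed.

Lemma alpha_coef_le1 (F G : set (set Om)) : F `<=` measurable -> G `<=` measurable ->
  alpha_coef P F G <= 1.
Proof.
by move=> mF mG; exact: sup_le1 (alpha_coef_ub mF mG).
Qed.

Lemma alpha_mixing_ge (U1 U2 : {set T}) q l A B : (#|U1| <= q)%N ->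
  (l%:R%:E <= set_dist R U1 U2)%E -> sigma_of X U1 A -> sigma_of X U2 B ->
  `|fine (P (A `&` B)) - fine (P A) * fine (P B)| <= alpha_mixing X q l.
Proof.
move=> Uq hd sA sB; apply: le_trans (alpha_coef_ge _ _ sA sB) _ => //.
- exact: sigma_of_measurable.
- exact: sigma_of_measurable.
rewrite le_max; apply/orP; right; apply: ub_le_sup.
  exists 1 => _ [U _ <-]; apply: alpha_coef_le1 => ?; exact: sigma_of_measurable.
by exists (U1, U2).
Qed.

Context (C v u rho b : R) (k : nat) (w : R).
(** The assumed bound at distance [2^l] stands in for the mixing coefficient: it is positive and at
    most 1, as Davydov's inequality requires, even where the coefficient itself vanishes. *)
Definition mixbound (l : nat) : R := Num.min 1 (C * (2 ^ l)%:R `^ (- v)).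
Local Notation J := (@levels d T R).

(** One set of moment and decay assumptions serves all lower orders [Q + w'], because shrinking the
    order only raises the power of the mixing coefficient. Approximations use [w' = w], cumulant
    bounds [w' = 1]. *)
Lemma nfield_mixing Cl (Q : nat) (w' : R) : (0 < d)%N -> T != fset0 -> 0 < C -> 0 < u -> 1 <= Cl ->
  0 < rho -> 0 < b ->
  (k.+1%:R + w) * rho < 1 -> (forall i, mb P rho b (nfield i)) ->
  (forall l, (1 <= l <= range_radius R T)%N -> alpha_mixing X k.+1 l <= C * l%:R `^ (- v)) ->
  (forall l, (0 < l <= J)%N -> mixbound l `^ (1 - (k.+1%:R + w) * rho) <= Cl * Lv u l) ->
  (Q <= k.+1)%N -> 0 < w' <= 1 -> Q%:R + w' <= k.+1%:R + w ->
  mixing_field P nfield (sigma_of X) (lvl R) mixbound J d Q rho b w' u (E2 (3 * d%:R)) Cl.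
Proof.
move=> d0 T0 C0 u0 Cl1 rho0 b0 rhoQ hY hal hdec Qk w'01 Qw.
have Qrho : (Q%:R + w') * rho <= (k.+1%:R + w) * rho by rewrite ler_wpM2r ?(ltW rho0).
have al01 l : 0 < mixbound l <= 1.
  by rewrite /mixbound lt_min ltr01 ge_min lexx/= andbT mulr_gt0 ?powR_gt0 ?ltr0n ?expn_gt0.
have E1 : 1 <= E2 (3 * d%:R) :> R by rewrite -[leLHS](@E20 R); apply: le_E2; rewrite mulr_ge0.
split.
- exact: rho0.
- exact: b0.
- exact: w'01.
- exact: u0.
- exact: d0.
- exact: E1.
- exact: Cl1.
- exact: le_lt_trans Qrho rhoQ.
- by move=> i s; exact: geq_minl.
- by move=> i l lJ; exact: (count_lvl d0 T0).
- by move=> U V UV; rewrite sigma_of_id; exact: sigma_of_mono.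
- exact: smeas_nfield.
- exact: hY.
- exact: al01.
- move=> U1 U2 l U1Q lJ hl E F; rewrite !sigma_of_id => sE sF.
  rewrite le_min; apply/andP; split.
    have mE := sigma_of_measurable sE; have mF := sigma_of_measurable sF.
    by apply: prob_diff_le1; apply: prob_itv01 => //; exact: measurableI.
  have dl := lvl_dist lJ hl.
  apply: le_trans (alpha_mixing_ge (leq_trans U1Q Qk) dl sE sF) _; apply: hal.
  rewrite expn_gt0/=; apply: leq_trans (levels_radius T0).
  by rewrite leq_exp2l//; case/andP: lJ.
- move=> l lJ; apply: le_trans (hdec l lJ).
  have /andP[a0 a1] := al01 l.
  by apply: ger_powR; rewrite ?a0// lerD2l lerN2.
Qed.

End field_instance.

(** * The properties of the normalised sum used by Stein's method *)

Section good.
Context {R : realType}.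

(* [eps ^ p] is the target rate, with [p = k.-1 + w]. *)
Record stein_good {dd} {Om : measurableType dd} (P : probability Om R) (W : Om -> R)
    (k : nat) (w K eps : R) : Prop := SteinGood {
  sg_mb : exists rho c, [/\ 0 < rho, (k.+1%:R + w) * rho < 1 & mb P rho c W];
  sg_mom1 : Ex P W = 0;
  sg_mom2 : Ex P (fun x => W x ^+ 2) = 1;
  sg_cum : forall s, (0 < s < k)%N ->
    `|cum (fun j => Ex P (fun x => W x ^+ j)) s.+2| <= K * eps `^ s%:R;
  sg_approx : forall j H g, (0 < j <= k)%N -> 0 < H -> smooth j w H g ->
    `|Ex P (fun x => W x * g 0%N (W x)) -
  \sum_(i < j.+1) cum (fun j => Ex P (fun x => W x ^+ j)) i.+1 / i`!%:R * Ex P (fun x => g i (W x))|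
    <= H * (K * eps `^ (j.-1%:R + w)) }.

Lemma uniform_bound (Q : nat -> R -> Prop) n :
  (forall j C C', C <= C' -> Q j C -> Q j C') ->
  (forall j, exists2 C, 0 <= C & Q j C) -> exists2 C, 0 <= C & forall j, (j <= n)%N -> Q j C.
Proof.
move=> mono h; elim: n => [|n [C C0 hC]].
  by have [C C0 hC] := h 0%N; exists C => // j; rewrite leqn0 => /eqP->.
have [C' C'0 hC'] := h n.+1; exists (C + C'); first exact: addr_ge0.
move=> j; rewrite leq_eqVlt => /predU1P[->|jn].
  by apply: mono hC'; rewrite lerDr.
by apply: mono (hC j jn); rewrite lerDl.
Qed.

Lemma ler_powR_max (b a p : R) : 0 < b -> 0 <= a <= p -> b `^ a <= 1 + b `^ p.
Proof.
move=> b0 /andP[a0 ap]; have [h|h] := leP b 1.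
  apply: (@le_trans _ _ 1); last by rewrite lerDl powR_ge0.
  have o : 1 `^ a = 1 :> R by rewrite powR1.
  rewrite -[leRHS]o.
  exact: (ge0_ler_powR a0 (ltW b0) ler01 h).
apply: (@le_trans _ _ (b `^ p)); last by rewrite lerDr.
by rewrite ler_powR// ltW.
Qed.

(** Products of [a + 2] factors of size [N^(-1/2)], summed over [N] sites, have size [N^(-a/2)]. *)
Lemma field_scale (N b0 a : R) : 0 < N -> 0 < b0 ->
  N * (b0 * N `^ (- 1 / 2)) `^ (a + 2) = b0 `^ (a + 2) * N `^ (- a / 2).
Proof.
move=> N0 b00; rewrite powRM ?powR_ge0 ?(ltW b00)// mulrCA; congr (_ * _).
rewrite -powRrM -{1}(powRr1 (ltW N0)) -powRD ?(gt_eqF N0) ?implybT//.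
by congr (_ `^ _); field.
Qed.

(** An estimate of order [q <= p] comes with the error [Ep q], which [Ep_power] turns into the power
    [q] of one [eps]. This is done for every [j <= k] and every cumulant up to order [k + 1], with
    constants taken uniform over these finitely many orders. *)
Lemma field_good (d k : nat) (w p u Cl b0 C v : R) : (0 < d)%N -> (0 < k)%N -> 0 < w <= 1 -> p = k.-1%:R + w ->
  d%:R * (p + 2) / 2 < u -> 1 <= Cl -> 0 < b0 -> 0 < C ->
  exists2 K, 0 <= K &
  forall (T : {fset 'rV[int]_d}) disp (Om : measurableType disp) (P : probability Om R)
    (X : T -> {RV P >-> R}) (rho : R),
  let N : R := (#|` T|)%:R in let J := @levels d T R in
  T != fset0 -> 0 < rho -> (k.+1%:R + w) * rho < 1 ->
  (forall i, mb P rho (b0 * N `^ (- 1 / 2)) (nfield X i)) ->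
  (forall i, Ex P (X i) = 0) ->
  Ex P (fun x => normed_sum X x ^+ 2) = 1 ->
  (forall l, (1 <= l <= range_radius R T)%N -> alpha_mixing X k.+1 l <= C * l%:R `^ (- v)) ->
  (forall l, (0 < l <= J)%N -> mixbound C v l `^ (1 - (k.+1%:R + w) * rho) <= Cl * Lv u l) ->
  stein_good P (normed_sum X) k w K (Ep u J d p N `^ p^-1).
Proof.
move=> d0 k0 w01 pE hu Cl1 b00 C0; have /andP[w0 w1] := w01.
have p0 : 0 < p by rewrite pE ltr_wpDl.
have dR : 0 < d%:R :> R by rewrite ltr0n.
have du : d%:R < u.
  by apply: le_lt_trans hu; rewrite ler_pdivlMr// ler_wpM2l ?(ltW dR)//; lra.
have u0 : 0 < u by apply: lt_trans du.
have D0 : 0 <= E2 (3 * d%:R) :> R by exact: E2_ge0.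
have g0 : 0 <= geo (u - d%:R) + 1 by rewrite addr_ge0// ltW// geo_gt0// subr_gt0.
have [|C1 C10 h1] := uniform_bound k _ (fun j => core_cumulant d j w D0 Cl1 u0).
  move=> j c c' cc' h dd Om P T Y G lv al J rho b MF EY H g H0 hg.
  apply: le_trans (h _ _ _ _ _ _ _ _ _ _ _ MF EY H g H0 hg) _.
  rewrite ler_wpM2l ?(ltW H0)// ler_wpM2r// mulr_ge0 ?(ltW (rate_gt0 _ _ _ _))//.
  by rewrite mulr_ge0// powR_ge0.
have [|C2 C20 h2] := uniform_bound k _ (fun j => cum_bound d j D0 Cl1 u0).
  move=> j c c' cc' h dd Om P T Y G lv al J rho b MF EY.
  apply: le_trans (h _ _ _ _ _ _ _ _ _ _ _ MF EY) _.
  rewrite ler_wpM2r// mulr_ge0 ?(ltW (rate_gt0 _ _ _ _))//.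
  by rewrite mulr_ge0// powR_ge0.
pose B := (1 + b0 `^ (p + 2)) * (geo (u - d%:R) + 1).
have B0 : 0 <= B by rewrite mulr_ge0// addr_ge0// powR_ge0.
exists (C1 * B + C2 * B); first exact: (addr_ge0 (mulr_ge0 C10 B0) (mulr_ge0 C20 B0)).
move=> T disp Om P X rho N J T0 rho0 rhok hY EX X2 hal hdec.
have N0 : 0 < N by apply: lt_le_trans (N_ge1 T0).
set eps := _ `^ p^-1.
have cardT : #|{: T}|%:R = N by rewrite /N cardfE.
have bb : 0 < b0 * N `^ (- 1 / 2) by rewrite mulr_gt0// powR_gt0.
have main q : 0 <= q <= p -> N * (b0 * N `^ (- 1 / 2)) `^ (q + 2) * rate u J d (q + 1) <= B * eps `^ q.
  move=> /andP[q0 qp]; rewrite field_scale// -mulrA -/(Ep u J d q N) -mulrA.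
  have -> : eps `^ q = Ep u J d p N `^ (q / p) by rewrite -powRrM mulrC.
  apply: ler_pM; first exact: powR_ge0.
  - by rewrite ltW// Ep_gt0.
  - by apply: ler_powR_max => //; rewrite lerD2r qp andbT addr_ge0.
  - by apply: Ep_power => //; rewrite q0.
have MF Q w' : (Q <= k.+1)%N -> 0 < w' <= 1 -> Q%:R + w' <= k.+1%:R + w ->
  mixing_field P (nfield X) (sigma_of X) (lvl R) (mixbound C v) J d Q rho (b0 * N `^ (- 1 / 2)) w' u (E2 (3 * d%:R)) Cl.
  exact: (nfield_mixing d0 T0 C0 u0 Cl1 rho0 bb rhok hY hal hdec).
have kw1 : 1 <= k.+1%:R + w by rewrite -natr1; apply: ler_wpDr (ltW w0) _; rewrite lerDr.
have hi i : itg P (nfield X i).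
  apply: mb_itg (hY i); rewrite rho0/=; apply: le_trans (ltW rhok).
  exact: (ler_peMl (ltW rho0) kw1).
have EY i : Ex P (nfield X i) = 0.
  rewrite /nfield ExZ ?EX ?mulr0//.
  (* With [sum_sd X = 0] the convention for inverses would make the normalised sum vanish, against
     its second moment 1. *)
  have s0 : sum_sd X != 0.
    apply/eqP => s0; have : Ex P (fun x => normed_sum X x ^+ 2) = 0.
  rewrite (_ : (fun x => _) = cst 0); first by rewrite Ex_cst.
  by apply/funext => x; rewrite normed_sumE /psum big1 ?expr0n// => j _; rewrite /nfield s0 invr0 mul0r.
    by rewrite X2 => /eqP; rewrite oner_eq0.
  have := itgZ (sum_sd X) (hi i); rewrite /nfield; congr (itg P _).
  by apply/funext => x; rewrite mulrA divff// mul1r.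
have WE : (normed_sum X : Om -> R) = psum (nfield X) [set: T]%SET by apply/funext => x; exact: normed_sumE.
have momE : (fun j => Ex P (fun x => normed_sum X x ^+ j)) = smom P (nfield X).
  by apply/funext => j; rewrite WE.
have kk : k.-1.+1 = k by rewrite prednK.
split.
- have [c hc] := fin_psum (MF k.+1 w (leqnn _) w01 (lexx _)) [set: T]%SET isT.
  exists rho, c; split; [exact: rho0|exact: rhok|].
  by rewrite WE; exact: hc.
- rewrite WE (_ : psum _ _ = fun x => \sum_(i <- index_enum T) nfield X i x); last first.
    by apply/funext => x; apply: eq_bigl => i; rewrite inE.
  by rewrite Ex_sum// big1.
- exact: X2.
- move=> s /andP[s0 sk]; rewrite momE.
  have sw : s.+1%:R + 1 <= k.+1%:R + w.
    by rewrite natr1; apply: (@le_trans _ _ k.+1%:R); [rewrite ler_nat ltnS|rewrite lerDl ltW].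
  have w1' : 0 < (1 : R) <= 1 by rewrite ltr01 lexx.
  have := h2 s (ltnW sk) _ _ _ _ _ _ _ _ _ _ _ (MF s.+1 1 (leq_trans sk (leqnSn _)) w1' sw) EY.
  rewrite cardT => h; apply: le_trans h _.
  have sp : 0 <= (s%:R : R) <= p.
    apply/andP; split; first exact: ler0n.
    rewrite pE; apply: (@le_trans _ _ k.-1%:R); last by rewrite lerDl ltW.
    by rewrite ler_nat -ltnS kk.
  have := main _ sp; rewrite natr1 (_ : s%:R + 2 = s.+2%:R :> R); last by rewrite -[s.+2]addn2 natrD.
  move=> hm; apply: le_trans (ler_wpM2l C20 hm) _.
  by rewrite mulrA ler_wpM2r ?powR_ge0// lerDr (mulr_ge0 C10 B0).
- move=> j H g /andP[j0 jk] H0 hg; rewrite momE.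
  have jw : j.+1%:R + w <= k.+1%:R + w by rewrite lerD2r ler_nat ltnS.
  have := h1 j jk _ _ _ _ _ _ _ _ _ _ _ (MF j.+1 w jk w01 jw) EY H g H0 hg.
  rewrite -WE cardT => h; apply: le_trans h _; rewrite ler_wpM2l ?(ltW H0)//.
  have sp : 0 <= j.-1%:R + w <= p.
    rewrite addr_ge0 ?(ltW w0)//= pE lerD2r ler_nat.
    by rewrite -ltnS kk prednK.
  have je : j%:R = j.-1%:R + 1 :> R by rewrite natr1 prednK.
  have := main _ sp.
  rewrite (_ : j.-1%:R + w + 2 = j.+1%:R + w); last by rewrite -[j.+1%:R]natr1 je; ring.
  rewrite (_ : j.-1%:R + w + 1 = j%:R + w); last by rewrite je; ring.
  move=> hm; apply: le_trans (ler_wpM2l C10 hm) _.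
  by rewrite mulrA ler_wpM2r ?powR_ge0// lerDl (mulr_ge0 C20 B0).
Qed.

End good.

(** * Comparison estimates for primitives against the Gaussian weight *)

Section comparison.
Context {R : realType}.
Implicit Types (x y q H : R).

Definition gphi (y : R) : R := expR (- y ^+ 2 / 2).

Lemma gphi_gt0 y : 0 < gphi y. Proof. exact: expR_gt0. Qed.

Lemma gphiN y : gphi (- y) = gphi y. Proof. by rewrite /gphi sqrrN. Qed.

Lemma isd_gphi y : isd gphi y (- y * gphi y).
Proof.
have h : isd (fun z => - z ^+ 2 / 2) y (- y).
  rewrite (_ : (fun z => _) = fun z => - 2^-1 * z ^+ 2); last by apply/funext => z; field.
  by apply: isd_eq (isdZ _ (isdX 2 y)) _ => /=; field.
by apply: isd_eq (isd_comp (isd_exp _) h) _; rewrite /gphi mulrC.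
Qed.

(** Convergence to 0 at minus infinity; the other end is reached by composing with the
    reflection. *)
Definition van (u : R -> R) := forall e, 0 < e -> exists A, forall y, y <= A -> `|u y| <= e.

Lemma vanD u v : van u -> van v -> van (fun y => u y + v y).
Proof.
move=> hu hv e e0; have e2 : 0 < e / 2 by rewrite divr_gt0.
have [A hA] := hu _ e2; have [B hB] := hv _ e2; exists (Num.min A B) => y.
rewrite le_min => /andP[yA yB]; rewrite (splitr e) (le_trans (ler_normD _ _))// lerD//.
  exact: hA.
exact: hB.
Qed.

Lemma vanZ c u : van u -> van (fun y => c * u y).
Proof.
move=> hu e e0; have c0 : 0 < `|c| + 1 by rewrite ltr_wpDl.
have [|A hA] := hu (e / (`|c| + 1)); first by rewrite divr_gt0.
exists A => y /hA h; rewrite normrM; apply: (@le_trans _ _ ((`|c| + 1) * (e / (`|c| + 1)))).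
  by apply: ler_pM => //; rewrite lerDl.
by rewrite mulrC divfK// gt_eqF.
Qed.

Lemma vanB u v : van u -> van v -> van (fun y => u y - v y).
Proof.
move=> hu hv; have := vanD hu (vanZ (-1) hv); congr van; apply/funext => y; by rewrite mulN1r.
Qed.

Lemma van_le u v : (forall y, `|u y| <= `|v y|) -> van v -> van u.
Proof. by move=> h hv e e0; have [A hA] := hv e e0; exists A => y /hA; apply: le_trans. Qed.

(** A substitute for integrating the bound on the derivative: [U - u] and [U + u] are nondecreasing
    up to [x], and far to the left they are at least minus an arbitrarily small number. *)
Lemma cmp u du U dU x : (forall y, isd u y (du y)) -> (forall y, isd U y (dU y)) ->
  (forall y, y <= x -> `|du y| <= dU y) -> (forall y, 0 <= U y) -> van u -> `|u x| <= U x.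
Proof.
move=> hu hU hd U0 vu; apply/ler_addgt0Pr => e e0.
have [A hA] := vu e e0; set y := Num.min A x.
have yA : y <= A by rewrite ge_min lexx.
have yx : y <= x by rewrite ge_min lexx orbT.
have uy := hA y yA; rewrite ler_norml in uy; case/andP: uy => uy1 uy2.
have [c1 /andP[_ c1x] e1] := mvt yx (fun z => isdB (hU z) (hu z)).
have [c2 /andP[_ c2x] e2] := mvt yx (fun z => isdD (hU z) (hu z)).
have xy0 : 0 <= x - y by rewrite subr_ge0.
have p1 : 0 <= (dU c1 - du c1) * (x - y).
  by rewrite mulr_ge0// subr_ge0 (le_trans (ler_norm _))// hd.
have p2 : 0 <= (dU c2 + du c2) * (x - y).
  by rewrite mulr_ge0// -[du c2]opprK subr_ge0 (le_trans (ler_norm _))// normrN hd.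
rewrite -e1 in p1; rewrite -e2 in p2; have := U0 y.
by move=> Uy; rewrite ler_norml; apply/andP; split; lra.
Qed.

(** From [1 + z <= exp z] at [z = t / (2 n)], raised to an integer power [n >= q]. *)
Lemma powR1D_exp q : 0 <= q -> exists2 C, 0 < C & forall t, 0 <= t -> (1 + t) `^ q <= C * expR (t / 2).
Proof.
move=> q0; pose n := (Num.truncn q).+1.
have qn : q <= n%:R by apply: ltW; exact: truncnS_gt.
have n0 : 0 < 2 * n%:R :> R by rewrite mulr_gt0// ltr0n.
exists ((2 * n%:R) ^+ n); first exact: exprn_gt0.
move=> t t0; have t1 : 1 <= 1 + t by rewrite lerDl.
apply: le_trans (ler_powR t1 qn) _; rewrite powR_mulrn ?(le_trans ler01)//.
have -> : expR (t / 2) = expR (t / (2 * n%:R)) ^+ n.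
  rewrite -expRM_natl; congr expR; rewrite -mulr_natl; field.
  by rewrite pnatr_eq0.
have z1 : 0 <= 1 + t by rewrite (le_trans ler01).
have z2 : 0 <= 2 * n%:R * expR (t / (2 * n%:R)) by rewrite mulr_ge0 ?expR_ge0 ?(ltW n0).
rewrite -exprMn; apply: (lerXn2r n z1 z2).
apply: (@le_trans _ _ (2 * n%:R * (1 + t / (2 * n%:R)))).
  rewrite (_ : _ * (1 + _) = 2 * n%:R + t); last by rewrite mulrDr mulr1 mulrCA mulfV ?mulr1// gt_eqF.
  by rewrite lerD2r -natrM ler1n muln_gt0.
by rewrite ler_pM2l// expR_ge1Dx.
Qed.

Lemma gphi_le_exp y : gphi y <= expR 2^-1 * expR (- `|y|).
Proof.
rewrite -expRD ler_expR.
have := sqr_ge0 (`|y| - 1); rewrite -(real_normK (num_real y)).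
by lra.
Qed.

(** The majorant [1 / (1 + y^2)] is chosen for its bounded primitive [atan], which serves as
    comparison function. *)
Lemma gphi_decay q : 0 <= q -> exists2 C, 0 < C &
  forall y, (1 + `|y|) `^ q * gphi y <= C * (1 + y ^+ 2)^-1.
Proof.
move=> q0; have [|C C0 hC] := @powR1D_exp (q + 2); first by rewrite addr_ge0.
exists (C * expR 2^-1); first by rewrite mulr_gt0// expR_gt0.
move=> y; have y0 := normr_ge0 y.
have d0 : 0 < 1 + y ^+ 2 by rewrite ltr_wpDr// sqr_ge0.
rewrite ler_pdivlMr//.
have y1 : 1 + y ^+ 2 <= (1 + `|y|) `^ 2.
  rewrite powR_mulrn ?addr_ge0// -[y ^+ 2]real_normK ?num_real//.
  by have := normr_ge0 y; nra.
have a0 : 0 < 1 + `|y| by rewrite ltr_wpDr.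
apply: (@le_trans _ _ ((1 + `|y|) `^ (q + 2) * gphi y)).
  rewrite powRD ?(gt_eqF a0) ?implybT// mulrAC ler_wpM2r ?(ltW (gphi_gt0 _))//.
  by rewrite ler_wpM2l// powR_ge0.
apply: (@le_trans _ _ (C * expR (`|y| / 2) * (expR 2^-1 * expR (- `|y|)))).
  apply: ler_pM; [exact: powR_ge0|exact: ltW (gphi_gt0 _)|exact: hC|exact: gphi_le_exp].
rewrite -!mulrA ler_pM2l// mulrCA -[leRHS]mulr1 ler_pM2l ?expR_gt0// -expRD.
by rewrite -[leRHS]expR0 ler_expR; lra.
Qed.

Lemma van_poly (B q : R) u : 0 <= q -> (forall y, `|u y| <= B * (1 + `|y|) `^ q) ->
  van (fun y => u y * gphi y).
Proof.
move=> q0 hu; have [|C C0 hC] := @gphi_decay (q + 0); first by rewrite addr0.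
have B0 : 0 <= B.
  by have := hu 0; rewrite normr0 addr0 powR1 mulr1; apply: le_trans.
move=> e e0; exists (- (B * C / e + 1)) => y hy.
have y1 : B * C / e + 1 <= - y by rewrite lerNr.
have k0 : 0 <= B * C / e by rewrite divr_ge0 ?mulr_ge0// ltW.
rewrite normrM (ger0_norm (ltW (gphi_gt0 y))).
apply: le_trans (ler_wpM2r (ltW (gphi_gt0 y)) (hu y)) _; rewrite -mulrA.
have := hC y; rewrite addr0 => h; apply: le_trans (ler_wpM2l B0 h) _.
have d0 : 0 < 1 + y ^+ 2 by rewrite ltr_wpDr// sqr_ge0.
rewrite mulrA ler_pdivrMr// -ler_pdivrMl// mulrC.
have y3 : 1 <= - y by apply: le_trans y1; rewrite lerDr.
apply: (@le_trans _ _ (- y)); first by apply: le_trans y1; rewrite lerDl.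
have y2 : 0 <= - y * (- y - 1) by rewrite mulr_ge0 ?subr_ge0// (le_trans ler01).
by rewrite -subr_ge0 (_ : _ - _ = - y * (- y - 1) + 1); [rewrite addr_ge0|ring].
Qed.

(** With [t = x - y], the inequality [t^2 / 2 >= t - 1/2] gives
    [gphi y <= C gphi x exp(-(1 - x) t)], and half of the exponent absorbs [((1 - x) t)^q]. Using
    [1 - x] instead of [|x|] keeps the estimate uniform near 0. *)
Lemma left_kernel q : 0 <= q -> exists2 C, 0 < C & forall x y, x <= 0 -> y <= x ->
  (x - y) `^ q * gphi y <= gphi x * (C * (1 - x) `^ (- q) * expR (- ((1 - x) * (x - y) / 2))).
Proof.
move=> q0; have [C C0 hC] := powR1D_exp q0.
exists (C * expR 2^-1); first by rewrite mulr_gt0// expR_gt0.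
move=> x y x0 yx; set a := 1 - x; set t := x - y.
have a0 : 0 < a by rewrite subr_gt0 (le_lt_trans x0).
have t0 : 0 <= t by rewrite subr_ge0.
have g1 : gphi y <= gphi x * (expR 2^-1 * expR (- (a * t))).
  rewrite /gphi -!expRD ler_expR; have -> : y = x - t by rewrite /t; ring.
  by have := sqr_ge0 (t - 1); rewrite /a; lra.
have g2 : t `^ q <= a `^ (- q) * (C * expR (a * t / 2)).
  rewrite powRN mulrC ler_pdivlMr ?powR_gt0// -powRM ?(ltW a0)//.
  have at0 : 0 <= t * a by rewrite mulr_ge0// ltW.
  rewrite (mulrC a); apply: le_trans (hC _ at0).
  apply: (ge0_ler_powR q0 at0); rewrite ?nnegrE ?addr_ge0//.
  by rewrite lerDr.
apply: le_trans (ler_pM (powR_ge0 _ _) (ltW (gphi_gt0 _)) g2 g1) _.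
have -> : expR (- (a * t)) = expR (- (a * t / 2)) * expR (- (a * t / 2)).
  by rewrite -expRD; congr expR; field.
have e1 : expR (a * t / 2) * expR (- (a * t / 2)) = 1 by rewrite -expRD subrr expR0.
rewrite le_eqVlt; apply/orP; left; apply/eqP.
transitivity (expR (a * t / 2) * expR (- (a * t / 2)) *
  (gphi x * (C * expR 2^-1 * a `^ (- q) * expR (- (a * t / 2))))); first by ring.
by rewrite e1 mul1r.
Qed.

(** The comparison function is the primitive of the exponential kernel, and integrating that kernel
    gains the further factor [(1 - x)^(-1)]. *)
Lemma left_bound q : 0 <= q -> exists2 C, 0 < C & forall u du x H, x <= 0 -> 0 <= H ->
  (forall y, isd u y (du y)) -> van u ->
  (forall y, y <= x -> `|du y| <= H * ((x - y) `^ q * gphi y)) ->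
  `|u x| <= C * H * (1 - x) `^ (- q - 1) * gphi x.
Proof.
move=> q0; have [C C0 hC] := left_kernel q0; exists (2 * C); first by rewrite mulr_gt0.
move=> u du x H x0 H0 hu vu hd; set a := 1 - x.
have a0 : 0 < a by rewrite subr_gt0 (le_lt_trans x0).
pose k := gphi x * H * C * a `^ (- q).
have k0 : 0 <= k by rewrite !mulr_ge0 ?powR_ge0// ltW// gphi_gt0.
pose U y := 2 * k / a * expR (a / 2 * (y - x)).
pose dU y := k * expR (a / 2 * (y - x)).
have hU y : isd U y (dU y).
  have h1 : isd (fun z => a / 2 * (z - x)) y (a / 2).
    by apply: isd_eq (isdZ _ (isdB (isd_id y) (isd_cst x y))) _; rewrite subr0 mulr1.
  apply: isd_eq (isdZ _ (isd_comp (isd_exp _) h1)) _.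
  by rewrite /dU; field; rewrite gt_eqF.
have U0 y : 0 <= U y by exact: (mulr_ge0 (divr_ge0 (mulr_ge0 (ler0n _ 2) k0) (ltW a0)) (expR_ge0 _)).
have := cmp hu hU _ U0 vu; move=> h; apply: le_trans (h x _) _.
  move=> y yx; apply: le_trans (hd y yx) _.
  apply: le_trans (ler_wpM2l H0 (hC x y x0 yx)) _.
  rewrite le_eqVlt; apply/orP; left; apply/eqP.
  rewrite /dU /k -/a (_ : a / 2 * (y - x) = - (a * (x - y) / 2)); last by field.
  by ring.
rewrite /U subrr mulr0 expR0 mulr1 /k powRD; last by rewrite (gt_eqF a0) implybT.
rewrite powR_inv1 ?(ltW a0)// le_eqVlt; apply/orP; left; apply/eqP.
by ring.
Qed.

End comparison.

(** * Stein's equation *)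

Section stein_system.
Context {R : realType}.
Implicit Types (x y w H nu : R) (k j : nat).

(** Values at a fixed [x] of successive derivatives under the homogeneous part of the differentiated
    Stein equation, [F'' = x F' + F] and its derivatives. *)
Fixpoint srec x (a0 a1 : R) j : R :=
  if j is j1.+1 then
    if j1 is j2.+1 then x * srec x a0 a1 j1 + j1%:R * srec x a0 a1 j2 else a1
  else a0.

(* The derivatives [F j] of a solution [F 0] of Stein's equation with right-hand
   side [nu - h 0], written out through the differentiated equation. *)
Record stein_sys k (F h : nat -> R -> R) nu : Prop := SteinSys {
  ss_0 : forall y, isd (F 0%N) y (F 1%N y);
  ss_1 : forall y, F 1%N y = y * F 0%N y + h 0%N y - nu;
  ss_S : forall j y, F j.+2 y = y * F j.+1 y + j.+1%:R * F j y + h j.+1 y;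
  ss_van : van (fun y => F 0%N y * gphi y);
  ss_vanN : van (fun y => F 0%N (- y) * gphi y) }.

Lemma stein_sys_isd k F h nu : stein_sys k F h nu ->
  (forall j y, (j < k.-1)%N -> isd (h j) y (h j.+1 y)) ->
  forall j y, (j < k)%N -> isd (F j) y (F j.+1 y).
Proof.
move=> S hh; elim/ltn_ind => -[|[|j]] IH y jk.
- exact: (ss_0 S).
- rewrite (_ : F 1%N = fun y => y * F 0%N y + h 0%N y - nu); last by apply/funext => z; exact: (ss_1 S).
  apply: isd_eq (isdB (isdD (isdM (isd_id y) (ss_0 S y)) (hh 0%N y _)) (isd_cst _ _)) _.
    by move: jk; case: k {S hh IH} => [|[]].
  by rewrite (ss_S S); ring.
- rewrite (_ : F j.+2 = fun y => y * F j.+1 y + j.+1%:R * F j y + h j.+1 y); last by apply/funext => z; exact: (ss_S S).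
  have j1 : (j.+1 < j.+2)%N by [].
  have j0 : (j < j.+2)%N by [].
  apply: isd_eq (isdD (isdD (isdM (isd_id y) (IH _ j1 y (ltnW jk))) (isdZ _ (IH _ j0 y (ltnW (ltnW jk))))) (hh j.+1 y _)) _.
    by move: jk; case: k {S hh IH} => [|k].
  by rewrite (ss_S S j.+1) -[j.+2%:R]natr1; ring.
Qed.

Definition sflip (a : bool) (F : nat -> R -> R) j y : R := (-1) ^+ (a + j) * F j (- y).

(** Reflection carries the right half-line to the left one: [F 0] is odd under it up to a sign, the
    mean [nu] is kept, and the conditions at the two ends are exchanged. *)
Lemma stein_sys_flip k F h nu : stein_sys k F h nu ->
  stein_sys k (sflip true F) (sflip false h) nu.
Proof.
move=> S; have dN y : isd (fun z => - z) y (-1) by apply: isd_eq (isdN (isd_id y)) _.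
split.
- move=> y; rewrite /sflip; apply: isd_eq (isdZ _ (isd_comp (g := fun z => - z) (ss_0 S (- y)) (dN y))) _.
  by rewrite !exprS expr0; ring.
- by move=> y; rewrite /sflip (ss_1 S) !exprS expr0; ring.
- by move=> j y; rewrite /sflip (ss_S S) !add1n !add0n !exprS; ring.
- apply: van_le (ss_vanN S) => y; rewrite /sflip !normrM normrX normrN1 expr1n mul1r.
  by [].
- apply: van_le (ss_van S) => y; rewrite /sflip opprK !normrM normrX normrN1 expr1n mul1r.
  by [].
Qed.

Lemma smooth_flip m w H h : smooth m w H h -> smooth m w H (sflip false h).
Proof.
move=> [h1 h2]; have dN y : isd (fun z => - z) y (-1) by apply: isd_eq (isdN (isd_id y)) _.
split => [j x jm|x y].
  rewrite /sflip; apply: isd_eq (isdZ _ (isd_comp (g := fun z => - z) (h1 j (- x) jm) (dN x))) _.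
  by rewrite !add0n exprS; ring.
rewrite /sflip -mulrBr normrM normrX normrN1 expr1n mul1r; apply: le_trans (h2 _ _) _.
by rewrite (_ : - x - - y = - (x - y)) ?normrN//; ring.
Qed.

(** [g] lists the derivatives of a solution for the right-hand side [t0], with [c] in the role of
    the Gaussian mean. The vanishing of [g j] from [n] on encodes a polynomial of degree less than
    [n]. *)
Definition stein_poly n (t0 : R -> R) := exists g c, [/\ forall j y, isd (g j) y (g j.+1 y),
  forall j y, (n <= j)%N -> g j y = 0, van (fun y => g 0%N y * gphi y),
  van (fun y => g 0%N (- y) * gphi y) &
  forall y, g 1%N y = y * g 0%N y + t0 y - c].

Lemma stein_polyD n (a b : R) t t' : stein_poly n t -> stein_poly n t' ->
  stein_poly n (fun y => a * t y + b * t' y).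
Proof.
move=> [g [c [g1 g2 g3 g4 g5]]] [g' [c' [g1' g2' g3' g4' g5']]].
exists (fun j y => a * g j y + b * g' j y), (a * c + b * c'); split.
- by move=> j y; apply: isdD; apply: isdZ.
- by move=> j y nj; rewrite g2// g2'// !mulr0 addr0.
- have := vanD (vanZ a g3) (vanZ b g3'); congr van; apply/funext => y; ring.
- have := vanD (vanZ a g4) (vanZ b g4'); congr van; apply/funext => y; ring.
- by move=> y; rewrite g5 g5'; ring.
Qed.

Lemma stein_poly_mono n n' t : (n <= n')%N -> stein_poly n t -> stein_poly n' t.
Proof.
move=> nn [g [c [g1 g2 g3 g4 g5]]]; exists g, c; split => // j y nj; apply: g2.
exact: leq_trans nj.
Qed.

Lemma van_monomial (x0 : R) n : van (fun y => (y - x0) ^+ n * gphi y).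
Proof.
apply: (@van_poly _ ((1 + `|x0|) ^+ n) n%:R) => // y.
rewrite powR_mulrn ?addr_ge0// normrX -exprMn; apply: lerXn2r; rewrite ?nnegrE ?mulr_ge0 ?addr_ge0//.
have h := ler_normB y x0; apply: le_trans h _.
have p : 0 <= `|x0| * `|y| by rewrite mulr_ge0.
by rewrite (_ : (1 + `|x0|) * (1 + `|y|) = `|y| + `|x0| + (1 + `|x0| * `|y|)); [rewrite lerDl addr_ge0|ring].
Qed.

(** [- (y - x0)^m] solves the equation for [y (y - x0)^m - m (y - x0)^(m-1)], and [y (y - x0)^m = (y
    - x0)^(m+1) + x0 (y - x0)^m]; so a monomial reduces to the two preceding degrees. *)
Lemma stein_monomial (x0 : R) n : stein_poly n (fun y => (y - x0) ^+ n).
Proof.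
pose e m j y : R := pwr m j (y - x0).
have de m j y : isd (e m j) y (e m j.+1 y).
  apply: isd_eq (isd_comp (g := fun z => z - x0) (isd_pwr m j (y - x0)) (isdB (isd_id y) (isd_cst x0 y))) _.
  by rewrite subr0 mulr1.
have e0 m y : e m 0%N y = (y - x0) ^+ m by rewrite /e /pwr ffactn0 subn0 mul1r.
have v1 m : van (fun y => - e m 0%N y * gphi y).
  have := vanZ (-1) (van_monomial x0 m); congr van; apply/funext => y; rewrite e0; ring.
have v2 m : van (fun y => - e m 0%N (- y) * gphi y).
  have := vanZ (- (-1) ^+ m) (van_monomial (- x0) m); congr van; apply/funext => y.
  have eN : - y - x0 = -1 * (y - - x0) by ring.
  by rewrite e0 eN exprMn -mulNr mulrA.
have base m : stein_poly m.+1 (fun y => y * (y - x0) ^+ m - m%:R * (y - x0) ^+ m.-1).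
  exists (fun j y => - e m j y), 0; split => //.
  - by move=> j y; exact: isdN.
  - by move=> j y mj; rewrite /e /pwr ffact_small// mul0r oppr0.
  - move=> y; rewrite e0 /e /pwr ffactn1 subn1; ring.
elim/ltn_ind: n => -[|[|n]] IH.
- exists (fun _ _ => 0), 1; split => //; try by move=> *; exact: isd_cst.
  + by move=> e1 e10; exists 0 => y _; rewrite mul0r normr0 ltW.
  + by move=> e1 e10; exists 0 => y _; rewrite mul0r normr0 ltW.
  + by move=> y; rewrite expr0 mulr0 add0r subrr.
- have [g [c [g1 g2 g3 g4 g5]]] := base 0%N; exists g, (c - x0); split => // y.
  by rewrite g5 expr0 expr1; ring.
- have h1 := stein_poly_mono (leqnSn _) (IH n.+1 (ltnSn _)).
  have h2 := stein_poly_mono (leq_trans (leqnSn _) (leqnSn _)) (IH n (ltn_trans (ltnSn n) (ltnSn _))).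
  have := stein_polyD 1 1 (base n.+1) (stein_polyD (- x0) (n.+1%:R) h1 h2).
  congr stein_poly; apply/funext => y /=; rewrite !exprS; ring.
Qed.

Lemma stein_poly_sum k (x0 : R) (a : nat -> R) : (0 < k)%N ->
  stein_poly k.-1 (fun y => \sum_(i < k) a i * (y - x0) ^+ i).
Proof.
case: k => // k _ /=; have : forall m, (m <= k.+1)%N -> stein_poly k (fun y => \sum_(i < m) a i * (y - x0) ^+ i).
  elim=> [_|m IH mk].
    have := stein_polyD 0 0 (stein_monomial x0 k) (stein_monomial x0 k); congr stein_poly.
    by apply/funext => y; rewrite big_ord0 !mul0r addr0.
  have := stein_polyD 1 (a m) (IH (ltnW mk)) (stein_poly_mono (mk : (m <= k)%N) (stein_monomial x0 m)).
  congr stein_poly; apply/funext => y; rewrite big_ord_recr/=; ring.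
by apply.
Qed.

Lemma isd_uniq (f : R -> R) (x a b : R) : isd f x a -> isd f x b -> a = b.
Proof. by move=> [_ <-] [_ <-]. Qed.

Lemma stein_poly_rec (g t : nat -> R -> R) c : (forall j y, isd (g j) y (g j.+1 y)) ->
  (forall j y, isd (t j) y (t j.+1 y)) -> (forall y, g 1%N y = y * g 0%N y + t 0%N y - c) ->
  forall j y, g j.+2 y = y * g j.+1 y + j.+1%:R * g j y + t j.+1 y.
Proof.
move=> dg dt g1; elim=> [|j IH] y; apply: isd_uniq (dg _ y) _.
  rewrite (_ : g 1%N = fun y => y * g 0%N y + t 0%N y - c); last by apply/funext.
  apply: isd_eq (isdB (isdD (isdM (isd_id y) (dg 0%N y)) (dt 0%N y)) (isd_cst c y)) _.
  by rewrite (g1 y); ring.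
rewrite (_ : g j.+2 = fun y => y * g j.+1 y + j.+1%:R * g j y + t j.+1 y); last by apply/funext.
apply: isd_eq (isdD (isdD (isdM (isd_id y) (dg j.+1 y)) (isdZ _ (dg j y))) (dt j.+1 y)) _.
by rewrite (IH y) -[j.+2%:R]natr1; ring.
Qed.

Lemma srec_bound j : exists2 C, 0 < C &
  forall x b : R, `|srec x b (x * b) j| <= C * (1 + `|x|) ^+ j * `|b|.
Proof.
elim/ltn_ind: j => -[|[|j]] IH.
- by exists 1 => // x b; rewrite expr0 !mul1r.
- by exists 1 => // x b; rewrite expr1 mul1r normrM ler_wpM2r// lerDr.
have [C C0 hC] := IH j.+1 (ltnSn _); have [C' C'0 hC'] := IH j (ltn_trans (ltnSn j) (ltnSn _)).
exists (C + j.+1%:R * C'); first by rewrite ltr_wpDr// mulr_ge0// ltW.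
move=> x b; have a1 : 1 <= 1 + `|x| by rewrite lerDl.
rewrite [srec _ _ _ _]/= -/(srec x b (x * b) j.+1); apply: le_trans (ler_normD _ _) _.
rewrite [leRHS](_ : _ = C * (1 + `|x|) ^+ j.+2 * `|b| + j.+1%:R * (C' * (1 + `|x|) ^+ j.+2 * `|b|)); last by ring.
apply: lerD.
  rewrite normrM [_ ^+ j.+2]exprS (_ : C * _ * `|b| = (1 + `|x|) * (C * (1 + `|x|) ^+ j.+1 * `|b|)); last by ring.
  by apply: ler_pM => //; rewrite lerDr.
rewrite normrM normr_nat ler_wpM2l//; apply: le_trans (hC' x b) _.
have h := ler_weXn2l a1 (leq_trans (leqnSn j) (leqnSn j.+1)).
exact: (ler_wpM2r (normr_ge0 b) (ler_wpM2l (ltW C'0) h)).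
Qed.

Section mills.
Context {Phi : R -> R}.
Hypothesis dPhi : forall y, isd Phi y (gphi y).
Hypothesis vPhi : van Phi.

(** [Phi / gphi] is the Mills ratio. Its derivatives follow [srec], the inhomogeneous term 1
    entering only in the first derivative. *)
Definition mills j y := srec y (Phi y / gphi y) (y * (Phi y / gphi y) + 1) j.

Lemma millsS j y : mills j.+1 y = y * mills j y + (if j == 0%N then 1 else j%:R * mills j.-1 y).
Proof. by case: j. Qed.

Lemma isd_mills j y : isd (mills j) y (mills j.+1 y).
Proof.
elim/ltn_ind: j y => -[|j] IH y.
  have gi : isd (fun z => (gphi z)^-1) y (y / gphi y).
    rewrite (_ : (fun z => _) = fun z => expR (z ^+ 2 / 2)); last first.
      by apply/funext => z; rewrite /gphi -expRN mulNr opprK.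
    have h : isd (fun z => z ^+ 2 / 2) y y.
      rewrite (_ : (fun z => _) = fun z => 2^-1 * z ^+ 2); last by apply/funext => z; field.
      by apply: isd_eq (isdZ _ (isdX 2 y)) _ => /=; field.
    by apply: isd_eq (isd_comp (isd_exp _) h) _; rewrite /gphi -expRN mulNr opprK mulrC.
  apply: isd_eq (isdM (dPhi y) gi) _; rewrite /mills/=.
  by field; rewrite gt_eqF// gphi_gt0.
rewrite (_ : mills j.+1 = fun y => y * mills j y + (if j == 0%N then 1 else j%:R * mills j.-1 y)); last first.
  by apply/funext => z; exact: millsS.
rewrite millsS/=; case: j IH => [|j] IH.
  apply: isd_eq (isdD (isdM (isd_id y) (IH 0%N _ y)) (isd_cst 1 y)) _ => //.
  by ring.
apply: isd_eq (isdD (isdM (isd_id y) (IH j.+1 _ y)) (isdZ _ (IH j _ y))) _ => //.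
by rewrite /= -[j.+2%:R]natr1; ring.
Qed.

Lemma Phi_ge0 y : 0 <= Phi y.
Proof.
apply/ler_addgt0Pr => e e0; have [A hA] := vPhi e0.
have yA : Num.min A y <= y by rewrite ge_min lexx orbT.
have [c _ h] := mvt yA dPhi.
have h1 : Phi (Num.min A y) <= Phi y.
  by rewrite -subr_ge0 h mulr_ge0 ?(ltW (gphi_gt0 _))// subr_ge0.
have := hA (Num.min A y); rewrite ge_min lexx => /(_ isT); rewrite ler_norml => /andP[h2 _].
by lra.
Qed.

Lemma Phi0_gt0 : 0 < Phi 0.
Proof.
have m1 : -1 <= 0 :> R by rewrite lerN10.
have [c _ h] := mvt m1 dPhi.
have := Phi_ge0 (-1); have := gphi_gt0 c; rewrite sub0r opprK mulr1 in h.
by lra.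
Qed.

Lemma van_neg u (B : R) q : 0 <= q -> (forall y, y <= 0 -> `|u y| <= B * (1 + `|y|) `^ q) ->
  van (fun y => u y * gphi y).
Proof.
move=> q0 hu; have B0 : 0 <= B by have := hu 0 (lexx _); rewrite normr0 addr0 powR1 mulr1; apply: le_trans.
have hv : forall y, `|if y <= 0 then u y else 0| <= B * (1 + `|y|) `^ q.
  by move=> y; case: ifPn => [/hu//|_]; rewrite normr0 mulr_ge0// powR_ge0.
move=> e e0; have [A hA] := van_poly q0 hv e0; exists (Num.min A 0) => y.
by rewrite le_min => /andP[yA y0]; have := hA y yA; rewrite y0.
Qed.

(** [mills j.+1 * gphi] has the derivative [j.+1 * mills j * gphi], so each order follows from the
    one before by [left_bound] with exponent 0 and gains one power of [1 - x]. *)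
Lemma mills_bound j : exists2 C, 0 < C &
  forall x, x <= 0 -> `|mills j x| <= C * (1 - x) `^ (- j.+1%:R).
Proof.
have [C1 C10 hC1] := left_bound (lexx (0 : R)).
have le1 x i : x <= 0 -> (1 - x) `^ (- i.+1%:R) <= 1.
  move=> x0; have a1 : 1 <= 1 - x by rewrite lerDl oppr_ge0.
  by rewrite -[leRHS](powRr0 (1 - x)) ler_powR// oppr_le0.
elim/ltn_ind: j => -[|j] IH.
  exists C1 => // x x0; have g0 := gphi_gt0 x.
  have := hC1 _ _ x 1 x0 ler01 dPhi vPhi; rewrite mulr1 oppr0 add0r => h.
  rewrite /mills/= normrM normfV (ger0_norm (ltW g0)) ler_pdivrMr//; apply: h => y yx.
  by rewrite powRr0 !mul1r ger0_norm// ltW// gphi_gt0.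
have [C C0 hC] := IH j (ltnSn j).
have [C' C'0 hC'] : exists2 C', 0 < C' & forall x, x <= 0 ->
    `|if j == 0%N then 1 else j%:R * mills j.-1 x| <= C'.
  case: j IH {hC C0} => [|j] IH; first by exists 1 => // x _; rewrite /= normr1.
  have [C' C'0 hC'] := IH j (ltn_trans (ltnSn j) (ltnSn _)).
  exists (j.+1%:R * C'); first by rewrite mulr_gt0.
  move=> x x0; rewrite /= normrM normr_nat ler_wpM2l//; apply: le_trans (hC' x x0) _.
  by rewrite -[leRHS]mulr1 ler_wpM2l ?(ltW C'0)// le1.
exists (C1 * (j.+1%:R * C)); first by rewrite !mulr_gt0.
move=> x x0; have g0 := gphi_gt0 x; have a0 : 0 < 1 - x by rewrite subr_gt0 (le_lt_trans x0).
have du y : isd (fun y => mills j.+1 y * gphi y) y (j.+1%:R * mills j y * gphi y).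
  apply: isd_eq (isdM (isd_mills j.+1 y) (isd_gphi y)) _.
  by rewrite [mills j.+2 y]millsS/=; ring.
have vu : van (fun y => mills j.+1 y * gphi y).
  apply: (@van_neg _ (C + C') 1) => // y y0.
  rewrite powRr1 ?addr_ge0// millsS; apply: le_trans (ler_normD _ _) _; rewrite mulrDl; apply: lerD.
    rewrite normrM mulrC; apply: ler_pM => //; last by rewrite lerDr.
    apply: le_trans (hC y y0) _.
    by rewrite -[leRHS]mulr1 ler_wpM2l ?(ltW C0)// le1.
  apply: le_trans (hC' y y0) _; rewrite ler_peMr ?(ltW C'0)//.
  by rewrite lerDl.
have H0 : 0 <= j.+1%:R * C * (1 - x) `^ (- j.+1%:R) by rewrite !mulr_ge0 ?powR_ge0 ?(ltW C0).
have := hC1 _ _ x _ x0 H0 du vu.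
rewrite normrM (ger0_norm (ltW g0)) ler_pM2r// oppr0 add0r => h.
apply: le_trans (h _) _.
  move=> y yx; rewrite powRr0 mul1r normrM (ger0_norm (ltW (gphi_gt0 y))) ler_wpM2r ?(ltW (gphi_gt0 y))//.
  rewrite normrM normr_nat -!mulrA ler_wpM2l//; apply: le_trans (hC y (le_trans yx x0)) _.
  rewrite ler_wpM2l ?(ltW C0)// !powRN lef_pV2 ?posrE ?powR_gt0//; last first.
    by rewrite subr_gt0 (le_lt_trans (le_trans yx x0)).
  rewrite !powR_mulrn ?(ltW a0)//; last by rewrite subr_ge0 (le_trans (le_trans yx x0)).
  apply: lerXn2r; rewrite ?nnegrE ?(ltW a0)//.
    by rewrite subr_ge0 (le_trans (le_trans yx x0)).
  by rewrite lerD2l lerN2.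
rewrite -!mulrA; do 3 rewrite ler_wpM2l ?(ltW C10) ?(ltW C0)//.
rewrite -powRD ?(gt_eqF a0) ?implybT//.
by rewrite -opprD natr1.
Qed.

(** [D 0 * gphi + nu * Phi] has the derivative [h 0 * gphi] and is bounded by means of [atan]. At
    plus infinity the first summand vanishes while [Phi] stays above [Phi 0 > 0], which isolates
    [nu]. *)
Lemma stein_const q : 0 <= q -> exists2 C, 0 < C & forall k D h nu H x0, 0 <= H ->
  stein_sys k D h nu -> (forall y, `|h 0%N y| <= H * `|y - x0| `^ q) ->
  `|nu| <= C * H * (1 + `|x0|) `^ q.
Proof.
move=> q0; have [C C0 hC] := gphi_decay q0; have P0 := Phi0_gt0.
exists (C * pi / Phi 0); first by rewrite divr_gt0 ?mulr_gt0// pi_gt0.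
move=> k D h nu H x0 H0 S hh.
set a := (1 + `|x0|) `^ q; have a0 : 0 <= a by exact: powR_ge0.
pose u y := D 0%N y * gphi y + nu * Phi y.
have du y : isd u y (h 0%N y * gphi y).
  apply: isd_eq (isdD (isdM (ss_0 S y) (isd_gphi y)) (isdZ nu (dPhi y))) _.
  by rewrite (ss_1 S); ring.
have vu : van u := vanD (ss_van S) (vanZ nu vPhi).
pose U y := H * a * C * (atan y + pi / 2).
have dU y : isd U y (H * a * C * (1 + y ^+ 2)^-1).
  apply: isdZ; apply: isd_eq (isdD (is_derive1_atan y) (isd_cst (pi / 2) y)) _.
  by rewrite addr0.
have k0 : 0 <= H * a * C by rewrite !mulr_ge0// ltW.
have U0 y : 0 <= U y by rewrite mulr_ge0// -[pi / 2]opprK subr_ge0 ltW// atan_gtNpi2.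
have uU x : `|u x| <= H * a * C * pi.
  apply: le_trans (_ : U x <= _).
    apply: (cmp du dU) => // y _; rewrite normrM (ger0_norm (ltW (gphi_gt0 y))).
    apply: le_trans (ler_wpM2r (ltW (gphi_gt0 y)) (hh y)) _; rewrite -!mulrA ler_wpM2l//.
    apply: le_trans (ler_wpM2l a0 (hC y)); rewrite [leRHS]mulrA.
    rewrite ler_wpM2r ?(ltW (gphi_gt0 y))// /a -powRM ?addr_ge0//.
    apply: ge0_ler_powR; rewrite ?nnegrE ?mulr_ge0 ?addr_ge0//.
    apply: le_trans (ler_normB _ _) _.
    have p : 0 <= `|x0| * `|y| by rewrite mulr_ge0.
    by rewrite (_ : (1 + `|x0|) * (1 + `|y|) = `|y| + `|x0| + (1 + `|x0| * `|y|)); [rewrite lerDl addr_ge0|ring].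
  rewrite /U ler_wpM2l// {2}(splitr pi) lerD2r; exact: ltW (atan_ltpi2 x).
rewrite (_ : C * pi / Phi 0 * H * a = (H * a * C * pi) / Phi 0); last by ring.
rewrite ler_pdivlMr//; apply/ler_addgt0Pr => e e0.
have [A hA] := ss_vanN S e0; set y := Num.min A 0.
have yA : y <= A by rewrite ge_min lexx.
have y0 : y <= 0 by rewrite ge_min lexx orbT.
have hy := hA y yA.
have P1 : Phi 0 <= Phi (- y).
  have y0' : 0 <= - y by rewrite oppr_ge0.
  have [c _ e1] := mvt y0' dPhi.
  by rewrite -subr_ge0 e1 mulr_ge0 ?(ltW (gphi_gt0 _))// subr0.
apply: (@le_trans _ _ `|nu * Phi (- y)|).
  by rewrite normrM ler_wpM2l// (le_trans P1)// ler_norm.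
have -> : nu * Phi (- y) = u (- y) - D 0%N (- y) * gphi y by rewrite /u gphiN; ring.
by apply: le_trans (ler_normB _ _) _; apply: lerD.
Qed.

End mills.
End stein_system.

Section stein_regularity.
Context {R : realType} {Phi : R -> R}.
Hypothesis dPhi : forall y, isd Phi y (gphi y).
Hypothesis vPhi : van Phi.

Lemma pwr0 i j : pwr i j 0 = if i == j then i`!%:R else 0 :> R.
Proof.
rewrite /pwr; case: (ltngtP i j) => [ij|ij|->].
- by rewrite ffact_small// mul0r.
- by rewrite expr0n subn_eq0 leqNgt ij/= mulr0.
- by rewrite subnn expr0 mulr1 ffactnn.
Qed.

(** The Taylor polynomial of [h] at [x0] is subtracted from [h], and its polynomial Stein solution
    from [F]. That solution has degree below [k - 1], so derivatives [k - 1] and [k] of [F] are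
    unchanged. The new right-hand side vanishes at [x0] with its first [k - 1] derivatives, so there
    the recursion has no source except the constant, whose share is the Mills ratio. *)
Lemma stein_left k (w : R) : (0 < k)%N -> 0 < w <= 1 -> exists2 C, 0 < C &
  forall F h nu H x0, 0 <= H -> x0 <= 0 -> stein_sys k F h nu -> smooth k.-1 w H h ->
  `|F k x0| <= C * H * (1 - x0) `^ (- w) /\ `|F k.-1 x0| <= C * H.
Proof.
move=> k0 /andP[w0 w1]; pose q := k.-1%:R + w; have q0 : 0 <= q by rewrite addr_ge0// ltW.
have kk : k.-1.+1 = k by rewrite prednK.
have [C1 C10 hC1] := left_bound q0.
have [C2 C20 hC2] := stein_const dPhi vPhi q0.
have [s1 s10 hs1] := srec_bound (R := R) k; have [s2 s20 hs2] := srec_bound (R := R) k.-1.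
have [m1 m10 hm1] := mills_bound dPhi vPhi k; have [m2 m20 hm2] := mills_bound dPhi vPhi k.-1.
exists (s1 * C1 + C2 * m1 + (s2 * C1 + C2 * m2)).
  by rewrite !addr_gt0// mulr_gt0.
move=> F h nu H x0 H0 x00 S hh.
pose al i := h i x0 / i`!%:R.
pose t j y := \sum_(i < k) al i * pwr i j (y - x0).
have [g [c [dg g0 vg vgN g1]]] := stein_poly_sum x0 al k0.
have t0E y : t 0%N y = \sum_(i < k) al i * (y - x0) ^+ i.
  by apply: eq_bigr => i _; rewrite /pwr ffactn0 subn0 mul1r.
have dt j y : isd (t j) y (t j.+1 y).
  apply: (isd_sum (F := fun i y => al i * pwr i j (y - x0)) (D := fun i => al i * pwr i j.+1 (y - x0))) => i _.
  apply: isdZ; apply: isd_eq (isd_comp (g := fun z => z - x0) (isd_pwr i j (y - x0)) (isdB (isd_id y) (isd_cst x0 y))) _.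
  by rewrite subr0 mulr1.
have g1' y : g 1%N y = y * g 0%N y + t 0%N y - c by rewrite g1 t0E.
pose D j y := F j y - g j y; pose hb j y := h j y - t j y.
have SD : stein_sys k D hb (nu - c).
  split.
  - by move=> y; apply: isdB; [exact: (ss_0 S)|exact: dg].
  - by move=> y; rewrite /D /hb (ss_1 S) g1'; ring.
  - by move=> j y; rewrite /D /hb (ss_S S) (stein_poly_rec dg dt g1'); ring.
  - have := vanB (ss_van S) vg; congr van; apply/funext => y; rewrite /D; ring.
  - have := vanB (ss_vanN S) vgN; congr van; apply/funext => y; rewrite /D; ring.
have hb0 j : (j < k)%N -> hb j x0 = 0.
  move=> jk; rewrite /hb /t subrr (bigD1 (Ordinal jk))//= pwr0 eqxx big1 ?addr0.
    by rewrite /al divfK ?subrr// pnatr_eq0 -lt0n fact_gt0.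
  by move=> i; rewrite -val_eqE/= pwr0 => /negbTE ->; rewrite mulr0.
have hbb y : `|hb 0%N y| <= H * `|y - x0| `^ q.
  have := taylor_bound w0 hh x0 (y - x0); rewrite (addrC x0) subrK.
  congr (`|_ - _| <= _); rewrite t0E /taylor kk; apply: eq_bigr => i _.
  by rewrite /al mulrAC.
have hN := hC2 k D hb (nu - c) H x0 H0 SD hbb.
set N := nu - c in SD hN.
pose a := 1 - x0; have a1 : 1 <= a by rewrite lerDl oppr_ge0.
have a0 : 0 < a by apply: lt_le_trans a1.
have aE : 1 + `|x0| = a by rewrite ler0_norm.
rewrite aE in hN.
(* [f1 * gphi x0] is the integral of [hb 0 * gphi] up to [x0]; the rest of [D 0%N x0] is a multiple
   of the Mills ratio. *)
pose f1 := D 0%N x0 + N * mills (Phi := Phi) 0 x0.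
have hf1 : `|f1| <= C1 * H * a `^ (- q - 1).
  have g00 := gphi_gt0 x0.
  pose u y := D 0%N y * gphi y + N * Phi y.
  have du y : isd u y (hb 0%N y * gphi y).
    apply: isd_eq (isdD (isdM (ss_0 SD y) (isd_gphi y)) (isdZ N (dPhi y))) _.
    by rewrite (ss_1 SD); ring.
  have vu : van u := vanD (ss_van SD) (vanZ N vPhi).
  have := hC1 u _ x0 H x00 H0 du vu.
  rewrite (_ : u x0 = f1 * gphi x0); last by rewrite /f1 /u /mills/=; field; rewrite gt_eqF.
  rewrite normrM (ger0_norm (ltW g00)) ler_pM2r//; apply => y yx.
  rewrite normrM (ger0_norm (ltW (gphi_gt0 y))) mulrA ler_wpM2r ?(ltW (gphi_gt0 y))//.
  by apply: le_trans (hbb y) _; rewrite ler0_norm ?subr_le0// opprB.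
have key j : (j <= k)%N -> D j x0 = srec x0 f1 (x0 * f1) j - N * mills (Phi := Phi) j x0.
  elim/ltn_ind: j => -[|[|j]] IH jk.
  - by rewrite /f1 /=; ring.
  - by rewrite (ss_1 SD) (hb0 0%N)//= /f1 /mills/=; ring.
  - rewrite (ss_S SD) hb0// (IH j.+1)// ?(ltnW jk)// (IH j)// ?(ltnW (ltnW jk))//.
    have srE b0 b1 : srec x0 b0 b1 j.+2 = x0 * srec x0 b0 b1 j.+1 + j.+1%:R * srec x0 b0 b1 j by [].
    by rewrite /mills !srE; ring.
have fin j s m e : (k.-1 <= j <= k)%N -> 0 < s -> 0 < m ->
    j%:R - k%:R - w <= e -> q - j.+1%:R <= e ->
    `|srec x0 f1 (x0 * f1) j| <= s * (1 + `|x0|) ^+ j * `|f1| ->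
    `|mills (Phi := Phi) j x0| <= m * (1 - x0) `^ (- j.+1%:R) ->
    `|F j x0| <= (s * C1 + C2 * m) * H * a `^ e.
  move=> /andP[kj jk] sp mp e1 e2 h1 h2.
  rewrite (_ : F j x0 = D j x0); last by rewrite /D g0// subr0.
  rewrite key//; apply: le_trans (ler_normB _ _) _.
  rewrite [leRHS](_ : _ = s * C1 * H * a `^ e + C2 * m * H * a `^ e); last by ring.
  apply: lerD.
    apply: le_trans h1 _; rewrite aE -powR_mulrn ?(ltW a0)//.
    apply: le_trans (ler_wpM2l _ hf1) _; first by rewrite mulr_ge0 ?powR_ge0// ltW.
    rewrite [leLHS](_ : _ = s * C1 * H * (a `^ j%:R * a `^ (- q - 1))); last by ring.
    rewrite -powRD ?(gt_eqF a0) ?implybT// ler_wpM2l ?mulr_ge0 ?(ltW C10) ?(ltW sp)//.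
    rewrite ler_powR//; apply: le_trans e1; have e1 : k%:R = k.-1%:R + 1 :> R by rewrite natr1 kk.
    by rewrite /q e1; lra.
  rewrite normrM; apply: le_trans (ler_pM _ _ hN h2) _ => //.
  rewrite -/a [leLHS](_ : _ = C2 * m * H * (a `^ q * a `^ (- j.+1%:R))); last by ring.
  rewrite -powRD ?(gt_eqF a0) ?implybT// ler_wpM2l ?mulr_ge0 ?(ltW C20) ?(ltW mp)//.
  by rewrite ler_powR.
have e1 : k%:R = k.-1%:R + 1 :> R by rewrite natr1 kk.
have e2 : k.+1%:R = k.-1%:R + 1 + 1 :> R by rewrite -[k.+1%:R]natr1 e1.
split.
  apply: le_trans (fin k s1 m1 (- w) _ s10 m10 _ _ (hs1 _ _) (hm1 _ x00)) _.
  - by rewrite leq_pred leqnn.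
  - by rewrite subrr sub0r.
  - by rewrite /q e2; lra.
  - rewrite -/a ler_wpM2r ?powR_ge0// ler_wpM2r// lerDl.
    exact: (addr_ge0 (mulr_ge0 (ltW s20) (ltW C10)) (mulr_ge0 (ltW C20) (ltW m20))).
apply: le_trans (fin k.-1 s2 m2 0 _ s20 m20 _ _ (hs2 _ _) (hm2 _ x00)) _.
- by rewrite leqnn leq_pred.
- by rewrite e1; lra.
- by rewrite /q kk e1; lra.
rewrite powRr0 mulr1 ler_wpM2r// lerDr.
exact: (addr_ge0 (mulr_ge0 (ltW s10) (ltW C10)) (mulr_ge0 (ltW C20) (ltW m10))).
Qed.

Lemma stein_pointwise k (w : R) : (0 < k)%N -> 0 < w <= 1 -> exists2 C, 0 < C &
  forall F h nu H x, 0 <= H -> stein_sys k F h nu -> smooth k.-1 w H h ->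
  `|F k x| <= C * H * (1 + `|x|) `^ (- w) /\ `|F k.-1 x| <= C * H.
Proof.
move=> k0 w01; have [C C0 hC] := stein_left k0 w01; exists C => // F h nu H x H0 S hh.
have [x0|x0] := leP x 0; first by rewrite (ler0_norm x0); exact: hC H0 x0 S hh.
have := hC _ _ _ _ (- x) H0 _ (stein_sys_flip S) (smooth_flip hh).
rewrite oppr_le0 opprK (gtr0_norm x0) /sflip !opprK !normrM !normrX normrN1 !expr1n !mul1r.
by apply; exact: ltW.
Qed.

(** Up to a constant [F k] is [G + h k.-1], and [G] contains the unbounded factor [y], which the
    decay [(1 + |x|)^(-w)] of [F k] has to compensate. For [|x - y| (1 + |x|) <= 1] the mean value
    theorem is applied to [G]; if this fails at both points, the decay alone is at most a constant
    times [|x - y|^w]. *)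
Lemma stein_regular k (w : R) : (0 < k)%N -> 0 < w <= 1 -> exists2 C, 0 < C &
  forall F h nu H, 0 <= H -> stein_sys k F h nu -> smooth k.-1 w H h -> smooth k w (C * H) F.
Proof.
move=> k0 w01; have /andP[w0 w1] := w01; have [C C0 hC] := stein_pointwise k0 w01.
have kk : k.-1.+1 = k by rewrite prednK.
exists (2 * C * (1 + k%:R) + 1 + 2 * C); first by rewrite !addr_gt0// !mulr_gt0// ltr_wpDr.
move=> F h nu H H0 S hh; split; first exact: stein_sys_isd S (proj1 hh).
pose G y := y * F k.-1 y + k.-1%:R * F k.-2 y.
pose dG y := y * F k y + k%:R * F k.-1 y.
have dF := stein_sys_isd S (proj1 hh).
have hG y : isd G y (dG y).
  have h1 : isd (F k.-1) y (F k y) by have := dF k.-1 y; rewrite kk; apply.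
  have h2 : isd (fun y => k.-1%:R * F k.-2 y) y (k.-1%:R * F k.-1 y).
    case: k k0 kk {hC h1 dG G hh} S dF => [//|[|k]] _ _ S dF /=.
      by rewrite mul0r (_ : (fun=> _) = fun=> 0); [exact: isd_cst|apply/funext => z; rewrite mul0r].
    by apply: isdZ; apply: dF.
  apply: isd_eq (isdD (isdM (isd_id y) h1) h2) _.
  have e1 : k%:R = k.-1%:R + 1 :> R by rewrite natr1 kk.
  by rewrite /dG e1; ring.
have FG x y : F k x - F k y = (G x - G y) + (h k.-1 x - h k.-1 y).
  rewrite /G; case: k k0 kk {hC dG G hG hh dF} S => [//|[|k]] _ _ S /=.
    by rewrite !(ss_1 S); ring.
  by rewrite !(ss_S S); ring.
have near x y : `|x - y| * (1 + `|x|) <= 1 -> `|F k x - F k y| <= (2 * C * (1 + k%:R) + 1) * H * `|x - y| `^ w.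
  move=> xy; set a := 1 + `|x| in xy *.
  have a1 : 1 <= a by rewrite lerDl.
  have a0 : 0 < a by apply: lt_le_trans a1.
  rewrite FG; apply: le_trans (ler_normD _ _) _; rewrite mulrDl mul1r mulrDl; apply: lerD; last exact: (proj2 hh).
  have bdG z : `|z| <= 2 * a -> `|dG z| <= 2 * C * (1 + k%:R) * H * a `^ (1 - w).
    move=> za; rewrite /dG.
    have [h1 h2] := hC F h nu H z H0 S hh.
    have z1 : 1 <= 1 + `|z| by rewrite lerDl.
    have z0 : 0 < 1 + `|z| by apply: lt_le_trans z1.
    have aw : 1 <= a `^ (1 - w) by rewrite -[leLHS](powRr0 a) ler_powR// subr_ge0.
    have k1 : `|z * F k z| <= C * H * (2 * a `^ (1 - w)).
      rewrite normrM; apply: (@le_trans _ _ (C * H * (`|z| * (1 + `|z|) `^ (- w)))).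
        by rewrite mulrCA ler_wpM2l.
      apply: ler_wpM2l; first by rewrite mulr_ge0// ltW.
      have [zs|zs] := leP `|z| 1.
        apply: (@le_trans _ _ 1); last by lra.
        apply: mulr_ile1; [exact: normr_ge0|exact: powR_ge0|exact: zs|].
        by rewrite -[leRHS](powRr0 (1 + `|z|)) ler_powR// oppr_le0 ltW.
      have z0' : 0 < `|z| by apply: lt_trans zs.
      apply: (@le_trans _ _ (`|z| `^ (1 - w))).
        rewrite powRB ?(gt_eqF z0') ?implybT// powRr1// ler_wpM2l// powRN lef_pV2 ?posrE ?powR_gt0//.
        by apply: ge0_ler_powR; rewrite ?nnegrE ?(ltW w0) ?(ltW z0)// lerDr.
      apply: (@le_trans _ _ ((2 * a) `^ (1 - w))).
        by apply: ge0_ler_powR; rewrite ?nnegrE ?mulr_ge0 ?(ltW a0) ?subr_ge0.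
      rewrite powRM ?(ltW a0)// ler_wpM2r ?powR_ge0//.
      by rewrite -[leRHS](powRr1 (ler0n R 2)) ler_powR ?ler1n// gerBl ltW.
    have k2 : `|k%:R * F k.-1 z| <= C * H * (k%:R * a `^ (1 - w)).
      rewrite normrM normr_nat; apply: le_trans (ler_wpM2l (ler0n _ _) h2) _.
      have CH : 0 <= C * H by rewrite mulr_ge0// ltW.
      by rewrite [leLHS]mulrC; apply: (ler_wpM2l CH); rewrite ler_peMr.
    apply: le_trans (ler_normD _ _) _; apply: le_trans (lerD k1 k2) _.
    have CH : 0 <= C * H * (k%:R * a `^ (1 - w)) by rewrite !mulr_ge0 ?powR_ge0// ltW.
    rewrite (_ : 2 * C * _ * H * _ = C * H * (2 * a `^ (1 - w)) + C * H * (k%:R * a `^ (1 - w)) + C * H * (k%:R * a `^ (1 - w))); last by ring.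
    by rewrite lerDl.
  have [z hz e] : exists2 z, `|z| <= 2 * a & G x - G y = dG z * (x - y).
    have bz z : `|z - x| <= `|x - y| -> `|z| <= 2 * a.
      move=> zx; have xy1 : `|x - y| <= 1 by apply: le_trans xy; rewrite ler_peMr.
      have := ler_normD (z - x) x; rewrite subrK /a; have := normr_ge0 x; lra.
    have [yx|xy'] := leP y x.
      have [z /andP[z1 z2] e] := mvt yx hG; exists z => //; apply: bz.
      rewrite distrC ger0_norm ?subr_ge0// ger0_norm ?subr_ge0//.
      by rewrite lerD2l lerN2.
    have [z /andP[z1 z2] e] := mvt (ltW xy') hG; exists z; last by rewrite -opprB e -mulrN opprB.
    apply: bz; rewrite ger0_norm ?subr_ge0// ler0_norm ?subr_le0 ?(ltW xy')// opprB.
    by rewrite lerD2r.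
  have Kp : 0 <= 2 * C * (1 + k%:R) * H.
    exact: (mulr_ge0 (mulr_ge0 (mulr_ge0 (ler0n _ 2) (ltW C0)) (addr_ge0 ler01 (ler0n _ k))) H0).
  rewrite e normrM; have := bdG z hz => hb.
  have [->|xy0] := eqVneq x y; first by rewrite subrr normr0 mulr0; exact: (mulr_ge0 Kp (powR_ge0 _ _)).
  have d0 : 0 < `|x - y| by rewrite normr_gt0 subr_eq0.
  apply: le_trans (ler_wpM2r (ltW d0) hb) _; rewrite -[leLHS]mulrA.
  apply: (ler_wpM2l Kp).
  have -> : `|x - y| `^ w = `|x - y| `^ (w - 1) * `|x - y|.
    transitivity (`|x - y| `^ (w - 1) * `|x - y| `^ 1); last by rewrite powRr1.
    by rewrite -powRD ?(gt_eqF d0) ?implybT// subrK.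
  rewrite ler_wpM2r//.
  have ad : a <= `|x - y|^-1 by rewrite -[leRHS]mul1r ler_pdivlMr// mulrC.
  have -> : `|x - y| `^ (w - 1) = (`|x - y|^-1) `^ (1 - w).
    by rewrite -powR_inv1// -powRrM; congr (_ `^ _); ring.
  have w1' : 0 <= 1 - w by rewrite subr_ge0.
  have i0 : 0 <= `|x - y|^-1 by rewrite invr_ge0.
  exact: (ge0_ler_powR w1' (ltW a0) i0 ad).
have far x : forall y, 1 < `|x - y| * (1 + `|x|) -> `|F k x| <= C * H * `|x - y| `^ w.
  move=> y xy; have [h1 _] := hC F h nu H x H0 S hh; apply: le_trans h1 _.
  have CH : 0 <= C * H by rewrite mulr_ge0// ltW.
  have a0 : 0 < 1 + `|x| by rewrite ltr_wpDr.
  rewrite ler_wpM2l// powRN -[leLHS]mul1r ler_pdivrMr ?powR_gt0// -powRM ?(ltW a0)//.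
  have o : 1 `^ w = 1 :> R by rewrite powR1.
  rewrite -[leLHS]o; apply: ge0_ler_powR; rewrite ?nnegrE ?mulr_ge0 ?(ltW a0) ?(ltW w0)//.
  exact: ltW.
move=> x y; have wxy := powR_ge0 `|x - y| w.
have K0 : 0 <= 2 * C * H by rewrite !mulr_ge0// ltW.
have [h1|h1] := leP (`|x - y| * (1 + `|x|)) 1.
  apply: le_trans (near x y h1) _; rewrite ler_wpM2r// [leRHS]mulrDl lerDl.
  exact: K0.
have [h2|h2] := leP (`|y - x| * (1 + `|y|)) 1.
  rewrite distrC (distrC x y); apply: le_trans (near y x h2) _; rewrite ler_wpM2r ?powR_ge0// [leRHS]mulrDl lerDl.
  exact: K0.
apply: le_trans (ler_normB _ _) _; apply: le_trans (lerD (far x y h1) (far y x h2)) _.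
rewrite (distrC y x) -mulrDl ler_wpM2r// [leRHS]mulrDl (_ : C * H + C * H = 2 * C * H); last by ring.
rewrite lerDr.
exact: (mulr_ge0 (addr_ge0 (mulr_ge0 (mulr_ge0 (ler0n _ 2) (ltW C0)) (addr_ge0 ler01 (ler0n _ k))) ler01) H0).
Qed.

End stein_regularity.

(** * Gaussian expectations as Lebesgue integrals *)

Section gaussian.
Context {R : realType}.
Local Notation mu := (@lebesgue_measure R).
Local Notation gam := (normal_prob (0 : R) 1).
Local Notation pdf := (normal_pdf (0 : R) 1).

Definition gpeak : R := normal_peak (1 : R).

Lemma gpeak_gt0 : 0 < gpeak.
Proof. by apply: normal_peak_gt0; rewrite oner_eq0. Qed.

Lemma pdfE x : pdf x = gpeak * gphi x.
Proof.
rewrite /normal_pdf oner_eq0 /normal_fun /gpeak /gphi.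
by rewrite subr0 expr1n.
Qed.

Lemma integral_gauss (f : R -> R) : measurable_fun setT f -> (forall x, 0 <= f x) ->
  (\int[gam]_x (f x)%:E = \int[mu]_x (f x * pdf x)%:E)%E.
Proof.
move=> mf f0; have dom := normal_prob_dominates (0 : R) 1.
have mf' : measurable_fun setT (EFin \o f) by exact/measurable_EFinP.
have f0' x : (0 <= (EFin \o f) x)%E by rewrite lee_fin.
rewrite -(Radon_Nikodym_SigmaFinite.change_of_variables dom f0' measurableT mf').
have ipdf := @integrable_normal_pdf R 0 1.
have h : ae_eq mu setT (Radon_Nikodym_SigmaFinite.f gam mu) (EFin \o pdf).
  apply: integral_ae_eq => //.
  - exact: Radon_Nikodym_SigmaFinite.f_integrable.
  - exact: measurable_int ipdf.
  - by move=> A _ mA; rewrite -Radon_Nikodym_SigmaFinite.f_integral.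
apply: ae_eq_integral => //.
- apply: emeasurable_funM => //; apply: (measurable_int mu).
  exact: Radon_Nikodym_SigmaFinite.f_integrable.
- apply/measurable_EFinP; apply: measurable_funM => //; exact: measurable_normal_pdf.
- by apply: filterS h => x /[apply] /= ->; rewrite EFinM.
Qed.

Lemma integrable_gauss (f : R -> R) : measurable_fun setT f ->
  mu.-integrable setT (EFin \o (fun x => f x * gphi x)) -> itg gam f.
Proof.
move=> mf /integrableP[_ hi]; apply/integrableP; split; first exact/measurable_EFinP.
under eq_integral do rewrite /=.
rewrite (@integral_gauss (fun x => `|f x|))//; last exact: measurableT_comp.
rewrite [X in (X < _)%E](_ : _ = (\int[mu]_x (gpeak%:E * `|f x * gphi x|%:E))%E); last first.
  apply: eq_integral => x _; rewrite pdfE -EFinM; congr EFin.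
  by rewrite normrM (ger0_norm (ltW (gphi_gt0 x))) mulrCA.
rewrite ge0_integralZl_EFin ?(ltW gpeak_gt0)//.
  by apply: lte_mul_pinfty => //; rewrite ?lee_fin ?(ltW gpeak_gt0).
apply/measurable_EFinP; apply: measurableT_comp => //; apply: measurable_funM => //.
apply: continuous_measurable_fun => x; exact: isd_continuous (isd_gphi x).
Qed.

Lemma Ex_gauss (f : R -> R) : measurable_fun setT f ->
  mu.-integrable setT (EFin \o (fun x => f x * gphi x)) ->
  Ex gam f = gpeak * \int[mu]_x (f x * gphi x).
Proof.
move=> mf hi; have ig := integrable_gauss mf hi.
have pos (g : R -> R) : measurable_fun setT g -> (forall x, 0 <= g x) ->
    mu.-integrable setT (EFin \o (fun x => g x * gphi x)) -> Ex gam g = gpeak * \int[mu]_x (g x * gphi x).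
  move=> mg g0 ig'; rewrite -RintegralZl// /Ex /Rintegral integral_gauss//.
  by congr fine; apply: eq_integral => x _; rewrite pdfE mulrCA.
have pn (g : R -> R) x : g x = Num.max (g x) 0 - Num.max (- g x) 0.
  by case: (leP (g x) 0) => h; case: (leP (- g x) 0) => h'; lra.
pose fp x := Num.max (f x) 0; pose fn x := Num.max (- f x) 0.
have mp : measurable_fun setT fp by apply: measurable_maxr.
have mn : measurable_fun setT fn by apply: measurable_maxr => //; exact: measurableT_comp.
have p0 x : 0 <= fp x by rewrite le_max lexx orbT.
have n0 x : 0 <= fn x by rewrite le_max lexx orbT.
have mg : measurable_fun setT (@gphi R).
  apply: continuous_measurable_fun => x; exact: isd_continuous (isd_gphi x).
have dom (g : R -> R) : measurable_fun setT g -> (forall x, `|g x| <= `|f x|) ->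
    mu.-integrable setT (EFin \o (fun x => g x * gphi x)).
  move=> mg' h; apply: (le_integrable _ _ _ hi) => //.
    by apply/measurable_EFinP; apply: measurable_funM.
  move=> x _; rewrite lee_fin !normrM ler_wpM2r//; exact: h.
have bp x : `|fp x| <= `|f x| by rewrite (ger0_norm (p0 x)) /fp ge_max normr_ge0 ler_norm.
have bn x : `|fn x| <= `|f x| by rewrite (ger0_norm (n0 x)) /fn ge_max normr_ge0 -normrN ler_norm.
have ip := dom _ mp bp; have in' := dom _ mn bn.
have fE : f = fun x => fp x - fn x by apply/funext => x; exact: pn.
rewrite [in LHS]fE ExB; [|exact: integrable_gauss mp ip|exact: integrable_gauss mn in'].
rewrite (pos fp)// (pos fn)// -mulrBr -RintegralB//; congr (_ * _).
by apply: eq_Rintegral => x _; rewrite -mulrBl -pn.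
Qed.

(** The weight with a polynomial factor is dominated by the integrable density of standard deviation
    2; the constant [1/6] is the maximum of [t / 2 - 3 t^2 / 8], attained at [t = 2/3]. *)
Lemma gphi_wide (q : R) : 0 <= q -> exists2 C, 0 < C &
  forall y, (1 + `|y|) `^ q * gphi y <= C * normal_pdf 0 2 y.
Proof.
move=> q0; have [C C0 hC] := powR1D_exp q0.
have two : (2 : R) != 0 by rewrite pnatr_eq0.
have pk : 0 < normal_peak (2 : R) by exact: normal_peak_gt0.
exists (C * expR (6^-1) / normal_peak 2); first by rewrite divr_gt0// mulr_gt0// expR_gt0.
move=> y; rewrite /normal_pdf (negbTE two) /normal_fun mulrA divfK ?gt_eqF//.
apply: (@le_trans _ _ (C * expR (`|y| / 2) * gphi y)).
  by rewrite ler_wpM2r ?(ltW (gphi_gt0 y))//; exact: hC.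
rewrite -!mulrA ler_pM2l// /gphi -!expRD ler_expR subr0 -(real_normK (num_real y)).
have := sqr_ge0 (`|y| - 2 / 3); rewrite (_ : 2 ^+ 2 *+ 2 = 8); last by ring.
by move=> h; lra.
Qed.

Definition pbound (B q : R) (g : R -> R) := forall y, `|g y| <= B * (1 + `|y|) `^ q.

Lemma integrable_pbound B q (g : R -> R) : 0 <= q -> measurable_fun setT g -> pbound B q g ->
  mu.-integrable setT (EFin \o (fun x => g x * gphi x)).
Proof.
move=> q0 mg hg; have [C C0 hC] := gphi_wide q0.
have B0 : 0 <= B by have := hg 0; rewrite normr0 addr0 powR1 mulr1; apply: le_trans.
have hi : mu.-integrable setT (fun x => (B * C)%:E * (normal_pdf (0 : R) 2 x)%:E)%E.
  by apply: integrableZl => //; exact: integrable_normal_pdf.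
apply: (le_integrable _ _ _ hi) => //.
  apply/measurable_EFinP; apply: measurable_funM => //.
  apply: continuous_measurable_fun => x; exact: isd_continuous (isd_gphi x).
move=> x _ /=; rewrite lee_fin normrM (ger0_norm (ltW (gphi_gt0 x))).
apply: le_trans (ler_norm _); rewrite -mulrA.
apply: le_trans (ler_wpM2r (ltW (gphi_gt0 x)) (hg x)) _; rewrite -mulrA.
exact: (ler_wpM2l B0 (hC x)).
Qed.

Lemma itg_pbound B q (g : R -> R) : 0 <= q -> measurable_fun setT g -> pbound B q g -> itg gam g.
Proof. by move=> q0 mg hg; apply: integrable_gauss mg (integrable_pbound q0 mg hg). Qed.

Definition gprim (g : R -> R) x : R := \int[mu]_(w in `]-oo, x]) (g w * gphi w).

Lemma isd_gprim B q g x : 0 <= q -> continuous g -> pbound B q g -> isd (gprim g) x (g x * gphi x).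
Proof.
move=> q0 cg hg; have mg := continuous_measurable_fun cg.
have hi := integrable_pbound q0 mg hg.
have hi' : mu.-integrable `]-oo, (x + 1)%R] (EFin \o (fun x => g x * gphi x)).
  by apply: integrableS hi.
have x1 : x < x + 1 by rewrite ltrDl.
have cx : {for x, continuous (fun x => g x * gphi x)}.
  by apply: continuousM; [exact: cg|exact: isd_continuous (isd_gphi x)].
have [|d1 d2] := continuous_FTC1 x1 hi' _ cx; first exact: ltNyr.
apply: DeriveDef; [exact: d1|rewrite -derive1E; exact: d2].
Qed.

(** One additional power of [1 + |x|], which is at least [M] on [D], is spent on the factor
    [1 / M]. *)
Lemma gtail B q : 0 <= q -> 0 <= B -> exists2 C, 0 <= C & forall g (D : set (measurableTypeR R)) M, measurable D -> measurable_fun setT g -> pbound B q g ->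
  0 < M -> (forall y, D y -> M <= `|y|) -> `|\int[mu]_(w in D) (g w * gphi w)| <= C / M.
Proof.
move=> q0 B0; have [|C C0 hC] := @gphi_wide (q + 1); first by rewrite addr_ge0.
exists (B * C); first by rewrite mulr_ge0// ltW.
move=> g D M mD mg hg M0 DM.
have hi := integrable_pbound q0 mg hg.
have hiD : mu.-integrable D (EFin \o (fun x => g x * gphi x)) by apply: integrableS hi.
have hn := le_normr_Rintegral mD hiD; apply: le_trans hn _.
have hp : mu.-integrable setT (fun x => (B * C / M)%:E * (normal_pdf (0 : R) 2 x)%:E)%E.
  by apply: integrableZl => //; exact: integrable_normal_pdf.
rewrite -lee_fin /Rintegral fineK; last first.
  apply: integrable_fin_num => //; exact: integrable_abse hiD.
apply: (@le_trans _ _ (\int[mu]_(x in D) ((B * C / M)%:E * (normal_pdf (0 : R) 2 x)%:E))%E).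
  apply: ge0_le_integral => //.
  - by apply: (measurable_int mu); exact: integrable_abse hiD.
  - by apply: (measurable_int mu); apply: integrableS hp.
  move=> x Dx; rewrite -EFinM lee_fin.
  have xM := DM x Dx; have g0 := ltW (gphi_gt0 x).
  rewrite normrM (ger0_norm g0) (mulrAC _ M^-1) ler_pdivlMr//.
  apply: (@le_trans _ _ (B * ((1 + `|x|) `^ (q + 1) * gphi x))); last first.
    by rewrite -mulrA; apply: (ler_wpM2l B0 (hC x)).
  have a0 : 0 < 1 + `|x| by rewrite ltr_wpDr.
  rewrite powRD ?(gt_eqF a0) ?implybT// powRr1 ?(ltW a0)//.
  rewrite (_ : B * _ = B * (1 + `|x|) `^ q * gphi x * (1 + `|x|)); last by ring.
  apply: ler_pM; [by rewrite mulr_ge0|exact: ltW|by apply: ler_wpM2r|].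
  by apply: le_trans xM _; rewrite lerDr.
apply: (@le_trans _ _ (\int[mu]_x ((B * C / M)%:E * (normal_pdf (0 : R) 2 x)%:E))%E).
  apply: ge0_subset_integral => //.
    exact: measurable_int hp.
  move=> x _; rewrite -EFinM lee_fin.
  exact: (mulr_ge0 (divr_ge0 (mulr_ge0 B0 (ltW C0)) (ltW M0)) (normal_pdf_ge0 _ _ _)).
rewrite integralZl//; last exact: integrable_normal_pdf.
by rewrite integral_normal_pdf mule1.
Qed.

Lemma van_inv (u : R -> R) C : 0 <= C -> (forall y, y < 0 -> `|u y| <= C / - y) -> van u.
Proof.
move=> C0 h e e0; exists (- (C / e + 1)) => y hy.
have k0 : 0 <= C / e by rewrite divr_ge0// ltW.
have y0 : C / e + 1 <= - y by rewrite lerNr.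
have y1 : 0 < - y by apply: lt_le_trans y0; rewrite ltr_wpDl.
apply: le_trans (h y _) _; first by rewrite -oppr_gt0.
rewrite ler_pdivrMr// -ler_pdivrMl// mulrC.
by apply: le_trans y0; rewrite lerDl.
Qed.

Lemma van_gprim B q g : 0 <= q -> continuous g -> pbound B q g -> van (gprim g).
Proof.
move=> q0 cg hg; have mg := continuous_measurable_fun cg.
have B0 : 0 <= B by have := hg 0; rewrite normr0 addr0 powR1 mulr1; apply: le_trans.
have [C C0 hC] := gtail q0 B0; apply: (van_inv C0) => y y0.
apply: hC => //; first by rewrite oppr_gt0.
by move=> z /=; rewrite in_itv/= => zy; rewrite ler0_norm ?lerN2// (le_trans zy) ?ltW.
Qed.

(** [Ex gam g / gpeak] is the integral over the whole line, so the difference is minus the right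
    tail. *)
Lemma van_gprimN B q g : 0 <= q -> continuous g -> pbound B q g ->
  van (fun y => gprim g (- y) - Ex gam g / gpeak).
Proof.
move=> q0 cg hg; have mg := continuous_measurable_fun cg.
have hi := integrable_pbound q0 mg hg.
have B0 : 0 <= B by have := hg 0; rewrite normr0 addr0 powR1 mulr1; apply: le_trans.
have [C C0 hC] := gtail q0 B0; apply: (van_inv C0) => y y0.
rewrite Ex_gauss// mulrAC divff ?gt_eqF ?gpeak_gt0// mul1r.
have e1 : \int[mu]_x (g x * gphi x) = gprim g (- y) + \int[mu]_(x in `]- y, +oo[) (g x * gphi x).
  rewrite /gprim -Rintegral_setU//=.
  - by congr (Rintegral mu _ _); rewrite -[LHS]set_itvNyy -itv_bndbnd_setU//= bnd_simp.
  - by apply: integrableS hi => //; exact: measurableU.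
  - apply/disj_setPS => z /= []; rewrite !in_itv/= andbT => h1 h2.
    by move: (le_lt_trans h1 h2); rewrite ltxx.
rewrite e1 opprD addrA subrr sub0r normrN.
apply: hC => //; first by rewrite oppr_gt0.
by move=> z /=; rewrite in_itv/= andbT => zy; apply: le_trans (ltW zy) (ler_norm _).
Qed.

Lemma isd0_const (u : R -> R) : (forall y, isd u y 0) -> forall x y, u x = u y.
Proof.
move=> h x y; wlog xy : x y / x <= y => [hw|].
  by case: (leP x y) => [/hw//|/ltW /hw].
by have [c _ e] := mvt xy h; apply/esym/eqP; rewrite -subr_eq0 e mul0r.
Qed.

Lemma van_const (c : R) : van (fun=> c) -> c = 0.
Proof.
move=> h; apply/eqP; rewrite -normr_le0; apply/ler_addgt0Pr => e e0; rewrite add0r.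
by have [A hA] := h e e0; exact: hA (lexx A).
Qed.

(** [u] and [gprim v] are primitives of one function and vanish at minus infinity, so they coincide;
    vanishing at plus infinity then says that the total integral is zero. *)
Lemma gauss_ibp B q (u v : R -> R) : 0 <= q -> continuous v -> pbound B q v ->
  (forall y, isd u y (v y * gphi y)) -> van u -> van (fun y => u (- y)) -> Ex gam v = 0.
Proof.
move=> q0 cv hv du vu vuN.
have dz y : isd (fun y => u y - gprim v y) y 0.
  by apply: isd_eq (isdB (du y) (isd_gprim y q0 cv hv)) _; rewrite subrr.
have zc : forall y, u y - gprim v y = 0.
  move=> y; have := isd0_const dz y 0 => e.
  have : van (fun=> u 0 - gprim v 0).
    have := vanB vu (van_gprim q0 cv hv); congr van; apply/funext => z.
    exact: isd0_const dz z 0.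
  by move/van_const; rewrite -e.
have : van (fun=> Ex gam v / gpeak).
  have := vanB vuN (van_gprimN q0 cv hv); congr van; apply/funext => z.
  have -> : u (- z) = gprim v (- z) by apply/eqP; rewrite -subr_eq0 zc.
  by rewrite opprB addrC subrK.
by move/van_const/eqP; rewrite mulf_eq0 invr_eq0 (gt_eqF gpeak_gt0) orbF => /eqP.
Qed.

End gaussian.

(** * Regularity of the solution operator [Theta] *)

Section theta.
Context {R : realType}.
Local Notation gam := (normal_prob (0 : R) 1).
Implicit Types (g h : R -> R) (w H : R).

Definition dseq g : nat -> R -> R := fun j => derive1n j g.

Lemma dseq_eq m (F : nat -> R -> R) : (forall j x, (j < m)%N -> isd (F j) x (F j.+1 x)) ->
  forall j, (j <= m)%N -> dseq (F 0%N) j = F j.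
Proof.
move=> h; elim=> // j IH jm; rewrite /dseq derive1nS -/(dseq (F 0%N) j) IH ?(ltnW jm)//.
by apply/funext => x; rewrite derive1E; have [] := h j x jm.
Qed.

Lemma smooth_dseq m w H F : smooth m w H F -> smooth m w H (dseq (F 0%N)).
Proof.
move=> [h1 h2]; have e := dseq_eq h1; split => [j x jm|x y]; last by rewrite e.
by rewrite !e// ?(ltnW jm)//; exact: h1.
Qed.

Lemma dseq_shift q g j : dseq g (q + j)%N = dseq (dseq g q) j.
Proof. by rewrite /dseq /derive1n addnC iterD. Qed.

Lemma Lambda_smooth (p : R) h : Lambda p h -> smooth (ceiln p).-1 (hoelder_exp p) 1 (dseq h).
Proof.
move=> [[[h1 h2] _] h3]; split => [j x jk|x y].
  apply: DeriveDef; first exact: h1.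
  by rewrite /dseq derive1nS derive1E.
have [->|xy] := eqVneq x y; first by rewrite subrr normr0 mul1r powR_ge0.
have d0 : 0 < `|x - y| by rewrite normr_gt0 subr_eq0.
have := ereal_sup_ubound (S := [set (`|derive1n (ceiln p).-1 h z.1 - derive1n (ceiln p).-1 h z.2| / `|z.1 - z.2| `^ hoelder_exp p)%:E |
              z in [set z : R * R | z.1 != z.2]]) (ex_intro2 _ _ (x, y) xy erefl).
by move=> /le_trans -/(_ _ h3); rewrite lee_fin ler_pdivrMr ?powR_gt0.
Qed.

Lemma pbound_mono B B' q q' g : B <= B' -> q <= q' -> pbound B q g -> pbound B' q' g.
Proof.
move=> BB qq h y; apply: le_trans (h y) _; have a1 : 1 <= 1 + `|y| by rewrite lerDl.
have B0 : 0 <= B by have := h 0; rewrite normr0 addr0 powR1 mulr1; apply: le_trans.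
by apply: ler_pM; rewrite ?powR_ge0// ler_powR.
Qed.

Lemma smooth_pbound m w H F : 0 < w -> smooth m w H F -> exists2 B, 0 <= B & pbound B (m%:R + w) (F 0%N).
Proof.
move=> w0 hF; have H0 : 0 <= H by have := proj2 hF 1 0; rewrite subr0 normr1 powR1 mulr1; apply: le_trans.
exists (\sum_(q < m.+1) `|F q 0| + H); first by rewrite addr_ge0// sumr_ge0.
move=> y; have a1 : 1 <= 1 + `|y| by rewrite lerDl.
have a0 : 0 < 1 + `|y| by apply: lt_le_trans a1.
have := taylor_bound w0 hF 0 y; rewrite add0r => h.
rewrite mulrDl -[F 0%N y](subrK (taylor m F 0 y)) addrC.
apply: le_trans (ler_normD _ _) _; apply: lerD.
  rewrite /taylor mulr_suml; apply: le_trans (ler_norm_sum _ _ _) _; apply: ler_sum => -[q qm] _ /=.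
  rewrite ltnS in qm; rewrite !normrM -mulrA ler_wpM2l//.
  apply: (@le_trans _ _ (`|y ^+ q| * 1)).
    rewrite ler_wpM2l// normfV normr_nat invf_le1 ?ltr0n ?fact_gt0// ler1n fact_gt0.
    by [].
  rewrite mulr1 normrX; apply: (@le_trans _ _ ((1 + `|y|) ^+ q)).
    by apply: lerXn2r; rewrite ?nnegrE ?(ltW a0)// lerDr.
  rewrite -powR_mulrn ?(ltW a0)// ler_powR//; apply: ler_wpDr; first exact: ltW.
  by rewrite ler_nat.
apply: le_trans h _; rewrite ler_wpM2l//.
have q0 : 0 <= m%:R + w by rewrite addr_ge0// ltW.
by apply: ge0_ler_powR; rewrite ?nnegrE ?(ltW a0)// lerDr.
Qed.

(** The derivatives as Stein's equation prescribes them, available before [f] is known to be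
    differentiable. *)
Fixpoint steinF h (nu : R) f j (y : R) : R :=
  if j is j1.+1 then
    if j1 is j2.+1 then y * steinF h nu f j1 y + j1%:R * steinF h nu f j2 y + dseq h j1 y
    else y * f y + h y - nu
  else f y.

Lemma stein_sys_Theta k w H h : 0 < w -> smooth k w H (dseq h) ->
  stein_sys k.+1 (steinF h (gaussE h) (Theta h)) (dseq h) (gaussE h).
Proof.
move=> w0 hh; have [B B0 hB] := smooth_pbound w0 hh.
have q0 : 0 <= k%:R + w by rewrite addr_ge0// ltW.
have ch : continuous h := smooth_continuous w0 hh (leq0n k).
have mh := continuous_measurable_fun ch.
set nu := gaussE h; pose g x := h x - nu.
have cg : continuous g by move=> x; apply: cvgB; [exact: ch|exact: cvg_cst].
have hg : pbound (B + `|nu|) (k%:R + w) g.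
  move=> y; rewrite mulrDl; apply: le_trans (ler_normB _ _) _; apply: lerD; first exact: hB.
  rewrite ler_peMr// -[leLHS](powRr0 (1 + `|y|)) ler_powR// lerDl.
  by [].
have ig := itg_pbound q0 mh hB.
have Eg : Ex gam g = 0 by rewrite /g ExB// ?Ex_cst ?subrr//; exact: itg_cst.
have TE x : Theta h x = expR (x ^+ 2 / 2) * gprim g x by [].
have Tg x : Theta h x * gphi x = gprim g x.
  by rewrite TE /gphi mulrAC -expRD mulNr subrr expR0 mul1r.
have e2 (x : R) : isd (fun z => expR (z ^+ 2 / 2)) x (x * expR (x ^+ 2 / 2)).
  have h2 : isd (fun z => z ^+ 2 / 2) x x.
    rewrite (_ : (fun z => _) = fun z => 2^-1 * z ^+ 2); last by apply/funext => z; field.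
    by apply: isd_eq (isdZ _ (isdX 2 x)) _ => /=; field.
  by apply: isd_eq (isd_comp (isd_exp _) h2) _; rewrite mulrC.
split => //.
- move=> y /=; rewrite (_ : Theta h = fun x => expR (x ^+ 2 / 2) * gprim g x); last by apply/funext.
  apply: isd_eq (isdM (e2 y) (isd_gprim y q0 cg hg)) _.
  rewrite /gphi mulNr (_ : expR (y ^+ 2 / 2) * (g y * _) = g y * (expR (y ^+ 2 / 2) * expR (- (y ^+ 2 / 2)))); last by ring.
  by rewrite -expRD subrr expR0 mulr1 /g; ring.
- have := van_gprim q0 cg hg; congr van; apply/funext => y; rewrite -Tg.
  by [].
(* The centring by [gaussE h] enters here: [g] has total integral 0, so its primitive also vanishes
   at plus infinity. *)
- have := van_gprimN q0 cg hg; rewrite Eg mul0r; congr van; apply/funext => y.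
  by rewrite subr0 -Tg gphiN.
Qed.

Lemma theta_regular k w : 0 < w <= 1 -> exists2 C, 0 < C & forall H h, 0 <= H ->
  smooth k w H (dseq h) ->
  smooth k.+1 w (C * H) (dseq (Theta h)) /\
  (forall x, dseq (Theta h) 1%N x = x * Theta h x + h x - gaussE h).
Proof.
move=> w01; have /andP[w0 w1] := w01.
have one : pbound 1 0 (fun=> 1 : R) by move=> y; rewrite powRr0 normr1 mulr1.
have c1 : continuous ((fun _ => 1) : R -> R) by move=> x; exact: cvg_cst.
have dP (y : R) : isd (gprim (fun _ : R => 1)) y (gphi y).
  by apply: isd_eq (isd_gprim y (lexx _) c1 one) _; rewrite mul1r.
have [C C0 hC] := stein_regular dP (van_gprim (lexx _) c1 one) (ltn0Sn k) w01.
exists C => // H h H0 hh; have S := stein_sys_Theta w0 hh.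
have hF := hC _ _ _ _ H0 S hh; split; first exact: smooth_dseq hF.
move=> x; have := dseq_eq (proj1 hF) (ltn0Sn k) => /= ->.
by [].
Qed.

Lemma theta_step k w : 0 < w <= 1 -> exists2 C, 0 < C & forall s H h, (s <= k)%N -> 0 <= H ->
  smooth k w H (dseq h) -> smooth (k - s) w (C * H) (dseq (dseq (Theta h) s.+1)).
Proof.
move=> w01; have [C C0 hC] := theta_regular k w01; exists C => // s H h sk H0 hh.
have [h1 _] := hC H h H0 hh; have := smooth_shift (sk : (s.+1 <= k.+1)%N) h1.
rewrite subSS; congr smooth; apply/funext => j; rewrite /shiftn -dseq_shift.
by [].
Qed.

End theta.

(** * The expansion by recursion over [Gamma] *)

Section expansion_terms.
Context {R : realType}.

(* Enumerates [Gamma q]; [n >= q] is fuel. The last entry of a sequence is the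
   index of the innermost operator. *)
Fixpoint gams (n q : nat) : seq (seq nat) :=
  if n is n1.+1 then
    flatten [seq [seq rcons t s.+1 | t <- [::] :: gams n1 (q - s.+1)] | s <- iota 0 q]
  else [::].

Lemma mem_gams n q t : (q <= n)%N -> (t \in gams n q) = [&& (0 < size t)%N, all (fun j => 0 < j)%N t & (sumn t <= q)%N].
Proof.
elim: n q t => [|n IH] q t; first by rewrite leqn0 => /eqP ->; case: t => //= -[|a] t; rewrite ?andbF//= addSn.
move=> qn; apply/flattenP/idP => [[_ /mapP[s + ->]]|].
  rewrite mem_iota add0n => /andP[_ sq] /mapP[t' ht ->].
  rewrite size_rcons all_rcons sumn_rcons /=.
  move: ht; rewrite in_cons => /predU1P[->|] /=; first by rewrite add0n.
  rewrite IH; last by lia.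
  by move=> /and3P[_ -> ht] /=; lia.
case/lastP: t => // t [|s]; first by rewrite all_rcons andbF.
rewrite size_rcons all_rcons sumn_rcons /= => /andP[ht st].
exists [seq rcons t s.+1 | t <- [::] :: gams n (q - s.+1)].
  by apply/mapP; exists s => //; rewrite mem_iota /=; lia.
apply: (map_f (fun t => rcons t s.+1)); rewrite in_cons; case: (t =P [::]) => //= /eqP tn.
rewrite IH; last by lia.
by rewrite ht lt0n size_eq0 tn /=; lia.
Qed.

Lemma uniq_flatten_map (A B : eqType) (f : A -> seq B) r : uniq r -> (forall s, uniq (f s)) ->
  (forall s s' t, t \in f s -> t \in f s' -> s = s') -> uniq (flatten (map f r)).
Proof.
move=> + uf dis; elim: r => // s r IH /= /andP[sr ur].
rewrite cat_uniq uf IH// andbT /=; apply/hasPn => t /flattenP[_ /mapP[i ir ->]] ti.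
by apply/negP => ts; rewrite (dis _ _ _ ts ti) ir in sr.
Qed.

Lemma uniq_gams n q : uniq (gams n q).
Proof.
elim: n q => // n IH q; apply: uniq_flatten_map; first exact: iota_uniq.
  move=> s; rewrite map_inj_uniq; last by move=> x y /rcons_inj[].
  rewrite cons_uniq IH andbT; case: n {IH} => // n.
  apply/negP => /flattenP[_ /mapP[i _ ->]].
  by case/mapP => t _ /(congr1 size); rewrite size_rcons.
by move=> s s' t /mapP[t' _ ->] /mapP[t'' _ /rcons_inj[_ ->]].
Qed.

Lemma Gamma_gams q : Gamma q = [set` gams q q].
Proof.
apply/seteqP; split => t /=; rewrite mem_gams//.
  by move=> [-> -> ->].
by move=> /and3P[].
Qed.

Lemma big_gams n q (F : seq nat -> R) :
  \sum_(t <- gams n.+1 q) F t =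
  \sum_(s < q) (F [:: s.+1] + \sum_(t <- gams n (q - s.+1)) F (rcons t s.+1)).
Proof.
rewrite /= big_flatten big_map -[in RHS](big_mkord xpredT (fun s => F [:: s.+1] + \sum_(t <- gams n (q - s.+1)) F (rcons t s.+1))).
rewrite /index_iota subn0; apply: eq_bigr => s _.
by rewrite big_cons big_map.
Qed.

Lemma gams_fuel n n' q : (q <= n)%N -> (q <= n')%N -> forall F : seq nat -> R,
  \sum_(t <- gams n q) F t = \sum_(t <- gams n' q) F t.
Proof.
move=> qn qn' F; apply: perm_big; apply: uniq_perm; rewrite ?uniq_gams// => t.
by rewrite !mem_gams.
Qed.

Definition gterm (kap : nat -> R) (h : R -> R) (t : seq nat) : R :=
  (-1) ^+ size t * (\prod_(j <- t) kap j) * gaussE (Stein_iter t h).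

Lemma gterm_rcons kap h t s :
  gterm kap h (rcons t s) = - kap s * gterm kap (dseq (Theta h) s.+1) t.
Proof.
rewrite /gterm size_rcons exprS -cats1 big_cat big_seq1 /Stein_iter cats1 foldr_rcons /=.
by ring.
Qed.

Definition gexp kap k h : R := \sum_(t <- gams k k) gterm kap h t.

(** Splitting off the innermost operator, the last entry of a sequence, matches the Stein recursion,
    which first replaces [h] by a derivative of [Theta h]. *)
Lemma gexp_rec kap k h : gexp kap k h =
  - \sum_(s < k) kap s.+1 * (gaussE (dseq (Theta h) s.+2) + gexp kap (k - s.+1) (dseq (Theta h) s.+2)).
Proof.
case: k => [|k]; first by rewrite /gexp big_nil big_ord0 oppr0.
rewrite /gexp big_gams -sumrN; apply: eq_bigr => -[s sk] _ /=.
rewrite mulrDr opprD; congr (_ + _).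
  by rewrite /gterm /= expr1 big_seq1 mulN1r !mulNr.
rewrite mulr_sumr -sumrN (gams_fuel (n' := k.+1 - s.+1)); [|by lia|by []].
by apply: eq_bigr => t _; rewrite gterm_rcons mulNr.
Qed.

Lemma expansion_gexp {d} {Om : measurableType d} (P : probability Om R) (W : {RV P >-> R}) p h :
  expansion W p h = gexp (fun j => cumulant W j.+2 / (j.+1)`!%:R) (ceiln p).-1 h.
Proof. by rewrite /expansion Gamma_gams -fsbig_seq// uniq_gams. Qed.

End expansion_terms.

Section expansion.
Context {R : realType}.

Lemma powR1D_le (a q : R) : 0 <= a -> 0 <= q -> (1 + a) `^ q <= 2 `^ q * (1 + a `^ q).
Proof.
move=> a0 q0; have [a1|/ltW a1] := leP a 1.
  apply: (@le_trans _ _ (2 `^ q)); last by rewrite ler_peMr ?powR_ge0// lerDl powR_ge0.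
  by apply: ge0_ler_powR; rewrite ?nnegrE ?addr_ge0//; lra.
apply: (@le_trans _ _ ((2 * a) `^ q)).
  by apply: ge0_ler_powR; rewrite ?nnegrE ?addr_ge0 ?mulr_ge0//; lra.
by rewrite powRM// ler_wpM2l ?powR_ge0// lerDr.
Qed.

Lemma itg_comp_pbound {d} {Om : measurableType d} (P : probability Om R) (W : Om -> R) rho c B q g :
  0 < rho -> mb P rho c W -> 0 < q -> q * rho <= 1 -> measurable_fun setT g -> pbound B q g ->
  itg P (fun x => g (W x)).
Proof.
move=> r0 hW q0 qr mg hg; have [mW _ _] := hW.
have hq := mb_powR q0 (ltW r0) hW.
have iq : itg P (fun x => `|W x| `^ q) by apply: mb_itg hq; rewrite mulr_gt0//= mulrC.
have B0 : 0 <= B by have := hg 0; rewrite normr0 addr0 powR1 mulr1; apply: le_trans.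
apply: (@itg_le0 _ _ _ _ _ (fun x => B * 2 `^ q * (1 + `|W x| `^ q))).
- exact: measurableT_comp.
- move=> x; apply: le_trans (hg _) _; rewrite -mulrA ler_wpM2l//.
  by apply: powR1D_le => //; exact: ltW.
- by apply: itgZ; apply: itgD => //; exact: itg_cst.
Qed.

Lemma cum1 (mu : nat -> R) : mu 0%N = 1 -> cum mu 1 = mu 1%N.
Proof. by move=> m0; rewrite (cum_rec 0 m0) big_ord1/= bin0 mul1r m0 mulr1. Qed.

Lemma cum2 (mu : nat -> R) : mu 0%N = 1 -> mu 1%N = 0 -> cum mu 2 = mu 2%N.
Proof.
move=> m0 m1; rewrite (cum_rec 1 m0) !big_ord_recl big_ord0 /bump/= subn0 m1 mulr0 add0r addr0.
by rewrite binn mul1r subnn m0 mulr1.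
Qed.

Section one.
Context {d} {Om : measurableType d} (P : probability Om R) (W : Om -> R) (k0 : nat) (w K eps : R).
Hypothesis G : stein_good P W k0 w K eps.
Hypothesis w01 : 0 < w <= 1.
Let w0 : 0 < w. Proof. by case/andP: w01. Qed.

Definition wmom (j : nat) : R := Ex P (fun x => W x ^+ j).
Definition wkap (j : nat) : R := cum wmom j.+2 / (j.+1)`!%:R.

Lemma wmom0 : wmom 0 = 1.
Proof. by rewrite /wmom -[RHS](Ex_cst P 1); congr Ex; apply/funext => x; rewrite expr0. Qed.

Lemma wmom1 : wmom 1 = 0.
Proof. by rewrite -(sg_mom1 G); congr Ex; apply/funext => x; rewrite expr1. Qed.

Lemma good_itg B q g : 0 < q <= k0.+1%:R + w -> measurable_fun setT g -> pbound B q g ->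
  itg P (fun x => g (W x)).
Proof.
move=> /andP[q0 qk] mg hg; have [rho [c [r0 rk hW]]] := sg_mb G.
apply: (itg_comp_pbound r0 hW q0 _ mg hg); apply: le_trans (ltW rk).
by rewrite ler_wpM2r// ltW.
Qed.

Lemma wkap_bound s : (0 < s < k0)%N -> `|wkap s| <= K * eps `^ s%:R.
Proof.
move=> sk; rewrite /wkap normrM normfV normr_nat; apply: le_trans (sg_cum G sk).
have f1 : 1 <= (s.+1)`!%:R :> R by rewrite ler1n fact_gt0.
have f0 : 0 < (s.+1)`!%:R :> R by apply: lt_le_trans f1.
by rewrite ler_pdivrMr// ler_peMr.
Qed.

(** The approximation is applied to [Theta g]. First cumulant 0 and second cumulant 1 leave Stein's
    operator, whose expectation is minus [E[g(W)] - gaussE g]; the higher cumulants form the sum. *)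
Lemma stein_expect k (C H : R) g : (0 < k <= k0)%N -> 0 < C * H ->
  smooth k.-1 w H (dseq g) -> smooth k w (C * H) (dseq (Theta g)) ->
  (forall x, dseq (Theta g) 1%N x = x * Theta g x + g x - gaussE g) ->
  `|Ex P (fun x => g (W x)) - gaussE g +
    \sum_(s < k.-1) wkap s.+1 * Ex P (fun x => dseq (Theta g) s.+2 (W x))|
  <= C * H * (K * eps `^ (k.-1%:R + w)).
Proof.
move=> /andP[kp kk] CH hg hF hE; have kS : k.-1.+1 = k by rewrite prednK.
have := sg_approx G (introT andP (conj kp kk)) CH hF.
have kR : (k%:R : R) <= k0%:R by rewrite ler_nat.
have kR1 : (k.-1%:R : R) <= k%:R by rewrite ler_nat leq_pred.
have [Bg Bg0 hBg] := smooth_pbound w0 hg; have [BF BF0 hBF] := smooth_pbound w0 hF.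
have mg : measurable_fun setT g := smooth_measurable w0 hg (leq0n _).
have mF : measurable_fun setT (Theta g) := smooth_measurable w0 hF (leq0n _).
have ig : itg P (fun x => g (W x)).
  apply: good_itg mg hBg; rewrite ltr_wpDl//= -natr1 lerD2r.
  by apply: le_trans kR1 (le_trans kR _); rewrite lerDl.
have iWF : itg P (fun x => W x * Theta g (W x)).
  apply: (@good_itg BF (k%:R + w + 1) (fun y => y * Theta g y)).
  - by rewrite addr_gt0 ?ltr_wpDl//= -natr1 addrAC lerD2r lerD2r.
  - exact: measurable_funM.
  - move=> y; have a0 : 0 < 1 + `|y| by rewrite ltr_wpDr.
    rewrite normrM mulrC powRD ?(gt_eqF a0) ?implybT// powRr1 ?(ltW a0)// mulrA.
    by apply: ler_pM => //; [exact: hBF|rewrite lerDr].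
have iF1 : itg P (fun x => dseq (Theta g) 1%N (W x)).
  rewrite (_ : (fun x => _) = fun x => (W x * Theta g (W x) + g (W x)) - gaussE g).
    by apply: itgB; [exact: itgD|exact: itg_cst].
  by apply/funext => x; rewrite hE.
have E1 : Ex P (fun x => dseq (Theta g) 1%N (W x)) =
    Ex P (fun x => W x * Theta g (W x)) + Ex P (fun x => g (W x)) - gaussE g.
  rewrite (_ : (fun x => _) = fun x => (W x * Theta g (W x) + g (W x)) - gaussE g); last first.
    by apply/funext => x; rewrite hE.
  by rewrite ExB ?ExD ?Ex_cst//; [exact: itgD|exact: itg_cst].
have spl (F : nat -> R) : \sum_(i < k.+1) F i = F 0%N + (F 1%N + \sum_(s < k.-1) F s.+2).
  by case: (k) kp => // k' _; rewrite !big_ord_recl/=; congr (_ + (_ + _)); apply: eq_bigr.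
rewrite (spl (fun i => cum wmom i.+1 / i`!%:R * Ex P (fun x => dseq (Theta g) i (W x)))).
rewrite cum1 ?wmom0// wmom1 !mul0r add0r.
rewrite cum2 ?wmom0 ?wmom1// (_ : wmom 2 = 1); last exact: (sg_mom2 G).
rewrite (_ : 1`!%:R = 1 :> R)// divr1 mul1r.
rewrite E1 -normrN.
congr (`|_| <= _); rewrite /dseq/=; rewrite /wkap; ring.
Qed.

End one.

(** The function in the correction with index [s] is [s + 1] orders less smooth than [h], so the
    induction hypothesis loses [eps^(s+1)]; the cumulant in front restores exactly this power. *)
Lemma expect_expansion (w K : R) : 0 < w <= 1 -> 0 <= K -> forall k, (0 < k)%N -> exists2 C, 0 <= C &
  forall d (Om : measurableType d) (P : probability Om R) (W : Om -> R) k0 eps,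
    (k <= k0)%N -> 0 < eps -> stein_good P W k0 w K eps ->
  forall H h, 0 < H -> smooth k.-1 w H (dseq h) ->
  `|Ex P (fun x => h (W x)) - gaussE h - gexp (wkap P W) k.-1 h| <= C * H * eps `^ (k.-1%:R + w).
Proof.
move=> w01 K0; elim/ltn_ind => k IH kp.
have w0 : 0 < w by case/andP: w01.
pose Q j C := (0 < j < k)%N -> forall d (Om : measurableType d) (P : probability Om R) (W : Om -> R) k0 eps,
    (j <= k0)%N -> 0 < eps -> stein_good P W k0 w K eps ->
  forall H h, 0 < H -> smooth j.-1 w H (dseq h) ->
  `|Ex P (fun x => h (W x)) - gaussE h - gexp (wkap P W) j.-1 h| <= C * H * eps `^ (j.-1%:R + w).
have [||C0 C00 hC0] := @uniform_bound _ Q k.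
- move=> j C C' CC h jk d Om P W k0 eps jk0 e0 G H g H0 hg.
  apply: le_trans (h jk _ _ _ _ _ _ jk0 e0 G H g H0 hg) _.
  by rewrite -!mulrA ler_wpM2r// mulr_ge0 ?powR_ge0// ltW.
- move=> j; case: (boolP (0 < j < k)%N) => jk; last by exists 0 => //; rewrite /Q (negbTE jk).
  by have /andP[j0 jk'] := jk; have [C CC hC] := IH j jk' j0; exists C => // _; exact: hC.
have [C1 C10 hC1] := theta_regular k.-1 w01; have [C2 C20 hC2] := theta_step k.-1 w01.
exists (C1 * K + \sum_(s < k.-1) K * (C0 * C2)).
  rewrite addr_ge0 ?mulr_ge0 ?(ltW C10)// sumr_ge0// => i _.
  exact: (mulr_ge0 K0 (mulr_ge0 C00 (ltW C20))).
move=> d Om P W k0 eps kk e0 G H h H0 hh.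
have kS : k.-1.+1 = k by rewrite prednK.
have [hF hE] := hC1 H h (ltW H0) hh; rewrite kS in hF.
have h1 := stein_expect G w01 (introT andP (conj kp kk)) (mulr_gt0 C10 H0) hh hF hE.
pose D s := dseq (Theta h) s.+2.
rewrite gexp_rec.
rewrite (_ : _ - - _ = (Ex P (fun x => h (W x)) - gaussE h + \sum_(s < k.-1) wkap P W s.+1 * Ex P (fun x => D s (W x)))
   - \sum_(s < k.-1) wkap P W s.+1 * (Ex P (fun x => D s (W x)) - gaussE (D s) - gexp (wkap P W) (k.-1 - s.+1) (D s))); last first.
  rewrite opprK -[RHS]addrA -sumrB; congr (_ + _); apply: eq_bigr => s _.
  by rewrite /D; ring.
apply: le_trans (ler_normB _ _) _; rewrite 2!mulrDl; apply: lerD.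
  by apply: le_trans h1 _; rewrite (_ : C1 * H * _ = C1 * K * H * eps `^ (k.-1%:R + w)); [|ring].
rewrite !mulr_suml; apply: le_trans (ler_norm_sum _ _ _) _; apply: ler_sum => -[s sk] _ /=.
have jE : (k - s.+1).-1 = (k.-1 - s.+1)%N by lia.
have jk : (0 < k - s.+1 < k)%N by lia.
have jkk : (k - s.+1 <= k)%N by lia.
have jk0 : (k - s.+1 <= k0)%N by apply: leq_trans kk.
have sk0 : (0 < s.+1 < k0)%N by apply: leq_trans kk; lia.
have hD : smooth (k - s.+1).-1 w (C2 * H) (dseq (D s)).
  by rewrite jE; exact: (hC2 _ _ _ sk (ltW H0) hh).
have h2 := hC0 _ jkk jk _ _ _ _ _ _ jk0 e0 G _ _ (mulr_gt0 C20 H0) hD.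
rewrite jE in h2; rewrite normrM.
apply: le_trans (ler_pM (normr_ge0 _) (normr_ge0 _) (wkap_bound G sk0) h2) _.
rewrite (_ : K * _ * _ = K * (C0 * C2) * H * (eps `^ s.+1%:R * eps `^ ((k.-1 - s.+1)%:R + w))); last by ring.
rewrite -powRD ?(gt_eqF e0) ?implybT// addrA -natrD subnKC//.
Qed.

End expansion.

(** * Test functions at the scale of a given displacement *)

Section bump.
Context {R : realType}.
Implicit Types (x y : R).

Lemma isd_quad (f : R -> R) x l M : (forall e, `|e| <= 1 -> `|f (x + e) - f x - e * l| <= M * e ^+ 2) -> isd f x l.
Proof.
move=> h; have M0 : 0 <= M.
  by have := h 1; rewrite normr1 expr1n mulr1 => /(_ (lexx _)); apply: le_trans.
have lim : (fun t : R => t^-1 *: (f (t *: 1 + x) - f x)) @ 0^' --> l.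
  apply/cvgrPdist_lt => e e0.
  have m1 : 0 < M + 1 by rewrite ltr_wpDl.
  near=> t.
  have t0 : t != 0 by near: t; exact: nbhs_dnbhs_neq.
  have nt : 0 < `|t| by rewrite normr_gt0.
  have t1 : `|t| < Num.min 1 (e / (M + 1)).
    near: t; apply: dnbhs0_lt; rewrite lt_min ltr01 divr_gt0//.
  move: t1; rewrite lt_min => /andP[t1 te].
  rewrite (_ : l - _ = - (t^-1 * (f (x + t) - f x - t * l))); last first.
    by rewrite /GRing.scale/= mulr1 (addrC t); field.
  rewrite normrN normrM normfV ltr_pdivrMl//.
  apply: le_lt_trans (h t (ltW t1)) _; rewrite -real_normK ?num_real// expr2 mulrA mulrC ltr_pM2l//.
  move: te; rewrite ltr_pdivlMr// => te; apply: le_lt_trans te.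
  by rewrite mulrC ler_wpM2l// lerDl.
apply: DeriveDef.
  by apply/cvg_ex; exists l.
exact: cvg_lim lim.
Unshelve. all: by end_near. Qed.

Lemma isd_maxsq x : isd (fun y => Num.max 0 y ^+ 2) x (2 * Num.max 0 x).
Proof.
apply: (@isd_quad _ _ _ 1) => e _; rewrite mul1r ler_norml.
by case: (leP 0 (x + e)) => h1; case: (leP 0 x) => h2; apply/andP; split; nra.
Qed.

Definition mbump (n : nat) x : R := Num.max 0 (1 - x ^+ 2) ^+ n.

Lemma isd_maxX n x : isd (fun y => Num.max 0 y ^+ n.+2) x (n.+2%:R * Num.max 0 x ^+ n.+1).
Proof.
have maxE (y : R) m : y ^+ m * Num.max 0 y = Num.max 0 y ^+ m.+1.
  by rewrite exprSr; case: (leP 0 y) => h; rewrite ?mulr0.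
case: n => [|n]; first by rewrite expr1; exact: isd_maxsq.
rewrite (_ : (fun y => _) = fun y => y ^+ n.+1 * Num.max 0 y ^+ 2); last first.
  by apply/funext => y; rewrite [Num.max 0 y ^+ 2]expr2 mulrA maxE -exprSr.
apply: isd_eq (isdM (isdX n.+1 x) (isd_maxsq x)) _ => /=.
have e1 : x ^+ n * Num.max 0 x ^+ 2 = Num.max 0 x ^+ n.+2 by rewrite expr2 mulrA maxE -exprSr.
rewrite -mulrA e1 (mulrCA _ 2) maxE -mulrDl -natrD.
by congr (_%:R * _); lia.
Qed.

Lemma isd_mbump n x : isd (mbump n.+2) x (- (2 * n.+2%:R * x) * mbump n.+1 x).
Proof.
have h : isd (fun y : R => 1 - y ^+ 2) x (- (2 * x)).
  by apply: isd_eq (isdB (isd_cst 1 x) (isdX 2 x)) _; rewrite sub0r expr1.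
by apply: isd_eq (isd_comp (g := fun y : R => 1 - y ^+ 2) (isd_maxX n (1 - x ^+ 2)) h) _; rewrite /mbump; ring.
Qed.

Lemma mbumpS n x : mbump n.+2 x = (1 - x ^+ 2) * mbump n.+1 x.
Proof.
rewrite /mbump; case: (leP 0 (1 - x ^+ 2)) => h; first by rewrite exprS.
by rewrite !expr0n/= mulr0.
Qed.

Lemma isd_horner (q : {poly R}) x : isd (fun y => q.[y]) x q^`().[x].
Proof.
elim/poly_ind: q => [|q c IH].
  rewrite deriv0 horner0 (_ : (fun y => _) = fun=> 0); first exact: isd_cst.
  by apply/funext => y; rewrite horner0.
rewrite (_ : (fun y => _) = fun y => q.[y] * y + c); last by apply/funext => y; rewrite hornerMXaddC.
apply: isd_eq (isdD (isdM IH (isd_id x)) (isd_cst c x)) _.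
by rewrite derivMXaddC !hornerE; ring.
Qed.

Lemma horner_bound (q : {poly R}) : exists2 B, 0 <= B & forall y, `|q.[y]| <= B * (1 + `|y|) `^ (size q)%:R.
Proof.
exists (\sum_(i < size q) `|q`_i|); first exact: sumr_ge0.
move=> y; have a0 : 0 <= 1 + `|y| by rewrite addr_ge0.
rewrite horner_coef mulr_suml; apply: le_trans (ler_norm_sum _ _ _) _; apply: ler_sum => -[i iq] _ /=.
rewrite normrM ler_wpM2l// normrX powR_mulrn//.
apply: (@le_trans _ _ ((1 + `|y|) ^+ i)).
  by apply: lerXn2r; rewrite ?nnegrE// lerDr.
by apply: ler_weXn2l; [rewrite lerDl|exact: ltnW].
Qed.

(** [e 1] is a bump on [[-1, 1]] and [e 0] its primitive, constant on either side. The bump is the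
    positive part of [1 - x^2] to the power [m + 2]; each derivative is a polynomial times a lower
    power, which still vanishes at the ends for all orders used. *)
Lemma bump_chain (m : nat) : exists e : nat -> R -> R, [/\
  forall j x, (j <= m)%N -> isd (e j) x (e j.+1 x),
  (forall x, x <= -1 -> e 0%N x = e 0%N (-1)) /\ (forall x, 1 <= x -> e 0%N x = e 0%N 1),
  forall j x, (0 < j <= m.+1)%N -> 1 <= `|x| -> e j x = 0,
  exists2 E, 0 < E & forall j x, (j <= m.+1)%N -> `|e j x| <= E &
  (forall x, 0 <= e 1%N x) /\ exists2 c, 0 < c & forall x, `|x| <= 2^-1 -> c <= e 1%N x].
Proof.
pose M := m.+2.
pose q := fix q j : {poly R} := if j is i.+1 then (q i)^`() * (1 - 'X^2) - (2 * (M - i)%:R) *: ('X * q i) else 1.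
pose b j x := (q j).[x] * mbump (M - j) x.
have db j x : (j <= m)%N -> isd (b j) x (b j.+1 x).
  move=> jm; have [n nE] : exists n, (M - j = n.+2)%N by exists (m - j)%N; rewrite /M; lia.
  have nE' : (M - j.+1 = n.+1)%N by lia.
  rewrite /b nE; apply: isd_eq (isdM (isd_horner (q j) x) (isd_mbump n x)) _.
  have qS : q j.+1 = (q j)^`() * (1 - 'X^2) - (2 * (M - j)%:R) *: ('X * q j) by [].
  rewrite nE' mbumpS qS nE !(hornerD, hornerN, hornerM, hornerZ, hornerC, hornerX, hornerXn).
  ring.
have b0 j x : (j <= m.+1)%N -> 1 <= `|x| -> b j x = 0.
  move=> jm x1; rewrite /b /mbump; have -> : (M - j = (M - j).-1.+1)%N by rewrite /M; lia.
  have h : 1 - x ^+ 2 <= 0 by rewrite subr_le0 -real_normK ?num_real// exprn_ege1.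
  by rewrite (max_l h) exprS mul0r mulr0.
have b01 x : b 0%N x = mbump M x by rewrite /b/= hornerC mul1r subn0.
have bge x : 0 <= b 0%N x by rewrite b01 exprn_ge0// le_max lexx.
have bbd j : exists2 E, 0 <= E & (j <= m.+1)%N -> forall x, `|b j x| <= E.
  have [B B0 hB] := horner_bound (q j); exists (B * 2 `^ (size (q j))%:R); first by rewrite mulr_ge0 ?powR_ge0.
  move=> jm x; have [x1|/ltW x1] := leP 1 `|x|; first by rewrite b0// normr0 mulr_ge0 ?powR_ge0.
  rewrite normrM -[leRHS]mulr1; apply: ler_pM => //.
    apply: le_trans (hB x) _; rewrite ler_wpM2l//.
    by apply: ge0_ler_powR; rewrite ?nnegrE ?addr_ge0//; lra.
  have x2 : 0 <= 1 - x ^+ 2 by rewrite subr_ge0 -real_normK ?num_real// exprn_ile1.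
  rewrite /mbump (max_r x2) ger0_norm ?exprn_ge0// exprn_ile1// gerBl.
  exact: sqr_ge0.
have [||E E0 hE] := @uniform_bound R (fun j E => (j <= m.+1)%N -> forall x, `|b j x| <= E) m.+1.
- by move=> j C C' CC h jm x; apply: le_trans (h jm x) CC.
- exact: bbd.
(* Division by the weight makes [gprim g] a primitive of the bump itself. *)
pose g x := b 0%N x / gphi x.
have cg : continuous g.
  move=> x; apply: cvgM; first exact: isd_continuous (db 0%N x (leq0n _)).
  apply: cvgV; first by rewrite gt_eqF// gphi_gt0.
  exact: isd_continuous (isd_gphi x).
have hg : pbound (E / gphi 1) 0 g.
  move=> x; rewrite powRr0 mulr1 /g normrM normfV (ger0_norm (ltW (gphi_gt0 x))).
  have [x1|/ltW x1] := leP 1 `|x|; first by rewrite b0// normr0 mul0r divr_ge0// ltW// gphi_gt0.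
  apply: ler_pM; rewrite ?invr_ge0 ?(ltW (gphi_gt0 _))//; first exact: hE.
  rewrite lef_pV2 ?posrE ?gphi_gt0// /gphi ler_expR.
  have : x ^+ 2 <= 1 by rewrite -real_normK ?num_real// exprn_ile1.
  by rewrite expr1n; lra.
have d0 x : isd (gprim g) x (b 0%N x).
  by apply: isd_eq (isd_gprim x (lexx _) cg hg) _; rewrite /g divfK// gt_eqF// gphi_gt0.
pose e j := if j is i.+1 then b i else gprim g.
have de j x : (j <= m)%N -> isd (e j) x (e j.+1 x).
  by case: j => [|j] jm; [exact: d0|exact: db (ltnW jm)].
have cl x : x <= -1 -> gprim g x = gprim g (-1).
  move=> x1; have [c /andP[_ c1] h] := mvt x1 d0; apply/eqP; rewrite eq_sym -subr_eq0 h b0 ?mul0r//.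
  have c2 : 1 <= - c by rewrite lerNr.
  by rewrite -normrN; exact: le_trans c2 (ler_norm (- c)).
have cr x : 1 <= x -> gprim g x = gprim g 1.
  move=> x1; have [c /andP[c1 _] h] := mvt x1 d0; apply/eqP; rewrite -subr_eq0 h b0 ?mul0r//.
  exact: le_trans c1 (ler_norm c).
exists e; split => //.
- move=> [|j] x jm x1; first by [].
  by move: jm => /andP[_ jm]; exact: (b0 j x (ltnW jm) x1).
- exists (E + (`|gprim g (-1)| + E * 2) + 1); first by rewrite ltr_wpDl// !addr_ge0// mulr_ge0.
  have big x : -1 <= x -> x <= 1 -> `|gprim g x| <= `|gprim g (-1)| + E * 2.
    move=> x1 x2; have [c _ h] := mvt x1 d0; rewrite -[gprim g x](subrK (gprim g (-1))) addrC.
    apply: le_trans (ler_normD _ _) _; rewrite lerD2l h normrM; apply: ler_pM => //; first exact: hE.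
    by rewrite ger0_norm ?subr_ge0//; lra.
  case=> [|j] x jm; last first.
    by apply: (le_trans (hE _ _ _ x)); [exact: ltnW|exact: ltnW|rewrite -addrA lerDl !addr_ge0// mulr_ge0].
  apply: (@le_trans _ _ (`|gprim g (-1)| + E * 2)); last by rewrite -addrA addrCA lerDl addr_ge0.
  rewrite /e; have [x1|x1] := leP x (-1); first by rewrite cl// lerDl mulr_ge0.
  have [x2|x2] := leP 1 x; first by rewrite cr//; apply: big => //; lra.
  by apply: big; exact: ltW.
- split=> // ; exists (2^-1 ^+ M); first by rewrite exprn_gt0// invr_gt0.
  move=> x x2; rewrite /e b01 /mbump; apply: lerXn2r; rewrite ?nnegrE ?invr_ge0// ?le_max ?lexx//.
  have : x ^+ 2 <= 2^-1 ^+ 2 by rewrite -real_normK ?num_real//; apply: lerXn2r; rewrite ?nnegrE ?invr_ge0.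
  by rewrite [leRHS]expr2 => h; apply/orP; right; lra.
Qed.

End bump.

Section kernel_integral.
Context {R : realType}.
Local Notation mu := (@lebesgue_measure R).
Implicit Types (f g : R -> R).

Definition lint f : R := \int[mu]_t f t.
Definition litg f : Prop := mu.-integrable setT (EFin \o f).

Definition bsupp M a b f := [/\ measurable_fun setT f, forall t, `|f t| <= M & forall t, f t != 0 -> a <= t <= b].

Lemma litgZ k f : litg f -> litg (fun t => k * f t).
Proof. by move=> hf; have := integrableZl measurableT k hf. Qed.

Lemma litgB f g : litg f -> litg g -> litg (fun t => f t - g t).
Proof. by move=> hf hg; have := integrableB measurableT hf hg. Qed.

Lemma box_litg (M a b : R) : litg (fun t => M * \1_(`[a, b]) t).
Proof.
apply: litgZ; apply/integrableP; split.
  by apply/measurable_EFinP; exact: measurable_indic.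
rewrite (eq_integral (fun t => (\1_(`[a, b] : set (measurableTypeR R)) t)%:E)); last first.
  by move=> t _ /=; rewrite ger0_norm// indic_ge0.
rewrite integral_indic// setIT.
by have /= -> := lebesgue_measure_itv `[a, b]; case: ifP => //; rewrite ?ltry.
Qed.

Lemma box_lint (M a b : R) : a <= b -> lint (fun t => M * \1_(`[a, b]) t) = M * (b - a).
Proof.
move=> ab; rewrite /lint RintegralZl//; last first.
  have := box_litg 1 a b; congr (integrable _ _ _); apply/funext => t /=; by rewrite mul1r.
congr (_ * _); rewrite /Rintegral integral_indic// setIT.
have /= -> := lebesgue_measure_itv `[a, b]; rewrite lte_fin.
by case: ltP => //= ba; apply/eqP; rewrite eq_sym subr_eq0 eq_le ab ba.
Qed.

Lemma bsupp_dom M a b f : bsupp M a b f -> forall t, `|f t| <= M * \1_(`[a, b]) t.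
Proof.
move=> [mf fM fs] t; have [f0|f0] := eqVneq (f t) 0.
  rewrite f0 normr0 mulr_ge0 ?indic_ge0//.
  exact: le_trans (normr_ge0 (f t)) (fM t).
rewrite indicE mem_set ?mulr1//=; by rewrite in_itv/=; exact: fs.
Qed.

Lemma litg_le f g : measurable_fun setT f -> (forall t, `|f t| <= g t) -> litg g -> litg f.
Proof.
move=> mf fg ig; apply: (le_integrable _ _ _ ig) => //.
  exact/measurable_EFinP.
by move=> x _; rewrite lee_fin; apply: le_trans (fg x) (ler_norm _).
Qed.

Lemma bsupp_litg M a b f : bsupp M a b f -> litg f.
Proof. by move=> h; apply: litg_le (bsupp_dom h) (box_litg _ _ _); case: h. Qed.

Lemma lint_le f g : litg f -> litg g -> (forall t, f t <= g t) -> lint f <= lint g.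
Proof. by move=> hf hg h; apply: le_Rintegral. Qed.

Lemma bsupp_lint M a b f : a <= b -> bsupp M a b f -> `|lint f| <= M * (b - a).
Proof.
move=> ab h; rewrite -box_lint//.
have hf := bsupp_litg h; apply: le_trans (le_normr_Rintegral _ hf) _ => //.
apply: lint_le; [exact: integrable_norm hf|exact: box_litg|exact: bsupp_dom].
Qed.

Lemma lint_ge f c a b : a <= b -> litg f -> (forall t, 0 <= f t) ->
  (forall t, a <= t <= b -> c <= f t) -> c * (b - a) <= lint f.
Proof.
move=> ab hf f0 fc; rewrite -box_lint//; apply: lint_le => //; first exact: box_litg.
move=> t; rewrite indicE; case: (boolP (t \in _)) => ht; last by rewrite mulr0.
by rewrite mulr1; apply: fc; rewrite inE/= in_itv/= in ht.
Qed.

Lemma lintB f g : litg f -> litg g -> lint (fun t => f t - g t) = lint f - lint g.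
Proof. by move=> hf hg; rewrite /lint RintegralB. Qed.

Lemma lintZ k f : litg f -> lint (fun t => k * f t) = k * lint f.
Proof. by move=> hf; rewrite /lint RintegralZl. Qed.

(** Differentiation under the integral sign: the quadratic remainder is uniform on a bounded
    interval and so survives integration. *)
Lemma isd_lint (F : R -> R -> R) G x M a b : a <= b -> (forall y, litg (F y)) -> litg G ->
  (forall e, `|e| <= 1 -> bsupp (M * e ^+ 2) a b (fun t => F (x + e) t - F x t - e * G t)) ->
  isd (fun y => lint (F y)) x (lint G).
Proof.
move=> ab hF hG h; apply: (@isd_quad _ _ _ _ (M * (b - a))) => e e1.
have hZ : litg (fun t => e * G t) by exact: litgZ.
have hB : litg (fun t => F (x + e) t - F x t) by exact: litgB.
rewrite -lintZ// -lintB// -lintB// mulrAC.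
by apply: bsupp_lint (h e e1).
Qed.

End kernel_integral.

Section radius.
Context {R : realType} (ta : R -> R) (dl : R).
Hypothesis ta0 : forall t, 0 <= ta t.
Hypothesis dl0 : 0 < dl.

(** Infimal convolution with the distance: the largest 1-Lipschitz function below [ta], raised by
    [dl] to stay positive. *)
Definition rho (s : R) : R := inf [set ta t + `|s - t| | t in setT] + dl.

Lemma rho_lb s : lbound [set ta t + `|s - t| | t in setT] 0.
Proof. by move=> _ [t _ <-]; rewrite addr_ge0. Qed.

Lemma rho_le s t : rho s <= ta t + `|s - t| + dl.
Proof.
rewrite /rho lerD2r; apply: ge_inf; first by exists 0; exact: rho_lb.
by exists t.
Qed.

Lemma le_rho s r : (forall t, r <= ta t + `|s - t|) -> r + dl <= rho s.
Proof.
move=> h; rewrite /rho lerD2r; apply: lb_le_inf; first by exists (ta s + `|s - s|), s.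
by move=> _ [t _ <-]; exact: h.
Qed.

Lemma rho_ge s : dl <= rho s.
Proof. by rewrite -[leLHS]add0r; apply: le_rho => t; rewrite addr_ge0. Qed.

Lemma rho_gt0 s : 0 < rho s. Proof. exact: lt_le_trans (rho_ge s). Qed.

Lemma rho_ta s : rho s <= ta s + dl.
Proof. by have := rho_le s s; rewrite subrr normr0 addr0. Qed.

Lemma rho_lip s t : rho s <= rho t + `|s - t|.
Proof.
have := @le_rho t (rho s - `|s - t| - dl); rewrite subrK => h; rewrite -lerBlDr; apply: h => z.
have := rho_le s z; have := ler_distD t s z; lra.
Qed.

Lemma rho_continuous : continuous rho.
Proof.
apply: (@hoelder_continuous _ 1 1) => // x y; rewrite mul1r powRr1// ler_norml.
by have := rho_lip x y; have := rho_lip y x; rewrite (distrC y x) => h1 h2; apply/andP; split; lra.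
Qed.

End radius.

Section test_function.
Context {R : realType}.

Lemma powR_compare (r x a : R) : 0 < r -> x / 4 <= r -> r <= x -> r `^ a <= 4 `^ `|a| * x `^ a.
Proof.
move=> r0 xr rx; have x0 : 0 < x by apply: lt_le_trans rx.
have -> : r `^ a = (r / x) `^ a * x `^ a by rewrite -powRM ?divr_ge0 ?(ltW r0) ?(ltW x0)// divfK ?gt_eqF.
rewrite ler_wpM2r ?powR_ge0//; have [a0|a0] := leP 0 a.
  apply: (@le_trans _ _ (1 `^ a)).
    by apply: ge0_ler_powR; rewrite ?nnegrE ?divr_ge0 ?(ltW r0) ?(ltW x0)// ler_pdivrMr// mul1r.
  by rewrite powR1 -[leLHS](powRr0 4) ler_powR// ler1n.
rewrite -[r / x]invrK invf_div -powR_inv1 ?divr_ge0 ?(ltW r0) ?(ltW x0)// -powRrM mulN1r (ltr0_norm a0).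
apply: ge0_ler_powR; rewrite ?nnegrE ?divr_ge0 ?(ltW r0) ?(ltW x0)//.
by rewrite oppr_ge0 ltW.
by rewrite ler_pdivrMr// -ler_pdivrMl// mulrC.
Qed.

Lemma le_powR_compare (r x a : R) : 0 < r -> x / 4 <= r -> r <= x -> 4 `^ (- `|a|) * x `^ a <= r `^ a.
Proof.
move=> r0 xr rx; have x0 : 0 < x by apply: lt_le_trans rx.
have := powR_compare (- a) r0 xr rx; rewrite normrN !powRN => h.
rewrite -[leRHS]invrK -[leLHS]invrK lef_pV2 ?posrE ?invr_gt0 ?mulr_gt0 ?invr_gt0 ?powR_gt0//.
by rewrite invfM invrK.
Qed.

Lemma far_side (x y s t d : R) : y + 2 < `|s - t| -> x <= (y + `|s - t|) / 2 -> 0 < y -> -1 <= d -> d <= 1 ->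
  (x <= s + d - t /\ x <= s - t) \/ (s + d - t <= - x /\ s - t <= - x).
Proof.
move=> tA h y0 d1 d2; case: (leP 0 (s - t)) => st; [left|right].
  by rewrite (ger0_norm st) in tA h; split; lra.
by rewrite (ltr0_norm st) in tA h; split; lra.
Qed.

Lemma quad_mvt (g g1 g2 : R -> R) M s e : (forall y, isd g y (g1 y)) -> (forall y, isd g1 y (g2 y)) ->
  (forall y, `|g2 y| <= M) -> `|g (s + e) - g s - e * g1 s| <= M * e ^+ 2.
Proof.
move=> h1 h2 h3; pose gg (j : nat) := if j is 0%N then g else g1.
have hs : smooth 1 1 M gg.
  split; first by case.
  move=> x y; rewrite powRr1//= /gg; wlog xy : x y / y <= x => [hw|].
    by case: (leP y x) => [/hw//|/ltW /hw]; rewrite distrC (distrC y).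
  have [c _ ->] := mvt xy h2; rewrite normrM ler_wpM2r//.
have := taylor_bound ltr01 hs s e; rewrite /taylor !big_ord_recl big_ord0 /= expr0 mulr1 divr1 addr0.
rewrite /bump/= expr1 (_ : 1%:R + 1 = 2%:R)// powR_mulrn// real_normK ?num_real//.
by rewrite (_ : 1`!%:R = 1 :> R)// divr1 opprD addrA (mulrC (g1 s)).
Qed.

Context (k : nat) (w p : R).
Hypothesis k0 : (0 < k)%N.
Hypothesis w01 : 0 < w <= 1.
Hypothesis pE : p = k.-1%:R + w.
Hypothesis p1 : 1 <= p.
Let w0 : 0 < w. Proof. by case/andP: w01. Qed.
Let w1 : w <= 1. Proof. by case/andP: w01. Qed.

Section kernels.
Context (e : nat -> R -> R) (E c : R).
Hypothesis E0 : 0 < E.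
Hypothesis c0 : 0 < c.
Hypothesis de : forall j x, (j <= k.+2)%N -> isd (e j) x (e j.+1 x).
Hypothesis el : forall x, x <= -1 -> e 0%N x = e 0%N (-1).
Hypothesis er : forall x, 1 <= x -> e 0%N x = e 0%N 1.
Hypothesis es : forall j x, (0 < j <= k.+3)%N -> 1 <= `|x| -> e j x = 0.
Hypothesis eE : forall j x, (j <= k.+3)%N -> `|e j x| <= E.
Hypothesis e10 : forall x, 0 <= e 1%N x.
Hypothesis e1c : forall x, `|x| <= 2^-1 -> c <= e 1%N x.

Context (ta : R -> R) (dl : R).
Hypothesis ta0 : forall t, 0 <= ta t.
Hypothesis dl0 : 0 < dl.
Local Notation rho := (rho ta dl).
Let r t := rho t / 2.
Let rho0 s : 0 < rho s. Proof. exact: rho_gt0. Qed.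
Let r0 t : 0 < r t. Proof. by rewrite divr_gt0. Qed.

(** A mollifier of variable radius [r t], weighted so that the integral over [t] has slope of order
    [rho^(p-1)]; each further derivative costs one power of the radius. For [j = 0] the value at
    [s = 0] is subtracted, since the step function [e 0] alone is not integrable in [t]. *)
Definition kern j s t : R := r t `^ (p - 1 - j%:R) *
  (if j is 0%N then e 0%N ((s - t) / r t) - e 0%N (- t / r t) else e j ((s - t) / r t)).

Definition tfun j s : R := lint (kern j s).

Lemma isd_kern j s t : (j <= k.+2)%N -> isd (fun s => kern j s t) s (kern j.+1 s t).
Proof.
move=> jk; have h : isd (fun y => (y - t) / r t) s (r t)^-1.
  rewrite (_ : (fun y => _) = fun y => (r t)^-1 * (y - t)); last by apply/funext => y; rewrite mulrC.
  by apply: isd_eq (isdZ _ (isdB (isd_id s) (isd_cst t s))) _; rewrite subr0 mulr1.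
have hp : r t `^ (p - 1 - j.+1%:R) = r t `^ (p - 1 - j%:R) * (r t)^-1.
  by rewrite -natr1 opprD addrA powRB ?(gt_eqF (r0 t)) ?implybT// powRr1 ?(ltW (r0 t)).
have hc := isd_comp (g := fun y => (y - t) / r t) (de ((s - t) / r t) jk) h.
rewrite /kern hp; case: j jk hc {hp} => [|j] jk hc.
  apply: isd_eq (isdZ _ (isdB hc (isd_cst _ s))) _.
  by rewrite subr0; ring.
by apply: isd_eq (isdZ _ hc) _; ring.
Qed.

Lemma measurable_r a : measurable_fun setT (fun t => r t `^ a).
Proof.
apply: (measurableT_comp (measurable_powR a)); apply: measurable_funM => //.
by apply: continuous_measurable_fun; exact: rho_continuous.
Qed.

Lemma measurable_kern j s : (j <= k.+2)%N -> measurable_fun setT (kern j s).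
Proof.
move=> jk; have me i : (i <= k.+2)%N -> measurable_fun setT (e i).
  by move=> ik; apply: continuous_measurable_fun => x; exact: isd_continuous (de x ik).
have mr : measurable_fun setT (fun t => (r t)^-1).
  rewrite (_ : (fun t => _) = fun t => r t `^ (-1)); first exact: measurable_r.
  by apply/funext => t; rewrite powR_inv1// ltW.
have mg i (u : R -> R) : (i <= k.+2)%N -> measurable_fun setT u -> measurable_fun setT (fun t => e i (u t / r t)).
  by move=> ik mu; apply: (measurableT_comp (me i ik)); exact: measurable_funM.
apply: measurable_funM; first exact: measurable_r.
have ms : measurable_fun setT (fun t : R => s - t) by apply: measurable_funB.
case: j jk => [|j] jk; last exact: mg.
apply: measurable_funB; first exact: mg.
by apply: mg => //; exact: measurable_funN.
Qed.

(** As [rho] is 1-Lipschitz, the radius at a point [t] whose kernel reaches [s] is comparable with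
    [rho s]; this is the source of the powers of 4. *)
Lemma rad_compare s t : `|s - t| < r t -> [/\ rho s / 4 <= r t, r t <= rho s & `|s - t| <= rho s].
Proof.
rewrite /r => h; have h1 := rho_lip dl ta0 s t; have h2 := rho_lip dl ta0 t s.
rewrite (distrC t) in h2; have := rho0 s; have := rho0 t.
by move=> ? ?; split; lra.
Qed.

Lemma kern_supp j s t : (0 < j <= k.+3)%N -> kern j s t != 0 -> `|s - t| < r t.
Proof.
move=> jk; rewrite ltNge; apply: contraNN => h.
rewrite /kern; case: j jk => // j jk; rewrite es ?mulr0//.
by rewrite normrM normfV (gtr0_norm (r0 t)) ler_pdivlMr// mul1r.
Qed.

Lemma kern_bsupp j s : (0 < j <= k.+2)%N ->
  bsupp (E * 4 `^ `|p - 1 - j%:R| * rho s `^ (p - 1 - j%:R)) (s - rho s) (s + rho s) (kern j s).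
Proof.
move=> /andP[j0 jk]; have jk3 : (0 < j <= k.+3)%N by rewrite j0 ltnW.
split; first exact: measurable_kern.
- move=> t; have [h|h] := eqVneq (kern j s t) 0.
    by rewrite h normr0 !mulr_ge0 ?powR_ge0 ?(ltW E0).
  have [h1 h2 _] := rad_compare (kern_supp jk3 h).
  rewrite /kern normrM (ger0_norm (powR_ge0 _ _)) mulrC -[leRHS]mulrA.
  apply: ler_pM; rewrite ?powR_ge0//; last exact: powR_compare.
  by case: j j0 jk jk3 {h} => // j _ _ /andP[_ jk3]; exact: eE.
- move=> t /(kern_supp jk3)/rad_compare[_ _]; rewrite ler_norml => /andP[h1 h2].
  by apply/andP; split; lra.
Qed.

Lemma tfun_bound j s : (0 < j <= k.+2)%N ->
  `|tfun j s| <= 2 * E * 4 `^ `|p - 1 - j%:R| * rho s `^ (p - j%:R).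
Proof.
move=> jk; have ab : s - rho s <= s + rho s by have := rho0 s; lra.
apply: le_trans (bsupp_lint ab (kern_bsupp s jk)) _.
have -> : rho s `^ (p - j%:R) = rho s `^ (p - 1 - j%:R) * rho s.
  rewrite -{3}(powRr1 (ltW (rho0 s))) -powRD ?(gt_eqF (rho0 s)) ?implybT//.
  by congr (_ `^ _); ring.
rewrite le_eqVlt; apply/orP; left; apply/eqP; ring.
Qed.

Lemma e0_same (x y : R) : (1 <= x /\ 1 <= y) \/ (x <= -1 /\ y <= -1) -> e 0%N x = e 0%N y.
Proof. by case=> -[h1 h2]; [rewrite er// [RHS]er|rewrite el// [RHS]el]. Qed.

Lemma litg_kern j s : (j <= k.+2)%N -> litg (kern j s).
Proof.
case: j => [_|j jk]; last by apply: bsupp_litg; exact: (kern_bsupp s).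
pose A := 2 * `|s| + rho 0.
have hr t : r t <= (rho 0 + `|t|) / 2.
  by rewrite ler_wpM2r// (le_trans (rho_lip dl ta0 t 0))// subr0.
apply: (@bsupp_litg _ ((rho 0 + A) `^ (p - 1) * (2 * E)) (- A) A).
have supp t : kern 0 s t != 0 -> `|t| <= A.
  rewrite leNgt; apply: contraNN => tA; rewrite /kern (@e0_same ((s - t) / r t) (- t / r t)).
    by rewrite subrr mulr0.
  have hrt := hr t; have rt := r0 t; rewrite !ler_pdivlMr// !ler_pdivrMr// mul1r mulN1r.
  rewrite /A in tA; have s1 := ler_norm s; have s2 := ler_norm (- s); rewrite normrN in s2.
  case: (leP 0 t) => t0; [right|left]; rewrite ?(ger0_norm t0) ?(ltr0_norm t0) in tA hrt; split; lra.
split; first exact: measurable_kern.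
- move=> t; have [h|h] := eqVneq (kern 0 s t) 0.
    by rewrite h normr0 mulr_ge0 ?powR_ge0// mulr_ge0// ltW.
  have tA := supp t h; rewrite /kern subr0 normrM (ger0_norm (powR_ge0 _ _)).
  have r00 := rho0 0.
  apply: ler_pM; rewrite ?powR_ge0//.
    apply: ge0_ler_powR; rewrite ?nnegrE ?(ltW (r0 t)) ?subr_ge0//.
      by rewrite addr_ge0 ?(ltW r00)// addr_ge0 ?(ltW r00)// mulr_ge0.
    by apply: le_trans (hr t) _; have := normr_ge0 t; lra.
  by apply: le_trans (ler_normB _ _) _; rewrite mulr_natl mulr2n lerD// eE.
- by move=> t /supp; rewrite ler_norml.
Qed.

Lemma isd_tfun j s : (j <= k)%N -> isd (tfun j) s (tfun j.+1 s).
Proof.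
move=> jk; pose A := rho s + 2; pose a := p - 1 - j.+2%:R.
have rs := rho0 s.
have j1 : (j <= k.+2)%N by lia.
have j2 : (j.+1 <= k.+2)%N by lia.
have j3 : (j.+2 <= k.+3)%N by lia.
(* The bound may depend on [s] and [dl], because only differentiability is at stake; the two powers
   cover both signs of [a]. *)
apply: (@isd_lint _ _ _ _ (((dl / 2) `^ a + (rho s + A) `^ a) * E) (s - A) (s + A)).
- by rewrite /A; lra.
- by move=> y; exact: litg_kern.
- exact: litg_kern.
move=> d d1.
have hr t : r t <= (rho s + `|s - t|) / 2.
  by rewrite ler_wpM2r// (le_trans (rho_lip dl ta0 t s))// distrC.
have supp t : kern j (s + d) t - kern j s t - d * kern j.+1 s t != 0 -> `|s - t| <= A.
  rewrite leNgt; apply: contraNN => tA.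
  have hrt := hr t; have rt := r0 t; rewrite /A in tA.
  have far y : `|s - y| <= 1 -> r t <= `|y - t|.
    by move=> sy; have := ler_distD y s t; lra.
  have z i y : (0 < i <= k.+3)%N -> `|s - y| <= 1 -> kern i y t = 0.
    move=> ik /far hy; apply/eqP; move: hy; rewrite leNgt; apply: contraNT.
    exact: kern_supp.
  have sd : `|s - (s + d)| <= 1 by rewrite opprD addrA subrr add0r normrN.
  have ss : `|s - s| <= 1 by rewrite subrr normr0.
  rewrite (z j.+1 s)// mulr0 subr0.
  case: j jk j1 j2 j3 a {z} (z j) => [|j] jk j1 j2 j3 a z; last first.
    have jj : (0 < j.+1 <= k.+3)%N by rewrite ltnS (leq_trans jk)// ltnW// ltnW.
    by rewrite (z _ jj sd) (z _ jj ss) subrr.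
  rewrite /kern (@e0_same ((s + d - t) / r t) ((s - t) / r t)) ?subrr//.
  rewrite !ler_pdivlMr// !ler_pdivrMr// mul1r mulN1r.
  move: d1; rewrite ler_norml => /andP[d1 d2].
  exact: far_side tA hrt rs d1 d2.
split.
- apply: measurable_funB; first by apply: measurable_funB; exact: measurable_kern.
  by apply: measurable_funM => //; exact: measurable_kern.
- move=> t; have [h|h] := eqVneq (kern j (s + d) t - kern j s t - d * kern j.+1 s t) 0.
    rewrite h normr0; apply: mulr_ge0; last exact: sqr_ge0.
    by rewrite mulr_ge0 ?(ltW E0)// addr_ge0 ?powR_ge0.
  have tA := supp t h; apply: (quad_mvt (g := fun y => kern j y t) (g1 := fun y => kern j.+1 y t) (g2 := fun y => kern j.+2 y t)).
  + by move=> y; exact: isd_kern.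
  + by move=> y; exact: isd_kern.
  move=> y; rewrite /kern normrM (ger0_norm (powR_ge0 _ _)) -/a.
  apply: ler_pM; rewrite ?powR_ge0// ?eE//.
  have rl : dl / 2 <= r t by rewrite ler_wpM2r//; exact: rho_ge.
  have ru : r t <= rho s + A by apply: le_trans (hr t) _; have := normr_ge0 (s - t); lra.
  have d2 : 0 < dl / 2 by rewrite divr_gt0.
  have [a0|a0] := leP 0 a.
    apply: (@le_trans _ _ ((rho s + A) `^ a)); last by rewrite lerDr powR_ge0.
    apply: ge0_ler_powR; rewrite ?nnegrE ?(ltW (r0 t))//.
    exact: le_trans (ltW (r0 t)) ru.
  apply: (@le_trans _ _ ((dl / 2) `^ a)); last by rewrite lerDl powR_ge0.
  rewrite -[a]opprK !(powRN _ (- a)) lef_pV2 ?posrE ?powR_gt0//.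
  by apply: ge0_ler_powR; rewrite ?nnegrE ?(ltW (r0 t)) ?(ltW d2)// oppr_ge0 ltW.
- by move=> t /supp; rewrite ler_norml => /andP[h1 h2]; apply/andP; split; lra.
Qed.

Lemma tfun1_ge0 s : 0 <= tfun 1 s.
Proof.
rewrite /tfun /lint; apply: Rintegral_ge0 => t _.
by rewrite /kern mulr_ge0 ?powR_ge0.
Qed.

(** If [|s - t| <= rho s / 8], the Lipschitz property puts the argument of [e 1] within [1/2] of 0,
    where the bump is at least [c]; the admissible [t] form an interval of length [rho s / 4]. *)
Lemma tfun1_ge s : c * 4 `^ (- `|p - 2|) / 4 * rho s `^ (p - 1) <= tfun 1 s.
Proof.
have rs := rho0 s; have e1 : p - 1 - 1%:R = p - 2 by ring.
have ab : s - rho s / 8 <= s + rho s / 8 by lra.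
have h : c * 4 `^ (- `|p - 2|) * rho s `^ (p - 2) * (s + rho s / 8 - (s - rho s / 8)) <= tfun 1 s.
  apply: lint_ge => //; first exact: litg_kern.
    by move=> t; rewrite /kern mulr_ge0 ?powR_ge0.
  move=> t /andP[t1 t2]; have st : `|s - t| <= rho s / 8 by rewrite ler_norml; apply/andP; split; lra.
  have h1 := rho_lip dl ta0 s t; have h2 := rho_lip dl ta0 t s; rewrite (distrC t) in h2.
  rewrite /kern e1 [leRHS]mulrC -mulrA; apply: ler_pM; rewrite ?mulr_ge0 ?powR_ge0 ?(ltW c0)//.
    apply: e1c; rewrite normrM normfV (gtr0_norm (r0 t)) ler_pdivrMr// /r; lra.
  by apply: le_powR_compare; rewrite ?r0// /r; lra.
apply: le_trans h; rewrite (_ : p - 1 = p - 2 + 1); last by ring.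
rewrite powRD ?(gt_eqF rs) ?implybT// powRr1 ?(ltW rs)//.
rewrite le_eqVlt; apply/orP; left; apply/eqP; by field.
Qed.

(** The factor 12 is [2 * 3 * 2]: support length in radii, radii up to [3 |x - y|] for distant
    points, and two points. *)
Definition tconst : R := 12 * E * (4 `^ `|p - 1 - k%:R| + 4 `^ `|p - 1 - k.-1%:R|).

(** Points closer than half of [rho x] use derivative [k], of size [rho^(w-1)], along the segment
    between them; distant points use the size [rho^w] of derivative [k - 1] at each of them. *)
Lemma smooth_tfun : smooth k.-1 w tconst tfun.
Proof.
have kS : k.-1.+1 = k by rewrite prednK.
have e1 : k%:R = k.-1%:R + 1 :> R by rewrite natr1 kS.
have Pk := powR_ge0 4 `|p - 1 - k%:R| : 0 <= 4 `^ `|p - 1 - k%:R|.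
have Pk' := powR_ge0 4 `|p - 1 - k.-1%:R| : 0 <= 4 `^ `|p - 1 - k.-1%:R|.
have EP := mulr_ge0 (ltW E0) Pk; have EP' := mulr_ge0 (ltW E0) Pk'.
have CkC : 2 * E * 4 `^ `|p - 1 - k%:R| <= tconst.
  by rewrite /tconst mulrDr; lra.
have C0 : 0 <= tconst by apply: le_trans CkC; lra.
split; first by move=> j x jk; apply: isd_tfun; exact: leq_trans (ltnW jk) (leq_pred _).
have dk y : isd (tfun k.-1) y (tfun k y) by have := @isd_tfun k.-1 y (leq_pred _); rewrite kS.
have pk : p - k%:R = w - 1 by rewrite pE e1; ring.
have bk z : `|tfun k z| <= 2 * E * 4 `^ `|p - 1 - k%:R| * rho z `^ (w - 1).
  by rewrite -pk; apply: tfun_bound; rewrite k0/= ltnW.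
have lip x y M : (forall z, `|z - x| <= `|x - y| -> `|tfun k z| <= M) -> `|tfun k.-1 x - tfun k.-1 y| <= M * `|x - y|.
  move=> hM; have [yx|xy'] := leP y x.
    have [z /andP[z1 z2] e'] := mvt yx dk; rewrite e' normrM ler_wpM2r// hM//.
    by rewrite distrC ger0_norm ?subr_ge0// ger0_norm ?subr_ge0// lerD2l lerN2.
  have [z /andP[z1 z2] e'] := mvt (ltW xy') dk; rewrite distrC e' normrM (distrC y) ler_wpM2r// hM//.
  by rewrite ger0_norm ?subr_ge0// ler0_norm ?subr_le0 ?(ltW xy')// opprB lerD2r.
move=> x y; have [->|xy] := eqVneq x y; first by rewrite !subrr normr0 mulr_ge0 ?powR_ge0.
have d0 : 0 < `|x - y| by rewrite normr_gt0 subr_eq0.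
have dw : `|x - y| `^ (w - 1) * `|x - y| = `|x - y| `^ w.
  by rewrite powRB ?(gt_eqF d0) ?implybT// powRr1// divfK ?gt_eqF.
have [near|far] := leP (2 * `|x - y|) (rho x).
  rewrite -dw mulrA; apply: lip => z zx; apply: le_trans (bk z) _.
  apply: ler_pM; rewrite ?powR_ge0//; first by rewrite -mulrA mulr_ge0.
  have hz : `|x - y| <= rho z by have := rho_lip dl ta0 x z; rewrite (distrC x z); lra.
  rewrite -opprB !powRN lef_pV2 ?posrE ?powR_gt0//.
  by apply: ge0_ler_powR; rewrite ?nnegrE ?subr_ge0// ltW.
(* For [k = 1] the size bound would concern [tfun 0], to which [tfun_bound] does not apply; but then
   [1 <= p] forces [w = 1], and the bounded first derivative suffices. *)
have [k1|k1] := leqP k 1.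
  have k1' : k = 1%N by apply/eqP; rewrite eqn_leq k1 k0.
  have w1' : w = 1 by apply/eqP; rewrite eq_le w1; move: p1; rewrite pE k1' add0r.
  rewrite [X in _ `^ X]w1' powRr1//; apply: lip => z _; apply: le_trans (bk z) _.
  have w1z : w - 1 = 0 by rewrite w1' subrr.
  by rewrite w1z powRr0 mulr1.
have bk' z : `|tfun k.-1 z| <= 2 * E * 4 `^ `|p - 1 - k.-1%:R| * rho z `^ w.
  rewrite (_ : w = p - k.-1%:R); last by rewrite pE; ring.
  by apply: tfun_bound; rewrite -[X in (X < _)%N]/0%N -ltnS kS k1/= (leq_trans (leq_pred k))// ltnW.
have fz z : rho z <= 3 * `|x - y| -> `|tfun k.-1 z| <= 2 * E * 4 `^ `|p - 1 - k.-1%:R| * (3 * `|x - y| `^ w).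
  move=> hz; apply: le_trans (bk' z) _; apply: ler_wpM2l; first by rewrite -mulrA mulr_ge0.
  apply: (@le_trans _ _ ((3 * `|x - y|) `^ w)).
    by apply: ge0_ler_powR; rewrite ?nnegrE ?(ltW w0) ?(ltW (rho0 z))// mulr_ge0.
  rewrite powRM// ler_wpM2r ?powR_ge0// -[leRHS](powRr1 (ler0n R 3)) ler_powR// ler1n.
  by [].
have h1 : rho x <= 3 * `|x - y| by lra.
have h2 : rho y <= 3 * `|x - y| by have := rho_lip dl ta0 y x; rewrite (distrC y x); lra.
apply: le_trans (ler_normB _ _) _; apply: le_trans (lerD (fz x h1) (fz y h2)) _.
have dwp := powR_ge0 `|x - y| w.
rewrite (_ : _ + _ = 12 * (E * 4 `^ `|p - 1 - k.-1%:R|) * `|x - y| `^ w); last by ring.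
by rewrite ler_wpM2r// /tconst mulrDr mulrA lerDr mulr_ge0// mulr_ge0// ltW.
Qed.

End kernels.

Lemma test_function : exists C c : R, [/\ 0 < C, 0 < c & forall (ta : R -> R) dl,
  (forall t, 0 <= ta t) -> 0 < dl -> exists f : nat -> R -> R,
  [/\ smooth k.-1 w C f, forall j s, (j <= 1)%N -> isd (f j) s (f j.+1 s),
      forall s, 0 <= f 1%N s <= C * (ta s + dl) `^ (p - 1) &
      forall s, c * rho ta dl s `^ (p - 1) <= f 1%N s]].
Proof.
have [e [de [el er] es [E E0 eE] [e10 [c c0 e1c]]]] := @bump_chain R k.+2.
pose a := 4 `^ `|p - 1 - 1%:R| : R; have a0 : 0 < a by rewrite powR_gt0.
have b0 : 0 < 2 * E * a by rewrite !mulr_gt0.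
exists (tconst E + 2 * E * a), (c * 4 `^ (- `|p - 2|) / 4); split.
- by rewrite ltr_wpDl// /tconst mulr_ge0 ?addr_ge0 ?powR_ge0// mulr_ge0// ltW.
- by rewrite divr_gt0// mulr_gt0// powR_gt0.
move=> ta dl ta0 dl0; exists (tfun e ta dl); split.
- apply: (@smooth_leH _ _ _ (tconst E)); last by apply: smooth_tfun.
  by rewrite lerDl ltW.
- move=> j s j1; have jk : (j <= k)%N by exact: leq_trans j1 k0.
  by apply: (isd_tfun (E := E)).
- move=> s; have h0 : 0 <= tfun e ta dl 1 s by apply: tfun1_ge0.
  rewrite h0/=.
  apply: le_trans (ler_norm _) _; have hb : `|tfun e ta dl 1 s| <= 2 * E * 4 `^ `|p - 1 - 1%:R| * rho ta dl s `^ (p - 1%:R) by apply: tfun_bound.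
  apply: le_trans hb _; apply: ler_pM; rewrite ?powR_ge0 ?(ltW b0)//.
    by rewrite lerDr /tconst mulr_ge0 ?addr_ge0 ?powR_ge0// mulr_ge0// ltW.
  apply: ge0_ler_powR; rewrite ?nnegrE ?subr_ge0// ?(ltW (rho_gt0 ta0 dl0 s))//.
    by rewrite addr_ge0 ?ta0 ?ltW.
  exact: rho_ta.
- by move=> s; apply: (tfun1_ge (E := E)).
Qed.
End test_function.

(** * Quantile coupling *)

Section quantile.
Context {R : realType}.
Local Notation mu := (@lebesgue_measure R).
Local Notation gam := (normal_prob (0 : R) 1).

Definition gcdf (z : R) : R := gpeak * gprim (fun=> 1) z.

Lemma pbound1 : pbound 1 0 (fun=> 1 : R).
Proof. by move=> y; rewrite powRr0 mulr1 normr1. Qed.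

Lemma gam_itv z : (gam [set` `]-oo, z]] = (gcdf z)%:E)%E.
Proof.
have ip : mu.-integrable `]-oo, z] (EFin \o normal_pdf (0 : R) 1).
  by apply: integrableS (integrable_normal_pdf 0 1).
have ig : mu.-integrable `]-oo, z] (EFin \o (fun w => 1 * gphi w)).
  have := integrable_pbound (lexx 0) (measurable_cst (1 : R)) pbound1.
  by apply: integrableS.
rewrite /gcdf /gprim -RintegralZl// /normal_prob /Rintegral fineK; last first.
  by apply: integrable_fin_num => //; exact: (integrableZl _ gpeak ig).
by apply: eq_integral => x _; rewrite pdfE mul1r.
Qed.

Lemma isd_gcdf z : isd gcdf z (gpeak * gphi z).
Proof.
have h : continuous (fun _ : R => 1 : R) by move=> x; exact: (isd_continuous (isd_cst (1 : R) x)).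
by have := isdZ gpeak (isd_gprim z (lexx 0) h pbound1); rewrite mul1r.
Qed.

Lemma gcdf_lt x y : x < y -> gcdf x < gcdf y.
Proof.
move=> xy; have [c _ h] := mvt (ltW xy) isd_gcdf.
by rewrite -subr_gt0 h mulr_gt0 ?subr_gt0// mulr_gt0 ?gpeak_gt0 ?gphi_gt0.
Qed.

Lemma gcdf_le x y : x <= y -> gcdf x <= gcdf y.
Proof. by rewrite le_eqVlt => /orP[/eqP->//|/gcdf_lt/ltW]. Qed.

Lemma gcdf_cont : continuous gcdf.
Proof. by move=> x; exact: isd_continuous (isd_gcdf x). Qed.

Lemma mfun_of d d' (T : measurableType d) (U : measurableType d') (f : T -> U) :
  measurable_fun setT f -> exists g : {mfun T >-> U}, g = f :> (T -> U).
Proof.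
move=> mf; have h := isMeasurableFun.Build _ _ _ _ f mf.
by exists (HB.pack f h : {mfun T >-> U}).
Qed.

Section cdf.
Context {d} {Om : measurableType d} (P : probability Om R) (W : {RV P >-> R}).

Definition rcdf x : R := fine (cdf W x).

Lemma rcdfE x : (P (W @^-1` `]-oo, x]) = (rcdf x)%:E)%E.
Proof. by rewrite /rcdf fineK// fin_num_measure. Qed.

Lemma rcdf_le x y : x <= y -> rcdf x <= rcdf y.
Proof. by move=> xy; rewrite fine_le ?fin_num_measure// cdf_nondecreasing. Qed.

Lemma rcdf_ge0 x : 0 <= rcdf x. Proof. exact: fine_ge0 (cdf_ge0 W x). Qed.

Lemma rcdf_le1 x : rcdf x <= 1.
Proof. by rewrite -lee_fin /rcdf fineK ?fin_num_measure// cdf_le1. Qed.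

Lemma rcdf_hi a : a < 1 -> exists x, a < rcdf x.
Proof.
have h : rcdf @ +oo --> (1 : R) by exact/fine_cvg/cvg_cdfy1.
move=> a1; have hl : \forall t \near +oo, a < rcdf t by exact: (cvgr_gt _ h).
by have [x] := filter_ex hl; exists x.
Qed.

Lemma rcdf_lo a : 0 < a -> exists x, rcdf x < a.
Proof.
have h : rcdf @ -oo --> (0 : R) by exact/fine_cvg/cvg_cdfNy0.
move=> a0; have hl : \forall t \near -oo, rcdf t < a by exact: (cvgr_lt _ h).
by have [x] := filter_ex hl; exists x.
Qed.

Lemma rcdf_right x a : rcdf x < a -> exists2 y, x < y & rcdf y < a.
Proof.
have h : rcdf y @[y --> x^'+] --> rcdf x.
  by apply: fine_cvg; rewrite -rcdfE; exact: cdf_right_continuous.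
move=> xa; have hl : \forall t \near x^'+, rcdf t < a by exact: (cvgr_lt _ h).
have hb : \forall y \near x^'+, x < y /\ rcdf y < a by apply: filterI => //; exact: nbhs_right_gt.
by have [y [xy ya]] := filter_ex hb; exists y.
Qed.

(** The quantile function of [W] at the level [gcdf z], so that the normal variable itself drives
    the coupling. *)
Definition quant z : R := inf [set x | gcdf z <= rcdf x].

End cdf.

Lemma gcdf_bounds z : 0 < gcdf z < 1.
Proof.
have h y : 0 <= gcdf y <= 1.
  by rewrite -!lee_fin -gam_itv measure_ge0/= probability_le1.
have z1 : z - 1 < z by rewrite gtrBl.
have z2 : z < z + 1 by rewrite ltrDl.
have /andP[h1 _] := h (z - 1); have /andP[_ h2] := h (z + 1).
by rewrite (le_lt_trans h1 (gcdf_lt z1)) (lt_le_trans (gcdf_lt z2) h2).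
Qed.

(** Seen as a random variable under the normal law, the identity lends [gcdf] the limits of a
    distribution function at both ends. *)
Lemma gcdf_id : exists g : {RV gam >-> R}, (forall z, g z = z) /\ forall z, rcdf g z = gcdf z.
Proof.
have mi : measurable_fun setT (fun z : measurableTypeR R => z : R) by exact: measurable_id.
have [g gE] := mfun_of mi; exists g; split=> [z|z]; first by rewrite gE.
by apply: EFin_inj; rewrite -rcdfE -gam_itv gE.
Qed.

Lemma gcdf_surj a : 0 < a < 1 -> exists z, gcdf z = a.
Proof.
move=> /andP[a0 a1]; have [g [_ gE]] := gcdf_id.
have [x xa] := rcdf_lo g a0; have [y ya] := rcdf_hi g a1.
rewrite !gE in xa ya; have xy : x <= y.
  by rewrite leNgt; apply/negP => /ltW/gcdf_le yx; lra.
have [||z _ ze] := @IVT R gcdf x y a xy; last by exists z.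
  by apply: continuous_subspaceT => z; exact: gcdf_cont.
by rewrite ge_min le_max (ltW xa) (ltW ya) orbT.
Qed.

Section coupling.
Context {d} {Om : measurableType d} (P : probability Om R) (W : {RV P >-> R}).
Local Notation F := (rcdf W).
Local Notation Q := (quant W).

(** A Galois connection; the direction from left to right needs the infimum to be attained, which is
    right continuity of [rcdf]. Monotonicity and the law of [quant] are read off from it. *)
Lemma quantP z x : (Q z <= x) = (gcdf z <= F x).
Proof.
have /andP[g0 g1] := gcdf_bounds z.
have [y0 hy0] := rcdf_lo W g0; have [y1 hy1] := rcdf_hi W g1.
have lo y : y < gcdf z -> True by [].
have lb t : F t < gcdf z -> lbound [set x | gcdf z <= F x] t.
  move=> ht s /= hs; rewrite leNgt; apply/negP => /ltW/(rcdf_le W) st; lra.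
apply/idP/idP => [|h]; last by apply: ge_inf => //; exists y0; exact: lb.
apply: contraTT; rewrite -!ltNge => /rcdf_right[y xy hy].
apply: (lt_le_trans xy); apply: lb_le_inf; last exact: lb.
by exists y1; exact: ltW.
Qed.

Lemma quant_le z z' : z <= z' -> Q z <= Q z'.
Proof.
by move=> zz; rewrite quantP; apply: le_trans (gcdf_le zz) _; rewrite -quantP.
Qed.

Lemma measurable_quant : measurable_fun setT (Q : measurableTypeR R -> R).
Proof. by apply: nondecreasing_measurable => // x y; exact: quant_le. Qed.

(** By [quantP] the event is [gcdf z <= F x]. It is a half-line ending where [gcdf] takes the value
    [F x], except if [F x] is 0 or 1, values that [gcdf] never takes. *)
Lemma quant_cdf x : gam (Q @^-1` `]-oo, x]) = P (W @^-1` `]-oo, x]).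
Proof.
rewrite rcdfE (_ : _ @^-1` _ = [set z | gcdf z <= F x]); last first.
  by apply/seteqP; split=> z /=; rewrite in_itv/= quantP.
have := rcdf_ge0 W x; rewrite le_eqVlt => /orP[/eqP F0|F0].
  rewrite -F0 (_ : [set z | _] = set0) ?measure0//; apply/seteqP; split=> z //=.
  by rewrite leNgt; case/andP: (gcdf_bounds z) => ->.
have := rcdf_le1 W x; rewrite le_eqVlt => /orP[/eqP F1|F1].
  rewrite F1 (_ : [set z | _] = setT) ?probability_setT//; apply/seteqP; split=> z //= _.
  by case/andP: (gcdf_bounds z) => _ /ltW.
have [|z0 z0E] := @gcdf_surj (F x); first by rewrite F0.
rewrite -z0E -gam_itv; congr (gam _); apply/seteqP; split=> z /=; rewrite in_itv/=.
  by rewrite leNgt => h; rewrite leNgt; apply: contra h; exact: gcdf_lt.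
exact: gcdf_le.
Qed.

Lemma quant_law (A : set R) : measurable A -> gam (Q @^-1` A) = P (W @^-1` A).
Proof.
have [q qE] := mfun_of measurable_quant.
move=> mA; rewrite -qE -/(distribution gam q A) -/(distribution P W A).
have GO x : distribution gam q `]x, +oo[ = distribution P W `]x, +oo[.
  have e : [set` `]x, +oo[] = ~` [set` `]-oo, x]] :> set R by rewrite setCitvl.
  rewrite e (probability_setC (distribution gam q))// (probability_setC (distribution P W))//.
  by congr (_ - _)%E; have := quant_cdf x; rewrite -qE.
apply: (@g_sigma_algebra_measure_unique _ R _ (@RGenOInfty.G R) _ (fun n => [set` `](- n%:R), +oo[]) _ _ (distribution gam q) (distribution P W)).
- by move=> _ [x ->].
- by move=> n; exists (- n%:R).
- apply/seteqP; split=> // x _; exists (Num.truncn (- x)).+1 => //=.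
  by rewrite in_itv/= andbT ltrNl truncnS_gt.
- move=> _ _ [x ->] [y ->]; exists (Num.max x y).
  by apply/seteqP; split=> t /=; rewrite !in_itv/= !andbT gt_max => /andP.
- by move=> _ [x ->]; exact: GO.
- by move=> n; apply: le_lt_trans (probability_le1 _ _) _; rewrite ?ltry.
- have mA' : (@ocitv R).-sigma.-measurable A := mA.
  by rewrite RGenOInfty.measurableE in mA'.
Qed.

Lemma quant_ge0 (f : R -> R) : measurable_fun setT f -> (forall x, 0 <= f x) ->
  (\int[gam]_z (f (Q z))%:E = \int[P]_x (f (W x))%:E)%E.
Proof.
move=> mf f0; have [q qE] := mfun_of measurable_quant.
have mf' : measurable_fun setT (EFin \o f) by exact/measurable_EFinP.
have e1 := @ge0_integral_distribution _ _ _ _ _ gam q (EFin \o f) mf' (fun y => ltac:(by rewrite /= lee_fin)).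
have e2 := @ge0_integral_distribution _ _ _ _ _ P W (EFin \o f) mf' (fun y => ltac:(by rewrite /= lee_fin)).
rewrite -[RHS]/(\int[P]_x ((EFin \o f) \o W) x)%E -e2.
rewrite (_ : (\int[gam]_z _)%E = (\int[gam]_z ((EFin \o f) \o q) z)%E); last by rewrite qE.
rewrite -e1; apply: eq_measure_integral => A mA _.
have := quant_law mA; by rewrite -qE.
Qed.

Lemma quant_itg (f : R -> R) : measurable_fun setT f -> itg P (f \o W) -> itg gam (f \o Q).
Proof.
move=> mf /integrableP[_ h]; apply/integrableP; split.
  by apply/measurable_EFinP; apply: measurableT_comp => //; exact: measurable_quant.
have := @quant_ge0 (fun x => `|f x|) (measurableT_comp (@normr_measurable _ _) mf) (fun x => normr_ge0 _).
by move=> e; move: h; rewrite /= -e.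
Qed.

(** Adding [|f|] reduces the signed case to nonnegative functions. *)
Lemma quant_Ex (f : R -> R) : measurable_fun setT f -> itg P (f \o W) -> Ex gam (f \o Q) = Ex P (f \o W).
Proof.
move=> mf hi; have hq := quant_itg mf hi.
have hn : itg P (fun x => `|f (W x)|) by exact: itg_norm.
have hqn : itg gam (fun x => `|f (Q x)|) by exact: itg_norm.
have mn : measurable_fun setT (fun x => `|f x| + f x).
  by apply: measurable_funD => //; exact: measurableT_comp.
have e1 : Ex gam (fun x => `|f (Q x)|) = Ex P (fun x => `|f (W x)|).
  by rewrite /Ex /Rintegral (@quant_ge0 (fun x => `|f x|))//; exact: measurableT_comp.
have e2 : Ex gam (fun x => `|f (Q x)| + f (Q x)) = Ex P (fun x => `|f (W x)| + f (W x)).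
  rewrite /Ex /Rintegral (@quant_ge0 (fun x => `|f x| + f x))// => x.
  by have := ler_norm (- f x); rewrite normrN; lra.
rewrite !ExD// e1 in e2; exact: addrI e2.
Qed.

Lemma Wasserstein_quant p : 0 < p -> (Wasserstein p (distribution P W) gam <=
  (\int[gam]_z (`|Q z - z| `^ p)%:E) `^ p^-1)%E.
Proof.
move=> p0; have mp : measurable_fun setT (fun z : measurableTypeR R => (Q z, z : R)).
  by apply/measurable_fun_pairP; split; [exact: measurable_quant|exact: measurable_id].
have [q qE] := mfun_of mp; apply: ereal_inf_le; eexists; last exact: lexx.
have e := @ge0_integral_distribution _ _ _ _ _ gam q (fun z => (`|z.1 - z.2| `^ p)%:E).
exists (distribution gam q); last first.
  rewrite e; first by rewrite qE.
    apply/measurable_EFinP; apply: (measurableT_comp (measurable_powR p)).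
    apply: measurableT_comp => //; apply: measurable_funB; [exact: measurable_fst|exact: measurable_snd].
  by move=> y; rewrite /= lee_fin powR_ge0.
have qx z : q z = (Q z, z) by rewrite qE.
move=> A mA; rewrite /distribution /pushforward; split.
  by rewrite -quant_law//; congr (gam _); apply/seteqP; split=> z /=; rewrite qx.
by congr (gam _); apply/seteqP; split=> z /=; rewrite qx.
Qed.

End coupling.
End quantile.

(** * Gaussian integration by parts for the expansion *)

Section duality.
Context {R : realType}.
Local Notation gam := (normal_prob (0 : R) 1).
Implicit Types (f g h : R -> R) (q Q : {poly R}).

Definition temp f := continuous f /\ exists B n, 0 <= B /\ pbound B n%:R f.

Lemma tempM f g : temp f -> temp g -> temp (fun x => f x * g x).
Proof.
move=> [cf [B [n [B0 hf]]]] [cg [B' [n' [B0' hg]]]]; split.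
  by move=> x; apply: continuousM; [exact: cf|exact: cg].
exists (B * B'), (n + n')%N; split; first exact: mulr_ge0.
move=> x; have a0 : 0 < 1 + `|x| by rewrite ltr_wpDr.
rewrite normrM natrD powRD ?(gt_eqF a0) ?implybT// mulrACA.
by apply: ler_pM.
Qed.

Lemma tempD f g : temp f -> temp g -> temp (fun x => f x + g x).
Proof.
move=> [cf [B [n [B0 hf]]]] [cg [B' [n' [B0' hg]]]]; split.
  by move=> x; apply: continuousD; [exact: cf|exact: cg].
exists (B + B'), (n + n')%N; split; first exact: addr_ge0.
move=> x; apply: le_trans (ler_normD _ _) _; rewrite mulrDl; apply: lerD.
  by apply: (pbound_mono (lexx B) _ hf); rewrite ler_nat leq_addr.
by apply: (pbound_mono (lexx B') _ hg); rewrite ler_nat leq_addl.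
Qed.

Lemma temp_horner q : temp (fun x => q.[x]).
Proof.
split; first by move=> x; exact: isd_continuous (isd_horner q x).
by have [B B0 hB] := horner_bound q; exists B, (size q).
Qed.

Lemma tempN f : temp f -> temp (fun x => - f x).
Proof.
move=> hf; have := tempM (temp_horner (-1)%:P) hf; congr temp; apply/funext => x.
by rewrite hornerC mulN1r.
Qed.

Lemma tempB f g : temp f -> temp g -> temp (fun x => f x - g x).
Proof. by move=> hf hg; have := tempD hf (tempN hg). Qed.

Lemma temp_id : temp (fun x => x).
Proof. by have := temp_horner 'X; congr temp; apply/funext => x; rewrite hornerX. Qed.

Lemma temp_norm f : temp f -> temp (fun x => `|f x|).
Proof.
move=> [cf [B [n [B0 hf]]]]; split; last by exists B, n; split=> // x; rewrite normr_id.
by move=> x; apply: continuous_comp; [exact: cf|exact: norm_continuous].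
Qed.

Lemma temp_itg f : temp f -> itg gam f.
Proof.
by move=> [cf [B [n [B0 hf]]]]; apply: itg_pbound hf => //; exact: continuous_measurable_fun.
Qed.

Lemma smooth_temp m w H (F : nat -> R -> R) j : 0 < w <= 1 -> smooth m w H F -> (j <= m)%N -> temp (F j).
Proof.
move=> /andP[w0 w1] hF jm; split; first exact: smooth_continuous hF jm.
have [B B0 hB] := smooth_pbound w0 (smooth_shift jm hF).
rewrite /shiftn addn0 in hB; exists B, (m - j).+1; split=> //; apply: (pbound_mono (lexx B) _ hB).
by rewrite -natr1 lerD2l.
Qed.

Lemma gauss_parts f f' : temp f -> temp f' -> (forall y, isd f y (f' y)) ->
  Ex gam f' = Ex gam (fun x => x * f x).
Proof.
move=> tf tf' df; have tv := tempB tf' (tempM temp_id tf).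
have [cf [B [n [B0 hf]]]] := tf; have [cv [C [m [C0 hv]]]] := tv.
have i1 := temp_itg tf'; have i2 := temp_itg (tempM temp_id tf).
apply/eqP; rewrite -subr_eq0 -ExB//; apply/eqP.
apply: (gauss_ibp (u := fun y => f y * gphi y) _ cv hv) => //.
- by move=> y; apply: isd_eq (isdM (df y) (isd_gphi y)) _; ring.
- exact: van_poly hf.
have hfN y : `|f (- y)| <= B * (1 + `|y|) `^ n%:R by have := hf (- y); rewrite normrN.
have := van_poly (ler0n R n) hfN; congr van; apply/funext => y; by rewrite gphiN.
Qed.

(** The adjoint of differentiation under the normal law, on polynomials. *)
Definition mulstep q := 'X * q - q^`().

Lemma Ex_mulstep q f f' : temp f -> temp f' -> (forall y, isd f y (f' y)) ->
  Ex gam (fun x => q.[x] * f' x) = Ex gam (fun x => (mulstep q).[x] * f x).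
Proof.
move=> tf tf' df.
have t1 := tempM (temp_horner q) tf; have t2 := tempM (temp_horner q^`()) tf.
have t3 := tempM (temp_horner q) tf'.
have := gauss_parts t1 (tempD t2 t3) (fun y => isdM (isd_horner q y) (df y)).
rewrite ExD; [|exact: temp_itg|exact: temp_itg]; move=> e.
rewrite (_ : (fun x => (mulstep q).[x] * f x) = fun x => x * (q.[x] * f x) - q^`().[x] * f x).
  by rewrite ExB; [rewrite -e; ring|apply: temp_itg; exact: tempM temp_id t1|exact: temp_itg].
by apply/funext => x; rewrite /mulstep hornerD hornerN hornerM hornerX; ring.
Qed.

Lemma Ex_iter_mulstep n (F : nat -> R -> R) i : (i <= n)%N -> (forall j, (j <= n)%N -> temp (F j)) ->
  (forall j y, (j < n)%N -> isd (F j) y (F j.+1 y)) -> forall q,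
  Ex gam (fun x => q.[x] * F i x) = Ex gam (fun x => (iter i mulstep q).[x] * F 0%N x).
Proof.
move=> + tF dF; elim: i => // i IH in_ q; rewrite (@Ex_mulstep q (F i)).
- by rewrite IH ?(ltnW in_)// -iterSr.
- exact: tF (ltnW in_).
- exact: tF.
- by move=> y; exact: dF.
Qed.

(** [mulstep] after differentiation is the Ornstein-Uhlenbeck number operator, so [dualop]
    multiplies the Hermite polynomial of degree [n] by [n + 1]. *)
Definition dualop Q := mulstep Q^`() + Q.

(** Triangularity takes the place of the Hermite basis: on ['X^m] the leading coefficient is
    multiplied by [m + 1] and all other terms have lower degree, so the degree can be reduced. *)
Lemma dualop_onto q : exists Q, dualop Q = q.
Proof.
have [n] := ubnP (size q); elim: n q => // n IH q; rewrite ltnS => sq.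
have DD (A B : {poly R}) : dualop (A + B) = dualop A + dualop B.
  by rewrite /dualop /mulstep !derivD; ring.
case: n IH sq => [|m] IH sq.
  exists 0; rewrite /dualop /mulstep !deriv0 mulr0 subr0 addr0.
  by apply/esym/eqP; rewrite -size_poly_leq0.
pose c := q`_m / m.+1%:R; pose A := c *: 'X^m : {poly R}.
have [|Q hQ] := IH (q - dualop A); last by exists (Q + A); rewrite DD hQ subrK.
rewrite ltnS; apply/leq_sizeP => j mj.
have e : (dualop A)`_j = A`_j *+ j.+1 - A`_j.+2 *+ (j.+2 * j.+1).
  rewrite /dualop /mulstep coefD coefB coefXM !coef_deriv -mulrnA.
  case: j {mj} => [|j]; rewrite /=; first by rewrite mulr1n sub0r addrC.
  by rewrite addrAC -mulrSr.
have j2 : (m <= j -> (j.+2 == m) = false)%N by move=> mj'; rewrite gtn_eqF// ltnS ltnW.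
rewrite coefB e /A !coefZ !coefXn (j2 mj) mulr0 mul0rn subr0; move: mj {j2 e}.
rewrite leq_eqVlt => /predU1P[<-|mj].
  by rewrite eqxx mulr1 -mulr_natr /c divfK ?subrr// pnatr_eq0.
rewrite gtn_eqF// mulr0 mul0rn subr0.
by apply: nth_default; exact: leq_trans sq mj.
Qed.

(** Integration by parts moves the [i] derivatives of [F = Theta h] onto the polynomial. Multiplying
    [F'' = x F' + F + h'] by [Q] and integrating by parts gives [E[(dualop Q) F] = - E[Q h']], so it
    remains to invert [dualop]. The polynomial found depends on [q] and [i] alone, which makes later
    bounds uniform in [h]. *)
Lemma Theta_dual q i : exists Q, forall m w H h, 0 < w <= 1 -> 0 <= H -> (0 < m)%N -> (i <= m.+1)%N ->
  smooth m w H (dseq h) ->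
  Ex gam (fun x => q.[x] * dseq (Theta h) i x) = Ex gam (fun x => Q.[x] * dseq h 1%N x).
Proof.
have [Q hQ] := dualop_onto (iter i mulstep q).
exists (- Q) => m w H h w01 H0 m0 im hh; have [C C0 hC] := theta_regular m w01.
have [hT T1] := hC H h H0 hh; pose F := dseq (Theta h).
have dF j y : (j < m.+1)%N -> isd (F j) y (F j.+1 y) by case: hT => h1 _; exact: h1.
have tF j : (j <= m.+1)%N -> temp (F j) by exact: smooth_temp hT.
have th j : (j <= m)%N -> temp (dseq h j) by exact: smooth_temp hh.
have m2 : (1 < m.+1)%N by [].
have F2 x : F 2%N x = x * F 1%N x + F 0%N x + dseq h 1%N x.
  apply: (isd_uniq (dF 1%N x m2)).
  rewrite [X in isd X](_ : F 1%N = fun x => x * F 0%N x + dseq h 0%N x - gaussE h); last exact/funext.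
  have dh : isd (dseq h 0%N) x (dseq h 1%N x) by case: hh => h1 _; exact: h1.
  by apply: isd_eq (isdB (isdD (isdM (isd_id x) (dF 0%N x isT)) dh) (isd_cst _ x)) _; ring.
rewrite (Ex_iter_mulstep im tF dF) -hQ.
have P q' j : (j <= m.+1)%N -> itg gam (fun x => q'.[x] * F j x).
  by move=> jm; apply: temp_itg; apply: tempM (temp_horner _) (tF j jm).
have e1 := Ex_mulstep Q (tF 1%N isT) (tF 2%N m2) (fun y => dF 1%N y m2).
have e0 := Ex_mulstep Q^`() (tF 0%N isT) (tF 1%N isT) (fun y => dF 0%N y isT).
have i3 : itg gam (fun x => Q.[x] * dseq h 1%N x) by apply: temp_itg; apply: tempM (temp_horner _) (th 1%N m0).
have eD f g : itg gam f -> itg gam g -> forall u, (forall x, u x = f x + g x) -> Ex gam u = Ex gam f + Ex gam g.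
  by move=> hf hg u hu; rewrite -(ExD hf hg); congr (Ex gam _); apply/funext.
rewrite (eD _ _ (P (mulstep Q^`()) 0%N isT) (P Q 0%N isT)); last by move=> x; rewrite /dualop hornerD mulrDl.
rewrite -e0.
have e2 : Ex gam (fun x => Q.[x] * F 2%N x) =
    Ex gam (fun x => ('X * Q).[x] * F 1%N x) + Ex gam (fun x => Q.[x] * F 0%N x) + Ex gam (fun x => Q.[x] * dseq h 1%N x).
  have p1 := P ('X * Q) 1%N isT; have p2 := P Q 0%N isT.
  have hu x : Q.[x] * F 2%N x = ('X * Q).[x] * F 1%N x + Q.[x] * F 0%N x + Q.[x] * dseq h 1%N x.
    by rewrite F2 hornerM hornerX; ring.
  by rewrite (eD _ _ (itgD p1 p2) i3 _ hu) (eD _ _ p1 p2 _ (fun x => erefl)).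
have e3 : Ex gam (fun x => ('X * Q).[x] * F 1%N x) =
    Ex gam (fun x => (mulstep Q).[x] * F 1%N x) + Ex gam (fun x => Q^`().[x] * F 1%N x).
  have p1 := P (mulstep Q) 1%N isT; have p2 := P Q^`() 1%N isT.
  by apply: (eD _ _ p1 p2) => x; rewrite /mulstep hornerD hornerN; ring.
have -> : Ex gam (fun x => (- Q).[x] * dseq h 1%N x) = - Ex gam (fun x => Q.[x] * dseq h 1%N x).
  rewrite -[RHS]mulN1r -(ExZ (-1) i3); congr (Ex gam _); apply/funext => x; by rewrite hornerN mulN1r mulNr.
move: e2; rewrite e1 e3.
move: (Ex gam (fun x => (mulstep Q).[x] * F 1%N x)) (Ex gam (fun x => Q^`().[x] * F 1%N x)) => a b.
move: (Ex gam (fun x => Q.[x] * F 0%N x)) (Ex gam (fun x => Q.[x] * dseq h 1%N x)) => c e.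
rewrite -!addrA => /eqP; rewrite -subr_eq0 opprD addNKr oppr_eq0 => /eqP abce.
by apply/eqP; rewrite -addr_eq0 -addrA abce.
Qed.

Lemma Stein_iter_smooth t : all (fun j => 0 < j)%N t -> forall m w H h, 0 < w <= 1 -> 0 <= H ->
  (sumn t <= m)%N -> smooth m w H (dseq h) ->
  exists2 H', 0 <= H' & smooth (m - sumn t) w H' (dseq (Stein_iter t h)).
Proof.
elim: t => [|j t IH] /=; first by move=> _ m w H h _ H0 _ hh; exists H => //; rewrite subn0.
move=> /andP[j0 ht] m w H h w01 H0 jm hh.
have [|H' H0' hH'] := IH ht m w H h w01 H0 _ hh; first exact: leq_trans (leq_addl _ _) jm.
have [C C0 hC] := theta_step (m - sumn t) w01.
have jj : (j <= m - sumn t)%N by rewrite leq_subRL ?(leq_trans (leq_addl _ _) jm)// addnC.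
exists (C * H'); first by rewrite mulr_ge0// ltW.
by have := hC j H' _ jj H0' hH'; rewrite -subnDA addnC.
Qed.

Lemma Stein_iter_dual t : all (fun j => 0 < j)%N t -> forall q, exists Q, forall m w H h, 0 < w <= 1 -> 0 <= H ->
  (sumn t < m)%N -> smooth m w H (dseq h) ->
  Ex gam (fun x => q.[x] * dseq (Stein_iter t h) 1%N x) = Ex gam (fun x => Q.[x] * dseq h 1%N x).
Proof.
elim: t => [|j t IH] /=; first by move=> _ q; exists q.
move=> /andP[j0 ht] q; have [Q hQ] := Theta_dual q j.+2; have [Q' hQ'] := IH ht Q.
exists Q' => m w H h w01 H0 jm hh.
have tm : (sumn t < m)%N by apply: leq_ltn_trans jm; exact: leq_addl.
rewrite -(hQ' m w H h w01 H0 tm hh); have [H' H0' hH'] := Stein_iter_smooth ht w01 H0 (ltnW tm) hh.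
have jj : (j < m - sumn t)%N by rewrite ltn_subRL addnC.
have m0 : (0 < m - sumn t)%N by rewrite subn_gt0.
exact: (hQ (m - sumn t)%N w H' _ w01 H0' m0 jj hH').
Qed.

(** The mean is the case [q = 1], and it takes one derivative fewer than [Stein_iter_dual]; hence
    [sumn t <= m] in place of a strict inequality. *)
Lemma gaussE_Stein_iter t : (0 < size t)%N -> all (fun j => 0 < j)%N t -> exists Q, forall m w H h, 0 < w <= 1 -> 0 <= H ->
  (sumn t <= m)%N -> smooth m w H (dseq h) ->
  gaussE (Stein_iter t h) = Ex gam (fun x => Q.[x] * dseq h 1%N x).
Proof.
case: t => // j t _ /= /andP[j0 ht]; have [Q hQ] := Theta_dual 1 j.+1; have [Q' hQ'] := Stein_iter_dual ht Q.
exists Q' => m w H h w01 H0 jm hh.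
have tm : (sumn t < m)%N by apply: leq_trans jm; rewrite -add1n leq_add2r.
rewrite -(hQ' m w H h w01 H0 tm hh); have [H' H0' hH'] := Stein_iter_smooth ht w01 H0 (ltnW tm) hh.
have jj : (j.+1 <= (m - sumn t).+1)%N by rewrite ltnS leq_subRL ?(ltnW tm)// addnC.
have m0 : (0 < m - sumn t)%N by rewrite subn_gt0.
rewrite -(hQ (m - sumn t)%N w H' _ w01 H0' m0 jj hH').
by congr (Ex gam _); apply/funext => x; rewrite hornerC mul1r.
Qed.

(** The first factor keeps one power of [eps]; all remaining powers are bounded by those of [E0]. *)
Lemma prod_kap_bound (K E0 : R) t : 0 <= K -> 0 <= E0 -> (0 < size t)%N -> all (fun j => 0 < j)%N t ->
  exists2 C, 0 <= C & forall (kap : nat -> R) eps, 0 < eps <= E0 ->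
    (forall s, s \in t -> `|kap s| <= K * eps `^ s%:R) -> `|\prod_(j <- t) kap j| <= C * eps.
Proof.
move=> K0 E00; case: t => // j t _ /= /andP[j0 ht].
have P (s : nat) eps : 0 < eps <= E0 -> eps `^ s%:R <= E0 `^ s%:R.
  by move=> /andP[e0 e1]; apply: ge0_ler_powR; rewrite ?nnegrE// ltW.
exists (K * E0 `^ j.-1%:R * \prod_(s <- t) (K * E0 `^ s%:R)).
  by rewrite mulr_ge0 ?mulr_ge0 ?powR_ge0//; apply: prodr_ge0 => s _; rewrite mulr_ge0 ?powR_ge0.
move=> kap eps e0 h; have /andP[e00 _] := e0.
rewrite big_cons normrM mulrAC; apply: ler_pM; rewrite ?normr_ge0//.
  apply: le_trans (h j _) _; first by rewrite mem_head.
  rewrite -mulrA ler_wpM2l// -[in leLHS](prednK j0) -[j.-1.+1%:R]natr1 powRD ?(gt_eqF e00) ?implybT//.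
  by rewrite powRr1 ?(ltW e00)// ler_wpM2r ?(ltW e00)// P.
rewrite normr_prod big_seq [leRHS]big_seq; apply: ler_prod => s st; rewrite normr_ge0/=.
apply: le_trans (h s _) _; first by rewrite in_cons st orbT.
by rewrite ler_wpM2l// P.
Qed.

(** Every term of the expansion has at least one cumulant and so a factor [eps]; the rest of the
    rate has to come from the size of [h'], kept inside the integral against a single polynomial
    weight. *)
Lemma gexp_dual k (w K E0 : R) : 0 < w <= 1 -> 0 <= K -> 0 <= E0 -> exists B n, 0 <= B /\
  forall (kap : nat -> R) eps H h, 0 < eps <= E0 -> 0 <= H ->
    (forall s, (0 < s <= k)%N -> `|kap s| <= K * eps `^ s%:R) -> smooth k w H (dseq h) ->
    `|gexp kap k h| <= eps * Ex gam (fun x => `|dseq h 1%N x| * (B * (1 + `|x|) `^ n%:R)).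
Proof.
move=> w01 K0 E00; rewrite /gexp.
have [k0|k0] := posnP k.
  exists 0, 0%N; split=> // kap eps H h /andP[e0 _] _ _ _; rewrite k0 big_nil normr0.
  by rewrite mulr_ge0 ?(ltW e0)//; apply: Ex_ge0 => x; rewrite mul0r mulr0.
have : all (fun t => [&& (0 < size t)%N, all (fun j => 0 < j)%N t & (sumn t <= k)%N]) (gams k k).
  by apply/allP => t; rewrite mem_gams.
elim: (gams k k) => [_|t r IH /= /andP[/and3P[t1 t2 t3] /IH[B [n [B0 hB]]]]].
  exists 0, 0%N; split=> // kap eps H h /andP[e0 _] _ _ _; rewrite big_nil normr0.
  by rewrite mulr_ge0 ?(ltW e0)//; apply: Ex_ge0 => x; rewrite mul0r mulr0.
have [Q hQ] := gaussE_Stein_iter t1 t2; have [C C0 hC] := prod_kap_bound K0 E00 t1 t2.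
have [_ [B' [n' [B0' hQ']]]] := temp_horner Q.
exists (B + C * B'), (n + n')%N; split; first by rewrite addr_ge0// mulr_ge0.
move=> kap eps H h e0 H0 hk hh; have /andP[e00 _] := e0; rewrite big_cons.
apply: le_trans (ler_normD _ _) _.
have t1' : temp (fun x => `|dseq h 1%N x|) by apply: temp_norm; exact: smooth_temp hh _.
have tp (b : R) (m : nat) : temp (fun x => b * (1 + `|x|) `^ m%:R).
  have := tempM (temp_horner b%:P) (_ : temp (fun x => (1 + `|x|) `^ m%:R)); rewrite (_ : (fun x => b%:P.[x] * _) = fun x => b * (1 + `|x|) `^ m%:R).
    apply; elim: m => [|m IH'].
      by have := temp_horner 1; congr temp; apply/funext => x; rewrite hornerC powRr0.
    have := tempM IH' (tempD (temp_horner 1) (temp_norm temp_id)); congr temp; apply/funext => x.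
    by rewrite -natr1 powRD ?powRr1 ?hornerC// ?addr_ge0// gt_eqF ?implybT// ltr_wpDr.
  by apply/funext => x; rewrite hornerC.
have i1 b m := temp_itg (tempM t1' (tp b m)).
have mono (b : R) (m m' : nat) x : 0 <= b -> (m <= m')%N -> b * (1 + `|x|) `^ m%:R <= b * (1 + `|x|) `^ m'%:R.
  by move=> b0 mm; rewrite ler_wpM2l// ler_powR ?lerDl// ler_nat.
have h1 : `|gterm kap h t| <= eps * Ex gam (fun x => `|dseq h 1%N x| * (C * B' * (1 + `|x|) `^ n'%:R)).
  rewrite /gterm (hQ k w H)// !normrM normrX normrN1 expr1n mul1r.
  apply: (@le_trans _ _ (C * eps * Ex gam (fun x => `|dseq h 1%N x| * (B' * (1 + `|x|) `^ n'%:R)))).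
    apply: ler_pM => //.
      apply: hC => // s st; apply: hk; move/allP : t2 => -> //=.
      by apply: leq_trans t3; rewrite (perm_sumn (perm_to_rem st))/= leq_addr.
    have i0 : itg gam (fun x => Q.[x] * dseq h 1%N x).
      by apply: temp_itg; apply: tempM (temp_horner _) _; exact: smooth_temp w01 hh k0.
    apply: (Ex_normle i0 (i1 B' n')) => x; rewrite normrM mulrC ler_wpM2l ?normr_ge0//.
  rewrite [C * eps]mulrC -mulrA; apply: ler_wpM2l; first exact: ltW.
  rewrite -(ExZ C (i1 B' n')) le_eqVlt; apply/orP; left; apply/eqP.
  by congr (Ex gam _); apply/funext => x; ring.
apply: le_trans (lerD h1 (hB kap eps H h e0 H0 hk hh)) _.
rewrite -mulrDr ler_wpM2l ?(ltW e00)// -ExD; [|exact: i1|exact: i1].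
apply: Ex_le; [by apply: itgD; exact: i1|exact: i1|move=> x].
rewrite -mulrDr ler_wpM2l// mulrDl addrC; apply: lerD; apply: mono; rewrite ?mulr_ge0 ?leq_addr ?leq_addl//.
Qed.

End duality.

(** * Transport distance *)

Section transport.
Context {R : realType}.
Local Notation gam := (normal_prob (0 : R) 1).

(** Young's inequality by cases on [b <= lam * a]; no conjugate exponent occurs, and [p = 1] is
    included. *)
Lemma powR_split (a b lam p : R) : 0 <= a -> 0 <= b -> 0 < lam -> 1 <= p ->
  a `^ (p - 1) * b <= lam * a `^ p + lam `^ (1 - p) * b `^ p.
Proof.
move=> a0 b0 l0 p1; have p0 : 0 < p by apply: lt_le_trans p1.
have [h|h] := leP b (lam * a).
  apply: (@le_trans _ _ (a `^ (p - 1) * (lam * a))); first by rewrite ler_wpM2l ?powR_ge0.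
  by rewrite mulrCA [a `^ _ * a]mulrC mulr_powRB1// lerDl mulr_ge0 ?powR_ge0.
apply: (@le_trans _ _ ((b / lam) `^ (p - 1) * b)).
  rewrite ler_wpM2r//; apply: ge0_ler_powR; rewrite ?nnegrE ?subr_ge0 ?divr_ge0 ?(ltW l0)//.
  by rewrite ler_pdivlMr// mulrC ltW.
rewrite powRM ?invr_ge0 ?(ltW l0)// -(powR_inv1 (ltW l0)) -powRrM mulN1r opprB mulrAC [_ * b]mulrC mulr_powRB1//.
by rewrite mulrC lerDr mulr_ge0 ?powR_ge0 ?(ltW l0).
Qed.

Lemma powRD_le (a b p : R) : 0 <= a -> 0 <= b -> 0 <= p -> (a + b) `^ p <= 2 `^ p * (a `^ p + b `^ p).
Proof.
move=> a0 b0 p0; wlog ab : a b a0 b0 / a <= b.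
  by move=> h; have [/h|/ltW/h] := leP a b; [apply|rewrite addrC [_ + b `^ _]addrC; apply].
apply: (@le_trans _ _ ((2 * b) `^ p)).
  by apply: ge0_ler_powR; rewrite ?nnegrE ?addr_ge0 ?mulr_ge0//; lra.
by rewrite powRM// ler_wpM2l ?powR_ge0// lerDr powR_ge0.
Qed.

(** On the middle third of [[a, b]] the radius is at least [(b - a) / 3]: for [t] in the interval
    the growth of [ta] and the distance add up to it, for [t] outside the distance alone does. *)
Lemma transport_gain (f0 f1 ta : R -> R) dl c p a b : (forall s, isd f0 s (f1 s)) -> (forall s, 0 <= f1 s) ->
  (forall s, c * rho ta dl s `^ (p - 1) <= f1 s) -> (forall t, 0 <= ta t) -> 0 < dl -> 1 <= p -> 0 <= c -> a <= b ->
  (forall t, a <= t <= b -> t - a <= ta t) \/ (forall t, a <= t <= b -> b - t <= ta t) ->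
  c * ((b - a) / 3) `^ p <= f0 b - f0 a.
Proof.
move=> df f10 fc ta0 dl0 p1 c0 ab hta; have p0 : 0 < p by apply: lt_le_trans p1.
have mon x y : x <= y -> f0 x <= f0 y.
  by move=> xy; have [z _ e] := mvt xy df; rewrite -subr_ge0 e mulr_ge0// subr_ge0.
pose L := (b - a) / 3; have L0 : 0 <= L by rewrite divr_ge0// subr_ge0.
have bL : b = a + 3 * L by rewrite /L mulrC divfK// addrC subrK.
have m1 := mon a (a + L); have m2 := mon (a + 2 * L) b.
have [||z /andP[z1 z2] e] := @mvt _ f0 f1 (a + L) (a + 2 * L); [lra|exact: df|].
have hz : L + dl <= rho ta dl z.
  apply: le_rho => // t; have t0 := ta0 t.
  have n1 := ler_norm (z - t); have n2 := ler_norm (- (z - t)); rewrite normrN in n2.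
  have [ta'|at'] := leP a t; last by lra.
  have [bt|tb] := leP t b; last by lra.
  by case: hta => /(_ t) ht; have := ht ltac:(by rewrite ta' bt); lra.
have : c * L `^ p <= f0 (a + 2 * L) - f0 (a + L).
  rewrite e (_ : a + 2 * L - (a + L) = L); last by ring.
  rewrite -(mulr_powRB1 L0 p0) mulrCA mulrC ler_wpM2r//; apply: le_trans (fc z); rewrite ler_wpM2l//.
  by apply: ge0_ler_powR; rewrite ?nnegrE ?subr_ge0 ?(ltW (rho_gt0 _ _ _))//; lra.
by have := m1 ltac:(lra); have := m2 ltac:(lra); rewrite -/L; lra.
Qed.

Lemma transport_loss (f0 f1 ta : R -> R) dl C p a b : (forall s, isd f0 s (f1 s)) ->
  (forall s, 0 <= f1 s <= C * (ta s + dl) `^ (p - 1)) -> a <= b -> (forall t, a <= t <= b -> ta t = 0) ->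
  f0 b - f0 a <= C * dl `^ (p - 1) * (b - a).
Proof.
move=> df fC ab ht; have [z zab ->] := mvt ab df; rewrite ler_wpM2r ?subr_ge0//.
by have /andP[_] := fC z; rewrite (ht z zab) add0r.
Qed.

(** Monotonicity of [X] is decisive. If [X z <= z], then [tau t >= t - X z] between the two points,
    so the positive part is large and the negative part vanishes there: [f], built on the former,
    gains, and [g], built on the latter, moves only by the contribution of [dl]. The other sign
    exchanges the roles. *)
Lemma transport_pointwise (X : R -> R) (f g : nat -> R -> R) dl C c p :
  let tau z := z - X z in let tp z := Num.max 0 (tau z) in let tm z := Num.max 0 (- tau z) in
  (forall z z', z <= z' -> X z <= X z') -> 0 < dl -> 1 <= p -> 0 <= c ->
  (forall s, isd (f 0%N) s (f 1%N s)) -> (forall s, isd (g 0%N) s (g 1%N s)) ->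
  (forall s, 0 <= f 1%N s <= C * (tp s + dl) `^ (p - 1)) -> (forall s, 0 <= g 1%N s <= C * (tm s + dl) `^ (p - 1)) ->
  (forall s, c * rho tp dl s `^ (p - 1) <= f 1%N s) -> (forall s, c * rho tm dl s `^ (p - 1) <= g 1%N s) ->
  forall z, c * (`|tau z| / 3) `^ p <=
    (f 0%N z - g 0%N z) - (f 0%N (X z) - g 0%N (X z)) + C * dl `^ (p - 1) * `|tau z|.
Proof.
move=> tau tp tm hX dl0 p1 c0 df dg fC gC fc gc z.
have f0 s : 0 <= f 1%N s by case/andP: (fC s).
have g0 s : 0 <= g 1%N s by case/andP: (gC s).
have tp0 t : 0 <= tp t by rewrite le_max lexx.
have tm0 t : 0 <= tm t by rewrite le_max lexx.
have tpg t : tau t <= tp t by rewrite le_max lexx orbT.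
have tmg t : - tau t <= tm t by rewrite le_max lexx orbT.
have [t0|t0] := leP 0 (tau z).
  have xz : X z <= z by rewrite -subr_ge0.
  have mid t : X z <= t <= z -> t - X z <= tau t by move=> /andP[t1 t2]; rewrite lerD2l lerN2 hX.
  have h1 := transport_gain df f0 fc tp0 dl0 p1 c0 xz (or_introl _).
  have h2 : g 0%N z - g 0%N (X z) <= C * dl `^ (p - 1) * (z - X z).
    apply: (transport_loss dg gC xz) => t ht; apply/max_idPl.
    by rewrite oppr_le0; apply: le_trans (mid t ht); rewrite subr_ge0; case/andP: ht.
  have := h1 (fun t ht => le_trans (mid t ht) (tpg t)).
  by rewrite (ger0_norm t0) -/(tau z); rewrite -/(tau z) in h2; lra.
have xz : z <= X z by rewrite -subr_le0 ltW.
have mid t : z <= t <= X z -> X z - t <= - tau t by move=> /andP[t1 t2]; rewrite opprB lerD2r hX.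
have h1 := transport_gain dg g0 gc tm0 dl0 p1 c0 xz (or_intror _).
have h2 : f 0%N (X z) - f 0%N z <= C * dl `^ (p - 1) * (X z - z).
  apply: (transport_loss df fC xz) => t ht; apply/max_idPl.
  by rewrite -oppr_ge0; apply: le_trans (mid t ht); rewrite subr_ge0; case/andP: ht.
have := h1 (fun t ht => le_trans (mid t ht) (tmg t)).
rewrite (ltr0_norm t0) (_ : - tau z = X z - z); last by rewrite opprB.
by lra.
Qed.

(* For [p = 1] the kernel test function degenerates and [h' = sgn tau] is used instead. *)
Lemma sign_potential (X : R -> R) : (forall z z', z <= z' -> X z <= X z') -> measurable_fun setT X ->
  exists h : R -> R, (forall x y, `|h x - h y| <= `|x - y|) /\
    forall z, `|z - X z| / 4 <= h z - h (X z).
Proof.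
move=> hX mX; pose s t : R := Num.sg (t - X t).
have ms : measurable_fun setT s.
  rewrite (_ : s = fun t => \1_[set t | 0 < t - X t] t - \1_[set t | t - X t < 0] t); last first.
    apply/funext => t; rewrite /s !indicE; have [h|h|h] := ltrgtP (t - X t) 0.
    - by rewrite ltr0_sg// memNset ?mem_set/= ?sub0r//; apply/negP; rewrite -leNgt ltW.
    - by rewrite gtr0_sg// mem_set//= memNset ?subr0//=; apply/negP; rewrite -leNgt ltW.
    - by rewrite h sgr0 !memNset ?subrr//= h ltxx.
  have mt : measurable_fun setT (fun t : R => t - X t) by apply: measurable_funB.
  apply: measurable_funB; apply: measurable_indic.
    have := mt measurableT `]0, +oo[%classic (measurable_itv _); rewrite setTI; congr measurable.
    by apply/seteqP; split=> t /=; rewrite in_itv/= andbT.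
  have := mt measurableT `]-oo, 0[%classic (measurable_itv _); rewrite setTI; congr measurable.
have s1 t : `|s t| <= 1 by rewrite /s normr_sg; case: (_ != _); rewrite ?lexx ?ler01.
pose I (x t : R) : R := (t <= x)%R%:R.
pose J x t : R := s t * (I x t - I 0 t).
have IE (x t : R) : I x t = (t <= x)%R%:R by [].
have mI x : measurable_fun setT (I x).
  rewrite (_ : I x = \1_[set` `]-oo, x]]); first by apply: measurable_indic.
  apply/funext => t; rewrite indicE /I; congr (nat_of_bool _)%:R.
  by apply/idP/idP; rewrite inE/= in_itv.
have JB a b : a <= b -> bsupp 1 a b (fun t => s t * (I b t - I a t)).
  move=> ab; split.
  - by apply: measurable_funM => //; apply: measurable_funB.
  - move=> t; rewrite normrM -[leRHS]mulr1; apply: ler_pM => //; rewrite !IE.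
    by case: (t <= b); case: (t <= a); rewrite ?subrr ?subr0 ?sub0r ?normrN ?normr0 ?normr1 ?ler01.
  - move=> t; rewrite !IE; have [tb|tb] := leP t b; have [ta|ta] := leP t a; rewrite ?subrr ?mulr0 ?eqxx//=.
      by rewrite (ltW ta).
    by have := le_lt_trans (le_trans ta ab) tb; rewrite ltxx.
have iJ x : litg (J x).
  case: (leP 0 x) => [/JB/bsupp_litg//|/ltW/JB/bsupp_litg/(litgZ (-1))].
  by congr litg; apply/funext => t; rewrite /J; ring.
have hab a b : lint (J b) - lint (J a) = lint (fun t => s t * (I b t - I a t)).
  by rewrite -(lintB (iJ b) (iJ a)); congr lint; apply/funext => t; rewrite /J; ring.
exists (fun x => lint (J x)); split=> [x y|z].
  wlog xy : x y / y <= x => [hw|].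
    by have [/hw//|/ltW/hw] := leP y x; rewrite distrC (distrC y).
  by rewrite hab; apply: le_trans (bsupp_lint xy (JB _ _ xy)) _; rewrite mul1r ler_norm.
have [t0|t0|t0] := ltrgtP (z - X z) 0.
- have xz : z <= X z by rewrite -subr_le0 ltW.
  have iK := bsupp_litg (JB _ _ xz).
  have e : lint (J z) - lint (J (X z)) = lint (fun t => -1 * (s t * (I (X z) t - I z t))).
    by rewrite (lintZ (-1) iK) -hab mulN1r opprB.
  rewrite e (ltr0_norm t0).
  have sE t : z <= t -> t <= X z -> s t <= 0 /\ (t < X z -> s t = -1).
    move=> t1 t2; have h := hX _ _ t1; split; last by move=> t3; rewrite /s ltr0_sg// subr_lt0; exact: lt_le_trans h.
    by rewrite /s sgr_le0 subr_le0; exact: le_trans h.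
  (* An interval of a quarter of the length, strictly between [z] and [X z], avoids the end points,
     where the sign may be 0 and the indicator changes. *)
  have e' : - (z - X z) / 4 = 1 * ((z + X z) / 2 - (3 * z + X z) / 4) by field.
  rewrite e'; apply: lint_ge; [lra|exact: litgZ| |].
    move=> t; rewrite !IE; have [tz|tz] := leP t z; have [tx|tx] := leP t (X z); rewrite ?subrr ?mulr0//.
      by have := le_lt_trans (le_trans tz xz) tx; rewrite ltxx.
    by have [h _] := sE t (ltW tz) tx; rewrite subr0 mulr1 mulN1r oppr_ge0.
  move=> t /andP[t1 t2]; have tz : z < t by lra.
  have tx : t < X z by lra.
  have [_ h] := sE t (ltW tz) (ltW tx).
  by rewrite !IE (ltW tx) (leNgt t z) tz h//=; lra.
- have xz : X z <= z by rewrite -subr_ge0 ltW.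
  rewrite hab (gtr0_norm t0).
  have sE t : X z < t -> t <= z -> s t = 1.
    by move=> t1 t2; rewrite /s gtr0_sg// subr_gt0; apply: le_lt_trans t1; exact: hX.
  have iK := bsupp_litg (JB _ _ xz).
  apply: (@le_trans _ _ (1 * (z - (X z + z) / 2))); first by lra.
  apply: lint_ge => //; first by lra.
    move=> t; rewrite !IE; have [tz|tz] := leP t z; have [tx|tx] := leP t (X z); rewrite ?subrr ?mulr0//.
      by rewrite sE// subr0 mulr1.
    by have := le_lt_trans (le_trans tx xz) tz; rewrite ltxx.
  move=> t /andP[t1 t2]; have tx : X z < t by lra.
  by rewrite !IE t2 (leNgt t) tx sE//= subr0 mulr1.
- by rewrite t0 normr0 mul0r; have /eqP := t0; rewrite subr_eq0 => /eqP <-; rewrite subrr.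
Qed.

End transport.

Section transport_rate.
Context {R : realType}.
Local Notation gam := (normal_prob (0 : R) 1).

Lemma powR_mono (a b q : R) : 0 <= q -> 0 <= a -> a <= b -> a `^ q <= b `^ q.
Proof.
by move=> q0 a0 ab; apply: (ge0_ler_powR q0) => //; rewrite nnegrE// (le_trans a0).
Qed.

Lemma measurable_abs_powR (q : R) : measurable_fun setT (fun z : R => `|z| `^ q).
Proof. exact: (measurableT_comp (measurable_powR q) (@normr_measurable _ _)). Qed.

Lemma abs_powR_pbound q : 0 <= q -> pbound 1 q (fun z : R => `|z| `^ q).
Proof. by move=> q0 y; rewrite ger0_norm ?powR_ge0// mul1r powR_mono// lerDr. Qed.

Lemma smoothB m w H H' (f g : nat -> R -> R) : smooth m w H f -> smooth m w H' g ->
  smooth m w (H + H') (fun j x => f j x - g j x).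
Proof.
move=> [f1 f2] [g1 g2]; split=> [j x jm|x y]; first by apply: isdB; [exact: f1|exact: g1].
rewrite (_ : _ - _ = (f m x - f m y) - (g m x - g m y)); last by ring.
by apply: le_trans (ler_normB _ _) _; rewrite mulrDl lerD.
Qed.

Lemma Wasserstein_moment {d} {Om : measurableType d} (P : probability Om R) (W : {RV P >-> R}) p C eps :
  0 < p -> 0 <= C -> 0 < eps -> itg gam (fun z => `|z - quant W z| `^ p) ->
  Ex gam (fun z => `|z - quant W z| `^ p) <= C * eps `^ p ->
  (Wasserstein p (distribution P W) gam <= (C `^ p^-1 * eps)%:E)%E.
Proof.
move=> p0 C0 e0 iq hq; apply: le_trans (Wasserstein_quant W p0) _.
have -> : (\int[gam]_z (`|quant W z - z| `^ p)%:E)%E = (Ex gam (fun z => `|z - quant W z| `^ p))%:E.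
  rewrite /Ex /Rintegral fineK; last exact: integrable_fin_num.
  by apply: eq_integral => z _; rewrite distrC.
rewrite poweR_EFin lee_fin.
apply: (@le_trans _ _ ((C * eps `^ p) `^ p^-1)).
  apply: ge0_ler_powR => //; rewrite ?nnegrE ?invr_ge0 ?(ltW p0)//.
    by apply: Ex_ge0 => z; rewrite powR_ge0.
  by rewrite mulr_ge0 ?powR_ge0.
by rewrite powRM ?powR_ge0// -powRrM mulfV ?gt_eqF// powRr1// ltW.
Qed.

Lemma itg_gam_powR q : 0 <= q -> itg gam (fun z => `|z| `^ q).
Proof.
by move=> q0; apply: itg_pbound q0 (measurable_abs_powR q) (abs_powR_pbound q0).
Qed.

Section good.
Context {d} {Om : measurableType d} (P : probability Om R) (W : {RV P >-> R}) (k : nat) (w K eps : R).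
Hypothesis w01 : 0 < w <= 1.
Hypothesis G : stein_good P W k w K eps.
Let p := k.-1%:R + w.
Let w0 : 0 < w. Proof. by case/andP: w01. Qed.
Let p0 : 0 < p. Proof. by rewrite /p ltr_wpDl. Qed.
Let pk : 0 < p <= k.+1%:R + w.
Proof. by rewrite p0 /p lerD2r ler_nat (leq_trans (leq_pred k)). Qed.

Lemma transport_itg : itg gam (fun z => `|z - quant W z| `^ p).
Proof.
have ma := measurable_abs_powR p; have h := abs_powR_pbound (ltW p0).
have iW := good_itg G pk ma h.
have iQ : itg gam (fun z => `|quant W z| `^ p) by have := quant_itg ma iW.
have iz := itg_gam_powR (ltW p0).
apply: (itg_le0 _ _ (itgZ (2 `^ p) (itgD iz iQ))).
  apply: (measurableT_comp ma); apply: measurable_funB => //; exact: measurable_quant.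
move=> z; rewrite ger0_norm ?powR_ge0//.
apply: le_trans (powRD_le (normr_ge0 _) (normr_ge0 _) (ltW p0)).
by rewrite powR_mono ?(ltW p0)// ler_normB.
Qed.

Lemma transport_smooth H h : smooth k.-1 w H (dseq h) ->
  [/\ itg gam h, itg gam (h \o quant W) & Ex gam (h \o quant W) = Ex P (h \o W)].
Proof.
move=> hh; have [B B0 hB] := smooth_pbound w0 hh.
have mh : measurable_fun setT h by exact: (smooth_measurable w0 hh (leq0n _)).
have iW : itg P (h \o W) by exact: (good_itg G pk mh hB).
split; [exact: itg_pbound (ltW p0) mh hB|exact: quant_itg|exact: quant_Ex].
Qed.

End good.

(** For [k = 1] the expansion has no correction terms, so a Lipschitz potential with derivative the
    sign of the displacement is enough. *)
Lemma transport_rate1 (K : R) : 0 <= K -> exists2 C, 0 <= C &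
  forall d (Om : measurableType d) (P : probability Om R) (W : {RV P >-> R}) eps, 0 < eps ->
  stein_good P W 1 1 K eps -> Ex gam (fun z => `|z - quant W z| `^ 1) <= C * eps `^ 1.
Proof.
move=> K0; have w01 : 0 < (1 : R) <= 1 by rewrite ltr01 lexx.
have [C C0 hC] := expect_expansion w01 K0 (ltn0Sn 0).
exists (4 * C); first exact: mulr_ge0.
move=> d Om P W eps e0 G; have it := transport_itg w01 G; rewrite /= add0r in it.
have [h [h1 h2]] := sign_potential (quant_le W) (measurable_quant W).
have hh : smooth 0 1 1 (dseq h) by split=> // x y; rewrite powRr1// mul1r; exact: h1.
have [ih iq eq] := transport_smooth w01 G hh.
have := hC _ _ P W 1%N eps (leqnn _) e0 G 1 h ltr01 hh.
rewrite /gexp/= big_nil subr0 add0r mulr1 => /ler_normlP[h3 _].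
have : Ex gam (fun z => 4^-1 * `|z - quant W z| `^ 1) <= Ex gam (fun z => h z - (h \o quant W) z).
  apply: Ex_le; [exact: itgZ|exact: itgB|move=> z].
  by rewrite powRr1// mulrC; exact: h2.
rewrite ExZ; last by []. rewrite ExB; [|by []|by []]; rewrite eq.
move: h3; rewrite -/(Ex gam h) /gaussE -/(Ex gam h) => h3 h4; rewrite -mulrA.
have : Ex P (fun x => h (W x)) = Ex P (h \o W) by [].
move=> e; rewrite e in h3; move: (Ex gam h) (Ex P (h \o W)) (C * eps `^ 1) h3 h4 => a b y.
by set D := Ex gam _; move: D => D; clear; lra.
Qed.

(** Half of [c1 * D] is absorbed: one quarter comes from the pointwise inequality, the other from
    the corrections. *)
Lemma rate_algebra (D a b e ep l NV C1 C Lam c1 : R) : 0 < c1 ->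
  c1 * D <= a - b + (C * (Lam * ep) + c1 / 4 * D) -> - (b - a - e) <= C1 * (C + C) * ep ->
  - e <= c1 / 4 * (D + ep) + l * (ep * NV) ->
  D <= 2 * (c1 / 4 + l * NV + C1 * (C + C) + C * Lam) / c1 * ep.
Proof.
move=> c0 h1 h2 h3; rewrite mulrAC ler_pdivlMr// mulrC; lra.
Qed.

Lemma transport_rate_gt1 k (w K E0 : R) : (0 < k)%N -> 0 < w <= 1 -> 0 <= K -> 0 < E0 -> 1 < k.-1%:R + w ->
  exists2 C, 0 <= C &
  forall d (Om : measurableType d) (P : probability Om R) (W : {RV P >-> R}) eps, 0 < eps <= E0 ->
  stein_good P W k w K eps -> Ex gam (fun z => `|z - quant W z| `^ (k.-1%:R + w)) <= C * eps `^ (k.-1%:R + w).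
Proof.
move=> k0 w01 K0 E00; set p := _ + w => p1; have p1' := ltW p1.
have p0 : 0 < p by apply: lt_trans p1.
have [C1 C10 hC1] := expect_expansion w01 K0 k0.
have [C [c [C0 c0 hf]]] := test_function k0 w01 erefl p1'.
have [B [n [B0 hB]]] := gexp_dual k.-1 w01 K0 (ltW E00).
(* [V] collects the polynomial weight from [gexp_dual]; its [p]-th Gaussian moment is a constant
   independent of the field. *)
pose V (x : R) := 2 * C * (B * (1 + `|x|) `^ n%:R).
have V0 x : 0 <= V x by rewrite !mulr_ge0 ?powR_ge0// ltW.
have iV : itg gam (fun x => V x `^ p).
  apply: (@itg_pbound _ ((2 * C * B) `^ p) (n%:R * p)); first by rewrite mulr_ge0 ?(ltW p0).
    apply: (measurableT_comp (measurable_powR p)); apply: measurable_funM => //; apply: measurable_funM => //.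
    by apply: (measurableT_comp (measurable_powR _)); apply: measurable_funD => //; apply: measurableT_comp.
  move=> y; have CB : 0 <= 2 * C * B by rewrite !mulr_ge0 ?(ltW C0).
  by rewrite ger0_norm ?powR_ge0// /V mulrA powRM ?powR_ge0// powRrM.
pose NV := Ex gam (fun x => V x `^ p); have NV0 : 0 <= NV by apply: Ex_ge0 => x; rewrite powR_ge0.
pose c1 := c * 3^-1 `^ p; have c10 : 0 < c1 by rewrite mulr_gt0// powR_gt0.
(* [lam] and [Lam] are set so that each use of Young's inequality returns exactly [c1 / 4] times the
   moment of [tau]: [lam] for the corrections, [Lam] for the loss term. Solving for [Lam] divides by
   [1 - p]. *)
pose lam := c1 / (4 * 2 `^ p); have l0 : 0 < lam by rewrite divr_gt0// mulr_gt0// powR_gt0.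
have le : lam * 2 `^ p = c1 / 4 by rewrite /lam; field; rewrite gt_eqF// powR_gt0.
pose Lam := (c1 / (4 * C)) `^ (1 - p)^-1; have c4 : 0 < c1 / (4 * C) by rewrite divr_gt0// mulr_gt0.
have L0 : 0 < Lam by rewrite powR_gt0.
have Le : C * Lam `^ (1 - p) = c1 / 4.
  rewrite /Lam -powRrM mulVf ?powRr1 ?(ltW c4)//; last by rewrite lt_eqF// subr_lt0.
  by field; rewrite gt_eqF.
pose M := c1 / 4 + lam `^ (1 - p) * NV + C1 * (C + C) + C * Lam.
have M0 : 0 <= M.
  have q1 : 0 <= c1 / 4 by rewrite divr_ge0 ?(ltW c10).
  have q2 := mulr_ge0 (powR_ge0 lam (1 - p)) NV0.
  have q3 := mulr_ge0 C10 (addr_ge0 (ltW C0) (ltW C0)).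
  exact: (addr_ge0 (addr_ge0 (addr_ge0 q1 q2) q3) (mulr_ge0 (ltW C0) (ltW L0))).
exists (2 * M / c1); first by rewrite divr_ge0 ?(ltW c10)// mulr_ge0.
move=> d Om P W eps /andP[e0 e1] G; set X := quant W; pose tau z := z - X z.
have it : itg gam (fun z => `|tau z| `^ p) by exact: (transport_itg w01 G).
set D := Ex gam _.
pose tp z := Num.max 0 (tau z); pose tm z := Num.max 0 (- tau z).
have tp0 t : 0 <= tp t by rewrite le_max lexx.
have tm0 t : 0 <= tm t by rewrite le_max lexx.
have [f [fs fd fC fc]] := hf tp eps tp0 e0.
have [g [gs gd gC gc]] := hf tm eps tm0 e0.
pose F j x := f j x - g j x.
have hF : smooth k.-1 w (C + C) F by exact: smoothB.
have hh := smooth_dseq hF; pose h := F 0%N; rewrite -/h in hh.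
have dF y : isd h y (F 1%N y) by apply: isdB; [exact: fd|exact: gd].
have h1 : dseq h 1 = F 1%N by apply/funext => x; rewrite /dseq/= derive1E; have [] := dF x.
have [ih iq eq] := transport_smooth w01 G hh.
have CC : 0 < C + C by rewrite addr_gt0.
have ex := hC1 _ _ P W k eps (leqnn _) e0 G (C + C) h CC hh.
have kb s : (0 < s <= k.-1)%N -> `|wkap P W s| <= K * eps `^ s%:R.
  by move=> /andP[s0 sk]; apply: (wkap_bound G); rewrite s0/= -(prednK k0) ltnS.
have ee : 0 < eps <= E0 by rewrite e0.
have gd1 := hB (wkap P W) eps (C + C) h ee (ltW CC) kb hh; rewrite h1 in gd1.
pose U x := `|F 1%N x| * (B * (1 + `|x|) `^ n%:R).
have ta_bnd t : tp t <= `|tau t| /\ tm t <= `|tau t|.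
  by rewrite !ge_max normr_ge0 ler_norm -normrN ler_norm.
have F1b x : `|F 1%N x| <= 2 * C * (`|tau x| + eps) `^ (p - 1).
  have /andP[f0 f1] := fC x; have /andP[g0 g1] := gC x; have [t1 t2] := ta_bnd x.
  have mono t : 0 <= t -> t <= `|tau x| -> C * (t + eps) `^ (p - 1) <= C * (`|tau x| + eps) `^ (p - 1).
    move=> t0 tt; rewrite ler_wpM2l ?(ltW C0)//.
    by rewrite powR_mono ?subr_ge0 ?addr_ge0 ?(ltW e0)// lerD2r.
  have := mono _ (tp0 x) t1; have := mono _ (tm0 x) t2.
  by rewrite /F => m1 m2; rewrite ler_norml; apply/andP; split; lra.
pose Mj x := lam * 2 `^ p * (`|tau x| `^ p + eps `^ p) + lam `^ (1 - p) * (eps `^ p * V x `^ p).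
have iM : itg gam Mj.
  by apply: itgD; [apply: itgZ; apply: itgD it (itg_cst _ _)|apply: itgZ; exact: itgZ].
have UM x : eps * U x <= Mj x.
  apply: (@le_trans _ _ ((`|tau x| + eps) `^ (p - 1) * (eps * V x))).
    rewrite [leRHS]mulrCA; apply: ler_wpM2l; first exact: ltW.
    rewrite /U /V [leRHS]mulrA [_ * (2 * C)]mulrC; apply: ler_wpM2r; last exact: F1b.
    by rewrite mulr_ge0 ?powR_ge0.
  apply: le_trans (powR_split (addr_ge0 (normr_ge0 _) (ltW e0)) (mulr_ge0 (ltW e0) (V0 x)) l0 p1') _.
  rewrite /Mj (powRM p (ltW e0) (V0 x)) -mulrA lerD2r ler_wpM2l ?(ltW l0)//.
  by apply: powRD_le; rewrite ?(ltW e0) ?(ltW p0).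
have U0 x : 0 <= U x by rewrite mulr_ge0// mulr_ge0 ?powR_ge0.
have iU' : itg gam (fun x => eps * U x).
  apply: (itg_le0 _ _ iM); last by move=> x; rewrite ger0_norm ?UM// mulr_ge0 ?(ltW e0).
  apply: measurable_funM => //; apply: measurable_funM.
    apply: measurableT_comp => //; apply: continuous_measurable_fun => x.
    have hx : isd (F 1%N) x (F 2%N x) by apply: isdB; [exact: fd|exact: gd].
    exact: isd_continuous hx.
  apply: measurable_funM => //.
  by apply: (measurableT_comp (measurable_powR _)); apply: measurable_funD => //; apply: measurableT_comp.
have iU : itg gam U.
  have := itgZ eps^-1 iU'; congr itg; apply/funext => x.
  by rewrite mulrA mulVf ?mul1r// gt_eqF.
have gb : `|gexp (wkap P W) k.-1 h| <= c1 / 4 * (D + eps `^ p) + lam `^ (1 - p) * (eps `^ p * NV).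
  apply: le_trans gd1 _; rewrite -(ExZ eps iU); apply: le_trans (Ex_le iU' iM UM) _.
  rewrite ExD; [|by apply: itgZ; apply: itgD it (itg_cst _ _)|by apply: itgZ; exact: itgZ].
  rewrite ExZ; last by apply: itgD it (itg_cst _ _).
  rewrite ExD; [|exact: it|exact: itg_cst]; rewrite Ex_cst ExZ; last exact: itgZ.
  by rewrite ExZ ?le; [exact: lexx|exact: iV].
have pw z : c1 * `|tau z| `^ p <= (h z - (h \o X) z) + C * (Lam * eps `^ p + Lam `^ (1 - p) * `|tau z| `^ p).
  have t := transport_pointwise (quant_le W) e0 p1' (ltW c0) (fun s => fd 0%N s isT) (fun s => gd 0%N s isT) fC gC fc gc z.
  rewrite /c1 -mulrA -powRM ?invr_ge0// [3^-1 * _]mulrC.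
  apply: le_trans t _; rewrite lerD2l -mulrA ler_wpM2l ?(ltW C0)//.
  by apply: powR_split; rewrite ?(ltW e0).
have iL : itg gam (fun z => Lam * eps `^ p + Lam `^ (1 - p) * `|tau z| `^ p).
  by apply: itgD (itg_cst _ _) _; exact: itgZ.
have := Ex_le (itgZ c1 it) (itgD (itgB ih iq) (itgZ C iL)) pw.
rewrite (ExZ c1 it) (ExD (itgB ih iq) (itgZ C iL)) (ExB ih iq) (ExZ C iL) eq.
rewrite (ExD (itg_cst _ _) (itgZ _ it)) Ex_cst (ExZ _ it) -/D mulrDr [C * (Lam `^ _ * _)]mulrA Le => fin.
have [ex1 _] := ler_normlP _ _ ex.
have gh : gaussE h = Ex gam h by [].
have eW : Ex P (fun x => h (W x)) = Ex P (h \o W) by [].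
rewrite gh eW in ex1; have [gb2 _] := ler_normlP _ _ gb.
exact: (rate_algebra c10 fin ex1 gb2).
Qed.

Lemma transport_rate k (w K E0 : R) : (0 < k)%N -> 0 < w <= 1 -> 0 <= K -> 0 < E0 -> 1 <= k.-1%:R + w ->
  exists2 C, 0 <= C &
  forall d (Om : measurableType d) (P : probability Om R) (W : {RV P >-> R}) eps, 0 < eps <= E0 ->
  stein_good P W k w K eps ->
  (Wasserstein (k.-1%:R + w) (distribution P W) gam <= (C * eps)%:E)%E.
Proof.
move=> k0 w01 K0 E00 p1; have p0 : 0 < k.-1%:R + w by apply: lt_le_trans p1.
have [C C0 hC] : exists2 C, 0 <= C &
    forall d (Om : measurableType d) (P : probability Om R) (W : {RV P >-> R}) eps, 0 < eps <= E0 ->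
    stein_good P W k w K eps -> Ex gam (fun z => `|z - quant W z| `^ (k.-1%:R + w)) <= C * eps `^ (k.-1%:R + w).
  have [p2|p2] := eqVneq (k.-1%:R + w) 1; last first.
    by apply: transport_rate_gt1 => //; rewrite lt_neqAle eq_sym p2.
  have /andP[w0 w1] := w01; have k1 : k = 1%N.
    have : k.-1%:R < 1%:R :> R by lra.
    by rewrite ltr_nat; case: (k) k0 => [|[]].
  have w1' : w = 1 by move: p2; rewrite k1 add0r.
  have [C C0 hC] := transport_rate1 K0; exists C => // d Om P W eps /andP[e0 _] G.
  by rewrite p2; apply: hC => //; move: G; rewrite k1 w1'.
exists (C `^ (k.-1%:R + w)^-1); first exact: powR_ge0.
move=> d Om P W eps ee G; have /andP[e0 _] := ee.
apply: Wasserstein_moment => //; [exact: transport_itg w01 G|exact: hC].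
Qed.

End transport_rate.

(** * The random field *)

Section hypotheses.
Context {R : realType}.

Lemma ceiln_spec (p : R) : 0 < p ->
  [/\ (0 < ceiln p)%N, 0 < hoelder_exp p <= 1 & p = (ceiln p).-1%:R + hoelder_exp p].
Proof.
move=> p0; have c0 : 0 < Num.ceil p by rewrite ceil_gt0.
have e : (ceiln p)%:R = (Num.ceil p)%:~R :> R.
  by rewrite /ceiln natr_absz gtr0_norm.
have k0 : (0 < ceiln p)%N by rewrite absz_gt0 gt_eqF.
have /andP[h1 h2] := ceil_itv p; rewrite intrB -e in h1; rewrite -e in h2.
have e1 : (ceiln p)%:R = (ceiln p).-1%:R + 1 :> R by rewrite natr1 prednK.
split=> //; first by rewrite /hoelder_exp; apply/andP; split; lra.
by rewrite /hoelder_exp e1; ring.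
Qed.

Lemma limn_einf_gt0 (u : (\bar R)^nat) : (0 < limn_einf u)%E ->
  exists2 c : R, 0 < c & \forall n \near \oo, (c%:E <= u n)%E.
Proof.
rewrite limn_einf_lim; have -> : limn (einfs u) = ereal_sup (range (einfs u)).
  by apply: cvg_lim => //; exact: cvg_einfs_sup.
move=> /ereal_sup_gt[_ [m _ <-]] h.
have [c c0 hc] : exists2 c : R, 0 < c & (c%:E <= einfs u m)%E.
  case: (einfs u m) h => [x| |]//; first by rewrite lte_fin => x0; exists x.
  by move=> _; exists 1 => //; rewrite leey.
exists c => //; exists m => // n /= mn; apply: le_trans hc _.
by apply: ereal_inf_lbound; exists n.
Qed.

(** The slack 1 between the exponents costs the factor 2; it is meant for [r = +oo], where the power
    1 of the mixing coefficient is only approached. *)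
Lemma mixbound_decay (C v u th : R) (l : nat) : 0 < C -> 0 < th <= 1 -> u * l%:R <= v * th * l%:R + 1 ->
  mixbound C v l `^ th <= 2 * Num.max 1 C * Lv u l.
Proof.
move=> C0 /andP[th0 th1] h; set M := Num.max 1 C.
have M1 : 1 <= M by rewrite le_max lexx.
have CM : C <= M by rewrite le_max lexx orbT.
have M0 : 0 < M by apply: lt_le_trans M1.
have e : (2 ^ l)%:R `^ (- v) = E2 (- (v * l%:R)) :> R by rewrite -E2n powR_E2 mulrN mulrC.
apply: (@le_trans _ _ ((C * E2 (- (v * l%:R))) `^ th)).
  apply: ge0_ler_powR; rewrite ?nnegrE ?(ltW th0)//.
  - by rewrite /mixbound le_min ler01/= mulr_ge0 ?(ltW C0)// powR_ge0.
  - by rewrite mulr_ge0 ?(ltW C0)// E2_ge0.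
  - by rewrite /mixbound e ge_min lexx orbT.
rewrite powRM ?(ltW C0) ?E2_ge0// powR_E2 mulrC [2 * M]mulrC -mulrA mulrC.
apply: ler_pM; rewrite ?powR_ge0 ?E2_ge0//.
  apply: (@le_trans _ _ (M `^ th)).
    by apply: ge0_ler_powR; rewrite ?nnegrE ?(ltW th0) ?(ltW C0) ?(ltW M0).
  by rewrite -[leRHS](powRr1 (ltW M0)) ler_powR.
have -> : 2 = E2 1 :> R by rewrite /E2 powRr1.
rewrite /Lv -E2D; apply: le_E2; lra.
Qed.

Section one_field.
Context {d} {Om : measurableType d} (P : probability Om R).

Lemma expectationE (f : Om -> R) : fine ('E_P[f])%E = Ex P f.
Proof. by rewrite unlock. Qed.

(** An essential bound yields every positive order, so for [r = +oo] the choice of [rho] stays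
    open. *)
Lemma Lnorm_mb (r : \bar R) (q B : R) (f : Om -> R) : (q%:E < r)%E -> 0 < q -> 0 < B ->
  measurable_fun setT f -> ('N[P]_r[EFin \o f] <= B%:E)%E ->
  (forall s : R, r = s%:E -> mb P s^-1 B f) /\ (r = +oo%E -> forall rho, 0 < rho -> mb P rho B f).
Proof.
move=> qr q0 B0 mf; rewrite unlock; case: r qr => [r|_|]//; last first.
  have P1 : (0 < P [set: Om])%E by have -> : (P [set: Om] = 1)%E by exact: (probability_setT P).
  case: ifPn => [_ hB|/negP[]]; last exact: P1.
  split=> // _ rho r0; split=> //.
  have /ess_sup_inf.ess_supP hae := hB.
  apply: (@le_trans _ _ (\int[P]_x (cst 1%E x))%E); last by rewrite integral_cst// mul1e probability_le1.
  apply: ae_ge0_le_integral => //.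
  - by move=> x _; rewrite lee_fin powR_ge0.
  - exact: measurable_mbfun.
  apply: filterS hae => x /=; rewrite lee_fin => h _; rewrite lee_fin.
  apply: (@le_trans _ _ (1 `^ rho^-1)); last by rewrite powR1.
  apply: ge0_ler_powR; rewrite ?nnegrE ?invr_ge0 ?(ltW r0) ?divr_ge0 ?(ltW B0)//.
  by rewrite ler_pdivrMr// mul1r.
rewrite lte_fin => qr hB; split=> // s [<-]; have r0 : 0 < r by apply: lt_trans qr.
split=> //; rewrite invrK.
have h0 : (0 <= \int[P]_x (`|f x| `^ r)%:E)%E by apply: integral_ge0 => x _; rewrite lee_fin powR_ge0.
have hi : (\int[P]_x (`|f x| `^ r)%:E <= (B `^ r)%:E)%E.
  have -> : (\int[P]_x (`|f x| `^ r)%:E = \int[P]_x `|(EFin \o f) x| `^ r)%E.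
    by apply: eq_integral => x _ /=; rewrite ?poweR_EFin.
  set I := (\int[P]_x _)%E in hB *.
  have I0 : (0 <= I)%E by apply: integral_ge0 => x _; exact: poweR_ge0.
  have : ((I `^ r^-1) `^ r <= B%:E `^ r)%E.
    by apply: gt0_ler_poweR; rewrite ?in_itv/= ?leey ?poweR_ge0 ?lee_fin ?(ltW r0) ?(ltW B0).
  by rewrite -poweRrM mulVf ?gt_eqF// poweRe1.
have -> : (\int[P]_x ((`|f x| / B) `^ r)%:E = \int[P]_x (((B `^ r)^-1)%:E * (`|f x| `^ r)%:E))%E.
  by apply: eq_integral => x _; rewrite -EFinM powR_div// mulrC.
rewrite ge0_integralZl_EFin//.
- have b0 : 0 < B `^ r by rewrite powR_gt0.
  apply: (@le_trans _ _ (((B `^ r)^-1)%:E * (B `^ r)%:E)%E).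
    by apply: lee_wpmul2l => //; rewrite lee_fin invr_ge0 ltW.
  by rewrite -EFinM mulVf ?lexx// gt_eqF.
- apply/measurable_EFinP; apply: (measurableT_comp (measurable_powR r)).
  exact: measurableT_comp.
- by rewrite invr_ge0 powR_ge0.
Qed.

End one_field.

Section field.
Context {d : nat} {T : {fset 'rV[int]_d}} {disp : measure_display}
  {Om : measurableType disp} (P : probability Om R) (X : T -> {RV P >-> R}) (rho b c : R).
Hypothesis rho0 : 0 < rho.
Hypothesis rho2 : rho * 2 <= 1.
Hypothesis Xb : forall i, mb P rho b (X i).
Hypothesis b0 : 0 < b.
Hypothesis X0 : forall i, Ex P (X i) = 0.
Hypothesis c0 : 0 < c.
Local Notation N := ((#|` T|)%:R : R).
Hypothesis N0 : 0 < N.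
Hypothesis low : (c%:E <= 'V_P[field_sum X] * (N^-1)%:E)%E.
Let v2 := Ex P (fun x => field_sum X x ^+ 2).

Let rho1 : 0 < rho <= 1. Proof. by rewrite rho0/=; apply: le_trans rho2; rewrite ler_peMr ?(ltW rho0)// ler1n. Qed.

Lemma field_sumE x : field_sum X x = \sum_(i <- index_enum T) X i x.
Proof. exact: mfun_sumE. Qed.

Lemma itg_field_sum2 : itg P (fun x => field_sum X x ^+ 2).
Proof.
have h (s : seq T) : itg P (fun x => (\sum_(i <- s) X i x) ^+ 2).
  have [C hC] : exists C, mb P rho C (fun x => \sum_(i <- s) X i x).
    elim: s => [|i s [C IH]].
      exists 1; rewrite (_ : (fun x => _) = fun=> 0); last by apply/funext => x; rewrite big_nil.
      by apply: mb_const; rewrite ?normr0 ?(ltW rho0).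
    exists (b + C); have := mb_add rho1 (Xb i) IH; congr mb.
    by apply/funext => x; rewrite big_cons.
  apply: (mb_itg _ (mb_expr 1 rho0 hC)).
  by rewrite rho2 andbT mulr_gt0.
have := h (index_enum T); congr itg; apply/funext => x; by rewrite field_sumE.
Qed.

Lemma Ex_field_sum : Ex P (field_sum X) = 0.
Proof.
rewrite (_ : (field_sum X : Om -> R) = fun x => \sum_(i <- index_enum T) X i x); last exact/funext/field_sumE.
rewrite Ex_sum; last by move=> i; exact: (mb_itg rho1 (Xb i)).
by rewrite big1.
Qed.

Lemma variance_field_sum : ('V_P[field_sum X] = v2%:E)%E.
Proof.
rewrite /variance unlock expectationE Ex_field_sum unlock.
rewrite /v2 /Ex /Rintegral fineK; last exact: integrable_fin_num itg_field_sum2.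
apply: eq_integral => x _; congr EFin.
by transitivity ((field_sum X x - 0) * (field_sum X x - 0)); [by []|rewrite subr0 expr2].
Qed.

Lemma sum_sd_low : 0 < sum_sd X /\ Num.sqrt c * Num.sqrt N <= sum_sd X.
Proof.
have h : c * N <= v2.
  by move: low; rewrite variance_field_sum -EFinM lee_fin ler_pdivlMr.
rewrite /sum_sd variance_field_sum/= -sqrtrM ?(ltW c0)//; split; last exact: ler_wsqrtr.
by rewrite sqrtr_gt0; apply: lt_le_trans h; exact: mulr_gt0.
Qed.

Lemma sum_sd2 : sum_sd X ^+ 2 = v2.
Proof.
rewrite /sum_sd variance_field_sum/= sqr_sqrtr//.
by apply: Ex_ge0 => x; exact: sqr_ge0.
Qed.

Lemma normed_sum2 : Ex P (fun x => normed_sum X x ^+ 2) = 1.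
Proof.
have [s0 _] := sum_sd_low.
have -> : (fun x => normed_sum X x ^+ 2) = fun x => (sum_sd X ^+ 2)^-1 * (field_sum X x ^+ 2).
  by apply/funext => x; rewrite -exprVn -exprMn.
rewrite ExZ; last exact: itg_field_sum2.
by rewrite sum_sd2 -/v2 mulVf// -sum_sd2 sqrf_eq0 gt_eqF.
Qed.

Lemma nfield_mb i : mb P rho (b / Num.sqrt c * N `^ (- 1 / 2)) (nfield X i).
Proof.
have [s0 sl] := sum_sd_low; have sv : 0 < (sum_sd X)^-1 by rewrite invr_gt0.
have := mb_scale (ltW rho0) sv (Xb i); apply: mb_lec; first exact: ltW.
have -> : N `^ (- 1 / 2) = (Num.sqrt N)^-1.
  by rewrite (_ : - 1 / 2 = - 2^-1); [rewrite powRN powR12_sqrt ?(ltW N0)|field].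
rewrite -mulrA -invfM mulrC ler_wpM2l ?(ltW b0)// lef_pV2// posrE.
by rewrite mulr_gt0// sqrtr_gt0.
Qed.

End field.
End hypotheses.

(** * From the hypotheses on the field to the three regimes of the rate *)

Section main.
Context {R : realType} {d : nat} (d_gt0 : (0 < d)%N) {T : nat -> {fset 'rV[int]_d}}
  (T_nonempty : forall n, T n != fset0) (T_infty : (fun n => #|` T n|) @ \oo --> \oo)
  {disp : nat -> measure_display} {Omega : forall n, measurableType (disp n)}
  {P : forall n, probability (Omega n) R} {X : forall n, T n -> {RV (P n) >-> R}}
  (X_mean : forall n (i : T n), ('E_(P n)[X n i] = 0)%E)
  {p : R} (p_gt0 : 0 < p) {r : \bar R} (r_gt : ((p + 2)%:E < r)%E)
  (sigma_low : (0 < limn_einf (fun n => 'V_(P n)[field_sum (X n)] * ((#|` T n|)%:R^-1)%:E))%E)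
  (X_Lr : (ereal_sup [set x | exists n (i : T n), x = 'N[P n]_r[EFin \o X n i]] < +oo)%E)
  {C v : R} (C_gt0 : 0 < C)
  (v_gt : (d%:R * (p + 2) + 2 * (1 - hoelder_exp p)) / 2 * (moment_ratio r (p + 2))^-1 < v)
  (mixing_decay : forall n l, (1 <= l <= range_radius R (T n))%N ->
     alpha_mixing (X n) (ceiln p).+1 l <= C * l%:R `^ (- v)).
Arguments X : clear implicits.
Local Notation k := (ceiln p).
Local Notation w := (hoelder_exp p).
Local Notation mr := (moment_ratio r (p + 2)).
Local Notation u := (mr * v - 1 + w).
Local Notation N n := ((#|` T n|)%:R : R).
Local Notation J n := (@levels d (T n) R).
Definition rate_of n : R := Ep u (J n) d p (N n).
Local Notation E := rate_of.

Let k0 : (0 < k)%N. Proof. by have [] := ceiln_spec p_gt0. Qed.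
Let w01 : 0 < w <= 1. Proof. by have [] := ceiln_spec p_gt0. Qed.
Let pE : p = k.-1%:R + w. Proof. by have [] := ceiln_spec p_gt0. Qed.
Let w0 : 0 < w. Proof. by case/andP: w01. Qed.
Let w1 : w <= 1. Proof. by case/andP: w01. Qed.
Let dR : 0 < d%:R :> R. Proof. by rewrite ltr0n. Qed.
Let kw : k.+1%:R + w = p + 2.
Proof. by rewrite [in RHS]pE -[k.+1%:R]natr1 -[in LHS](prednK k0) -natr1; ring. Qed.

Let mr01 : 0 < mr <= 1.
Proof.
move: r_gt; rewrite /moment_ratio; case: r => [s| |]//; last by rewrite ltr01 lexx.
rewrite lte_fin => h; have s0 : 0 < s by apply: lt_trans h; rewrite addr_gt0.
by rewrite divr_gt0 ?subr_gt0//= ler_pdivrMr// mul1r gerBl addr_ge0// ltW.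
Qed.
Let mr0 : 0 < mr. Proof. by case/andP: mr01. Qed.

Let u_gt : d%:R * (p + 2) / 2 < u.
Proof. by have := v_gt; rewrite ltr_pdivrMr// [v * _]mulrC; lra. Qed.

Let v0 : 0 < v.
Proof.
apply: le_lt_trans v_gt; rewrite mulr_ge0 ?invr_ge0 ?(ltW mr0)// divr_ge0// addr_ge0//.
  by rewrite mulr_ge0 ?(ltW dR)// addr_ge0 ?(ltW p_gt0).
by rewrite mulr_ge0// subr_ge0.
Qed.

Let N1 n : 1 <= N n. Proof. exact: N_ge1 (T_nonempty n). Qed.
Let N0 n : 0 < N n. Proof. exact: lt_le_trans ltr01 (N1 n). Qed.
Let hJ n : E2 (d%:R * (J n)%:R) <= N n. Proof. exact: levels_le d_gt0 (T_nonempty n). Qed.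

Let E0 n : 0 < E n. Proof. exact: Ep_gt0. Qed.

Lemma norm_bound : exists2 B : R, 0 < B & forall n (i : T n), ('N[P n]_r[EFin \o X n i] <= B%:E)%E.
Proof.
move: X_Lr; set S := ereal_sup _ => Sy; exists (Num.max 1 (fine S)); first by rewrite lt_max ltr01.
move=> n i; have : ('N[P n]_r[EFin \o X n i] <= S)%E by apply: ereal_sup_ubound; exists n, i.
case: S Sy => [s| |]//= _ h; last by apply: le_trans h _; rewrite leNye.
by apply: le_trans h _; rewrite lee_fin le_max lexx orbT.
Qed.

(** For finite [r] the order is [1 / r], and the power left in Davydov's inequality is exactly
    [moment_ratio]. For [r = +oo] no positive order leaves the full power 1; an order that shrinks
    with the number of levels loses at most a factor 2 on each of them. *)
Lemma field_mb B n : 0 < B -> (forall i : T n, ('N[P n]_r[EFin \o X n i] <= B%:E)%E) ->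
  exists rho, [/\ 0 < rho, (p + 2) * rho < 1, forall i : T n, mb (P n) rho B (X n i) &
    forall l, (l <= J n)%N -> u * l%:R <= v * (1 - (p + 2) * rho) * l%:R + 1].
Proof.
move=> B0 hB; have p2 : 0 < p + 2 by rewrite addr_gt0.
have h i := Lnorm_mb r_gt p2 B0 (measurable_funPT (X n i)) (hB i).
have [[s rE]|ry] : (exists s, r = s%:E) \/ r = +oo%E.
  by move: r_gt; case: (r) => [s| |]//; [left; exists s|right].
- have s2 : p + 2 < s by move: r_gt; rewrite rE lte_fin.
  have s0 : 0 < s by apply: lt_trans s2.
  exists s^-1; split; rewrite ?invr_gt0//.
  + by rewrite ltr_pdivrMr// mul1r.
  + by move=> i; have [h1 _] := h i; exact: h1.
  + move=> l _; have -> : 1 - (p + 2) * s^-1 = mr by rewrite rE /moment_ratio; field; rewrite gt_eqF.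
    rewrite ler_wpDr// ler_wpM2r// [v * _]mulrC; have := w1; lra.
(* Large enough for [v (p + 2) l / D <= 1] at every level [l <= J n]. *)
pose D := p + 3 + (J n)%:R * v * (p + 2).
have J0 : 0 <= (J n)%:R * v * (p + 2) by rewrite !mulr_ge0 ?(ltW v0) ?(ltW p2).
have D2 : p + 2 < D by rewrite /D; lra.
have D0 : 0 < D by apply: lt_trans D2.
exists D^-1; split; rewrite ?invr_gt0//.
- by rewrite ltr_pdivrMr// mul1r.
- by move=> i; have [_ h1] := h i; apply: h1 => //; rewrite invr_gt0.
move=> l lJ; have lJ' : l%:R <= (J n)%:R :> R by rewrite ler_nat.
have hD : v * ((p + 2) * D^-1) * l%:R <= 1.
  rewrite (_ : _ * l%:R = (l%:R * v * (p + 2)) / D); last by ring.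
  rewrite ler_pdivrMr// mul1r; apply: (@le_trans _ _ ((J n)%:R * v * (p + 2))); last by rewrite /D; have := p_gt0; lra.
  by rewrite ler_wpM2r ?(ltW p2)// ler_wpM2r ?(ltW v0).
have -> : mr = 1 by rewrite ry.
have hl : (w - 1) * l%:R <= 0 by rewrite mulr_le0_ge0// subr_le0.
rewrite mul1r (_ : (v - 1 + w) * l%:R = v * l%:R + (w - 1) * l%:R); last by ring.
rewrite (_ : v * (1 - _) * _ = v * l%:R - v * ((p + 2) / D) * l%:R); last by ring.
by rewrite -[leRHS]addrA lerD2l; apply: le_trans hl _; rewrite addrC subr_ge0.
Qed.

Lemma good_eventually : exists2 K, 0 <= K &
  \forall n \near \oo, stein_good (P n) (normed_sum (X n)) k w K (E n `^ p^-1).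
Proof.
have [c c0 hc] := limn_einf_gt0 sigma_low.
have [B B0 hB] := norm_bound.
have b00 : 0 < B / Num.sqrt c by rewrite divr_gt0// sqrtr_gt0.
have Cl1 : 1 <= 2 * Num.max 1 C.
  have : 1 <= Num.max 1 C by rewrite le_max lexx.
  lra.
have [K K0 hK] := field_good v d_gt0 k0 w01 pE u_gt Cl1 b00 C_gt0.
exists K => //; apply: filterS hc => n hn.
have [rho [r0 rp rX rJ]] := field_mb B0 (hB n).
have r2 : rho * 2 <= 1.
  by apply: le_trans (ltW rp); rewrite mulrC ler_wpM2r ?(ltW r0)// lerDr ltW.
have X0 i : Ex (P n) (X n i) = 0 by rewrite -expectationE X_mean.
apply: (hK (T n) _ _ (P n) (X n) rho (T_nonempty n) r0); rewrite ?kw//.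
- move=> i; exact: (nfield_mb r0 r2 rX B0 X0 c0 (N0 n) hn).
- exact: (normed_sum2 r0 r2 rX X0 c0 (N0 n) hn).
- exact: mixing_decay.
- move=> l /andP[_ lJ]; apply: mixbound_decay => //; last exact: rJ.
  have : 0 < (p + 2) * rho by rewrite mulr_gt0// addr_gt0.
  by rewrite subr_gt0 rp/= gerBl => /ltW.
Qed.

Lemma rate_bounded n : E n <= geo (u - d%:R * (p + 2) / 2).
Proof. exact: Ep_bounded. Qed.

(** By the definition of [u], the assumed decay turns the summand into a multiple of
    [l^(d (p + 1) - u - 1)], and the dyadic blocks of that sum are the levels of [E n]. Thus the
    same three estimates of [E n] serve for [mixing_M] and for the distances. *)
Lemma mixing_M_le : exists2 G, 0 <= G & forall n, 0 <= mixing_M (X n) p r <= G * E n.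
Proof.
have c0 : d%:R * (p + 1) - w - v * mr = d%:R * (p + 1) - u - 1 by ring.
exists (C `^ mr * E2 `|d%:R * (p + 1) - u - 1|); first by rewrite mulr_ge0 ?powR_ge0 ?E2_ge0.
move=> n; rewrite /mixing_M; apply/andP; split.
  by rewrite mulr_ge0 ?powR_ge0// sumr_ge0// => l _; rewrite mulr_ge0 ?powR_ge0.
rewrite /rate_of /Ep rateE mulrCA ler_wpM2l ?powR_ge0// -mulrA.
apply: le_trans (ler_wpM2l (powR_ge0 _ _) (dyadic_sum_powR _ _)).
apply: (@le_trans _ _ (\sum_(1 <= l < (range_radius R (T n)).+1) C `^ mr * l%:R `^ (d%:R * (p + 1) - u - 1))).
  apply: ler_sum_nat => l /andP[l1 lr]; have l0 : 0 < l%:R :> R by rewrite ltr0n.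
  have a0 : 0 <= alpha_mixing (X n) k.+1 l by rewrite le_max lexx.
  have hl : alpha_mixing (X n) k.+1 l <= C * l%:R `^ (- v) by apply: mixing_decay; rewrite l1.
  apply: (@le_trans _ _ (l%:R `^ (d%:R * (p + 1) - w) * (C * l%:R `^ (- v)) `^ mr)).
    rewrite ler_wpM2l ?powR_ge0//; apply: ge0_ler_powR; rewrite ?nnegrE ?(ltW mr0)//.
    exact: le_trans a0 hl.
  rewrite powRM ?(ltW C_gt0) ?powR_ge0// -powRrM mulrCA -c0 ler_wpM2l ?powR_ge0//.
  by rewrite -powRD ?(gt_eqF l0) ?implybT// mulNr.
rewrite -mulr_sumr ler_wpM2l ?powR_ge0//.
rewrite (big_cat_nat (n := (range_radius R (T n)).+1) _ (p := 2 ^ (J n).+1))//=; last exact: radius_levels.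
by rewrite lerDl sumr_ge0// => l _; rewrite powR_ge0.
Qed.

Lemma card_large : \forall n \near \oo, 2 <= N n.
Proof.
have := T_infty; move/cvgnyPge => /(_ 2%N); apply: filterS => n.
by rewrite ler_nat.
Qed.

Lemma rate_super : d%:R * (p + 1) < u -> forall n, E n <= geo (u - d%:R * (p + 1)) * N n `^ (- p / 2).
Proof. by move=> h n; exact: Ep_super. Qed.

Lemma rate_crit : u = d%:R * (p + 1) -> forall n, 2 <= N n -> E n <= 2 / ln 2 * (N n `^ (- p / 2) * ln (N n)).
Proof.
by move=> h n n2; apply: Ep_crit => //; exact: (E2_levels_le d_gt0 (T_nonempty n)).
Qed.

Lemma rate_sub : u < d%:R * (p + 1) -> forall n,
  E n <= geo (d%:R * (p + 1) - u) * N n `^ (- p / 2 + p + 1 - u / d%:R).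
Proof. by move=> h n; exact: Ep_sub. Qed.

Lemma mixing_M_bigO G (a : nat -> R) : 0 <= G -> (\forall n \near \oo, E n <= G * a n) ->
  (fun n => mixing_M (X n) p r) =O_\oo a.
Proof.
have [G' G0' hM] := mixing_M_le; move=> G0 h; apply/eqO_exP; exists (G' * G + 1).
  by rewrite ltr_wpDl// mulr_ge0.
apply: filterS h => n hn; have /andP[m0 m1] := hM n; rewrite (ger0_norm m0).
apply: le_trans m1 _; apply: le_trans (ler_wpM2l G0' hn) _; rewrite mulrA.
apply: (@le_trans _ _ (G' * G * `|a n|)); first by rewrite ler_wpM2l ?mulr_ge0// ler_norm.
by rewrite ler_wpM2r// lerDl.
Qed.

(** The transport estimate needs an a priori bound on [eps]; it is [E1], which exists because [u]
    exceeds the lower threshold. *)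
Lemma Wasserstein_rate G (a b : nat -> R) : 1 <= p -> 0 <= G ->
  (\forall n \near \oo, [/\ E n <= G * a n, 0 <= a n & a n `^ p^-1 = b n]) ->
  exists K : R, \forall n \near \oo,
    (Wasserstein p (distribution (P n) (normed_sum (X n))) (normal_prob 0%R 1%R) <= (K * b n)%:E)%E.
Proof.
move=> p1 G0 h; have [K K0 hK] := good_eventually.
pose E1 := geo (u - d%:R * (p + 2) / 2) `^ p^-1 : R.
have E10 : 0 < E1 by rewrite powR_gt0// geo_gt0// subr_gt0.
have p1' : 1 <= k.-1%:R + w by rewrite -pE.
have [D D0 hD] := transport_rate k0 w01 K0 E10 p1'.
exists (D * G `^ p^-1); apply: filterS2 h hK => n [En a0 ab] G1.
have ip : 0 <= p^-1 by rewrite invr_ge0 ltW.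
have e1 : 0 < E n `^ p^-1 <= E1.
  rewrite powR_gt0//=; apply: (ge0_ler_powR ip) (rate_bounded n); rewrite nnegrE ?(ltW (E0 n))//.
  by apply: le_trans (rate_bounded n); exact: ltW.
have := hD _ _ (P n) (normed_sum (X n)) _ e1 G1; rewrite -pE => /le_trans; apply.
rewrite lee_fin -mulrA ler_wpM2l// -ab -powRM//.
apply: (ge0_ler_powR ip) En; rewrite nnegrE ?(ltW (E0 n))//.
exact: mulr_ge0.
Qed.

Lemma expansion_rate G (a : nat -> R) : 0 <= G -> (\forall n \near \oo, E n <= G * a n) ->
  exists K : R, \forall n \near \oo, forall h : R -> R, Lambda p h ->
    `|fine ('E_(P n)[h \o normed_sum (X n)])%E - gaussE h - expansion (normed_sum (X n)) p h| <= K * a n.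
Proof.
move=> G0 hG; have [K K0 hK] := good_eventually.
have [D D0 hD] := expect_expansion w01 K0 k0.
exists (D * G); apply: filterS2 hG hK => n En G1 h hh.
have e0 : 0 < E n `^ p^-1 by rewrite powR_gt0.
have := hD _ _ (P n) (normed_sum (X n)) k _ (leqnn _) e0 G1 1 h ltr01 (Lambda_smooth hh).
rewrite expansion_gexp expectationE -pE -powRrM mulVf ?gt_eqF// powRr1 ?(ltW (E0 n))// mulr1.
have -> : (fun j => cumulant (normed_sum (X n)) j.+2 / (j.+1)`!%:R) = wkap (P n) (normed_sum (X n)).
  apply/funext => j; rewrite /wkap -[cumulant _ _]/(cum (moment (normed_sum (X n))) j.+2).
  by congr (cum _ _ / _); apply/funext => i; exact: expectationE.
by move=> /le_trans; apply; rewrite -mulrA ler_wpM2l.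
Qed.

End main.

Theorem proposition2p5 (R : realType) (d : nat) (d_gt0 : (0 < d)%N)
    (T : nat -> {fset 'rV[int]_d})
    (T_nonempty : forall n, T n != fset0)
    (T_mono : forall n, (T n `<=` T n.+1)%fset)
    (T_infty : (fun n => #|` T n|) @ \oo --> \oo)
    (disp : nat -> measure_display)
    (Omega : forall n, measurableType (disp n))
    (P : forall n, probability (Omega n) R)
    (X : forall n, T n -> {RV (P n) >-> R})
    (X_mean : forall n (i : T n), ('E_(P n)[X n i] = 0)%E)
    (X_L2 : forall n (i : T n), (X n i : Omega n -> R) \in Lfun (P n) 2%:E)
    (p : R) (p_gt0 : 0 < p)
    (r : \bar R) (r_gt : ((p + 2)%:E < r)%E)
    (sigma_low :
       (0 < limn_einf (fun n =>
              'V_(P n)[field_sum (X n)] * ((#|` T n|)%:R^-1)%:E))%E)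
    (X_Lr :
       (ereal_sup [set x | exists n (i : T n),
          x = 'N[P n]_r[EFin \o X n i]] < +oo)%E)
    (mixing_summable :
       (ereal_sup (range (fun n =>
          (\sum_(1 <= l < (range_radius R (T n)).+1)
             l%:R ^+ d.-1 *
             alpha_mixing (X n) (ceiln p).+1 l `^ moment_ratio r (p + 2))%:E))
        < +oo)%E)
    (C v : R) (C_gt0 : 0 < C)
    (v_gt : (d%:R * (p + 2) + 2 * (1 - hoelder_exp p)) / 2 *
              (moment_ratio r (p + 2))^-1 < v)
    (mixing_decay : forall n l, (1 <= l <= range_radius R (T n))%N ->
       alpha_mixing (X n) (ceiln p).+1 l <= C * l%:R `^ (- v)) :
  let u := moment_ratio r (p + 2) * v - 1 + hoelder_exp p in
  let N n : R := (#|` T n|)%:R in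
  let M n := mixing_M (X n) p r in
  let Wp n := Wasserstein p (distribution (P n) (normed_sum (X n)))
                (normal_prob 0 1) in
  [/\ [/\ d%:R * (p + 1) < u ->
            M =O_\oo (fun n => N n `^ (- p / 2)),
          u = d%:R * (p + 1) ->
            M =O_\oo (fun n => N n `^ (- p / 2) * ln (N n)) &
          d%:R * (p + 2) / 2 < u < d%:R * (p + 1) ->
            M =O_\oo (fun n => N n `^ (- p / 2 + p + 1 - u / d%:R))],
      1 <= p ->
      [/\ d%:R * (p + 1) < u ->
            exists K : R, \forall n \near \oo,
              (Wp n <= (K * N n `^ (- 1 / 2))%:E)%E,
          u = d%:R * (p + 1) ->
            exists K : R, \forall n \near \oo,
              (Wp n <= (K * (N n `^ (- 1 / 2) * ln (N n) `^ p^-1))%:E)%E &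
          d%:R * (p + 2) / 2 < u < d%:R * (p + 1) ->
            exists K : R, \forall n \near \oo,
              (Wp n <=
               (K * N n `^ (- 1 / 2 + (p + 1) / p - u / (d%:R * p)))%:E)%E] &
      u = d%:R * (p + 1) ->
        exists K : R, \forall n \near \oo, forall h : R -> R, Lambda p h ->
          `|fine ('E_(P n)[h \o normed_sum (X n)])%E - gaussE h
            - expansion (normed_sum (X n)) p h|
          <= K * (N n `^ (- p / 2) * ln (N n))].
Proof.
move=> u N M Wp.
have Mrate := mixing_M_bigO p_gt0 r_gt C_gt0 mixing_decay.
have Wrate := Wasserstein_rate d_gt0 T_nonempty X_mean p_gt0 r_gt sigma_low X_Lr C_gt0 v_gt mixing_decay.
have Erate := expansion_rate d_gt0 T_nonempty X_mean p_gt0 r_gt sigma_low X_Lr C_gt0 v_gt mixing_decay.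
have N2 := card_large (R := R) T_infty.
have ln2 : 0 <= 2 / ln 2 :> R by rewrite divr_ge0// ln_ge0// ler1n.
have dR : 0 < d%:R :> R by rewrite ltr0n.
have geo0 (c : R) : 0 < c -> 0 <= geo c by move=> c0; rewrite ltW// geo_gt0.
have gup : d%:R * (p + 1) < u -> 0 <= geo (u - d%:R * (p + 1)) by move=> h; apply: geo0; rewrite subr_gt0.
have glo : u < d%:R * (p + 1) -> 0 <= geo (d%:R * (p + 1) - u) by move=> h; apply: geo0; rewrite subr_gt0.
have super (h : d%:R * (p + 1) < u) n := rate_super T_nonempty h n.
have crit (h : u = d%:R * (p + 1)) n (n2 : 2 <= N n) := rate_crit d_gt0 T_nonempty h n2.
have sub (h : u < d%:R * (p + 1)) n := rate_sub d_gt0 T_nonempty h n.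
have p0 : p != 0 by rewrite gt_eqF.
split.
- split=> [h|h|/andP[_ h]].
  + by apply: (Mrate _ _ (gup h)); apply: nearW => n; exact: super.
  (* The logarithm vanishes at one site, so this case uses [2 <= N n], which holds eventually. *)
  + by apply: (Mrate _ _ ln2); apply: filterS N2 => n; exact: crit.
  + by apply: (Mrate _ _ (glo h)); apply: nearW => n; exact: sub.
- move=> p1; split=> [h|h|/andP[_ h]].
  + apply: (Wrate _ (fun n => N n `^ (- p / 2)) _ p1 (gup h)).
    apply: nearW => n; split; [exact: super|exact: powR_ge0|].
    by rewrite -powRrM; congr (_ `^ _); field.
  + apply: (Wrate _ (fun n => N n `^ (- p / 2) * ln (N n)) _ p1 ln2).
    apply: filterS N2 => n n2.
    have l0 : 0 <= ln (N n) by rewrite ln_ge0// (le_trans _ n2)// ler1n.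
    split; [exact: crit|by rewrite mulr_ge0 ?powR_ge0|].
    by rewrite powRM ?powR_ge0// -powRrM; congr (_ `^ _ * _); field.
  + apply: (Wrate _ (fun n => N n `^ (- p / 2 + p + 1 - u / d%:R)) _ p1 (glo h)).
    apply: nearW => n; split; [exact: sub|exact: powR_ge0|].
    by rewrite -powRrM; congr (_ `^ _); field; rewrite p0 gt_eqF.
- move=> h; apply: (Erate _ (fun n => N n `^ (- p / 2) * ln (N n)) ln2).
  by apply: filterS N2 => n; exact: crit.
Qed.
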